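(* Let $\mathbb{F}\in\{\mathbb{R},\mathbb{C}\}$, let $W$ be a random positive-semidefinite $d\times d$ matrix over $\mathbb{F}$ with $\mathbb{E}\|W\|^2<+\infty$, and let $k\in\mathbb{N}$. Let $Y=\sum_{j=1}^kW_j$ with $W_1,\dots,W_k$ iid copies of $W$, and let $Z\sim\textsc{normal}(0,\mathsf{V})$ be a centered self-adjoint Gaussian matrix with variance function $\mathsf{V}=k\cdot\mathsf{Mom}[W]$. Let $\sigma_*^2(Z)=\max_{\|u\|=1}\operatorname{Var}[u^*Zu]$ and fix a self-adjoint $\Delta\in\mathbb{F}^{d\times d}$. Then \[ \mathbb{E}\,\lambda_{\min}(Y-\mathbb{E}Y+\Delta)\ge\mathbb{E}\,\lambda_{\min}(Z+\Delta)-\sqrt{2\sigma_*^2(Z)\log(2d)}, \] and for all $t\ge0$, \[ \mathbb{P}\big\{\lambda_{\min}(Y-\mathbb{E}Y+\Delta)\le\mathbb{E}\,\lambda_{\min}(Z+\Delta)-t\big\}\le2d\cdot e^{-t^2/(2\sigma_*^2(Z))}. \]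
   Context: $\mathbb{H}_d$ denotes the self-adjoint $d\times d$ matrices over $\mathbb{F}$ with $\langle M,A\rangle=\operatorname{Tr}[M^*A]$. $\mathsf{Mom}[W](M)=\mathbb{E}|\langle M,W\rangle|^2$ for $M\in\mathbb{H}_d$. A self-adjoint random matrix is Gaussian if the real and imaginary parts of its entries are jointly Gaussian; $\textsc{normal}(0,\mathsf{V})$ is the centered self-adjoint Gaussian distribution whose variance function $M\mapsto\operatorname{Var}[\langle M,Z\rangle]$ equals $\mathsf{V}$. *)

(* Defs.v *)
From HB Require Import structures.
From mathcomp Require Import all_boot all_order all_algebra.
From mathcomp Require Import all_classical all_reals all_analysis.
From mathcomp Require Import complex.

Set Implicit Arguments.
Unset Strict Implicit.
Unset Printing Implicit Defensive.

Import Order.TTheory GRing.Theory Num.Theory.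
Import numFieldNormedType.Exports.

Local Open Scope classical_set_scope.
Local Open Scope ring_scope.

(* The scalar field F in {R, C}.  Matrices over F are represented as complex
   matrices whose entries lie in F (real entries when F = R). *)
Inductive scalar_field := FieldR | FieldC.

Section Defs.
Variable R : realType.
Local Notation C := (R[i]).

Definition inF (F : scalar_field) (z : C) : Prop :=
  if F is FieldR then complex.Im z = 0 else True.

Definition mxF (F : scalar_field) m n (A : 'M[C]_(m, n)) : Prop :=
  forall i j, inF F (A i j).

Definition adjmx m n (A : 'M[C]_(m, n)) : 'M[C]_(n, m) := (map_mx (@conjc R) A)^T.

Definition selfadj (F : scalar_field) n (A : 'M[C]_n) : Prop :=
  mxF F A /\ adjmx A = A.

Definition psd (F : scalar_field) n (A : 'M[C]_n) : Prop :=
  selfadj F A /\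
  forall u : 'cV[C]_n, mxF F u -> 0 <= (adjmx u *m A *m u) 0 0.

Definition cabs2 (z : C) : R := complex.Re z ^+ 2 + complex.Im z ^+ 2.

Definition vnorm n (u : 'cV[C]_n) : R := Num.sqrt (\sum_i cabs2 (u i 0)).

Definition opnorm (F : scalar_field) n (A : 'M[C]_n) : R :=
  sup [set vnorm (A *m u) | u in [set u : 'cV[C]_n | mxF F u /\ vnorm u = 1]].

Definition hsinner n (M A : 'M[C]_n) : C := \tr (adjmx M *m A).

(* minimal eigenvalue of a self-adjoint matrix (its eigenvalues are real) *)
Definition lmin n (A : 'M[C]_n) : R := inf [set a : R | eigenvalue A (a%:C)%C].

(* Borel sigma-algebra on matrices: generated by the real and imaginary parts
   of the entries *)
Definition mx_meas m n : set (set 'M[C]_(m, n)) :=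
  <<s [set B : set 'M[C]_(m, n) | exists (i : 'I_m) (j : 'I_n) (S : set R), measurable S /\
        (B = [set A : 'M[C]_(m, n) | S (complex.Re (A i j))] \/
         B = [set A : 'M[C]_(m, n) | S (complex.Im (A i j))])] >>.

Section Prob.
Context {dT : measure_display} {T : measurableType dT}.

Definition mx_rv m n (X : T -> 'M[C]_(m, n)) : Prop :=
  forall B, mx_meas B -> measurable (X @^-1` B).

Definition Ex (P : probability T R) (f : T -> R) : R :=
  fine (\int[P]_w (f w)%:E)%E.

Definition var (P : probability T R) (f : T -> R) : R :=
  Ex P (fun w => (f w - Ex P f) ^+ 2).

Definition mxEx (P : probability T R) m n (X : T -> 'M[C]_(m, n)) : 'M[C]_(m, n) :=
  \matrix_(i, j) (Ex P (fun w => complex.Re (X w i j)) +i*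
                  Ex P (fun w => complex.Im (X w i j)))%C.

Definition Mom (P : probability T R) n (W : T -> 'M[C]_n) (M : 'M[C]_n) : R :=
  Ex P (fun w => cabs2 (hsinner M (W w))).

Definition mx_indep (P : probability T R) k m n (X : 'I_k -> T -> 'M[C]_(m, n)) : Prop :=
  forall B : 'I_k -> set 'M[C]_(m, n), (forall j, mx_meas (B j)) ->
    P (\bigcap_(j in [set: 'I_k]) (X j @^-1` B j)) =
    (\prod_(j < k) P (X j @^-1` B j))%E.

Definition real_gaussian (P : probability T R) (f : T -> R) : Prop :=
  measurable_fun setT f /\
  exists (mu s : R), forall B : set R, measurable B ->
    P (f @^-1` B) = if s == 0 then \d_mu B else normal_prob mu s B.

Definition jointly_gaussian_mx (P : probability T R) n (Z : T -> 'M[C]_n) : Prop :=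
  forall a b : 'I_n -> 'I_n -> R,
    real_gaussian P (fun w => \sum_i \sum_j
      (a i j * complex.Re (Z w i j) + b i j * complex.Im (Z w i j))).

Definition normal_mx (F : scalar_field) (P : probability T R) n
    (Z : T -> 'M[C]_n) (V : 'M[C]_n -> R) : Prop :=
  [/\ forall w, selfadj F (Z w),
      jointly_gaussian_mx P Z,
      mxEx P Z = 0 &
      forall M, selfadj F M -> var P (fun w => complex.Re (hsinner M (Z w))) = V M].

Definition sigma_star2 (F : scalar_field) (P : probability T R) n (Z : T -> 'M[C]_n) : R :=
  sup [set var P (fun w => complex.Re ((adjmx u *m Z w *m u) 0 0))
      | u in [set u : 'cV[C]_n | mxF F u /\ vnorm u = 1]].

End Prob.

Definition same_law {d1 d2 : measure_display} {T1 : measurableType d1}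
  {T2 : measurableType d2} (P1 : probability T1 R) (P2 : probability T2 R) m n
  (X1 : T1 -> 'M[C]_(m, n)) (X2 : T2 -> 'M[C]_(m, n)) : Prop :=
  forall B, mx_meas B -> P1 (X1 @^-1` B) = P2 (X2 @^-1` B).

(* exp(-t^2 / (2 s2)), with the convention exp(-t^2/0) = 0 for t > 0
   (and = 1 for t = 0) when s2 = 0 *)
Definition gauss_tail (t s2 : R) : R :=
  if s2 == 0 then (if t == 0 then 1 else 0) else expR (- t ^+ 2 / (2 * s2)).

End Defs.

(* Main.v *)
(* A trace-exponential argument.  Write phi X = tr exp X and let T be the operator
   (T h)(A) = E h(A - theta W), so that E phi(A - theta Y) = (T^k phi)(A).

   For W psd, phi(A - W) <= phi A - <W, exp A> + Q_A(W) / 2, where Q_A is the second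
   derivative of phi at A: the third-order remainder has a sign because the divided
   differences of exp are positive.  Hence one step of the lazy chain (1 - k/n) + (k/n) T
   is dominated, up to O(n^(-3/2)), by a centering shift composed with an average over
   Rademacher increments with the covariance (k/n) theta^2 Mom[W].  The two families of
   operators commute, so the n-th powers compare as well.  The n-th power of the lazy chain
   is a Binomial(n, k/n) mixture of the decreasing sequence T^j phi, hence at least
   P(Bin <= k) T^k phi, and the median property of the Poisson(k) law gives
   P(Bin <= k) >= 1/2 - o(1).  This is the origin of the factor 2 in 2d.

   On the Rademacher side, log phi is concentrated at scale theta^2 sigma_*^2 / 2, so the
   average of phi is at most exp(average of log phi + theta^2 sigma_*^2 / 2), and by the
   central limit theorem the average of log phi <= log d + lambda_max tends to its Gaussian
   value.  Altogether
     E exp(-theta lambda_min(Y - EY + Delta))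
       <= 2 d exp(theta^2 sigma_*^2 / 2 - theta E lambda_min(Z + Delta)),
   and Markov's and Jensen's inequalities conclude. *)
Require Import Defs.
From HB Require Import structures.
From mathcomp Require Import all_boot all_order all_algebra.
From mathcomp Require Import all_classical all_reals all_analysis.
From mathcomp Require Import complex spectral sesquilinear.
From mathcomp Require Import measurable_realfun.
From mathcomp Require Import ring lra.
Import Order.TTheory GRing.Theory Num.Theory.
Import numFieldNormedType.Exports.
Set Implicit Arguments.
Unset Strict Implicit.
Unset Printing Implicit Defensive.
Local Open Scope classical_set_scope.
Local Open Scope ring_scope.

(** * Monotonicity from small increments; integrals over the unit interval *)

Section Scalar.
Variable R : realType.
Implicit Types (x y z s t M : R) (f g : R -> R).

(** The second-order bound for [phi (A - W)] holds for W of any size, but the Rademacher average is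
    controlled from below only up to a cubic error in its increments. Replacing the k summands one
    by one would leave an error that does not vanish; spreading them over n lazy steps makes the
    increments of order n^(-1/2), and the accumulated error is n * n^(-3/2).

    The sign of the third-order term is the delicate point. It is a triple sum of products of matrix
    entries against second divided differences of exp, and positivity of these numbers alone does
    not decide its sign. Apart from confluent cases, the Peano kernel splits a divided difference
    into three terms, one for each argument; with that argument fixed, the term is a min kernel in
    the other two, hence a superposition of rank-one kernels, and each of these yields the quadratic
    form of the psd direction at some vector.

    Errors are kept relative to [phi], because factors pass through iterated commuting averages.
    Both fields are treated with complex hermitian matrices; for real data the covariance and the
    weak variance are extended from real to complex test objects. *)

Lemma le_of_quadratic_increments (F : R -> R) (C a b : R) : a <= b ->
  (forall s t, a <= s -> s <= t -> t <= b -> F t - F s <= C * (t - s) ^+ 2) ->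
  F b <= F a.
Proof.
move=> ab HF; rewrite -subr_le0.
set D := b - a; have D0 : 0 <= D by rewrite /D subr_ge0.
(* Cutting [[a, b]] into n + 1 equal pieces turns the sum of the bounds into a multiple of 1 / (n +
   1). This replaces differentiation along paths of matrices later on. *)
have step n : F b - F a <= `|C| * D ^+ 2 / n.+1%:R.
  pose p i := a + D * (i%:R / n.+1%:R).
  have n0 : (0 : R) < n.+1%:R by rewrite ltr0n.
  have p0 : p 0%N = a by rewrite /p mul0r mulr0 addr0.
  have pn : p n.+1 = b by rewrite /p divff ?gt_eqF// mulr1 /D addrC subrK.
  have pm i : p i.+1 - p i = D / n.+1%:R.
    by rewrite /p -natr1 opprD addrACA subrr add0r -mulrBr -mulrBl [_ + 1 - _]addrC addKr mul1r.
  have pS i : (i <= n)%N -> F (p i.+1) - F (p i) <= C * (D / n.+1%:R) ^+ 2.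
    move=> ilen; rewrite -(pm i); apply: HF.
    - by rewrite /p lerDl mulr_ge0// divr_ge0.
    - by rewrite -subr_ge0 pm divr_ge0// ltW.
    - rewrite -pn /p lerD2l ler_wpM2l// ler_pM2r ?invr_gt0// ler_nat.
      by rewrite ltnS.
  have -> : F b - F a = \sum_(0 <= i < n.+1) (F (p i.+1) - F (p i)).
    by rewrite telescope_sumr// pn p0.
  rewrite big_mkord; apply: (le_trans (ler_sum _ (fun i _ => pS _ (leq_ord i)))).
  rewrite sumr_const card_ord -[X in X <= _]mulr_natr.
  have -> : C * (D / n.+1%:R) ^+ 2 * n.+1%:R = C * (D ^+ 2 / n.+1%:R).
    by field; rewrite gt_eqF.
  by rewrite -mulrA ler_wpM2r ?ler_norm// divr_ge0// sqr_ge0.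
rewrite leNgt; apply/negP => pos.
set K := `|C| * D ^+ 2 in step.
have K0 : 0 <= K by rewrite mulr_ge0// sqr_ge0.
have [n nlt] : exists n, K / (F b - F a) < n%:R.
  exists (Num.truncn (K / (F b - F a))).+1.
  by have := truncnS_gt (K / (F b - F a)).
have := step n; rewrite leNgt => /negP; apply.
rewrite ltr_pdivrMr ?ltr0n// mulrC -ltr_pdivrMr//.
by apply: (lt_le_trans nlt); rewrite ler_nat.
Qed.

(** A class of integrands inside the continuous functions on which [int01] is linear and monotone,
    and which is stable under the few operations used. *)
Definition lip01 f := exists C, forall s t, 0 <= s <= 1 -> 0 <= t <= 1 ->
  `|f s - f t| <= C * `|s - t|.

Lemma lip01_continuous f : lip01 f -> {within `[0, 1], continuous f}.
Proof.
move=> [C HC]; apply/continuous_within_itvP => //.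
have C1 : 0 < `|C| + 1 by rewrite ltr_wpDl.
have HC' s t : 0 <= s <= 1 -> 0 <= t <= 1 -> `|f s - f t| <= (`|C| + 1) * `|s - t|.
  move=> hs ht; apply: (le_trans (HC _ _ hs ht)); rewrite ler_wpM2r//.
  by apply: (le_trans (ler_norm _)); rewrite lerDl.
split.
- move=> x; rewrite in_itv/= => /andP[x0 x1].
  apply/cvgrPdist_le => e e0.
  near=> t.
  have ht : 0 <= t <= 1.
    apply/andP; split; apply: ltW; near: t.
      exact: lt_nbhsr.
    exact: lt_nbhsl.
  apply: (le_trans (HC' _ _ _ ht)); first by rewrite !ltW.
  rewrite mulrC -ler_pdivlMr//; near: t.
  by apply: (@cvgr_dist_le _ _ _ (nbhs x) _ id) => //; rewrite divr_gt0.
- apply/cvgrPdist_le => e e0; near=> t.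
  have ht : 0 <= t <= 1.
    apply/andP; split; apply: ltW; near: t; first exact: nbhs_right_gt.
    exact: nbhs_right_lt.
  apply: (le_trans (HC' _ _ _ ht)); first by rewrite lexx/=.
  rewrite mulrC -ler_pdivlMr// sub0r normrN ger0_norm; last by case/andP: ht.
  by near: t; apply: nbhs_right_le; rewrite divr_gt0.
- apply/cvgrPdist_le => e e0; near=> t.
  have ht : 0 <= t <= 1.
    apply/andP; split; apply: ltW; near: t; last exact: nbhs_left_lt.
    exact: nbhs_left_gt.
  apply: (le_trans (HC' _ _ _ ht)); first by rewrite lexx/= ler01.
  rewrite mulrC -ler_pdivlMr// ger0_norm; last by rewrite subr_ge0; case/andP: ht.
  rewrite lerBlDr -lerBlDl; near: t; apply: nbhs_left_ge.
  by rewrite ltrBlDr ltrDl divr_gt0.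
Unshelve. all: by end_near. Qed.

Local Notation mu := (@lebesgue_measure R).
Definition int01 f : R := \int[mu]_(s in `[0, 1]) f s.

Lemma lip01_integrable f : lip01 f -> mu.-integrable `[0, 1] (EFin \o f).
Proof.
move=> /lip01_continuous cf; apply: continuous_compact_integrable => //.
exact: segment_compact.
Qed.

Lemma int01B f g : lip01 f -> lip01 g -> int01 (fun s => f s - g s) = int01 f - int01 g.
Proof. by move=> /lip01_integrable hf /lip01_integrable hg; rewrite /int01 RintegralB. Qed.

Lemma int01Z f (c : R) : lip01 f -> int01 (fun s => c * f s) = c * int01 f.
Proof. by move=> /lip01_integrable hf; rewrite /int01 RintegralZl. Qed.

Lemma int01_cst (c : R) : int01 (fun=> c) = c.
Proof.
rewrite /int01 Rintegral_cst; last exact: measurable_itv.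
rewrite (_ : fine _ = 1) ?mulr1//.
have /(congr1 fine) := @lebesgue_measure_itv R `[0, 1]%R.
by move=> ->; rewrite /= lte_fin ltr01 oppr0 addr0.
Qed.

Lemma int01_ext f g : (forall s, 0 <= s <= 1 -> f s = g s) -> int01 f = int01 g.
Proof. by move=> h; apply: eq_Rintegral => s; rewrite inE/= in_itv/=; exact: h. Qed.

Lemma lip01_norm f : lip01 f -> lip01 (fun s => `|f s|).
Proof.
move=> [C HC]; exists C => s t hs ht; apply: le_trans (HC _ _ hs ht).
exact: ler_dist_dist.
Qed.

Lemma lip01_cst (c : R) : lip01 (fun=> c).
Proof. by exists 0 => s t _ _; rewrite subrr normr0 mul0r. Qed.

Lemma lip01B f g : lip01 f -> lip01 g -> lip01 (fun s => f s - g s).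
Proof.
move=> [C HC] [D HD]; exists (C + D) => s t hs ht.
have -> : f s - g s - (f t - g t) = (f s - f t) - (g s - g t) by ring.
by rewrite mulrDl (le_trans (ler_normB _ _))// lerD ?HC ?HD.
Qed.

Lemma lip01Z f (c : R) : lip01 f -> lip01 (fun s => c * f s).
Proof.
move=> [C HC]; exists (`|c| * C) => s t hs ht.
by rewrite -mulrBr normrM -mulrA ler_wpM2l ?HC.
Qed.

Lemma lip01_idM f : lip01 f -> lip01 (fun s => s * f s).
Proof.
move=> [C HC]; exists (C + (`|f 0| + `|C|)) => s t hs ht.
have -> : s * f s - t * f t = s * (f s - f t) + (s - t) * f t by ring.
case/andP: (hs) => s0 s1; case/andP: (ht) => t0 t1.
rewrite (le_trans (ler_normD _ _))// [leRHS]mulrDl lerD//.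
  by rewrite normrM (ger0_norm s0) (le_trans _ (HC _ _ hs ht))// ler_piMl.
rewrite normrM mulrC ler_wpM2r//.
have h0 : 0 <= (0 : R) <= 1 by rewrite lexx ler01.
have -> : f t = f 0 + (f t - f 0) by ring.
rewrite (le_trans (ler_normD _ _))// lerD2l (le_trans (HC _ _ ht h0))//.
by rewrite subr0 (le_trans (ler_norm _))// normrM normr_id (ger0_norm t0) ler_piMr.
Qed.

Lemma int01_le f g : lip01 f -> lip01 g -> (forall s, 0 <= s <= 1 -> f s <= g s) ->
  int01 f <= int01 g.
Proof.
move=> /lip01_integrable hf /lip01_integrable hg h; rewrite /int01.
by apply: le_Rintegral => // s; rewrite /= in_itv/=; exact: h.
Qed.

Lemma int01_dist f g M : lip01 f -> lip01 g ->
  (forall s, 0 <= s <= 1 -> `|f s - g s| <= M) -> `|int01 f - int01 g| <= M.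
Proof.
move=> hf hg h; rewrite -int01B// -(int01_cst M).
have hfg := lip01B hf hg.
apply: le_trans (int01_le (lip01_norm hfg) (lip01_cst M) h).
by apply: le_normr_Rintegral => //; exact: lip01_integrable.
Qed.

Lemma int01_FTC (F f : R -> R) : (forall s : R, is_derive s (1 : R) F (f s)) -> lip01 f ->
  int01 f = F 1 - F 0.
Proof.
move=> dF lf; rewrite /int01 /Rintegral (@continuous_FTC2 _ f F 0 1)//.
- exact: lip01_continuous.
- have cF : {within `[0 : R, 1], continuous F}.
    by apply: derivable_within_continuous => s _; apply: ex_derive.
  move/continuous_within_itvP : cF => /(_ ltr01)[c1 c2 c3].
  by split => // s _; apply: ex_derive.
- by move=> s _; rewrite derive1E; apply: derive_val.
Qed.

End Scalar.

(** * First and second divided differences of the exponential *)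

Section DividedDifferences.
Variable R : realType.
Implicit Types (x y z s t M : R).

Definition seg x y s : R := x + s * (y - x).

Lemma expR_lip x y M : expR x <= M -> expR y <= M -> `|expR x - expR y| <= M * `|x - y|.
Proof.
wlog xy : x y / x <= y.
  move=> H hx hy; have [xy|/ltW yx] := leP x y; first exact: H.
  by rewrite distrC [`|x - y|]distrC; exact: H.
move=> hx hy; rewrite distrC [`|x - y|]distrC !ger0_norm ?subr_ge0 ?ler_expR//.
have h := expR_ge1Dx (x - y).
have -> : expR x = expR y * expR (x - y) by rewrite -expRD; congr expR; ring.
apply: (@le_trans _ _ (expR y * (y - x))); last by rewrite ler_wpM2r// subr_ge0.
have := expR_ge0 y; nra.
Qed.

Lemma expR_seg x y s M : 0 <= s <= 1 -> expR x <= M -> expR y <= M -> expR (seg x y s) <= M.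
Proof.
move=> /andP[s0 s1] hx hy; have [xy|/ltW yx] := leP x y.
  apply: le_trans hy; rewrite ler_expR /seg; nra.
apply: le_trans hx; rewrite ler_expR /seg; nra.
Qed.

Lemma lip01_expR_seg x y : lip01 (fun s => expR (seg x y s)).
Proof.
exists (Num.max (expR x) (expR y) * `|y - x|) => s t hs ht.
set M := Num.max _ _.
have hx : expR x <= M by rewrite le_max lexx.
have hy : expR y <= M by rewrite le_max lexx orbT.
rewrite (le_trans (expR_lip (expR_seg hs hx hy) (expR_seg ht hx hy)))//.
have -> : seg x y s - seg x y t = (y - x) * (s - t) by rewrite /seg; ring.
by rewrite normrM mulrA.
Qed.

(** First divided difference of exp in Hermite-Genocchi form; the diagonal needs no separate case,
    and positivity and Lipschitz bounds are read off the integrand. *)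
Definition e1 x y : R := int01 (fun s => expR (seg x y s)).

Lemma e1E x y : (y - x) * e1 x y = expR y - expR x.
Proof.
rewrite /e1 -int01Z; last exact: lip01_expR_seg.
have dF s : is_derive s (1 : R) (fun s => expR (seg x y s)) ((y - x) * expR (seg x y s)).
  rewrite /seg; have h1 : is_derive s (1 : R) (fun s : R => x + s * (y - x)) (y - x).
    by apply: is_derive_eq; rewrite /GRing.scale/=; ring.
  by apply: is_derive_eq; rewrite /GRing.scale/=; ring.
rewrite (int01_FTC dF); first by rewrite /seg mul0r mul1r addr0 subrKC.
by apply: lip01Z; exact: lip01_expR_seg.
Qed.

Lemma e1_ge0 x y : 0 <= e1 x y.
Proof. by apply: Rintegral_ge0 => s _; exact: expR_ge0. Qed.

Lemma e1_le x y M : expR x <= M -> expR y <= M -> e1 x y <= M.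
Proof.
move=> hx hy; rewrite -(int01_cst M); apply: int01_le.
- exact: lip01_expR_seg.
- exact: lip01_cst.
- by move=> s hs; exact: expR_seg.
Qed.

Lemma e1xx x : e1 x x = expR x.
Proof.
by rewrite -[RHS]int01_cst; apply: int01_ext => s _; rewrite /seg subrr mulr0 addr0.
Qed.

Lemma e1C x y : e1 x y = e1 y x.
Proof.
have [->//|xy] := eqVneq x y.
apply: (mulfI (x := y - x)); first by rewrite subr_eq0 eq_sym.
by rewrite e1E -[y - x]opprB mulNr e1E opprB.
Qed.

Lemma e1_lip x y x' y' M : expR x <= M -> expR y <= M -> expR x' <= M -> expR y' <= M ->
  `|e1 x y - e1 x' y'| <= M * (`|x - x'| + `|y - y'|).
Proof.
move=> hx hy hx' hy'; apply: int01_dist; [exact: lip01_expR_seg..|].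
move=> s hs; apply: (le_trans (expR_lip (expR_seg hs hx hy) (expR_seg hs hx' hy'))).
have M0 : 0 <= M by exact: le_trans (expR_ge0 x) hx.
rewrite ler_wpM2l//; case/andP: hs => s0 s1.
have -> : seg x y s - seg x' y' s = (1 - s) * (x - x') + s * (y - y') by rewrite /seg; ring.
rewrite (le_trans (ler_normD _ _))// !normrM (ger0_norm s0).
by rewrite ger0_norm ?subr_ge0// lerD// ler_piMl// gerBl.
Qed.

Lemma lip01_e1_seg x y z : lip01 (fun s => e1 (seg x y s) (seg x z s)).
Proof.
set M := Num.max (expR x) (Num.max (expR y) (expR z)).
have hx : expR x <= M by rewrite le_max lexx.
have hy : expR y <= M by rewrite !le_max lexx/= orbT.
have hz : expR z <= M by rewrite !le_max lexx/= !orbT.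
exists (M * (`|y - x| + `|z - x|)) => s t hs ht.
apply: (le_trans (e1_lip _ _ _ _)); try by apply: expR_seg; eassumption.
have E u : seg x u s - seg x u t = (u - x) * (s - t) by rewrite /seg; ring.
by rewrite !E !normrM -mulrDl mulrA.
Qed.

(** Second divided difference of exp: the Hermite-Genocchi integral over the triangle with vertices
    x, y, z, in coordinates centered at x. Symmetry in y and z is visible, the exchange of x with y
    is not. *)
Definition e2 x y z : R := int01 (fun s => s * e1 (seg x y s) (seg x z s)).

Lemma e2E x y z : (z - y) * e2 x y z = e1 x z - e1 x y.
Proof.
rewrite /e2 -int01Z; last by apply: lip01_idM; exact: lip01_e1_seg.
rewrite /e1 -int01B; [|exact: lip01_expR_seg..].
apply: int01_ext => s _; rewrite -/(e1 _ _) -e1E.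
by rewrite {3 4}/seg; ring.
Qed.

Lemma e2_bound x y z M : expR x <= M -> expR y <= M -> expR z <= M -> `|e2 x y z| <= M.
Proof.
move=> hx hy hz; rewrite -[e2 _ _ _]subr0 -[0](int01_cst 0).
apply: int01_dist.
- by apply: lip01_idM; exact: lip01_e1_seg.
- exact: lip01_cst.
move=> s hs; rewrite subr0 normrM; case/andP: (hs) => s0 s1.
rewrite (ger0_norm s0) ger0_norm ?e1_ge0//.
have h : e1 (seg x y s) (seg x z s) <= M by apply: e1_le; apply: expR_seg.
by apply: le_trans h; rewrite ler_piMl// e1_ge0.
Qed.

Lemma e2_lip x y z x' y' z' M : expR x <= M -> expR y <= M -> expR z <= M ->
  expR x' <= M -> expR y' <= M -> expR z' <= M ->
  `|e2 x y z - e2 x' y' z'| <= M * ((`|x - x'| + `|y - y'|) + (`|x - x'| + `|z - z'|)).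
Proof.
move=> hx hy hz hx' hy' hz'.
have M0 : 0 <= M by exact: le_trans (expR_ge0 x) hx.
apply: int01_dist; [by apply: lip01_idM; exact: lip01_e1_seg..|].
move=> s hs; rewrite -mulrBr normrM; case/andP: (hs) => s0 s1.
have h a b a' b' : `|seg a b s - seg a' b' s| <= `|a - a'| + `|b - b'|.
  have -> : seg a b s - seg a' b' s = (1 - s) * (a - a') + s * (b - b') by rewrite /seg; ring.
  rewrite (le_trans (ler_normD _ _))// !normrM (ger0_norm s0).
  by rewrite ger0_norm ?subr_ge0// lerD// ler_piMl// gerBl.
rewrite (ger0_norm s0).
apply: (@le_trans _ _ `|e1 (seg x y s) (seg x z s) - e1 (seg x' y' s) (seg x' z' s)|).
  by rewrite ler_piMl.
apply: (le_trans (@e1_lip _ _ _ _ M _ _ _ _)); try by apply: expR_seg; eassumption.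
by rewrite ler_wpM2l// lerD.
Qed.

Lemma e2C23 x y z : e2 x y z = e2 x z y.
Proof. by apply: int01_ext => s _; rewrite e1C. Qed.

(* Off the diagonals both sides are the same second divided difference; the
   confluent cases follow by Lipschitz continuity. *)
Lemma e2C12 x y z : e2 x y z = e2 y x z.
Proof.
have gen a b c : a != b -> b != c -> a != c -> e2 a b c = e2 b a c.
  move=> ab bc ac.
  move: (e2E a b c) (e2E b a c) (e1E a b) (e1E b c) (e1E a c); rewrite (e1C b a).
  move: (e2 a b c) (e2 b a c) (e1 a b) (e1 b c) (e1 a c) => p q v w u E1 E2 E3 E4 E5.
  have cb : c - b != 0 by rewrite subr_eq0 eq_sym.
  have ca : c - a != 0 by rewrite subr_eq0 eq_sym.
  apply: (mulfI cb); rewrite E1; apply: (mulfI ca).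
  transitivity ((c - b) * (w - v)); last by rewrite -E2; ring.
  by rewrite !mulrBr E4 E5 -[c - a](subrKA b) mulrDl E3; ring.
have [->//|xy] := eqVneq x y.
apply/eqP; rewrite -subr_eq0 -normr_le0 leNgt; apply/negP => pos.
set D := `|_| in pos.
set M := Num.max (expR x) (Num.max (expR y) (expR (z + 1))).
have M0 : 0 < M by rewrite lt_max expR_gt0.
have hx : expR x <= M by rewrite le_max lexx.
have hy : expR y <= M by rewrite !le_max lexx/= orbT.
have hz w : w <= z + 1 -> expR w <= M by move=> wz; rewrite !le_max (@ler_expR _ w (z + 1)) wz !orbT.
have [r [r0 r1 rx ry rD]] : exists r, [/\ 0 < r, r <= 1, z + r != x, z + r != y & M * r * 2 < D].
  pose a := Num.min 1 (D / (M * 4)).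
  have a0 : 0 < a by rewrite lt_min ltr01 divr_gt0// mulr_gt0.
  have a1 : a <= 1 by rewrite ge_min lexx.
  have aD : M * a * 2 < D.
    apply: (@le_lt_trans _ _ (D / 2)); last by rewrite ltr_pdivrMr// mulr_natr mulr2n ltrDl.
    have : a <= D / (M * 4) by rewrite ge_min lexx orbT.
    rewrite ler_pdivlMr ?mulr_gt0// => h.
    by rewrite ler_pdivlMr// (le_trans _ h)//; lra.
  have sm q : 0 < q -> q <= 1 -> M * (a * q) * 2 < D.
    move=> q0 q1; apply: le_lt_trans aD; rewrite ler_wpM2r//.
    by rewrite ler_wpM2l ?(ltW M0)// ler_piMr// ltW.
  have nn q : 0 < q -> q <= 1 -> 0 < a * q /\ a * q <= 1.
    by move=> q0 q1; rewrite mulr_gt0// mulr_ile1// ltW.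
  have h2 : (0 : R) < 1/2 by lra.
  have h3 : (0 : R) < 1/3 by lra.
  have h2' : (1/2 : R) <= 1 by lra.
  have h3' : (1/3 : R) <= 1 by lra.
  case: (altP (z + a * 1 =P x)) => e1x.
    case: (altP (z + a * (1/2) =P y)) => e2y.
      exists (a * (1/3)); have [? ?] := nn _ h3 h3'; split => //; last exact: sm.
        by apply/eqP; move: a0 e1x; lra.
      by apply/eqP; move: a0 e2y; lra.
    exists (a * (1/2)); have [? ?] := nn _ h2 h2'; split => //; last exact: sm.
    by apply/eqP; move: a0 e1x; lra.
  case: (altP (z + a * 1 =P y)) => e1y.
    case: (altP (z + a * (1/2) =P x)) => e2x.
      exists (a * (1/3)); have [? ?] := nn _ h3 h3'; split => //; last exact: sm.
        by apply/eqP; move: a0 e2x; lra.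
      by apply/eqP; move: a0 e1y; lra.
    exists (a * (1/2)); have [? ?] := nn _ h2 h2'; split => //; last exact: sm.
    by apply/eqP; move: a0 e1y; lra.
  by exists (a * 1); have [? ?] := nn _ ltr01 (lexx _); split => //; exact: sm.
have E : e2 x y (z + r) = e2 y x (z + r) by apply: gen; rewrite // eq_sym.
have hzz : z <= z + 1 by rewrite lerDl.
have hzr : z + r <= z + 1 by rewrite lerD2l.
move: gen => _.
have L1 := @e2_lip x y z x y (z + r) M hx hy (hz _ hzz) hx hy (hz _ hzr).
have L2 := @e2_lip y x z y x (z + r) M hy hx (hz _ hzz) hy hx (hz _ hzr).
move: @D pos rD L1 L2 E.
move: (e2 x y z) (e2 x y (z + r)) (e2 y x z) (e2 y x (z + r)) => p p' q q' /= pos rD L1 L2 E.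
rewrite !subrr !normr0 !add0r opprD addrA subrr sub0r normrN (gtr0_norm r0) in L1 L2.
suff : `|p - q| <= M * r * 2 by rewrite leNgt rD.
have -> : p - q = (p - p') - (q - q') by rewrite E; ring.
by rewrite (le_trans (ler_normB _ _))// mulr_natr mulr2n lerD.
Qed.

Lemma e2xxx x : e2 x x x = expR x / 2.
Proof.
have e s : seg x x s = x by rewrite /seg subrr mulr0 addr0.
rewrite /e2 (int01_ext (g := fun s => expR x * (s * 1))); last first.
  by move=> s _; rewrite !e e1xx mulr1 mulrC.
rewrite int01Z; last by apply: lip01_idM; exact: lip01_cst.
congr (_ * _); have dF (s : R) : is_derive s (1 : R) (fun s => s ^+ 2 / 2) (s * 1).
  by apply: is_derive_eq; rewrite /GRing.scale/=; field.
rewrite (int01_FTC dF); first by rewrite expr1n expr0n/= mul0r subr0 mul1r.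
by apply: lip01_idM; exact: lip01_cst.
Qed.

End DividedDifferences.

(** * Divided differences of exp as sums of min kernels *)

Section HatDecomposition.
Variable R : realType.
Implicit Types (x y z s t M : R).

(* [Plow s m] and [Pup m s] are the integrals over [c] between [s] and [m] of
   [e^c * |c - s|]. *)
Definition Plow s m : R := expR m * (m - s) - expR m + expR s.
Definition Pup m s : R := expR s - expR m - expR m * (s - m).

Lemma Plow_le s y z : s <= y -> y <= z -> Plow s y <= Plow s z.
Proof.
move=> sy yz; rewrite -subr_ge0 /Plow.
have -> : expR z = expR y * expR (z - y) by rewrite -expRD; congr expR; ring.
set u := y - s; set w := z - y.
have u0 : 0 <= u by rewrite subr_ge0.
have w0 : 0 <= w by rewrite subr_ge0.
have -> : expR y * expR w * (z - s) - expR y * expR w + expR s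
          - (expR y * u - expR y + expR s) = expR y * (expR w * (u + w - 1) - (u - 1)).
  by rewrite /u /w; ring.
rewrite mulr_ge0 ?expR_ge0//.
have h1 := expR_ge1Dx w.
have [uw|uw] := leP 0 (u + w - 1); first by nra.
have h2 := expR_ge1Dx (- w).
have h3 : expR w * expR (- w) = 1 by rewrite expRN divff ?gt_eqF ?expR_gt0.
have h4 : (1 - u - w) <= (1 - u) * expR (- w) by nra.
have := expR_gt0 w; nra.
Qed.

Lemma Plowss s : Plow s s = 0. Proof. by rewrite /Plow; ring. Qed.

Lemma Pup_le s y z : y <= z -> z <= s -> Pup z s <= Pup y s.
Proof.
move=> yz zs; rewrite -subr_ge0 /Pup.
have -> : expR z = expR y * expR (z - y) by rewrite -expRD; congr expR; ring.
have h1 := expR_ge1Dx (z - y).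
have -> : expR s - expR y - expR y * (s - y) - (expR s - expR y * expR (z - y)
     - expR y * expR (z - y) * (s - z)) = expR y * (expR (z - y) * (1 + s - z) - (1 + s - y)).
  by ring.
rewrite mulr_ge0 ?expR_ge0//; nra.
Qed.

Lemma Pupss s : Pup s s = 0. Proof. by rewrite /Pup; ring. Qed.

(** The share of the vertex s: if y and z lie on the same side of s, the mass of e^c * |c - s|
    between s and the nearer of them, divided by both distances. By monotonicity of [Plow] and [Pup]
    the nearer point is selected by [min], which makes this a positive semidefinite kernel in y and
    z. *)
Definition hat s y z : R :=
  (if (s < y) && (s < z) then Num.min (Plow s y) (Plow s z) / ((y - s) * (z - s)) else 0) +
  (if (y < s) && (z < s) then Num.min (Pup y s) (Pup z s) / ((s - y) * (s - z)) else 0).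

Lemma hatC s y z : hat s y z = hat s z y.
Proof.
by rewrite /hat (andbC (s < y)) (andbC (y < s)) (minC (Plow s y)) (minC (Pup y s))
  (mulrC (y - s)) (mulrC (s - y)).
Qed.

Definition hats x y z : R := hat x y z + hat y z x + hat z x y +
  (if (x == y) && (y == z) then expR x / 2 else 0).

Lemma hatsC12 x y z : hats x y z = hats y x z.
Proof.
rewrite /hats (hatC x z y) (hatC y x z) (hatC z y x) (addrC (hat x y z)); congr (_ + _).
by have [->//|/=] := eqVneq x y.
Qed.

Lemma hatsC23 x y z : hats x y z = hats x z y.
Proof.
rewrite /hats (hatC x z y) (hatC y x z) (hatC z y x) (addrAC (hat x y z)); congr (_ + _).
by rewrite (eq_sym z y); have [->|] := eqVneq y z; rewrite ?andbF.
Qed.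

(** This is the Peano kernel of the second divided difference, cut at the middle point: for a < b <
    c only the hats at the extreme points a and c survive, and both stop at b. *)
Lemma e2_hats x y z : e2 x y z = hats x y z.
Proof.
suff sorted a b c : a <= b -> b <= c -> e2 a b c = hats a b c.
  have [xy|/ltW yx] := leP x y; have [yz|/ltW zy] := leP y z;
    have [xz|/ltW zx] := leP x z.
  - exact: sorted.
  - exact: sorted.
  - by rewrite e2C23 hatsC23; exact: sorted.
  - by rewrite e2C23 hatsC23 e2C12 hatsC12; exact: sorted.
  - by rewrite e2C12 hatsC12; exact: sorted.
  - by rewrite e2C12 hatsC12 e2C23 hatsC23; exact: sorted.
  - by rewrite e2C12 hatsC12 e2C23 hatsC23 e2C12 hatsC12; exact: sorted.
  - by rewrite e2C12 hatsC12 e2C23 hatsC23 e2C12 hatsC12; exact: sorted.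
move=> ab bc; rewrite /hats /hat.
have [ltab|geab] := ltP a b; have [ltbc|gebc] := ltP b c.
- have ltac : a < c by exact: lt_trans ltbc.
  rewrite ltac (lt_eqF ltab) !(lt_gtF ltab) !(lt_gtF ltbc) (lt_gtF ltac)/= !addr0 !add0r.
  have ab0 : b - a != 0 by rewrite subr_eq0 gt_eqF.
  have bc0 : c - b != 0 by rewrite subr_eq0 gt_eqF.
  have ac0 : c - a != 0 by rewrite subr_eq0 gt_eqF.
  rewrite min_l; last by apply: Plow_le => //; exact: ltW.
  rewrite min_r; last by apply: Pup_le => //; exact: ltW.
  apply: (mulfI bc0); rewrite e2E.
  have -> : e1 a c = (expR c - expR a) / (c - a) by rewrite -e1E mulrC mulKf.
  have -> : e1 a b = (expR b - expR a) / (b - a) by rewrite -e1E mulrC mulKf.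
  by rewrite /Plow /Pup; field; rewrite ab0 bc0 ac0.
- have E : b = c by apply/eqP; rewrite eq_le bc gebc.
  subst c; rewrite !ltxx !(lt_gtF ltab) ltab (lt_eqF ltab) /= !addr0 minxx.
  have ab0 : b - a != 0 by rewrite subr_eq0 gt_eqF.
  rewrite e2C12; apply: (mulfI ab0); rewrite e2E e1xx.
  have -> : e1 b a = (expR b - expR a) / (b - a) by rewrite -e1E e1C mulrC mulKf.
  by rewrite /Plow; field.
- have E : a = b by apply/eqP; rewrite eq_le ab geab.
  subst b; rewrite !ltxx !(lt_gtF ltbc) ltbc eqxx (lt_eqF ltbc) /= !addr0 !add0r minxx.
  have bc0 : c - a != 0 by rewrite subr_eq0 gt_eqF.
  apply: (mulfI bc0); rewrite e2E e1xx.
  have -> : e1 a c = (expR c - expR a) / (c - a) by rewrite -e1E mulrC mulKf.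
  by rewrite /Pup; field.
- have E : a = b by apply/eqP; rewrite eq_le ab geab.
  have E' : b = c by apply/eqP; rewrite eq_le bc gebc.
  by subst b; subst c; rewrite !ltxx eqxx/= !addr0 !add0r e2xxx.
Qed.

(** Layer-cake decomposition of [min]: subtracting the smallest level g j0 everywhere releases g j0
    times the sum of b over J x J, and the index j0 drops out of the remaining sum. *)
Lemma sum_min_ge0 (I : finType) (b : I -> I -> R) (g : I -> R) (J : {set I}) :
  (forall K : {set I}, 0 <= \sum_(j in K) \sum_(k in K) b j k) ->
  (forall j, j \in J -> 0 <= g j) ->
  0 <= \sum_(j in J) \sum_(k in J) b j k * Num.min (g j) (g k).
Proof.
move=> hb; move: {2}#|J| (leqnn #|J|) => n; elim: n J g => [|n IH] J g.
  rewrite leqn0 cards_eq0 => /eqP -> _.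
  by rewrite big1// => j; rewrite inE.
move=> cJ g0; have [->|/set0Pn[j1 j1J]] := eqVneq J finset.set0.
  by rewrite big1// => j; rewrite inE.
case: (@arg_minP _ _ _ j1 (mem J) g j1J) => j0 j0J jmin.
have {}j0J : j0 \in J by [].
have minB (u v c : R) : Num.min (u - c) (v - c) = Num.min u v - c.
  by rewrite /Num.min ltrD2r; case: ifP.
have E : \sum_(j in J) \sum_(k in J) b j k * Num.min (g j) (g k) =
   g j0 * (\sum_(j in J) \sum_(k in J) b j k) +
   \sum_(j in J) \sum_(k in J) b j k * Num.min (g j - g j0) (g k - g j0).
  rewrite mulr_sumr -big_split/=; apply: eq_bigr => j jJ.
  rewrite mulr_sumr -big_split/=; apply: eq_bigr => k kJ.
  by rewrite minB (mulrC (g j0)) -mulrDr subrKC.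
rewrite E addr_ge0//; first by rewrite mulr_ge0// g0.
rewrite (big_setD1 j0)//= big1 ?add0r; last first.
  by move=> k kJ; rewrite subrr min_l ?mulr0// subr_ge0; exact: jmin.
rewrite (eq_bigr (fun j => \sum_(k in J :\ j0) b j k * Num.min (g j - g j0) (g k - g j0))); last first.
  move=> j; rewrite in_setD1 => /andP[_ jJ]; rewrite (big_setD1 j0)//= subrr min_r ?mulr0 ?add0r//.
  by rewrite subr_ge0; exact: jmin.
apply: IH; first by move: cJ; rewrite (cardsD1 j0 J) j0J.
by move=> j; rewrite in_setD1 => /andP[_ jJ]; rewrite subr_ge0; exact: jmin.
Qed.

End HatDecomposition.

(** * Elementary facts on complex numbers *)

Section ComplexBasics.
Variable R : realType.
Local Notation C := R[i].
Implicit Types (z w : C).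

Definition cabs z : R := Normc.normc z.

Lemma ReD z w : complex.Re (z + w) = complex.Re z + complex.Re w.
Proof. by case: z; case: w. Qed.
Lemma ImD z w : complex.Im (z + w) = complex.Im z + complex.Im w.
Proof. by case: z; case: w. Qed.
Lemma ReN z : complex.Re (- z) = - complex.Re z. Proof. by case: z. Qed.
Lemma ImN z : complex.Im (- z) = - complex.Im z. Proof. by case: z. Qed.
Lemma ReJ z : complex.Re (conjc z) = complex.Re z. Proof. by case: z. Qed.
Lemma ImJ z : complex.Im (conjc z) = - complex.Im z. Proof. by case: z. Qed.

Lemma Re_sum (I : Type) (r : seq I) (P : pred I) (F : I -> C) :
  complex.Re (\sum_(i <- r | P i) F i) = \sum_(i <- r | P i) complex.Re (F i).
Proof. by apply: (big_morph _ ReD). Qed.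
Lemma Re_scale (a : R) z : complex.Re (a%:C%C * z) = a * complex.Re z.
Proof. by case: z => u v /=; rewrite mul0r subr0. Qed.
Lemma Im_scale (a : R) z : complex.Im (a%:C%C * z) = a * complex.Im z.
Proof. by case: z => u v /=; rewrite mul0r addr0. Qed.

Lemma complex_ext z w : complex.Re z = complex.Re w -> complex.Im z = complex.Im w -> z = w.
Proof. by case: z => a b; case: w => a' b' /= -> ->. Qed.

Lemma cabs_ge0 z : 0 <= cabs z. Proof. by case: z => a b; exact: sqrtr_ge0. Qed.
Lemma cabsM z w : cabs (z * w) = cabs z * cabs w. Proof. exact: Normc.normcM. Qed.
Lemma cabsD z w : cabs (z + w) <= cabs z + cabs w.
Proof. exact: (@le_normcD R z w). Qed.
Lemma cabs0 : cabs 0 = 0. Proof. exact: Normc.normc0. Qed.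
Lemma cabsN z : cabs (- z) = cabs z. Proof. by case: z => a b; rewrite /cabs /= !sqrrN. Qed.
Lemma cabs_conj z : cabs (conjc z) = cabs z.
Proof. by case: z => a b; rewrite /cabs /= sqrrN. Qed.
Lemma cabs_real (a : R) : cabs (a%:C%C) = `|a|.
Proof. by rewrite /cabs /= expr0n/= addr0 sqrtr_sqr. Qed.
Lemma sqr_cabs z : cabs z ^+ 2 = cabs2 z.
Proof. by case: z => a b; rewrite /cabs /= sqr_sqrtr// addr_ge0// sqr_ge0. Qed.
Lemma cabs_sum (I : Type) (r : seq I) (P : pred I) (F : I -> C) :
  cabs (\sum_(i <- r | P i) F i) <= \sum_(i <- r | P i) cabs (F i).
Proof.
elim/big_rec2: _ => [|i x y _ h]; first by rewrite cabs0.
by apply: le_trans (cabsD _ _) _; rewrite lerD2l.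
Qed.
Lemma Re_le_cabs z : `|complex.Re z| <= cabs z.
Proof. by case: z => a b; rewrite /cabs /= -sqrtr_sqr ler_sqrt ?lerDl ?sqr_ge0// addr_ge0 ?sqr_ge0. Qed.
Lemma cabs_le z : cabs z <= `|complex.Re z| + `|complex.Im z|.
Proof.
case: z => a b; rewrite /cabs /= -[leRHS]ger0_norm ?addr_ge0// -sqrtr_sqr ler_sqrt ?sqr_ge0//.
rewrite sqrrD !real_normK ?num_real// lerD2r lerDl mulrn_wge0// mulr_ge0//.
Qed.
Lemma mul_conjc z : z * conjc z = (cabs2 z)%:C%C.
Proof. by case: z => a b; apply: complex_ext; rewrite /cabs2 /=; ring. Qed.
Lemma Re_mul_conjc z : complex.Re (z * conjc z) = cabs2 z.
Proof. by rewrite mul_conjc. Qed.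
Lemma cabs2_ge0 z : 0 <= cabs2 z. Proof. by rewrite addr_ge0 ?sqr_ge0. Qed.
Lemma conjcM z w : conjc (z * w) = conjc z * conjc w. Proof. exact: rmorphM. Qed.
Lemma conjcD z w : conjc (z + w) = conjc z + conjc w. Proof. exact: rmorphD. Qed.
Lemma conjc_sum (I : Type) (r : seq I) (P : pred I) (F : I -> C) :
  conjc (\sum_(i <- r | P i) F i) = \sum_(i <- r | P i) conjc (F i).
Proof. exact: rmorph_sum. Qed.

End ComplexBasics.

(** * Spectral decomposition, changes of basis and the trace pairing *)

Section Spectral.
Variable R : realType.
Local Notation C := R[i].
Variable d : nat.
Implicit Types (A B H X Y U V W : 'M[C]_d) (a b l m : 'I_d -> R).

Lemma adjmxE p q (X : 'M[C]_(p, q)) i j : adjmx X i j = conjc (X j i).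
Proof. by rewrite !mxE. Qed.

Lemma adjmxK p q (X : 'M[C]_(p, q)) : adjmx (adjmx X) = X.
Proof. by apply/matrixP => i j; rewrite !adjmxE conjcK. Qed.

Lemma adjmxM p q r (X : 'M[C]_(p, q)) (Y : 'M[C]_(q, r)) :
  adjmx (X *m Y) = adjmx Y *m adjmx X.
Proof.
apply/matrixP => i j; rewrite adjmxE !mxE conjc_sum; apply: eq_bigr => k _.
by rewrite !adjmxE conjcM mulrC.
Qed.

Lemma adjmxD p q (X Y : 'M[C]_(p, q)) : adjmx (X + Y) = adjmx X + adjmx Y.
Proof. by apply/matrixP => i j; rewrite adjmxE !mxE conjcD. Qed.

Lemma adjmxN p q (X : 'M[C]_(p, q)) : adjmx (- X) = - adjmx X.
Proof. by apply/matrixP => i j; rewrite !mxE rmorphN. Qed.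

Lemma adjmxZ p q (s : R) (X : 'M[C]_(p, q)) : adjmx (s%:C%C *: X) = s%:C%C *: adjmx X.
Proof. by apply/matrixP => i j; rewrite !mxE conjcM /= oppr0. Qed.

Lemma adjmx0 p q : adjmx (0 : 'M[C]_(p, q)) = 0.
Proof. by apply/matrixP => i j; rewrite !mxE conjc0. Qed.

Lemma adjmx1 n : adjmx (1%:M : 'M[C]_n) = 1%:M.
Proof. by rewrite /adjmx map_mx1 trmx1. Qed.

Definition rdiag a : 'M[C]_d := diag_mx (\row_i (a i)%:C%C).
Definition fmx U a : 'M[C]_d := adjmx U *m rdiag a *m U.
Definition spec A U l := U *m adjmx U = 1%:M /\ A = fmx U l.
Definition herm A := adjmx A = A.

Definition seig A : 'I_d -> R := fun i => complex.Re (spectral_diag A 0 i).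
Definition sbas A : 'M[C]_d := spectralmx A.

Lemma specP A : herm A -> spec A (sbas A) (seig A).
Proof.
move=> hA.
have tc p q (X : 'M[C]_(p, q)) : map_mx Num.conj X^T = adjmx X by rewrite /adjmx map_trmx.
have hs : A \is hermitianmx _ false Num.conj.
  by apply/is_hermitianmxP; rewrite expr0 scale1r tc.
have hn : A \is normalmx by apply: hermitian_normalmx.
have hu : sbas A \is unitarymx := spectral_unitarymx A.
have UU : sbas A *m adjmx (sbas A) = 1%:M by rewrite -tc; apply/unitarymxP.
split=> //.
have /orthomx_spectralP AE := hn.
have iU : invmx (spectralmx A) = adjmx (sbas A) by rewrite -tc; apply: invmx_unitary.
suff E : rdiag (seig A) = diag_mx (spectral_diag A) by rewrite /fmx E; rewrite iU in AE; exact: AE.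
congr diag_mx; apply/rowP => i; rewrite !mxE /seig.
have /mxOverP/(_ 0 i) := hermitian_spectral_diag_real hs.
by move=> /RRe_real.
Qed.

Definition chg U V X := U *m X *m adjmx V.

Lemma fmxK U a X V : U *m adjmx U = 1%:M -> chg U V (fmx U a *m X) = rdiag a *m chg U V X.
Proof. by move=> UU; rewrite /chg /fmx !mulmxA UU mul1mx. Qed.

Lemma mulfmxK V a X U : V *m adjmx V = 1%:M -> chg U V (X *m fmx V a) = chg U V X *m rdiag a.
Proof.
move=> VV; rewrite /chg /fmx -!mulmxA; congr (_ *m (_ *m _)).
by rewrite VV mulmx1.
Qed.

Lemma rdiagME a X i j : (rdiag a *m X) i j = (a i)%:C%C * X i j.
Proof. by rewrite mul_diag_mx !mxE. Qed.

Lemma mulrdiagE a X i j : (X *m rdiag a) i j = (a j)%:C%C * X i j.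
Proof. by rewrite mul_mx_diag !mxE mulrC. Qed.

Lemma uadj U : U *m adjmx U = 1%:M -> adjmx U *m U = 1%:M.
Proof. exact: mulmx1C. Qed.

Lemma chg_mul U V W X Y : V *m adjmx V = 1%:M -> chg U V X *m chg V W Y = chg U W (X *m Y).
Proof. by move=> /uadj VV; rewrite /chg !mulmxA -(mulmxA _ (adjmx V)) VV mulmx1. Qed.

Lemma adjmx_chg U V X : adjmx (chg U V X) = chg V U (adjmx X).
Proof. by rewrite /chg !adjmxM adjmxK mulmxA. Qed.

Lemma trace_chg U X : U *m adjmx U = 1%:M -> \tr (chg U U X) = \tr X.
Proof. by move=> /uadj UU; rewrite /chg mxtrace_mulC mulmxA UU mul1mx. Qed.

Lemma chg1 U : U *m adjmx U = 1%:M -> chg U U 1%:M = 1%:M.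
Proof. by move=> UU; rewrite /chg mulmx1. Qed.

(* [ovl U V i j] is the squared overlap of the [i]-th vector of [U] with the
   [j]-th vector of [V]. *)
Definition ovl U V i j : R := cabs2 (chg U V 1%:M i j).

Lemma ovl_ge0 U V i j : 0 <= ovl U V i j. Proof. exact: cabs2_ge0. Qed.

Lemma sum_cabs2 p q (X : 'M[C]_(p, q)) : \sum_i \sum_j cabs2 (X i j) = complex.Re (\tr (X *m adjmx X)).
Proof.
rewrite /mxtrace Re_sum; apply: eq_bigr => i _; rewrite !mxE Re_sum; apply: eq_bigr => j _.
by rewrite adjmxE Re_mul_conjc.
Qed.

Lemma sum_cabs2_chg U V X : U *m adjmx U = 1%:M -> V *m adjmx V = 1%:M ->
  \sum_i \sum_j cabs2 (chg U V X i j) = \sum_i \sum_j cabs2 (X i j).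
Proof.
by move=> UU VV; rewrite !sum_cabs2 adjmx_chg chg_mul// trace_chg.
Qed.

Lemma sum_ovl_r U V i : U *m adjmx U = 1%:M -> V *m adjmx V = 1%:M -> \sum_j ovl U V i j = 1.
Proof.
move=> UU VV; have : (chg U V 1%:M *m adjmx (chg U V 1%:M)) i i = 1.
  by rewrite adjmx_chg chg_mul// mul1mx adjmx1 chg1// mxE eqxx.
rewrite mxE => /(congr1 (@complex.Re R)); rewrite Re_sum /= => <-.
by apply: eq_bigr => j _; rewrite adjmxE Re_mul_conjc.
Qed.

Lemma ovlC U V i j : ovl U V i j = ovl V U j i.
Proof.
have E : chg U V 1%:M = adjmx (chg V U 1%:M) by rewrite adjmx_chg adjmx1.
by rewrite /ovl E adjmxE /cabs2 ReJ ImJ sqrrN.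
Qed.

Lemma sum_ovl_l U V j : U *m adjmx U = 1%:M -> V *m adjmx V = 1%:M -> \sum_i ovl U V i j = 1.
Proof. by move=> UU VV; under eq_bigr do rewrite ovlC; exact: sum_ovl_r. Qed.

Lemma ovl_le1 U V i j : U *m adjmx U = 1%:M -> V *m adjmx V = 1%:M -> ovl U V i j <= 1.
Proof.
move=> UU VV; rewrite -(sum_ovl_r i UU VV) (bigD1 j)//= lerDl.
by apply: sumr_ge0 => k _; exact: ovl_ge0.
Qed.

Definition rtr X Y : R := complex.Re (\tr (X *m Y)).

Lemma rtrE U V X Y : U *m adjmx U = 1%:M -> V *m adjmx V = 1%:M ->
  rtr X Y = \sum_i \sum_j complex.Re (chg U V X i j * chg V U Y j i).
Proof.
move=> UU VV; rewrite /rtr -(trace_chg _ UU) -(chg_mul _ _ _ _ VV) /mxtrace Re_sum.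
by apply: eq_bigr => i _; rewrite mxE Re_sum.
Qed.

Lemma rtrC X Y : rtr X Y = rtr Y X. Proof. by rewrite /rtr mxtrace_mulC. Qed.
Lemma rtrDl X Y W : rtr (X + Y) W = rtr X W + rtr Y W.
Proof. by rewrite /rtr mulmxDl mxtraceD ReD. Qed.
Lemma rtrDr X Y W : rtr W (X + Y) = rtr W X + rtr W Y.
Proof. by rewrite !(rtrC W) rtrDl. Qed.
Lemma rtrNl X Y : rtr (- X) Y = - rtr X Y.
Proof. by rewrite /rtr mulNmx raddfN ReN. Qed.
Lemma rtrNr X Y : rtr X (- Y) = - rtr X Y.
Proof. by rewrite !(rtrC X) rtrNl. Qed.
Lemma rtrBl X Y W : rtr (X - Y) W = rtr X W - rtr Y W. Proof. by rewrite rtrDl rtrNl. Qed.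
Lemma rtrBr X Y W : rtr W (X - Y) = rtr W X - rtr W Y. Proof. by rewrite rtrDr rtrNr. Qed.
Lemma rtrZl (s : R) X Y : rtr (s%:C%C *: X) Y = s * rtr X Y.
Proof. by rewrite /rtr -scalemxAl mxtraceZ Re_scale. Qed.
Lemma rtrZr (s : R) X Y : rtr X (s%:C%C *: Y) = s * rtr X Y.
Proof. by rewrite !(rtrC X) rtrZl. Qed.

(** A crude entrywise norm suffices, since every constant built from it is multiplied by a vanishing
    power of n in the end. *)
Definition l1 p q (X : 'M[C]_(p, q)) : R := \sum_i \sum_j cabs (X i j).

Lemma l1_ge0 p q (X : 'M[C]_(p, q)) : 0 <= l1 X.
Proof. by apply: sumr_ge0 => i _; apply: sumr_ge0 => j _; exact: cabs_ge0. Qed.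
Lemma l1D p q (X Y : 'M[C]_(p, q)) : l1 (X + Y) <= l1 X + l1 Y.
Proof.
rewrite /l1 -big_split; apply: ler_sum => i _; rewrite -big_split; apply: ler_sum => j _.
by rewrite mxE; exact: cabsD.
Qed.
Lemma l1N p q (X : 'M[C]_(p, q)) : l1 (- X) = l1 X.
Proof. by apply: eq_bigr => i _; apply: eq_bigr => j _; rewrite mxE cabsN. Qed.
Lemma l1Z p q (s : R) (X : 'M[C]_(p, q)) : l1 (s%:C%C *: X) = `|s| * l1 X.
Proof.
rewrite /l1 mulr_sumr; apply: eq_bigr => i _; rewrite mulr_sumr; apply: eq_bigr => j _.
by rewrite mxE cabsM cabs_real.
Qed.
Lemma l10 p q : l1 (0 : 'M[C]_(p, q)) = 0.
Proof. by rewrite /l1 big1// => i _; rewrite big1// => j _; rewrite mxE cabs0. Qed.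

Lemma sum_sqr_le (I : finType) (f : I -> R) : (forall i, 0 <= f i) ->
  \sum_i f i ^+ 2 <= (\sum_i f i) ^+ 2.
Proof.
move=> f0; rewrite expr2 mulr_suml; apply: ler_sum => i _.
by rewrite expr2 ler_wpM2l// (bigD1 i)//= lerDl sumr_ge0.
Qed.

Lemma sum_cabs2_le X : \sum_i \sum_j cabs2 (X i j) <= l1 X ^+ 2.
Proof.
rewrite /l1 pair_big/= [X in _ <= X ^+ 2]pair_big/=.
apply: le_trans (sum_sqr_le (fun p => cabs_ge0 (X p.1 p.2))).
by apply: ler_sum => p _; rewrite sqr_cabs.
Qed.

Lemma cabs_chg_le U V X i j : U *m adjmx U = 1%:M -> V *m adjmx V = 1%:M ->
  cabs (chg U V X i j) <= l1 X.
Proof.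
move=> UU VV; rewrite -(ler_pXn2r (n := 2))// ?nnegrE ?cabs_ge0 ?l1_ge0//.
apply: le_trans (sum_cabs2_le X); rewrite -(sum_cabs2_chg X UU VV) sqr_cabs.
rewrite (bigD1 i)//= (bigD1 j)//= -addrA lerDl addr_ge0//.
  by apply: sumr_ge0 => k _; exact: cabs2_ge0.
by apply: sumr_ge0 => k _; apply: sumr_ge0 => k' _; exact: cabs2_ge0.
Qed.

End Spectral.

(** * First-order estimates for the trace exponential *)

Section TraceExp.
Variable R : realType.
Local Notation C := R[i].
Variable d : nat.
Implicit Types (A B H X Y U V W : 'M[C]_d) (a b l m : 'I_d -> R).

Lemma hermD A B : herm A -> herm B -> herm (A + B).
Proof. by rewrite /herm adjmxD => -> ->. Qed.
Lemma hermN A : herm A -> herm (- A). Proof. by rewrite /herm adjmxN => ->. Qed.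
Lemma hermB A B : herm A -> herm B -> herm (A - B).
Proof. by move=> hA hB; apply: hermD => //; exact: hermN. Qed.
Lemma hermZ (s : R) A : herm A -> herm (s%:C%C *: A).
Proof. by rewrite /herm adjmxZ => ->. Qed.
Lemma herm0 : herm (0 : 'M[C]_d). Proof. exact: adjmx0. Qed.

Lemma chgD U V X Y : chg U V (X + Y) = chg U V X + chg U V Y.
Proof. by rewrite /chg mulmxDr mulmxDl. Qed.
Lemma chgN U V X : chg U V (- X) = - chg U V X.
Proof. by rewrite /chg mulmxN mulNmx. Qed.
Lemma chgB U V X Y : chg U V (X - Y) = chg U V X - chg U V Y.
Proof. by rewrite chgD chgN. Qed.

(** The mixed basis, eigenvectors of one matrix on the left and of the other on the right,
    diagonalizes both terms at once: a difference of matrix functions becomes a difference of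
    scalars times an overlap, without perturbation theory. *)
Lemma chg_diff U V a b i j : U *m adjmx U = 1%:M -> V *m adjmx V = 1%:M ->
  chg U V (fmx V b - fmx U a) i j = (b j - a i)%:C%C * chg U V 1%:M i j.
Proof.
move=> UU VV; rewrite chgB -[fmx V b]mul1mx mulfmxK// -[fmx U a]mulmx1 fmxK//.
by rewrite [LHS]mxE [X in _ + X]mxE mulrdiagE rdiagME rmorphB mulrBl.
Qed.

Lemma chg_fmx U V f i j : U *m adjmx U = 1%:M ->
  chg U V (fmx U f) i j = (f i)%:C%C * chg U V 1%:M i j.
Proof. by move=> UU; rewrite -[fmx U f]mulmx1 fmxK// rdiagME. Qed.

Lemma chg1_conj U V i j : chg V U 1%:M j i = conjc (chg U V 1%:M i j).
Proof. by rewrite -adjmxE adjmx_chg adjmx1. Qed.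

Lemma rtr_ovl U V a b X (c : 'I_d -> 'I_d -> R) : U *m adjmx U = 1%:M -> V *m adjmx V = 1%:M ->
  (forall i j, chg U V X i j = (c i j)%:C%C * chg U V 1%:M i j) ->
  rtr X (fmx V b - fmx U a) = \sum_i \sum_j ovl U V i j * (c i j * (b j - a i)).
Proof.
move=> UU VV Xc; rewrite (rtrE _ _ UU VV); apply: eq_bigr => i _; apply: eq_bigr => j _.
have -> : chg V U (fmx V b - fmx U a) j i = (b j - a i)%:C%C * conjc (chg U V 1%:M i j).
  by rewrite -opprB chgN mxE chg_diff// -mulNr -rmorphN opprB chg1_conj.
by rewrite Xc mulrACA mul_conjc -!rmorphM /= mulrC.
Qed.

Definition phi A : R := \sum_i expR (seig A i).
Definition dphi A : 'M[C]_d := fmx (sbas A) (fun i => expR (seig A i)).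
(** Daletskii-Krein form of the Hessian of [phi], whose gradient is [dphi]. *)
Definition Qf A X : R :=
  \sum_i \sum_k cabs2 (chg (sbas A) (sbas A) X i k) * e1 (seig A i) (seig A k).

Lemma phi_ge0 A : 0 <= phi A.
Proof. by apply: sumr_ge0 => i _; exact: expR_ge0. Qed.
Lemma expR_le_phi A i : expR (seig A i) <= phi A.
Proof. by rewrite /phi (bigD1 i)//= lerDl sumr_ge0// => j _; exact: expR_ge0. Qed.
Lemma phi_gt0 A : (0 < d)%N -> 0 < phi A.
Proof. by move=> d0; apply: lt_le_trans (expR_le_phi A (Ordinal d0)); exact: expR_gt0. Qed.
Lemma Qf_ge0 A X : 0 <= Qf A X.
Proof.
apply: sumr_ge0 => i _; apply: sumr_ge0 => j _.
by rewrite mulr_ge0 ?cabs2_ge0// e1_ge0.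
Qed.

(** Squared overlaps form a doubly stochastic matrix, so both traces can be averaged against it;
    Klein's inequality and the quadratic upper bound then become statements on scalars. *)
Lemma klein A B : herm A -> herm B ->
  phi B - phi A - rtr (dphi A) (B - A) =
  \sum_i \sum_j ovl (sbas A) (sbas B) i j *
    (expR (seig B j) - expR (seig A i) - expR (seig A i) * (seig B j - seig A i)).
Proof.
move=> /specP[UU AE] /specP[VV BE].
set U := sbas A in UU AE *; set V := sbas B in VV BE *.
set l := seig A in AE *; set m := seig B in BE *.
have -> : B - A = fmx V m - fmx U l by rewrite -BE -AE.
rewrite (rtr_ovl _ _ UU VV (c := fun i j => expR (l i))); last first.
  by move=> i j; rewrite /dphi chg_fmx.
have -> : phi A = \sum_i \sum_j ovl U V i j * expR (l i).
  by apply: eq_bigr => i _; rewrite -mulr_suml sum_ovl_r// mul1r.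
have -> : phi B = \sum_i \sum_j ovl U V i j * expR (m j).
  by rewrite exchange_big/=; apply: eq_bigr => j _; rewrite -mulr_suml sum_ovl_l// mul1r.
rewrite -!sumrB; apply: eq_bigr => i _; rewrite -!sumrB; apply: eq_bigr => j _.
by rewrite -!mulrBr.
Qed.

Lemma phi_ge_tangent A B : herm A -> herm B -> phi A + rtr (dphi A) (B - A) <= phi B.
Proof.
move=> hA hB; rewrite -subr_ge0 opprD addrA klein//.
apply: sumr_ge0 => i _; apply: sumr_ge0 => j _; rewrite mulr_ge0 ?ovl_ge0//.
have -> : expR (seig B j) = expR (seig A i) * expR (seig B j - seig A i).
  by rewrite -expRD subrKC.
have := expR_ge1Dx (seig B j - seig A i); have := expR_ge0 (seig A i); nra.
Qed.

Lemma sum_ovl_sqr A B : herm A -> herm B ->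
  \sum_i \sum_j ovl (sbas A) (sbas B) i j * (seig B j - seig A i) ^+ 2 <= l1 (B - A) ^+ 2.
Proof.
move=> /specP[UU AE] /specP[VV BE].
apply: le_trans (sum_cabs2_le (B - A)); rewrite -(sum_cabs2_chg _ UU VV).
have -> : chg (sbas A) (sbas B) (B - A) = chg (sbas A) (sbas B) (fmx (sbas B) (seig B) - fmx (sbas A) (seig A)).
  by rewrite -BE -AE.
apply: ler_sum => i _; apply: ler_sum => j _.
rewrite chg_diff// -sqr_cabs cabsM exprMn cabs_real real_normK ?num_real//.
by rewrite sqr_cabs mulrC.
Qed.

Lemma phi_le_quad A B : herm A -> herm B ->
  phi B <= phi A + rtr (dphi A) (B - A) + l1 (B - A) ^+ 2 * (phi A + phi B).
Proof.
move=> hA hB; rewrite -lerBlDl opprD addrA klein//.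
apply: le_trans (_ : _ <= (\sum_i \sum_j ovl (sbas A) (sbas B) i j * (seig B j - seig A i) ^+ 2)
   * (phi A + phi B)) _; last first.
  by rewrite ler_wpM2r ?addr_ge0 ?phi_ge0// sum_ovl_sqr.
rewrite mulr_suml; apply: ler_sum => i _; rewrite mulr_suml; apply: ler_sum => j _.
rewrite -mulrA ler_wpM2l ?ovl_ge0//.
have hx : expR (seig A i) <= phi A + phi B by rewrite ler_wpDr ?phi_ge0// expR_le_phi.
have hy : expR (seig B j) <= phi A + phi B by rewrite ler_wpDl ?phi_ge0// expR_le_phi.
move: (phi A + phi B) hx hy => M; move: (seig A i) (seig B j) => x y hx hy.
have E := e1E x y; have := @e1_lip R x y x x M hx hy hx hx.
rewrite subrr normr0 add0r e1xx => L.
have -> : expR y - expR x - expR x * (y - x) = (y - x) * (e1 x y - expR x) by rewrite -E; ring.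
apply: (le_trans (ler_norm _)); rewrite normrM.
apply: le_trans (ler_wpM2l (normr_ge0 _) L) _.
by rewrite mulrCA -expr2 real_normK ?num_real// mulrC.
Qed.

Lemma rtr_dphi_le A H : herm A -> `|rtr (dphi A) H| <= l1 H * phi A.
Proof.
move=> /specP[UU AE]; rewrite (rtrE _ _ UU UU).
have -> : \sum_i \sum_j complex.Re (chg (sbas A) (sbas A) (dphi A) i j * chg (sbas A) (sbas A) H j i)
  = \sum_i expR (seig A i) * complex.Re (chg (sbas A) (sbas A) H i i).
  apply: eq_bigr => i _; rewrite (bigD1 i)//= big1 ?addr0.
    by rewrite /dphi chg_fmx// chg1// mxE eqxx mulr1 Re_scale.
  move=> j ji; rewrite /dphi chg_fmx// chg1// mxE eq_sym (negbTE ji) mulr0 mul0r //.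
apply: le_trans (ler_norm_sum _ _ _) _.
rewrite mulr_sumr; apply: ler_sum => i _; rewrite normrM ger0_norm ?expR_ge0// mulrC.
rewrite ler_wpM2r ?expR_ge0//; apply: le_trans (Re_le_cabs _) _.
exact: cabs_chg_le.
Qed.

(** The tangent at B gives phi B <= phi A + l1 (B - A) * phi B, and the last term is absorbed on the
    left. *)
Lemma phi_le2 A B : herm A -> herm B -> l1 (B - A) <= 1 / 2 -> phi B <= 2 * phi A.
Proof.
move=> hA hB h; have := phi_ge_tangent hB hA; have := rtr_dphi_le (A - B) hB.
rewrite -l1N opprB ler_norml => /andP[h1 h2] h3; have := phi_ge0 B; nra.
Qed.

Lemma phi_rel_lip A B : herm A -> herm B -> l1 (B - A) <= 1 / 2 ->
  `|phi B - phi A| <= 2 * l1 (B - A) * phi A.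
Proof.
move=> hA hB h; have h2 := phi_le2 hA hB h.
have T1 := phi_ge_tangent hB hA; have := rtr_dphi_le (A - B) hB.
have T2 := phi_ge_tangent hA hB; have := rtr_dphi_le (B - A) hA.
rewrite -(l1N (A - B)) opprB; rewrite ler_norml => /andP[h4 h5].
rewrite ler_norml => /andP[h7 h8]; rewrite ler_norml.
have p1 := ler_wpM2l (l1_ge0 (B - A)) h2; have p2 := mulr_ge0 (l1_ge0 (B - A)) (phi_ge0 A).
move: p1 p2 h4 h5 h7 h8 T1 T2; move: (l1 _) (phi A) (phi B) (rtr _ _) (rtr _ _) => n p q t1 t2 *.
by apply/andP; split; lra.
Qed.

End TraceExp.

(** * Third-order expansion of the trace exponential and the sign of its cubic term *)

Section ThirdOrder.
Variable R : realType.
Local Notation C := R[i].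
Variable d : nat.
Implicit Types (A B H X Y U V W : 'M[C]_d) (a b l m : 'I_d -> R).

Lemma e2_lip3 (x y z z' K : R) : expR x <= K -> expR y <= K -> expR z <= K -> expR z' <= K ->
  `|e2 x y z - e2 x y z'| <= K * `|z - z'|.
Proof.
move=> hx hy hz hz'; have := e2_lip hx hy hz hx hy hz'.
by move: (e2 x y z) (e2 x y z') => p q; rewrite !subrr normr0 !add0r.
Qed.

Lemma chgE U V W X i j : V *m adjmx V = 1%:M ->
  chg U W X i j = \sum_k chg U V X i k * chg V W 1%:M k j.
Proof. by move=> VV; rewrite -[in LHS](mulmx1 X) -(chg_mul _ _ _ _ VV) mxE. Qed.

Lemma chgE' U V W X i j : V *m adjmx V = 1%:M ->
  chg U W X i j = \sum_k chg U V 1%:M i k * chg V W X k j.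
Proof. by move=> VV; rewrite -[in LHS](mul1mx X) -(chg_mul _ _ _ _ VV) mxE. Qed.

Section Pair.
Variables A B : 'M[C]_d.
Hypotheses (hA : herm A) (hB : herm B).
Let H := B - A.
Let U := sbas A.
Let V := sbas B.
Let l := seig A.
Let m := seig B.
Let UU : U *m adjmx U = 1%:M. Proof. by case: (specP hA). Qed.
Let VV : V *m adjmx V = 1%:M. Proof. by case: (specP hB). Qed.
Let h := chg U U H.
Let S := chg U V (1%:M : 'M[C]_d).
Let S' := chg V U (1%:M : 'M[C]_d).
(** Common weights for three expansions: after inserting resolutions of the identity, the increment
    of the gradient, the Hessian and the cubic term are sums over the same w, against
    [e1 (l i) (m j)], [e1 (l i) (l k)] and [(m j - l k) * e2 (l i) (l k) (l n)]. They can then be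
    compared term by term through [e2E]. *)
Let w i n j k : C := h i n * S n j * S' j k * h k i.

Let HE : H = fmx V m - fmx U l.
Proof. by case: (specP hA) => _ <-; case: (specP hB) => _ <-. Qed.

Let S'E i j : S' j i = conjc (S i j). Proof. exact: chg1_conj. Qed.

Let Huv i j : chg U V H i j = (m j - l i)%:C%C * S i j.
Proof. by rewrite HE chg_diff. Qed.

Let Hvu j i : chg V U H j i = (m j - l i)%:C%C * S' j i.
Proof.
have -> : H = - (fmx U l - fmx V m) by rewrite HE opprB.
by rewrite chgN mxE chg_diff// -mulNr -rmorphN opprB.
Qed.

Let herm_h i j : h j i = conjc (h i j).
Proof.
have {1}-> : h = adjmx h by rewrite /h adjmx_chg (hermB hB hA).
by rewrite adjmxE.
Qed.

Let Huv_conj i j : chg V U H j i = conjc (chg U V H i j).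
Proof. by rewrite -adjmxE adjmx_chg (hermB hB hA). Qed.

Lemma rtr_dphi_diff :
  rtr H (dphi B - dphi A) = \sum_i \sum_j \sum_k \sum_n complex.Re (w i n j k) * e1 (l i) (m j).
Proof.
rewrite /dphi (rtr_ovl _ _ UU VV Huv); apply: eq_bigr => i _; apply: eq_bigr => j _.
rewrite -e1E.
have -> : ovl U V i j * ((m j - l i) * ((m j - l i) * e1 (l i) (m j))) =
   complex.Re (chg U V H i j * chg V U H j i) * e1 (l i) (m j).
  rewrite Huv_conj Re_mul_conjc Huv -sqr_cabs cabsM exprMn cabs_real real_normK ?num_real//.
  by rewrite sqr_cabs -/(ovl U V i j); move: (e1 _ _) (ovl _ _ _ _) => e o; ring.
rewrite (@chgE' V U U H j i UU) mulr_sumr Re_sum mulr_suml; apply: eq_bigr => k _.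
rewrite (@chgE U U V H i j UU) mulr_suml Re_sum mulr_suml; apply: eq_bigr => n _.
by rewrite /w !mulrA.
Qed.

Lemma Qf_quad :
  Qf A H = \sum_i \sum_j \sum_k \sum_n complex.Re (w i n j k) * e1 (l i) (l k).
Proof.
rewrite /Qf; apply: eq_bigr => i _; rewrite exchange_big/=; apply: eq_bigr => k _.
rewrite -Re_mul_conjc -/U -/h -herm_h -/l.
rewrite {1}/h (@chgE U V U H i k VV) mulr_suml Re_sum mulr_suml; apply: eq_bigr => j _.
rewrite (@chgE U U V H i j UU) !mulr_suml Re_sum mulr_suml; apply: eq_bigr => n _.
by rewrite /w.
Qed.

(** Half of the third derivative of [phi] at A along H. *)
Definition cubic (A H : 'M[C]_d) : R := \sum_i \sum_k \sum_n
  complex.Re (chg (sbas A) (sbas A) H i n * chg (sbas A) (sbas A) H n k * chg (sbas A) (sbas A) H k i)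
  * e2 (seig A i) (seig A k) (seig A n).

Lemma cubic_quad :
  cubic A H = \sum_i \sum_j \sum_k \sum_n complex.Re (w i n j k) * ((m j - l k) * e2 (l i) (l k) (l n)).
Proof.
rewrite /cubic -/U -/h -/l; apply: eq_bigr => i _; rewrite [RHS]exchange_big/=; apply: eq_bigr => k _.
rewrite [RHS]exchange_big/=; apply: eq_bigr => n _.
rewrite {2}/h (@chgE' U V U H n k VV) mulr_sumr mulr_suml Re_sum mulr_suml; apply: eq_bigr => j _.
rewrite -/S Hvu; set z := (X in complex.Re X).
have -> : z = (m j - l k)%:C%C * w i n j k by rewrite /z /w; ring.
by rewrite Re_scale (mulrC (m j - l k)) mulrA.
Qed.

Let M := phi A + phi B.
Let hl i : expR (l i) <= M. Proof. by rewrite ler_wpDr ?phi_ge0// expR_le_phi. Qed.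
Let hm i : expR (m i) <= M. Proof. by rewrite ler_wpDl ?phi_ge0// expR_le_phi. Qed.
Let M0 : 0 <= M. Proof. by rewrite addr_ge0 ?phi_ge0. Qed.
Let N := l1 H.
Let N0 : 0 <= N. Proof. exact: l1_ge0. Qed.
Let hN i j : cabs (h i j) <= N. Proof. exact: cabs_chg_le. Qed.
Let HN i j : cabs (chg U V H i j) <= N. Proof. exact: cabs_chg_le. Qed.
Let SN i j : cabs (S i j) <= 1.
Proof.
rewrite -(ler_pXn2r (n := 2))// ?nnegrE ?cabs_ge0// expr1n sqr_cabs.
exact: ovl_le1.
Qed.

Let sum4 (f : 'I_d -> 'I_d -> 'I_d -> 'I_d -> R) K : (forall i j k n, `|f i j k n| <= K) ->
  `|\sum_i \sum_j \sum_k \sum_n f i j k n| <= d%:R ^+ 4 * K.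
Proof.
move=> fK.
have s (g : 'I_d -> R) L : (forall i, `|g i| <= L) -> `|\sum_i g i| <= d%:R * L.
  move=> gL; apply: le_trans (ler_norm_sum _ _ _) _.
  apply: (le_trans (ler_sum _ (fun i _ => gL i))).
  by rewrite sumr_const card_ord mulr_natl.
rewrite !exprS expr0 mulr1 -!mulrA; do 4 (apply: (s _ _ _) => ?); exact: fK.
Qed.

(** The gap [m j - l k] may be large, but only where the overlap [S' j k] is small: their product is
    an entry of H in the mixed basis. *)
Let wl i n j k : `|complex.Re (w i n j k) * (m j - l k)| <= cabs (h i n) * cabs (S n j) * (N * N).
Proof.
rewrite mulrC -Re_scale; apply: le_trans (Re_le_cabs _) _.
have -> : (m j - l k)%:C%C * w i n j k = h i n * S n j * ((m j - l k)%:C%C * S' j k) * h k i.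
  by rewrite /w; ring.
rewrite -Hvu Huv_conj !cabsM cabs_conj -!mulrA.
by do 2 (apply: ler_wpM2l; first exact: cabs_ge0); apply: ler_pM; rewrite ?cabs_ge0.
Qed.

Lemma rtr_dphi_diff_Qf :
  `|rtr H (dphi B - dphi A) - Qf A H| <= d%:R ^+ 4 * (l1 H ^+ 3 * (phi A + phi B)).
Proof.
rewrite rtr_dphi_diff Qf_quad -sumrB.
under eq_bigr do rewrite -sumrB.
under eq_bigr do under eq_bigr do rewrite -sumrB.
under eq_bigr do under eq_bigr do under eq_bigr do rewrite -sumrB.
apply: sum4 => i j k n; rewrite -mulrBr -e2E mulrA normrM -/M.
apply: ler_pM => //; last by apply: e2_bound.
apply: le_trans (wl _ _ _ _) _; rewrite -/N exprS expr2.
rewrite -mulrA; apply: ler_pM => //; rewrite ?mulr_ge0 ?cabs_ge0//.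
by rewrite ler_piMl// mulr_ge0.
Qed.

Lemma rtr_dphi_diff_cubic :
  `|rtr H (dphi B - dphi A) - Qf A H - cubic A H| <= d%:R ^+ 4 * (l1 H ^+ 4 * (phi A + phi B)).
Proof.
rewrite rtr_dphi_diff Qf_quad cubic_quad -!sumrB.
under eq_bigr do rewrite -!sumrB.
under eq_bigr do under eq_bigr do rewrite -!sumrB.
under eq_bigr do under eq_bigr do under eq_bigr do rewrite -!sumrB.
apply: sum4 => i j k n; rewrite -mulrBr -e2E -mulrBr -mulrBr mulrA normrM -/M.
(* Replacing the argument m j of [e2] by l n costs a factor m j - l n, which the overlap [S n j]
   turns into one more entry of H: hence the fourth power. *)
have L := e2_lip3 (hl i) (hl k) (hm j) (hl n).
apply: le_trans (ler_pM _ _ (wl _ _ _ _) L) _ => //.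
have -> : cabs (h i n) * cabs (S n j) * (N * N) * (M * `|m j - l n|) =
   cabs (h i n) * (cabs (chg U V H n j)) * (N * N) * M.
  by rewrite Huv cabsM cabs_real; ring.
rewrite -/N !exprS expr0 mulr1 !mulrA ler_wpM2r// -!mulrA ler_pM// ?mulr_ge0 ?cabs_ge0//.
by rewrite ler_wpM2r// mulr_ge0.
Qed.

End Pair.

(** Complex test vectors are used for both fields, which [psd F] does not do when F = R. *)
Definition psdc H := herm H /\ forall u : 'cV[C]_d, 0 <= complex.Re ((adjmx u *m H *m u) 0 0).

Lemma psdcZ (s : R) H : 0 <= s -> psdc H -> psdc (s%:C%C *: H).
Proof.
move=> s0 [hH pH]; split; first exact: hermZ.
by move=> u; rewrite -scalemxAr -scalemxAl mxE Re_scale mulr_ge0.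
Qed.

Lemma quad_sum (h : 'M[C]_d) (u : 'cV[C]_d) :
  (adjmx u *m h *m u) 0 0 = \sum_j \sum_k conjc (u j 0) * h j k * u k 0.
Proof.
rewrite mxE exchange_big/=; apply: eq_bigr => k _; rewrite mxE mulr_suml.
by apply: eq_bigr => j _; rewrite adjmxE.
Qed.

Lemma psdc_chg U H : psdc H -> psdc (chg U U H).
Proof.
move=> [hH pH]; split; first by rewrite /herm adjmx_chg hH.
by move=> u; have := pH (adjmx U *m u); rewrite adjmxM adjmxK /chg !mulmxA.
Qed.

(* For fixed [i] the sum over [j] and [k] is the quadratic form of [h] at the
   vector [k |-> r k * h k i]. *)
Lemma cubic_quad_ge0 (h : 'M[C]_d) i (r : 'I_d -> R) : psdc h ->
  0 <= \sum_j \sum_k complex.Re (h i j * h j k * h k i) * (r j * r k).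
Proof.
move=> [hh ph]; have := ph (\col_k ((r k)%:C%C * h k i)).
rewrite quad_sum Re_sum; under eq_bigr do rewrite Re_sum.
congr (_ <= _); apply: eq_bigr => j _; apply: eq_bigr => k _.
rewrite !mxE.
have -> : conjc ((r j)%:C%C * h j i) = (r j)%:C%C * h i j.
  by rewrite conjcM -adjmxE hh; congr (_ * _); rewrite /= oppr0.
set z := (X in complex.Re X).
have -> : z = (r j * r k)%:C%C * (h i j * h j k * h k i) by rewrite /z rmorphM/=; ring.
by rewrite Re_scale mulrC.
Qed.

(** With one index fixed, each hat is a min kernel, and [cubic_quad_ge0] supplies the nonnegative
    sums over K x K that [sum_min_ge0] asks for. The cyclic symmetry of t brings the other two hats
    to the same fixed index. *)
Lemma cubic_ge0 A H : psdc H -> 0 <= cubic A H.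
Proof.
move=> pH; rewrite /cubic; set h := chg _ _ _; set l := seig A.
have ph : psdc h := psdc_chg _ pH.
pose t i k n := complex.Re (h i n * h n k * h k i).
have tC i k n : t i k n = t k n i by congr complex.Re; ring.
(* The denominators f k * f n are absorbed into the weights, where they rescale the test vector; a
   pure min kernel is left. *)
have part (f g : 'I_d -> R) (D : rel 'I_d) i : (forall j, D i j -> 0 <= g j) ->
    0 <= \sum_k \sum_n t i k n *
      (if D i k && D i n then Num.min (g k) (g n) / (f k * f n) else 0).
  move=> g0.
  have key := @sum_min_ge0 R _ (fun k n => t i k n * ((f k)^-1 * (f n)^-1)) g [set k | D i k]%SET.
  have -> : \sum_k \sum_n t i k n * (if D i k && D i n then Num.min (g k) (g n) / (f k * f n) else 0)
     = \sum_(k in [set k | D i k]%SET) \sum_(n in [set k | D i k]%SET)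
         t i k n * ((f k)^-1 * (f n)^-1) * Num.min (g k) (g n).
    rewrite [RHS]big_mkcond/=; apply: eq_bigr => k _; rewrite inE.
    case: (D i k) => /=; last by rewrite big1// => n _; rewrite mulr0.
    rewrite [RHS]big_mkcond/=; apply: eq_bigr => n _; rewrite inE.
    by case: (D i n) => /=; rewrite ?mulr0// invfM; ring.
  apply: key; last by move=> j; rewrite inE; exact: g0.
  move=> K; have := @cubic_quad_ge0 h i (fun k => if k \in K then (f k)^-1 else 0) ph.
  congr (_ <= _); rewrite exchange_big [RHS]big_mkcond/=; apply: eq_bigr => k _.
  case: ifP => kK; last by rewrite big1// => n _; rewrite !mulr0.
  rewrite [RHS]big_mkcond/=; apply: eq_bigr => n _.
  by case: ifP => nK; rewrite ?mul0r ?mulr0// /t; congr (_ * _); rewrite mulrC.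
have hatp i : 0 <= \sum_k \sum_n t i k n * hat (l i) (l k) (l n).
  have p1 := part (fun k => l k - l i) (fun k => Plow (l i) (l k)) (fun i j => l i < l j) i.
  have p2 := part (fun k => l i - l k) (fun k => Pup (l k) (l i)) (fun i j => l j < l i) i.
  under eq_bigr do under eq_bigr do rewrite /hat mulrDr.
  under eq_bigr do rewrite big_split/=.
  rewrite big_split/= addr_ge0//.
    by apply: p1 => j ij; rewrite -(Plowss (l i)); apply: Plow_le => //; exact: ltW.
  by apply: p2 => j ij; rewrite -(Pupss (l i)); apply: Pup_le => //; exact: ltW.
have eqp i : 0 <= \sum_k \sum_n t i k n *
    (if (l i == l k) && (l k == l n) then expR (l i) / 2 else 0).
  have := @cubic_quad_ge0 h i (fun k => if l i == l k then 1 else 0) ph.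
  move/(mulr_ge0 (divr_ge0 (expR_ge0 (l i)) (ler0n R 2))).
  congr (_ <= _); rewrite exchange_big mulr_sumr/=; apply: eq_bigr => k _.
  rewrite mulr_sumr; apply: eq_bigr => n _; rewrite /t.
  have [lk|] := eqVneq (l i) (l k) => /=; last by rewrite !mulr0.
  by rewrite -lk; case: eqP => _; rewrite ?mulr0 ?mul0r ?mulr1 ?mulr0// mulrC.
have -> : \sum_i \sum_k \sum_n t i k n * e2 (l i) (l k) (l n) =
  \sum_i \sum_k \sum_n t i k n * hat (l i) (l k) (l n) +
  \sum_i \sum_k \sum_n t i k n * hat (l k) (l n) (l i) +
  \sum_i \sum_k \sum_n t i k n * hat (l n) (l i) (l k) +
  \sum_i \sum_k \sum_n t i k n * (if (l i == l k) && (l k == l n) then expR (l i) / 2 else 0).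
  rewrite -!big_split/=; apply: eq_bigr => i _; rewrite -!big_split/=; apply: eq_bigr => k _.
  rewrite -!big_split/=; apply: eq_bigr => n _; rewrite e2_hats /hats !mulrDr //.
have P1 : 0 <= \sum_i \sum_k \sum_n t i k n * hat (l i) (l k) (l n).
  by apply: sumr_ge0 => i _; exact: hatp.
have E2 : \sum_i \sum_k \sum_n t i k n * hat (l k) (l n) (l i) =
    \sum_i \sum_k \sum_n t i k n * hat (l i) (l k) (l n).
  rewrite exchange_big/=; apply: eq_bigr => k _; rewrite exchange_big/=; apply: eq_bigr => n _.
  by apply: eq_bigr => i _; rewrite tC.
have E3 : \sum_i \sum_k \sum_n t i k n * hat (l n) (l i) (l k) =
    \sum_i \sum_k \sum_n t i k n * hat (l i) (l k) (l n).
  under eq_bigr do rewrite exchange_big/=.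
  rewrite exchange_big/=; apply: eq_bigr => n _; apply: eq_bigr => i _.
  by apply: eq_bigr => k _; rewrite -tC.
rewrite E2 E3 !addr_ge0//.
by apply: sumr_ge0 => i _; exact: eqp.
Qed.

End ThirdOrder.

(** * Second-order bounds for the trace exponential, from above and from below *)

Section SecondOrderComparison.
Variable R : realType.
Local Notation C := R[i].
Variable d : nat.
Implicit Types (A B H X Y U V W : 'M[C]_d) (s t : R).

Lemma mxNE p q (X : 'M[C]_(p, q)) i j : (- X) i j = - X i j.
Proof. by rewrite mxE. Qed.

Lemma chgZ U V s X : chg U V (s%:C%C *: X) = s%:C%C *: chg U V X.
Proof. by rewrite /chg -scalemxAr -scalemxAl. Qed.

Lemma QfZ A s X : Qf A (s%:C%C *: X) = s ^+ 2 * Qf A X.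
Proof.
rewrite /Qf mulr_sumr; apply: eq_bigr => i _; rewrite mulr_sumr; apply: eq_bigr => k _.
by rewrite chgZ mxE -sqr_cabs cabsM cabs_real exprMn real_normK ?num_real// sqr_cabs mulrA.
Qed.

Lemma QfN A X : Qf A (- X) = Qf A X.
Proof.
rewrite /Qf; apply: eq_bigr => i _; apply: eq_bigr => k _.
by rewrite chgN mxNE -sqr_cabs cabsN sqr_cabs.
Qed.

Lemma cubicN A X : cubic A (- X) = - cubic A X.
Proof.
rewrite /cubic raddf_sum; apply: eq_bigr => i _; rewrite raddf_sum; apply: eq_bigr => k _.
rewrite raddf_sum; apply: eq_bigr => n _.
by rewrite chgN !mxNE mulrNN mulrN ReN mulNr.
Qed.

Lemma rtr_dphi A H : herm A ->
  rtr (dphi A) H = \sum_i expR (seig A i) * complex.Re (chg (sbas A) (sbas A) H i i).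
Proof.
move=> /specP[UU AE]; rewrite (rtrE _ _ UU UU); apply: eq_bigr => i _.
rewrite (bigD1 i)//= big1 ?addr0.
  by rewrite /dphi chg_fmx// chg1// mxE eqxx mulr1 Re_scale.
by move=> j ji; rewrite /dphi chg_fmx// chg1// mxE eq_sym (negbTE ji) mulr0 mul0r.
Qed.

Lemma psdc_diag H i : psdc H -> 0 <= complex.Re (H i i).
Proof.
move=> [_ pH]; have := pH (delta_mx i 0); rewrite quad_sum (bigD1 i)//=.
rewrite [X in _ + X]big1 ?addr0 => [|j ji]; last first.
  by rewrite big1// => k _; rewrite [X in conjc X]mxE (negbTE ji) conjc0 !mul0r.
rewrite (bigD1 i)//= [X in _ + X]big1 ?addr0 => [|k ki]; last first.
  by rewrite [X in _ * X]mxE (negbTE ki) mulr0.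
have -> : (delta_mx i 0 : 'cV[C]_d) i 0 = 1 by rewrite mxE !eqxx.
by rewrite conjc1 mul1r mulr1.
Qed.

Lemma rtr_dphi_ge0 A H : herm A -> psdc H -> 0 <= rtr (dphi A) H.
Proof.
move=> hA pH; rewrite rtr_dphi//; apply: sumr_ge0 => i _.
by rewrite mulr_ge0 ?expR_ge0// psdc_diag//; exact: psdc_chg.
Qed.

Lemma phi_sub_le A W : herm A -> psdc W -> phi (A - W) <= phi A.
Proof.
move=> hA pW; have hB : herm (A - W) by apply: hermB => //; case: pW.
have := phi_ge_tangent hB hA; rewrite opprB subrKC; apply: le_trans.
by rewrite lerDl rtr_dphi_ge0.
Qed.

Let arith_Qf (h K r c1 c2 q1 q2 : R) : 0 < h ->
  `|r - h ^+ 2 * q1 - c1| <= h ^+ 4 * (K / 2) -> `|r - h ^+ 2 * q2 - - c2| <= h ^+ 4 * (K / 2) ->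
  0 <= c1 -> 0 <= c2 -> q1 - q2 <= K * h ^+ 2.
Proof.
move=> h0; rewrite !ler_norml => /andP[T1 _] /andP[_ T2] c10 c20.
rewrite -(ler_pM2l (x := h ^+ 2)) ?exprn_gt0//.
have -> : h ^+ 2 * (K * h ^+ 2) = h ^+ 4 * K by ring.
lra.
Qed.

Let arith_psi (h s u K r1 r2 q Q0 : R) : 0 < h -> u = s + h ->
  `|- (h * (r2 - r1)) - h ^+ 2 * q| <= h ^+ 3 * K -> q <= Q0 ->
  - r2 - u * Q0 - (- r1 - s * Q0) <= K * h ^+ 2.
Proof.
move=> h0 ->; rewrite ler_norml => /andP[_ T2] Q.
rewrite -(ler_pM2l h0).
have -> : h * (K * h ^+ 2) = h ^+ 3 * K by ring.
have P : h * (h * (Q0 - q)) >= 0 by rewrite !mulr_ge0 ?subr_ge0// ltW.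
move: T2 P; lra.
Qed.

Let arith_phi (h s u K p1 p2 r0 r1 Q0 e : R) : 0 <= h -> u = s + h ->
  p1 <= p2 + - (h * r1) + e -> e <= K * h ^+ 2 -> - r1 - s * Q0 <= - r0 -> 0 <= Q0 ->
  p1 + u * r0 - u ^+ 2 * Q0 / 2 - (p2 + s * r0 - s ^+ 2 * Q0 / 2) <= K * h ^+ 2.
Proof.
move=> h0 -> T b P Q.
have P2 : h * (r0 - r1 - s * Q0) <= 0 by rewrite mulr_ge0_le0//; move: P; lra.
have QQ : 0 <= h ^+ 2 * Q0 by rewrite mulr_ge0 ?sqr_ge0.
move: T b P2 QQ; lra.
Qed.

Let arith_slope (t K r1 r0 q : R) : 0 < t ->
  `|t * (r1 - r0) - t ^+ 2 * q| <= t * K -> r0 + t * q - K <= r1.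
Proof.
move=> t0; rewrite ler_norml => /andP[T _].
rewrite -(ler_pM2l t0); move: T; lra.
Qed.

Let arith_lower (h s u K p1 p2 r1 r q : R) : 0 <= h -> u = s + h ->
  p2 + h * r1 <= p1 -> r + s * q - K <= r1 ->
  - p1 + u * r + u ^+ 2 * q / 2 - u * K - (- p2 + s * r + s ^+ 2 * q / 2 - s * K) <= q / 2 * h ^+ 2.
Proof.
move=> h0 -> T S; have S' := ler_wpM2l h0 S.
move: T S'; lra.
Qed.

Let arith_neg (x r q K p : R) : - x + r + q - K <= - p -> p + r + q - K <= x.
Proof. lra. Qed.

Section Path.
Variables A W : 'M[C]_d.
Hypotheses (hA : herm A) (pW : psdc W).
Let At t := A - t%:C%C *: W.
Let hW : herm W. Proof. by case: pW. Qed.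
Let hAt t : herm (At t). Proof. by apply: hermB => //; exact: hermZ. Qed.
Let AtB s t : At t - At s = - ((t - s)%:C%C *: W).
Proof. by rewrite /At rmorphB scalerBl !opprB addrC addrA subrK. Qed.
Let AtB' s t : At s - At t = (t - s)%:C%C *: W. Proof. by rewrite -opprB AtB opprK. Qed.
Let phi_At t : 0 <= t -> phi (At t) <= phi A.
Proof. by move=> t0; apply: phi_sub_le => //; exact: psdcZ. Qed.
Let N := l1 W.
Let D : R := d%:R ^+ 4.
Let D0 : 0 <= D. Proof. by rewrite exprn_ge0. Qed.
Let N0 : 0 <= N. Proof. exact: l1_ge0. Qed.
Let l1AtB s t : s <= t -> l1 (At t - At s) = (t - s) * N.
Proof. by move=> st; rewrite AtB l1N l1Z ger0_norm ?subr_ge0. Qed.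

Let M2 s t : 0 <= s -> 0 <= t -> phi (At s) + phi (At t) <= 2 * phi A.
Proof. by move=> s0 t0; rewrite mulr_natl mulr2n lerD ?phi_At. Qed.

(** The same increment of the gradient is expanded from both ends of a short interval. In the
    difference the two cubic terms enter with the same sign and are dropped; the quartic errors,
    divided by h^2, leave a quadratic increment. *)
Lemma Qf_path t : 0 <= t -> Qf (At t) W <= Qf A W.
Proof.
move=> t0; have -> : A = At 0 by rewrite /At scale0r subr0.
pose K := 2 * (D * (N ^+ 4 * (2 * phi A))).
apply: (@le_of_quadratic_increments R (fun t => Qf (At t) W) K 0 t) => // s u s0 su _.
have u0 : 0 <= u by exact: le_trans su.
have [->|neq] := eqVneq s u; first by rewrite !subrr expr0n/= mulr0.
set h := u - s; have h0 : 0 < h by rewrite subr_gt0 lt_neqAle neq.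
have T1 := rtr_dphi_diff_cubic (hAt u) (hAt s).
have T2 := rtr_dphi_diff_cubic (hAt s) (hAt u).
rewrite AtB' -/h l1Z (ger0_norm (ltW h0)) QfZ -/N in T1.
rewrite l1AtB// AtB QfN QfZ rtrNl cubicN -rtrNr opprB -/h in T2.
have c1 : 0 <= cubic (At u) (h%:C%C *: W) by apply: cubic_ge0; apply: psdcZ => //; exact: ltW.
have c2 : 0 <= cubic (At s) (h%:C%C *: W) by apply: cubic_ge0; apply: psdcZ => //; exact: ltW.
have b (p q : R) : p + q <= 2 * phi A -> d%:R ^+ 4 * ((h * N) ^+ 4 * (p + q)) <= h ^+ 4 * (K / 2).
  move=> pq; have -> : h ^+ 4 * (K / 2) = D * ((h * N) ^+ 4 * (2 * phi A)) by rewrite /K; field.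
  by apply: ler_wpM2l => //; apply: ler_wpM2l => //; rewrite exprn_ge0// mulr_ge0// ltW.
have b1 := b _ _ (M2 u0 s0); have b2 := b _ _ (M2 s0 u0).
have {T1 b1} T1 := le_trans T1 b1; have {T2 b2} T2 := le_trans T2 b2.
exact: (arith_Qf h0 T1 T2 c1 c2).
Qed.

(** [Qf_path] is integrated twice along t |-> A - t W, once for the slope and once for [phi]
    itself. *)
Lemma phi_sub_le_quad : phi (A - W) <= phi A - rtr W (dphi A) + Qf A W / 2.
Proof.
have A0 : At 0 = A by rewrite /At scale0r subr0.
have A1 : At 1 = A - W by rewrite /At scale1r.
set Q0 := Qf A W.
pose K := D * (N ^+ 3 * (2 * phi A)).
have K0 : 0 <= K by rewrite !mulr_ge0// ?exprn_ge0// phi_ge0.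
(* First integration: the slope at time t exceeds the initial slope by at most t * Q0. *)
have psi_le t : 0 <= t -> - rtr W (dphi (At t)) - t * Q0 <= - rtr W (dphi A).
  move=> t0; have -> : - rtr W (dphi A) = - rtr W (dphi (At 0)) - 0 * Q0.
    by rewrite A0 mul0r subr0.
  apply: (@le_of_quadratic_increments R (fun t => - rtr W (dphi (At t)) - t * Q0) K 0 t) => // s u s0 su _.
  have u0 : 0 <= u by exact: le_trans su.
  have [->|neq] := eqVneq s u; first by rewrite !subrr expr0n/= mulr0.
  set h := u - s; have h0 : 0 < h by rewrite subr_gt0 lt_neqAle neq.
  have T2 := rtr_dphi_diff_Qf (hAt s) (hAt u).
  rewrite l1AtB// AtB QfN QfZ rtrNl rtrZl -/h rtrBr in T2.
  have Q := Qf_path s0; rewrite -/Q0 in Q.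
  have b : d%:R ^+ 4 * ((h * N) ^+ 3 * (phi (At s) + phi (At u))) <= h ^+ 3 * K.
    have -> : h ^+ 3 * K = D * ((h * N) ^+ 3 * (2 * phi A)) by rewrite /K; ring.
    apply: ler_wpM2l => //; apply: ler_wpM2l; last exact: M2.
    by rewrite exprn_ge0// mulr_ge0// ltW.
  have {T2 b} T2 := le_trans T2 b.
  by apply: (arith_psi h0 _ T2 Q); rewrite /h subrKC.
pose K2 := N ^+ 2 * (2 * phi A).
have := @le_of_quadratic_increments R
  (fun t => phi (At t) + t * rtr W (dphi A) - t ^+ 2 * Q0 / 2) K2 0 1 ler01.
rewrite A0 A1 mul1r mul0r expr1n expr0n/= !mul0r mul1r addr0 subr0 => H.
suff : phi (A - W) + rtr W (dphi A) - Q0 / 2 <= phi A by rewrite lerBlDr -lerBrDr [X in _ <= X]addrAC.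
apply: H => s u s0 su _.
have u0 : 0 <= u by exact: le_trans su.
set h := u - s; have h0 : 0 <= h by rewrite subr_ge0.
have T := phi_le_quad (hAt s) (hAt u).
rewrite l1AtB// AtB rtrNr rtrZr (rtrC _ W) -/h in T.
have b : (h * N) ^+ 2 * (phi (At s) + phi (At u)) <= K2 * h ^+ 2.
  have -> : K2 * h ^+ 2 = (h * N) ^+ 2 * (2 * phi A) by rewrite /K2; ring.
  by apply: ler_wpM2l; [rewrite sqr_ge0|exact: M2].
have P := psi_le s s0.
by apply: (arith_phi h0 _ T b P (Qf_ge0 _ _)); rewrite /h subrKC.
Qed.

End Path.

(** For small H of no particular sign the cubic term is only estimated; the factor 3 comes from phi
    A + phi (B t) <= 3 * phi A. *)
Lemma phi_add_ge A H : herm A -> herm H -> l1 H <= 1 / 2 ->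
  phi A + rtr (dphi A) H + Qf A H / 2 - 3 * d%:R ^+ 4 * l1 H ^+ 3 * phi A <= phi (A + H).
Proof.
move=> hA hH N12; set N := l1 H; have N0 : 0 <= N := l1_ge0 H.
pose B t := A + t%:C%C *: H.
have hB t : herm (B t) by apply: hermD => //; exact: hermZ.
have B0 : B 0 = A by rewrite /B scale0r addr0.
have B1 : B 1 = A + H by rewrite /B scale1r.
have BA t : B t - A = t%:C%C *: H by rewrite /B addrC addKr.
set Q := Qf A H; set r := rtr (dphi A) H.
pose K := 3 * d%:R ^+ 4 * N ^+ 3 * phi A.
have D0 : 0 <= d%:R ^+ 4 :> R by rewrite exprn_ge0.
have slope t : 0 <= t <= 1 -> r + t * Q - K <= rtr (dphi (B t)) H.
  move=> /andP[t0 t1]; have [->|tn0] := eqVneq t 0.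
    by rewrite B0 mul0r addr0 gerBl !mulr_ge0// ?exprn_ge0// ?phi_ge0.
  have tp : 0 < t by rewrite lt_neqAle eq_sym tn0.
  have T := rtr_dphi_diff_Qf hA (hB t).
  have l1t : l1 (B t - A) = t * N by rewrite BA l1Z ger0_norm.
  have pB : phi (B t) <= 2 * phi A.
    by apply: phi_le2 => //; rewrite l1t; apply: le_trans N12; rewrite ler_piMl.
  rewrite l1t BA QfZ rtrZl rtrBr !(rtrC H) -/Q -/r in T.
  have b : d%:R ^+ 4 * ((t * N) ^+ 3 * (phi A + phi (B t))) <= t * K.
    have -> : t * K = d%:R ^+ 4 * (t * N ^+ 3 * (3 * phi A)) by rewrite /K; ring.
    apply: ler_wpM2l => //; apply: ler_pM.
    - by rewrite exprn_ge0// mulr_ge0.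
    - by rewrite addr_ge0 ?phi_ge0.
    - rewrite exprMn ler_wpM2r ?exprn_ge0// -[leRHS]expr1.
      by apply: ler_wiXn2l.
    - by move: pB; lra.
  have {T b} T := le_trans T b.
  exact: (arith_slope tp T).
have := @le_of_quadratic_increments R
  (fun t => - phi (B t) + t * r + t ^+ 2 * Q / 2 - t * K) (Q / 2) 0 1 ler01.
rewrite B0 B1 !mul1r !mul0r expr1n expr0n/= !mul0r mul1r addr0 addr0 subr0 => HH.
suff : - phi (A + H) + r + Q / 2 - K <= - phi A.
  exact: arith_neg.
apply: HH => s u s0 su u1.
set h := u - s; have h0 : 0 <= h by rewrite subr_ge0.
have T := phi_ge_tangent (hB s) (hB u).
have Bus : B u - B s = h%:C%C *: H by rewrite /B opprD addrACA subrr add0r -scalerBl -rmorphB.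
rewrite Bus rtrZr in T.
have S : r + s * Q - K <= rtr (dphi (B s)) H by rewrite slope// s0 (le_trans su).
by apply: (arith_lower h0 _ T S); rewrite /h subrKC.
Qed.

End SecondOrderComparison.

(** * Scalar inequalities obtained from the sign of a derivative *)

Section DerivativeSign.
Variable R : realType.

Lemma le_of_derive_le0 (F F' : R -> R) (a b : R) : a <= b ->
  (forall x, is_derive x (1 : R) F (F' x)) -> (forall x, a <= x <= b -> F' x <= 0) ->
  F b <= F a.
Proof.
rewrite le_eqVlt => /orP[/eqP->//|ab] dF F0.
have cF : {within `[a, b], continuous F}.
  by apply: derivable_within_continuous => x _; have [] := dF x.
have [c cab E] := MVT ab (fun x _ => dF x) cF.
rewrite -subr_le0 E mulr_le0_ge0 ?subr_ge0 ?(ltW ab)// F0//.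
by move: cab; rewrite in_itv/= => /andP[/ltW-> /ltW->].
Qed.

(** The product of expR y + expR (- y) with expR (- (y ^+ 2 / 2)) decreases for y >= 0: its
    derivative has the sign of sinh y - y cosh y. *)
Lemma cosh_le (a : R) : (expR a + expR (- a)) / 2 <= expR (a ^+ 2 / 2).
Proof.
wlog a0 : a / 0 <= a.
  move=> H; have [/H//|/ltW a0] := leP 0 a.
  by have := H (- a); rewrite oppr_ge0 opprK sqrrN addrC; apply.
have S0 (x : R) : 0 <= x -> 0 <= x * (expR x + expR (- x)) - (expR x - expR (- x)).
  move=> x0; rewrite -oppr_le0.
  have dF (y : R) : is_derive y (1 : R) (fun y => - (y * (expR y + expR (- y)) - (expR y - expR (- y))))
      (- (y * (expR y - expR (- y)))).
    by apply: is_derive_eq; rewrite /GRing.scale/=; ring.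
  have := le_of_derive_le0 x0 dF; rewrite oppr0 mul0r sub0r expR0 subrr !oppr0.
  apply=> y /andP[y0 _]; rewrite oppr_le0 mulr_ge0// subr_ge0 ler_expR.
  by rewrite (le_trans _ y0)// oppr_le0.
have dG (y : R) : is_derive y (1 : R) (fun y => (expR y + expR (- y)) * expR (- (y ^+ 2 / 2)))
    (- (expR (- (y ^+ 2 / 2)) * (y * (expR y + expR (- y)) - (expR y - expR (- y))))).
  by apply: is_derive_eq; rewrite /GRing.scale/=; field.
have := le_of_derive_le0 a0 dG.
rewrite expr0n/= mul0r oppr0 expR0 mulr1 => H.
rewrite ler_pdivrMr// -[leRHS]mulr1; apply: le_trans (_ : expR (a ^+ 2 / 2) * ((expR a + expR (- a)) * expR (- (a ^+ 2 / 2))) <= _).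
  by rewrite mulrCA -expRD subrr expR0 mulr1.
rewrite mulr1 ler_wpM2l ?expR_ge0//; apply: (le_trans (H _)) => [y /andP[y0 _]|].
  by rewrite oppr_le0 mulr_ge0 ?expR_ge0// S0.
by lra.
Qed.

Lemma expR_le_quad (r : R) : `|r| <= 1 -> expR r <= 1 + r + r ^+ 2.
Proof.
rewrite ler_norml => /andP[r1 r2].
have [->|rn0] := eqVneq r 0; first by rewrite expR0; lra.
have E := e1E 0 r; rewrite subr0 expR0 in E.
have [r0|r0] := leP 0 r.
  have dF (y : R) : is_derive y (1 : R) (fun y => (1 + y + y ^+ 2) * expR (- y))
      (y * (1 - y) * expR (- y)).
    by apply: is_derive_eq; rewrite /GRing.scale/=; ring.
  have dF' (y : R) : is_derive y (1 : R) (fun y => - ((1 + y + y ^+ 2) * expR (- y)))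
      (- (y * (1 - y) * expR (- y))).
    by apply: is_derive_eq; rewrite /GRing.scale/=; ring.
  have := le_of_derive_le0 r0 dF'; rewrite expr0n/= !addr0 oppr0 expR0 mulr1 lerN2 => H.
  have {}H : 1 <= (1 + r + r ^+ 2) * expR (- r).
    apply: H => y /andP[y0 yr]; rewrite oppr_le0 !mulr_ge0 ?expR_ge0// subr_ge0; lra.
  have := ler_wpM2r (expR_ge0 r) H; rewrite mul1r -mulrA -expRD addNr expR0 mulr1//.
have dF (y : R) : is_derive y (1 : R) (fun y => (1 - y + y ^+ 2) - expR (- y))
      (- 1 + 2 * y + expR (- y)).
  by apply: is_derive_eq; rewrite /GRing.scale/=; ring.
have dF' (y : R) : is_derive y (1 : R) (fun y => - ((1 - y + y ^+ 2) - expR (- y)))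
      (- (- 1 + 2 * y + expR (- y))).
  by apply: is_derive_eq; rewrite /GRing.scale/=; ring.
have nr0 : 0 <= - r by rewrite oppr_ge0 ltW.
have := le_of_derive_le0 nr0 dF'; rewrite expr0n/= !oppr0 !addr0 expR0 subrr oppr0 opprK sqrrN oppr_le0 subr_ge0.
apply=> y /andP[y0 yr]; rewrite oppr_le0.
have := expR_ge1Dx (- y); lra.
Qed.

Lemma expR_sub1_le (r : R) : `|r| <= 1 -> `|expR r - 1| <= 2 * `|r|.
Proof.
move=> r1; have h1 := expR_le_quad r1; have h2 := expR_ge1Dx r.
have h3 : r ^+ 2 <= `|r|.
  by rewrite -(real_normK (num_real r)) expr2 ler_piMl.
have h4 := ler_norm r; have h5 := lerNnormlW (lexx `|r|).
rewrite ler_norml; apply/andP; split; lra.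
Qed.

(** Since expR (- u) >= 1 - u, it is enough that (1 + t) * (1 - t + 2 t^2) = 1 + t^2 * (1 + 2 t) is
    at least 1; this is where t >= - 1 / 2 enters. *)
Lemma ln_ge_quad (t : R) : `|t| <= 1 / 2 -> t - 2 * t ^+ 2 <= ln (1 + t).
Proof.
rewrite ler_norml => /andP[t1 t2].
have pos : 0 < 1 + t by lra.
rewrite -ler_expR lnK ?posrE//.
have h := expR_ge1Dx (- (t - 2 * t ^+ 2)).
have e : expR (t - 2 * t ^+ 2) * expR (- (t - 2 * t ^+ 2)) = 1 by rewrite -expRD subrr expR0.
have p : 0 < expR (t - 2 * t ^+ 2) := expR_gt0 _.
move: (expR (t - 2 * t ^+ 2)) (expR (- (t - 2 * t ^+ 2))) h e p => x y h e p.
have s : 1 <= (1 + t) * (1 - (t - 2 * t ^+ 2)).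
  have -> : (1 + t) * (1 - (t - 2 * t ^+ 2)) = 1 + t ^+ 2 * (1 + 2 * t) by ring.
  by rewrite lerDl mulr_ge0 ?sqr_ge0//; lra.
have s2 : 1 <= (1 + t) * y.
  by apply: le_trans s _; rewrite ler_wpM2l// ltW.
have := ler_wpM2l (ltW p) s2; rewrite mulr1 mulrCA e mulr1//.
Qed.

End DerivativeSign.

(** * Rademacher averages of functions of a matrix *)

Section Rademacher.
Variable R : realType.
Local Notation C := R[i].
Variable d : nat.
Local Notation M := 'M[C]_d.
Implicit Types (A B H X W v w : M) (vs : seq M) (f g h l : M -> R).

(* [rade vs h A] is the average of [h (A + sum_i eps_i v_i)] over all signs. *)
Fixpoint rade vs h A : R :=
  if vs is v :: vs' then (rade vs' h (A + v) + rade vs' h (A - v)) / 2 else h A.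

Definition l1s vs : R := \sum_(v <- vs) l1 v.
Definition herms vs := forall v, v \in vs -> herm v.

Lemma l1s_ge0 vs : 0 <= l1s vs.
Proof. by apply: sumr_ge0 => v _; exact: l1_ge0. Qed.

Lemma rad_le_near vs h g A : herm A -> herms vs ->
  (forall X, herm X -> l1 (X - A) <= l1s vs -> h X <= g X) -> rade vs h A <= rade vs g A.
Proof.
elim: vs A => [|v vs IH] A hA hvs hg /=.
  by apply: hg => //; rewrite subrr l10 l1s_ge0.
have hv : herm v by apply: hvs; rewrite mem_head.
have hvs' : herms vs by move=> x xvs; apply: hvs; rewrite inE xvs orbT.
rewrite ler_pM2r ?invr_gt0//; apply: lerD; apply: IH => //.
- exact: hermD.
- move=> X hX XA; apply: hg => //; rewrite /l1s big_cons.
  have -> : X - A = v + (X - (A + v)) by rewrite [RHS]addrC opprD addrA subrK.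
  by apply: le_trans (l1D _ _) _; rewrite lerD2l.
- exact: hermB.
- move=> X hX XA; apply: hg => //; rewrite /l1s big_cons.
  have -> : X - A = - v + (X - (A - v)) by rewrite [RHS]addrC opprB addrA [RHS]addrAC addrK.
  by apply: le_trans (l1D _ _) _; rewrite l1N lerD2l.
Qed.

Lemma rad_le vs h g A : herm A -> herms vs ->
  (forall X, herm X -> h X <= g X) -> rade vs h A <= rade vs g A.
Proof. by move=> hA hvs hg; apply: rad_le_near => // X hX _; exact: hg. Qed.

Lemma radD vs h g A : rade vs (fun X => h X + g X) A = rade vs h A + rade vs g A.
Proof. by elim: vs A => //= v vs IH A; rewrite !IH; field. Qed.

Lemma radZ vs h (c : R) A : rade vs (fun X => c * h X) A = c * rade vs h A.
Proof. by elim: vs A => //= v vs IH A; rewrite !IH; field. Qed.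

Lemma rad_cst vs (c : R) A : rade vs (fun=> c) A = c.
Proof. by elim: vs A => //= v vs IH A; rewrite !IH; field. Qed.

Lemma rad_ext vs h g A : (forall X, h X = g X) -> rade vs h A = rade vs g A.
Proof. by move=> hg; elim: vs A => //= v vs IH A; rewrite !IH. Qed.

Lemma rad_shift vs h A X : rade vs (fun Y => h (Y + X)) A = rade vs h (A + X).
Proof. by elim: vs A => //= v vs IH A; rewrite !IH [A + v + X]addrAC [A - v + X]addrAC. Qed.

Lemma rad_cat vs vs' h A : rade (vs ++ vs') h A = rade vs (rade vs' h) A.
Proof. by elim: vs A => //= v vs IH A; rewrite !IH. Qed.

Definition addl l := forall X Y, l (X + Y) = l X + l Y.

Lemma addl0 l : addl l -> l 0 = 0.
Proof. by move=> al; have := al 0 0; rewrite addr0 => /eqP; rewrite addrC -subr_eq subrr => /eqP <-. Qed.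

Lemma addlN l X : addl l -> l (- X) = - l X.
Proof. by move=> al; apply/eqP; rewrite -addr_eq0 -al addNr addl0. Qed.

Lemma rad_addl vs l A : addl l -> rade vs l A = l A.
Proof. by move=> al; elim: vs A => //= v vs IH A; rewrite !IH !al addlN//; field. Qed.

Lemma rad_sqr vs l A : addl l -> rade vs (fun X => l X ^+ 2) A = l A ^+ 2 + \sum_(v <- vs) l v ^+ 2.
Proof.
move=> al; elim: vs A => [|v vs IH] A /=; first by rewrite big_nil addr0.
by rewrite !IH big_cons !al addlN//; field.
Qed.

Lemma rad_expR vs l A : addl l ->
  rade vs (fun X => expR (l X)) A <= expR (l A + (\sum_(v <- vs) l v ^+ 2) / 2).
Proof.
move=> al; elim: vs A => [|v vs IH] A /=; first by rewrite big_nil mul0r addr0.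
rewrite big_cons; set s := \sum_(v <- vs) _ in IH *.
have := IH (A + v); have := IH (A - v); rewrite !al addlN// => h1 h2.
have := ler_wpM2l (expR_ge0 (l A + s / 2)) (cosh_le (l v)).
rewrite -expRD => h3.
have -> : l A + (l v ^+ 2 + s) / 2 = l A + s / 2 + l v ^+ 2 / 2 by ring.
apply: le_trans h3; rewrite mulrA ler_wpM2r// mulrDr -!expRD.
by apply: lerD; [apply: le_trans h2 _|apply: le_trans h1 _]; rewrite ler_expR; lra.
Qed.

Lemma mxDE p q (X Y : 'M[C]_(p, q)) i j : (X + Y) i j = X i j + Y i j.
Proof. by rewrite mxE. Qed.

Lemma Qf_parallelogram A X Y : Qf A (X + Y) + Qf A (X - Y) = 2 * (Qf A X + Qf A Y).
Proof.
rewrite /Qf -!big_split/= mulr_sumr; apply: eq_bigr => i _; rewrite -!big_split/= mulr_sumr.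
apply: eq_bigr => k _ /=; rewrite chgB chgD !mxDE mxNE.
by move: (chg _ _ X i k) (chg _ _ Y i k) (e1 _ _) => [a b] [a' b'] e; rewrite /cabs2 /=; ring.
Qed.

Lemma rad_Qf vs A0 A : rade vs (Qf A0) A = Qf A0 A + \sum_(v <- vs) Qf A0 v.
Proof.
elim: vs A => [|v vs IH] A /=; first by rewrite big_nil addr0.
rewrite !IH big_cons; have := Qf_parallelogram A0 A v.
move: (Qf A0 (A + v)) (Qf A0 (A - v)) (Qf A0 A) (Qf A0 v) (\sum_(_ <- _) _) => a b c e s H; lra.
Qed.

Lemma rad_cos vs l c A : addl l ->
  rade vs (fun X => cos (l X + c)) A = (\prod_(v <- vs) cos (l v)) * cos (l A + c).
Proof.
move=> al; elim: vs A => [|v vs IH] A /=; first by rewrite big_nil mul1r.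
rewrite !IH big_cons !al addlN//.
have -> : l A + l v + c = (l A + c) + l v by ring.
have -> : l A - l v + c = (l A + c) - l v by ring.
by rewrite cosB cosD; field.
Qed.

(* First order approximability with quadratic error, the slope [l] at every
   point being controlled along the directions [vs]. *)
Definition tame vs (L K : R) f := forall A, herm A -> exists l,
  [/\ addl l,
      forall H, herm H -> l1 H <= 1 / 2 -> `|f (A + H) - f A - l H| <= K * l1 H ^+ 2,
      \sum_(v <- vs) l v ^+ 2 <= L &
      forall H, herm H -> `|l H| <= l1 H].

Lemma tame_addc vs L K f (c : R) : tame vs L K f -> tame vs L K (fun X => f X + c).
Proof.
move=> tf A hA; have [l [? h ? ?]] := tf A hA; exists l; split=> // H hH HN.
have -> : f (A + H) + c - (f A + c) - l H = f (A + H) - f A - l H by ring.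
exact: h.
Qed.

Lemma tame_mean vs L K f v : herm v -> tame vs L K f ->
  tame vs L K (fun A => (f (A + v) + f (A - v)) / 2).
Proof.
move=> hv tf A hA.
have [l [al hl sl nl]] := tf _ (hermD hA hv).
have [m [am hm sm nm]] := tf _ (hermB hA hv).
exists (fun X => (l X + m X) / 2); split.
- by move=> X Y; rewrite al am; field.
- move=> H hH HN; have := hl H hH HN; have := hm H hH HN.
  rewrite [A + H + v]addrAC [A + H - v]addrAC.
  set a := f (_ + v + H); set b := f (_ - v + H); move: a b (f (A + v)) (f (A - v)) (l H) (m H) => a b p q x y h1 h2.
  have -> : (a + b) / 2 - (p + q) / 2 - (x + y) / 2 = (a - p - x) / 2 + (b - q - y) / 2 by field.
  rewrite (le_trans (ler_normD _ _))// !normrM (ger0_norm (_ : 0 <= 2^-1))//; lra.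
- have : \sum_(u <- vs) ((l u + m u) / 2) ^+ 2 <= \sum_(u <- vs) (l u ^+ 2 / 2 + m u ^+ 2 / 2).
    apply: ler_sum => u _; rewrite -subr_ge0.
    have -> : l u ^+ 2 / 2 + m u ^+ 2 / 2 - ((l u + m u) / 2) ^+ 2 = ((l u - m u) / 2) ^+ 2 by field.
    exact: sqr_ge0.
  by rewrite big_split/= -!mulr_suml; lra.
- move=> H hH; have := nl H hH; have := nm H hH.
  move: (l H) (m H) => x y h1 h2.
  rewrite mulrDl (le_trans (ler_normD _ _))// !normrM (ger0_norm (_ : 0 <= 2^-1))//; lra.
Qed.

(** Slopes are averaged along with the function, and a sum of squares is convex in the slope, so the
    bound L does not deteriorate. This allows [rad_exp_step] to be iterated. *)
Lemma tame_rad vs ws L K f : herms ws -> tame vs L K f -> tame vs L K (rade ws f).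
Proof.
elim: ws => //= w ws IH hws tf; apply: tame_mean; first by apply: hws; rewrite mem_head.
by apply: IH => // x xw; apply: hws; rewrite inE xw orbT.
Qed.

Definition scal (s : R) vs : seq M := [seq s%:C%C *: v | v <- vs].

Lemma herms_scal s vs : herms vs -> herms (scal s vs).
Proof. by move=> hvs x /mapP[v vvs ->]; apply: hermZ; exact: hvs. Qed.

Lemma l1s_scal s vs : l1s (scal s vs) = `|s| * l1s vs.
Proof. by rewrite /l1s big_map mulr_sumr; apply: eq_bigr => v _; exact: l1Z. Qed.

(** f is linearized at A. The linear part contributes exactly s^2 * L / 2 through cosh x <= exp (x^2
    / 2). The remainder is of order s^2, but its mean is kept inside [rade f]; only products of it
    with the linear part or with itself are lost, and these are of order s^3. *)
Lemma rad_exp_step vs L K f (s : R) A : herms vs -> 0 <= L -> 0 <= K -> tame (scal s vs) (s ^+ 2 * L) K f ->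
  0 <= s <= 1 -> s * l1s vs <= 1 / 2 -> K * (s * l1s vs) ^+ 2 <= 1 -> s ^+ 2 * L <= 1 -> herm A ->
  rade (scal s vs) (fun X => expR (f X)) A <=
  expR (rade (scal s vs) f A + (s ^+ 2 * L / 2 +
     (4 * K * l1s vs ^+ 3 + 2 * K ^+ 2 * l1s vs ^+ 4 + K * l1s vs ^+ 2 * L) * s ^+ 3)).
Proof.
move=> hvs L0 K0 tf /andP[s0 s1] sr Ksr sL hA; set r := l1s vs in sr Ksr *.
have r0 : 0 <= r := l1s_ge0 vs.
have [l [al hl sl nl]] := tf A hA.
have hs := herms_scal (s := s) hvs.
set K1 := 4 * K * r ^+ 3 + 2 * K ^+ 2 * r ^+ 4.
pose rem X := f X - f A - l (X - A).
have near X : herm X -> l1 (X - A) <= l1s (scal s vs) ->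
   [/\ `|rem X| <= K * (s * r) ^+ 2 & `|l (X - A)| <= s * r].
  move=> hX; rewrite l1s_scal ger0_norm// -/r => XA; split.
    have := hl (X - A) (hermB hX hA) (le_trans XA sr); rewrite subrKC => /le_trans; apply.
    by rewrite ler_wpM2l// ler_pXn2r ?nnegrE ?l1_ge0// mulr_ge0.
  exact: le_trans (nl _ (hermB hX hA)) XA.
have sr0 : 0 <= s * r by rewrite mulr_ge0.
have ub X : herm X -> l1 (X - A) <= l1s (scal s vs) ->
   expR (f X) <= expR (f A) * ((expR (l (X - A)) + rem X) + K1 * s ^+ 3).
  move=> hX XA; have [h1 h2] := near X hX XA.
  have -> : f X = f A + (l (X - A) + rem X) by rewrite /rem; ring.
  rewrite (expRD (f A)) (expRD (l (X - A))) ler_wpM2l ?expR_ge0//.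
  set x := l (X - A) in h2 *; move: (rem X) h1 => y h1.
  have y1 : `|y| <= 1 by exact: le_trans h1 Ksr.
  have x1 : `|x| <= 1 by apply: le_trans h2 _; apply: le_trans sr _; lra.
  have E := expR_le_quad y1.
  apply: le_trans (ler_wpM2l (expR_ge0 x) E) _.
  have ex := expR_sub1_le x1.
  have ex2 : expR x <= 2.
    have : `|x| <= 1/2 by exact: le_trans sr.
    by have := ler_norm (expR x - 1); lra.
  have t1 : (expR x - 1) * y <= 2 * (s * r) * (K * (s * r) ^+ 2).
    apply: le_trans (ler_norm _) _; rewrite normrM; apply: ler_pM => //.
    by apply: le_trans ex _; rewrite ler_wpM2l.
  have t2 : expR x * y ^+ 2 <= 2 * (K * (s * r) ^+ 2) ^+ 2.
    apply: ler_pM; rewrite ?expR_ge0 ?sqr_ge0//.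
    by rewrite -(real_normK (num_real y)) ler_pXn2r ?nnegrE ?(le_trans _ h1).
  have t3 : 2 * (s * r) * (K * (s * r) ^+ 2) + 2 * (K * (s * r) ^+ 2) ^+ 2 <= K1 * s ^+ 3.
    have -> : 2 * (s * r) * (K * (s * r) ^+ 2) = 2 * K * r ^+ 3 * s ^+ 3 by ring.
    have -> : 2 * (K * (s * r) ^+ 2) ^+ 2 = 2 * K ^+ 2 * r ^+ 4 * s ^+ 3 * s by ring.
    rewrite /K1 [leRHS]mulrDl; apply: lerD.
      by rewrite !ler_wpM2r ?exprn_ge0//; lra.
    by rewrite ler_piMr// !mulr_ge0// exprn_ge0.
  move: t1 t2 t3; move: (expR x) => e; lra.
apply: le_trans (rad_le_near hA hs ub) _.
rewrite radZ.
set u := s ^+ 2 * L / 2.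
have al' : addl (fun X => - l X) by move=> X Y; rewrite al opprD.
(* The linear part has mean zero, so the remainder averages exactly to the drift of f. *)
have rr : rade (scal s vs) rem A = rade (scal s vs) f A - f A.
  rewrite (@rad_ext _ _ (fun X => f X + (- f A + - l (X - A)))); last first.
    by move=> X; rewrite /rem addrA.
  rewrite (radD _ f) (radD _ (fun=> - f A)) rad_cst (rad_shift _ (fun X => - l X)) subrr.
  by rewrite (rad_addl _ _ al') addl0// oppr0 addr0.
have -> : rade (scal s vs) (fun X => expR (l (X - A)) + rem X + K1 * s ^+ 3) A =
   rade (scal s vs) (fun X => expR (l X)) 0 + (rade (scal s vs) f A - f A) + K1 * s ^+ 3.
  rewrite (radD _ (fun X => expR (l (X - A)) + rem X)) rad_cst.
  rewrite (radD _ (fun X => expR (l (X - A))) rem) rr.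
  by rewrite (rad_shift _ (fun X => expR (l X))) subrr.
have ra : `|rade (scal s vs) f A - f A| <= K * (s * r) ^+ 2.
  rewrite -rr ler_norml; apply/andP; split.
    rewrite -(rad_cst (scal s vs) (- (K * (s * r) ^+ 2)) A); apply: rad_le_near => // X hX XA.
    by have [h _] := near X hX XA; move: h; rewrite ler_norml => /andP[].
  rewrite -[leRHS](rad_cst (scal s vs) (K * (s * r) ^+ 2) A); apply: rad_le_near => // X hX XA.
  by have [h _] := near X hX XA; move: h; rewrite ler_norml => /andP[].
have re : rade (scal s vs) (fun X => expR (l X)) 0 <= expR u.
  apply: le_trans (rad_expR _ _ al) _; rewrite addl0// add0r ler_expR /u.
  by rewrite ler_wpM2r.
set p := rade (scal s vs) f A in ra *; move: (rade (scal s vs) _ 0) re => q re.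
set y := p - f A in ra *.
have -> : p + (u + (K1 + K * r ^+ 2 * L) * s ^+ 3) = f A + (u + (y + (K1 + K * r ^+ 2 * L) * s ^+ 3)).
  by rewrite /y; ring.
rewrite (expRD (f A)) (expRD u); apply: ler_wpM2l; rewrite ?expR_ge0//.
have u0 : 0 <= u by rewrite /u divr_ge0// mulr_ge0// sqr_ge0.
have u1 : `|u| <= 1 by rewrite ger0_norm// /u; lra.
have h1 := expR_ge1Dx (y + (K1 + K * r ^+ 2 * L) * s ^+ 3).
apply: le_trans (ler_wpM2l (expR_ge0 u) h1).
have e1 := expR_sub1_le u1.
have eu1 : 1 <= expR u by rewrite -[leLHS]expR0 ler_expR.
have t1 : `|(expR u - 1) * y| <= (K * r ^+ 2 * L) * s ^+ 3.
  rewrite normrM; apply: le_trans (ler_pM _ _ e1 ra) _ => //.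
  have -> : 2 * `|u| * (K * (s * r) ^+ 2) = K * r ^+ 2 * L * s ^+ 3 * s.
    by rewrite ger0_norm// /u; field.
  by rewrite ler_piMr// !mulr_ge0// exprn_ge0.
have K10 : 0 <= (K1 + K * r ^+ 2 * L) * s ^+ 3.
  by rewrite mulr_ge0 ?exprn_ge0// addr_ge0// /K1 ?addr_ge0// !mulr_ge0// exprn_ge0.
have t2 : (K1 + K * r ^+ 2 * L) * s ^+ 3 <= expR u * ((K1 + K * r ^+ 2 * L) * s ^+ 3).
  by rewrite ler_peMl.
have t3 := lerNnormlW t1.
move: t1 t2 t3 re; move: (expR u) => e; rewrite mulrDl; lra.
Qed.

End Rademacher.

(** * Concentration of the log-trace-exponential at the scale of the weak variance *)

Section Concentration.
Variable R : realType.
Local Notation C := R[i].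
Variable d : nat.
Hypothesis d_gt0 : (0 < d)%N.
Local Notation M := 'M[C]_d.
Implicit Types (A B H X W v w : M) (vs : seq M) (f g h l : M -> R).

Definition rayl (u : 'cV[C]_d) X : R := complex.Re ((adjmx u *m X *m u) 0 0).

(** L bounds the weak variance of the Rademacher sum with coefficients vs. *)
Definition weak_var_le vs L := forall u : 'cV[C]_d, \sum_i cabs2 (u i 0) = 1 ->
  \sum_(v <- vs) rayl u v ^+ 2 <= L.

Lemma rayl_chg (U X : M) i : rayl (adjmx (row i U)) X = complex.Re (chg U U X i i).
Proof.
rewrite /rayl adjmxK /chg; congr complex.Re.
have -> : adjmx (row i U) = col i (adjmx U) by apply/matrixP => a b; rewrite !mxE.
by rewrite -row_mul !mxE; apply: eq_bigr => k _; rewrite !mxE.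
Qed.

Lemma unit_row (U : M) i : U *m adjmx U = 1%:M -> \sum_k cabs2 (adjmx (row i U) k 0) = 1.
Proof.
move=> UU; have : (U *m adjmx U) i i = 1 by rewrite UU mxE eqxx.
rewrite mxE => /(congr1 (@complex.Re R)); rewrite Re_sum /= => <-.
by apply: eq_bigr => k _; rewrite !adjmxE Re_mul_conjc /cabs2 ReJ ImJ sqrrN mxE.
Qed.

Lemma sqr_wmean_le (p q : 'I_d -> R) : (forall i, 0 <= p i) ->
  (\sum_i p i * q i) ^+ 2 <= (\sum_i p i) * \sum_i p i * q i ^+ 2.
Proof.
move=> p0; rewrite -subr_ge0.
have -> : (\sum_i p i) * (\sum_i p i * q i ^+ 2) - (\sum_i p i * q i) ^+ 2
   = (\sum_i \sum_j p i * p j * (q i - q j) ^+ 2) / 2.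
  have E1 : (\sum_i p i) * (\sum_i p i * q i ^+ 2) = \sum_i \sum_j p i * p j * q j ^+ 2.
    by rewrite mulr_suml; apply: eq_bigr => i _; rewrite mulr_sumr; apply: eq_bigr => j _; ring.
  have E2 : (\sum_i p i) * (\sum_i p i * q i ^+ 2) = \sum_i \sum_j p i * p j * q i ^+ 2.
    rewrite mulrC mulr_suml; apply: eq_bigr => i _; rewrite mulr_sumr.
    by apply: eq_bigr => j _; ring.
  have E3 : (\sum_i p i * q i) ^+ 2 = \sum_i \sum_j p i * p j * (q i * q j).
    by rewrite expr2 mulr_suml; apply: eq_bigr => i _; rewrite mulr_sumr; apply: eq_bigr => j _; ring.
  have E4 : \sum_i \sum_j p i * p j * (q i - q j) ^+ 2 =
     \sum_i \sum_j p i * p j * q i ^+ 2 + \sum_i \sum_j p i * p j * q j ^+ 2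
     - 2 * \sum_i \sum_j p i * p j * (q i * q j).
    rewrite mulr_sumr -big_split/= -sumrB; apply: eq_bigr => i _.
    rewrite mulr_sumr -big_split/= -sumrB; apply: eq_bigr => j _; ring.
  by rewrite E4 -E1 -E2 E3; field.
rewrite divr_ge0// sumr_ge0// => i _; rewrite sumr_ge0// => j _.
by rewrite mulr_ge0 ?sqr_ge0// mulr_ge0.
Qed.

(** The gradient of log phi is exp A / tr exp A, a mixture of rank-one projections onto
    eigenvectors; by Cauchy-Schwarz its squared slopes are dominated by the mixture of those at
    single unit vectors. *)
Lemma rtr_dphi_weak_var vs L A : herm A -> weak_var_le vs L ->
  \sum_(v <- vs) rtr (dphi A) v ^+ 2 <= L * phi A ^+ 2.
Proof.
move=> hA wv; have [UU AE] := specP hA.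
apply: (@le_trans _ _ (\sum_(v <- vs) phi A *
   \sum_i expR (seig A i) * rayl (adjmx (row i (sbas A))) v ^+ 2)).
  apply: ler_sum => v _; rewrite rtr_dphi//.
  under eq_bigr do rewrite -rayl_chg.
  by apply: sqr_wmean_le => i; exact: expR_ge0.
rewrite -mulr_sumr exchange_big/= expr2 mulrCA ler_wpM2l ?phi_ge0//.
rewrite /phi mulr_sumr; apply: ler_sum => i _; rewrite -mulr_sumr mulrC.
by rewrite ler_wpM2r ?expR_ge0// wv// unit_row.
Qed.

(** The slope is [rtr (dphi A) X / phi A]. The constant 3 stems from phi A + phi (A + H) <= 3 * phi
    A; the lower side, from [ln_ge_quad], needs only 2. *)
Lemma tame_ln_phi vs L (s : R) : weak_var_le vs L ->
  tame (scal s vs) (s ^+ 2 * L) 3 (fun A => ln (phi A)).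
Proof.
move=> wv A hA; have p0 := phi_gt0 A d_gt0.
have pn0 : phi A != 0 by rewrite gt_eqF.
have nl X : `|rtr (dphi A) X / phi A| <= l1 X.
  rewrite normrM normfV (gtr0_norm p0) ler_pdivrMr//; exact: rtr_dphi_le.
exists (fun X => rtr (dphi A) X / phi A); split.
- by move=> X Y; rewrite rtrDr mulrDl.
- move=> H hH HN; have hB := hermD hA hH.
  have EH : A + H - A = H by rewrite addrC addKr.
  have T1 := phi_ge_tangent hA hB; have T2 := phi_le_quad hA hB.
  have T3 := phi_le2 hA hB; rewrite !EH in T1 T2 T3; have {}T3 := T3 HN.
  have q0 := phi_gt0 (A + H) d_gt0.
  have nlH := nl H; set l := _ / phi A in nlH *.
  have El : rtr (dphi A) H = l * phi A by rewrite /l divfK.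
  rewrite El in T1 T2.
  rewrite -ln_div ?posrE//; set x := phi (A + H) / phi A.
  have xl : 1 + l <= x by rewrite /x ler_pdivlMr// mulrDl mul1r.
  have xu : x <= 1 + l + 3 * l1 H ^+ 2.
    rewrite /x ler_pdivrMr//; apply: (le_trans T2).
    have : l1 H ^+ 2 * (phi A + phi (A + H)) <= l1 H ^+ 2 * (3 * phi A).
      by rewrite ler_wpM2l ?sqr_ge0//; lra.
    by rewrite !mulrDl mul1r; lra.
  have x0 : 0 < x by rewrite divr_gt0.
  have l2 : `|l| <= 1 / 2 by exact: le_trans nlH HN.
  have lsq : l ^+ 2 <= l1 H ^+ 2.
    by rewrite -(real_normK (num_real l)) ler_pXn2r ?nnegrE ?l1_ge0.
  have u1 : ln x <= x - 1.
    have h := @le_ln1Dx R (x - 1); rewrite subrKC in h; apply: h.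
    by move: x0; clear; lra.
  have u2 : l - 2 * l ^+ 2 <= ln x.
    apply: le_trans (ln_ge_quad l2) _.
    by rewrite ler_ln ?posrE//; move: l2; rewrite ler_norml => /andP[? ?]; lra.
  have N2 : 0 <= l1 H ^+ 2 by exact: sqr_ge0.
  by rewrite ler_norml; apply/andP; split; lra.
- rewrite big_map; under eq_bigr do rewrite rtrZr -mulrA exprMn.
  rewrite -mulr_sumr ler_wpM2l ?sqr_ge0//.
  under eq_bigr do rewrite expr_div_n.
  by rewrite -mulr_suml ler_pdivrMr ?exprn_gt0// rtr_dphi_weak_var.
- by move=> H _; exact: nl.
Qed.

Section Iterate.
Variables (vs : seq M) (L s : R).
Hypotheses (hvs : herms vs) (L0 : 0 <= L) (wv : weak_var_le vs L).
Hypotheses (s01 : 0 <= s <= 1) (sr : s * l1s vs <= 1 / 2) (Ksr : 3 * (s * l1s vs) ^+ 2 <= 1)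
  (sL : s ^+ 2 * L <= 1).
Let Rd := rade (scal s vs).
Let hs : herms (scal s vs) := herms_scal hvs.

Lemma iter_rad_le n f g A : (forall X, herm X -> f X <= g X) -> herm A ->
  iter n Rd f A <= iter n Rd g A.
Proof.
move=> fg; elim: n A => [|n IH] A hA /=; first exact: fg.
by apply: rad_le => // X hX; exact: IH.
Qed.

Lemma iter_rad_addc n f c A : iter n Rd (fun X => f X + c) A = iter n Rd f A + c.
Proof.
elim: n A => //= n IH A.
rewrite -[in RHS](rad_cst (scal s vs) c A) -radD; apply: rad_ext => X; exact: IH.
Qed.

(** The coefficient of s^3 in [rad_exp_step] at K = 3. *)
Definition conc_const : R := 12 * l1s vs ^+ 3 + 18 * l1s vs ^+ 4 + 3 * l1s vs ^+ 2 * L.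

(** The innermost average goes first: [rade f] plus a constant is tame with the same constants, so
    the remaining averages fall under the induction hypothesis. *)
Lemma iter_rad_exp n f A : tame (scal s vs) (s ^+ 2 * L) 3 f -> herm A ->
  iter n Rd (fun X => expR (f X)) A <=
  expR (iter n Rd f A + n%:R * (s ^+ 2 * L / 2 + conc_const * s ^+ 3)).
Proof.
set c := s ^+ 2 * L / 2 + _.
elim: n f A => [|n IH] f A tf hA; first by rewrite mul0r addr0.
rewrite !iterSr.
have tf' : tame (scal s vs) (s ^+ 2 * L) 3 (fun X => Rd f X + c).
  by apply: tame_addc; exact: tame_rad.
apply: (@le_trans _ _ (iter n Rd (fun X => expR (Rd f X + c)) A)).
  apply: iter_rad_le => // X hX.
  have := rad_exp_step hvs L0 (ler0n _ 3) tf s01 sr Ksr sL hX.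
  rewrite /Rd => /le_trans; apply; rewrite ler_expR lerD2l /c /conc_const lerD2l.
  by rewrite ler_wpM2r ?exprn_ge0//; [case/andP: s01|lra].
apply: le_trans (IH _ _ tf' hA) _.
by rewrite ler_expR iter_rad_addc -natr1 mulrDl mul1r -addrA [c + _]addrC.
Qed.

Lemma iter_rad_phi n A : herm A ->
  iter n Rd (@phi R d) A <=
  expR (iter n Rd (fun X => ln (phi X)) A + n%:R * (s ^+ 2 * L / 2 + conc_const * s ^+ 3)).
Proof.
move=> hA; apply: le_trans (iter_rad_exp n (tame_ln_phi s wv) hA).
by apply: iter_rad_le => // X hX; rewrite lnK// posrE phi_gt0.
Qed.

End Iterate.

(** The Taylor error is at most K * phi A, and phi A is at most twice the average itself; the error
    thus becomes a factor, with 6 = 2 * 3. A factor, unlike an additive error, survives the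
    iteration of commuting operators. *)
Lemma rad_phi_ge vs w (s : R) A : herm A -> herm w -> herms vs -> 0 <= s <= 1 ->
  s * (l1 w + l1s vs) <= 1 / 2 ->
  phi A - s ^+ 2 * rtr (dphi A) w + s ^+ 2 / 2 * \sum_(v <- vs) Qf A v <=
  (1 + 6 * d%:R ^+ 4 * (l1 w + l1s vs) ^+ 3 * s ^+ 3) *
    rade (scal s vs) (@phi R d) (A - (s ^+ 2)%:C%C *: w).
Proof.
move=> hA hw hvs /andP[s0 s1] sr.
have hs : herms (scal s vs) := herms_scal hvs.
set r := l1 w + l1s vs in sr *.
have r0 : 0 <= r by rewrite addr_ge0 ?l1_ge0 ?l1s_ge0.
set c := - ((s ^+ 2)%:C%C *: w).
have hc : herm c by apply: hermN; exact: hermZ.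
have D0 : 0 <= d%:R ^+ 4 :> R by rewrite exprn_ge0.
set K := 3 * d%:R ^+ 4 * (s * r) ^+ 3.
have K0 : 0 <= K by rewrite !mulr_ge0// exprn_ge0// mulr_ge0.
have near H : herm H -> l1 (H - c) <= l1s (scal s vs) -> l1 H <= s * r.
  move=> hH Hc; rewrite -(subrKC c H) (le_trans (l1D _ _))//.
  rewrite mulrDr lerD//; last by apply: le_trans Hc _; rewrite l1s_scal ger0_norm.
  rewrite /c l1N l1Z ger0_norm ?sqr_ge0// ler_wpM2r ?l1_ge0//.
  by rewrite expr2 ler_piMl.
have lb : phi A + rade (scal s vs) (rtr (dphi A)) c + rade (scal s vs) (Qf A) c / 2 - K * phi A <=
   rade (scal s vs) (@phi R d) (A + c).
  rewrite -(rad_shift _ _ A c) (@rad_ext _ _ (scal s vs) (fun X => phi (X + c)) (fun H => phi (A + (H - A + c))) A); last first.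
    by move=> X; rewrite (addrA A) subrKC.
  rewrite (rad_shift _ (fun H => phi (A + (H + c))) A (- A)) subrr.
  rewrite (rad_shift _ (fun H => phi (A + H)) 0 c) add0r.
  have -> : phi A + rade (scal s vs) (rtr (dphi A)) c + rade (scal s vs) (Qf A) c / 2 - K * phi A =
    rade (scal s vs) (fun H => phi A + rtr (dphi A) H + 2^-1 * Qf A H + - (K * phi A)) c.
    rewrite (radD _ (fun H => phi A + rtr (dphi A) H + 2^-1 * Qf A H)) rad_cst.
    rewrite (radD _ (fun H => phi A + rtr (dphi A) H)) radZ (radD _ (fun=> phi A)) rad_cst.
    by rewrite [_ / 2]mulrC.
  apply: rad_le_near => // H hH Hc; have Hn := near H hH Hc.
  have := phi_add_ge hA hH (le_trans Hn sr).
  rewrite [_ / 2]mulrC; apply: le_trans; rewrite lerD2l lerN2 ler_wpM2r ?phi_ge0//.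
  rewrite /K; apply: ler_wpM2l; first by rewrite mulr_ge0.
  by rewrite ler_pXn2r ?nnegrE ?l1_ge0// mulr_ge0.
have ub : phi A <= 2 * rade (scal s vs) (@phi R d) (A + c).
  rewrite -(rad_cst (scal s vs) (phi A) (A + c)) -radZ; apply: rad_le_near => //.
    exact: hermD.
  move=> X hX XA; apply: phi_le2 => //; rewrite -l1N opprB.
  apply: le_trans sr; apply: near; first exact: hermB.
  by rewrite -addrA -opprD.
rewrite (rad_addl _ _ (_ : addl (rtr (dphi A)))) in lb; last by move=> X Y; exact: rtrDr.
rewrite rad_Qf big_map in lb.
have E1 : rtr (dphi A) c = - (s ^+ 2 * rtr (dphi A) w) by rewrite /c rtrNr rtrZr.
have E2 : \sum_(v <- vs) Qf A (s%:C%C *: v) = s ^+ 2 * \sum_(v <- vs) Qf A v.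
  by rewrite mulr_sumr; apply: eq_bigr => v _; rewrite QfZ.
rewrite E1 E2 in lb.
have Q0 := Qf_ge0 A c.
have -> : 6 * d%:R ^+ 4 * r ^+ 3 * s ^+ 3 = 2 * K by rewrite /K; ring.
have Kub := ler_wpM2l K0 ub.
move: lb Q0 Kub; rewrite -/c.
move: (phi A) (rade _ _ _) (rtr _ w) (Qf A c) (\sum_(_ <- _) _) => a b e q t; lra.
Qed.

End Concentration.

(** * The minimal eigenvalue and its variational form *)

Section MinEigenvalue.
Variable R : realType.
Local Notation C := R[i].
Variable d : nat.
Local Notation M := 'M[C]_d.
Implicit Types (A B H X : M) (u : 'cV[C]_d).

Lemma eigenvalue_seig A (a : R) : herm A -> eigenvalue A (a%:C%C) -> exists i, seig A i = a.
Proof.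
move=> /specP[UU AE] /eigenvalueP[v vA v0].
set U := sbas A in UU AE; pose w := v *m adjmx U.
have wD : w *m rdiag (seig A) = a%:C%C *: w.
  rewrite /w scalemxAl -vA {2}AE /fmx -!mulmxA; congr (_ *m _).
  by rewrite UU mulmx1.
have /rV0Pn[i wi] : w != 0.
  apply: contra v0 => /eqP w0.
  by rewrite -(mulmx1 v) -(uadj UU) mulmxA -/w w0 mul0mx.
exists i; move: (w) wD wi => w' wD wi.
have := congr1 (fun x : 'rV_d => x 0 i) wD.
rewrite /= /rdiag mul_mx_diag !mxE [RHS]mulrC => E.
by have /(@complexI R) := mulfI wi E.
Qed.

Lemma seig_eigenvalue A i : herm A -> eigenvalue A ((seig A i)%:C%C).
Proof.
move=> /specP[UU AE]; set U := sbas A in UU AE.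
apply/eigenvalueP; exists (row i U).
  rewrite {1}AE /fmx -row_mul !mulmxA UU mul1mx.
  by apply/rowP => j; rewrite [LHS]mxE rdiagME !mxE.
apply/eqP => r0; have := unit_row i UU; rewrite r0 adjmx0 big1 => [|k _].
  by move/eqP; rewrite eq_sym oner_eq0.
by rewrite mxE /cabs2 /= expr0n/= addr0.
Qed.

Hypothesis d_gt0 : (0 < d)%N.

Lemma lmin_seig A : herm A -> (forall i, lmin A <= seig A i) /\ exists i, lmin A = seig A i.
Proof.
move=> hA; pose i1 := Ordinal d_gt0.
case: (@arg_minP _ _ _ i1 xpredT (seig A) isT) => i0 _ imin.
set E := [set a : R | eigenvalue A a%:C%C]%classic.
have lb : lbound E (seig A i0).
  by move=> a /= ea; have [i <-] := eigenvalue_seig hA ea; exact: imin.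
have Ei i : E (seig A i) by exact: seig_eigenvalue.
have hlb : has_lbound E by exists (seig A i0).
have le1 i : lmin A <= seig A i by move: (ge_inf hlb (Ei i)).
split=> //; exists i0; apply/eqP; rewrite eq_le le1 /=.
have ne : E !=set0 by exists (seig A i0).
exact: (lb_le_inf ne lb).
Qed.

Lemma lminN_seig_le (t : R) A i : 0 < t -> herm A ->
  seig ((- t)%:C%C *: A) i <= - t * lmin A.
Proof.
move=> t0 hA; have hB : herm ((- t)%:C%C *: A) by exact: hermZ.
set l := seig _ i.
have tc0 : (- t)%:C%C != 0 :> C by rewrite -(rmorph0 (real_complex R)) (inj_eq (@complexI R)) oppr_eq0 gt_eqF.
have ev : eigenvalue A ((- (l / t))%:C%C).
  have /eigenvalueP[v vB v0] := seig_eigenvalue i hB.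
  apply/eigenvalueP; exists v => //.
  apply: (scalerI tc0); rewrite scalemxAr vB scalerA -rmorphM; congr (_%:C%C *: _).
  by rewrite mulrNN mulrC divfK// gt_eqF.
have [j ej] := eigenvalue_seig hA ev.
have h := (lmin_seig hA).1 j; rewrite ej in h.
have E : - (l / t) * t = - l by field; rewrite gt_eqF.
have := ler_wpM2r (ltW t0) h; rewrite E; move: (l) (lmin A) => x y; clear; lra.
Qed.

Lemma lminN_seig (t : R) A : 0 < t -> herm A ->
  exists i, seig ((- t)%:C%C *: A) i = - t * lmin A.
Proof.
move=> t0 hA; have hB : herm ((- t)%:C%C *: A) by exact: hermZ.
have [_ [j ej]] := lmin_seig hA.
apply: eigenvalue_seig => //.
have /eigenvalueP[v vB v0] := seig_eigenvalue j hA.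
apply/eigenvalueP; exists v => //.
by rewrite -scalemxAr vB scalerA -rmorphM ej.
Qed.

Lemma phi_le_lmin (t : R) A : 0 < t -> herm A ->
  phi ((- t)%:C%C *: A) <= d%:R * expR (- t * lmin A).
Proof.
move=> t0 hA; apply: (@le_trans _ _ (\sum_(i < d) expR (- t * lmin A))).
  by apply: ler_sum => i _; rewrite ler_expR lminN_seig_le.
by rewrite sumr_const card_ord mulr_natl.
Qed.

Lemma phi_ge_lmin (t : R) A : 0 < t -> herm A ->
  expR (- t * lmin A) <= phi ((- t)%:C%C *: A).
Proof. by move=> t0 hA; have [i <-] := lminN_seig t0 hA; exact: expR_le_phi. Qed.

Lemma rayl_spec A u : herm A ->
  rayl u A = \sum_i seig A i * cabs2 ((sbas A *m u) i 0) .
Proof.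
move=> /specP[UU AE]; set U := sbas A in UU AE *; rewrite /rayl {1}AE /fmx.
have -> : adjmx u *m (adjmx U *m rdiag (seig A) *m U) *m u =
   adjmx (U *m u) *m (rdiag (seig A) *m (U *m u)) by rewrite adjmxM !mulmxA.
rewrite mxE Re_sum; apply: eq_bigr => i _.
by rewrite adjmxE /rdiag mul_diag_mx !mxE mulrCA Re_scale mulrC (mulrC (conjc _)) Re_mul_conjc mulrC.
Qed.

Lemma sum_cabs2_unitary (U : M) u : U *m adjmx U = 1%:M ->
  \sum_i cabs2 ((U *m u) i 0) = \sum_i cabs2 (u i 0).
Proof.
move=> UU.
have E (w : 'cV[C]_d) : \sum_i cabs2 (w i 0) = complex.Re ((adjmx w *m w) 0 0).
  rewrite mxE Re_sum; apply: eq_bigr => i _.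
  by rewrite adjmxE mulrC Re_mul_conjc.
by rewrite !E adjmxM mulmxA -(mulmxA _ (adjmx U)) uadj// mulmx1.
Qed.

Lemma lmin_le_rayl A u : herm A -> lmin A * (\sum_i cabs2 (u i 0)) <= rayl u A.
Proof.
move=> hA; have [UU _] := specP hA; rewrite rayl_spec// -(sum_cabs2_unitary u UU) mulr_sumr.
by apply: ler_sum => i _; rewrite ler_wpM2r ?cabs2_ge0// (lmin_seig hA).1.
Qed.

(** Variational form of [lmin], which is Lipschitz on all matrices and not only on hermitian
    ones. *)
Definition rmin A : R := inf ((fun u => rayl u A) @` [set u : 'cV[C]_d | \sum_i cabs2 (u i 0) = 1])%classic.

Lemma raylD u A B : rayl u (A + B) = rayl u A + rayl u B.
Proof. by rewrite /rayl mulmxDr mulmxDl mxE ReD. Qed.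

Lemma rayl_le u X : \sum_i cabs2 (u i 0) = 1 -> `|rayl u X| <= l1 X.
Proof.
move=> u1; have ui i : cabs (u i 0) <= 1.
  rewrite -(ler_pXn2r (n := 2))// ?nnegrE ?cabs_ge0// expr1n sqr_cabs -u1.
  by rewrite (bigD1 i)//= lerDl sumr_ge0// => j _; exact: cabs2_ge0.
rewrite /rayl quad_sum; apply: le_trans (Re_le_cabs _) _.
apply: le_trans (cabs_sum _ _ _) _; apply: ler_sum => i _.
apply: le_trans (cabs_sum _ _ _) _; apply: ler_sum => j _.
rewrite !cabsM cabs_conj -[leRHS]mulr1; apply: ler_pM; rewrite ?mulr_ge0 ?cabs_ge0//.
by rewrite ler_piMl ?cabs_ge0.
Qed.

Let unit0 : exists u : 'cV[C]_d, \sum_i cabs2 (u i 0) = 1.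
Proof.
exists (delta_mx (Ordinal d_gt0) 0); rewrite (bigD1 (Ordinal d_gt0))//= big1 => [|j /negbTE jn].
  by rewrite mxE !eqxx /cabs2 /= expr1n expr0n/= !addr0.
by rewrite mxE jn /cabs2 /= expr0n/= addr0.
Qed.

Lemma rmin_le A u : \sum_i cabs2 (u i 0) = 1 -> rmin A <= rayl u A.
Proof.
move=> u1; rewrite /rmin; set E := (X in inf X).
have lb : lbound E (- l1 A).
  by move=> _ [w /= w1 <-]; have := rayl_le A w1; rewrite ler_norml => /andP[].
have Eu : E (rayl u A) by exists u.
have hlb : has_lbound E by exists (- l1 A).
by move: (ge_inf hlb) => /(_ _ Eu).
Qed.

Lemma rmin_ge A (x : R) : (forall u : 'cV[C]_d, \sum_i cabs2 (u i 0) = 1 -> x <= rayl u A) -> x <= rmin A.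
Proof.
move=> h; apply: lb_le_inf.
  by have [u u1] := unit0; exists (rayl u A); exists u.
by move=> _ [w /= w1 <-]; exact: h.
Qed.

Lemma rmin_lip A B : `|rmin A - rmin B| <= l1 (A - B).
Proof.
have h X Y : rmin X - rmin Y <= l1 (X - Y).
  rewrite lerBlDr -lerBlDl; apply: rmin_ge => u u1.
  rewrite lerBlDl; apply: (le_trans (rmin_le X u1)).
  rewrite -{1}(subrKC Y X) raylD addrC lerD2r.
  exact: le_trans (ler_norm _) (rayl_le _ u1).
rewrite ler_norml h lerNl opprB andbT.
by apply: le_trans (h B A) _; rewrite -l1N opprB.
Qed.

Lemma rmin_lmin A : herm A -> rmin A = lmin A.
Proof.
move=> hA; apply/eqP; rewrite eq_le; apply/andP; split.
  have [_ [i ->]] := lmin_seig hA; have [UU AE] := specP hA.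
  apply: (le_trans (rmin_le A (unit_row i UU))).
  by rewrite rayl_chg {3}AE chg_fmx// chg1// mxE eqxx mulr1.
apply: rmin_ge => u u1; apply: le_trans (lmin_le_rayl u hA).
by rewrite u1 mulr1.
Qed.

Lemma lmin_lip A B : herm A -> herm B -> `|lmin A - lmin B| <= l1 (A - B).
Proof. by move=> hA hB; rewrite -!rmin_lmin//; exact: rmin_lip. Qed.

End MinEigenvalue.

(** * Integration against the normal density and integration by parts *)

Section GaussianIntegral.
Variable R : realType.
Local Notation leb := (@lebesgue_measure R).
Variables (m s : R).
Hypothesis s0 : s != 0.
Local Notation p := (normal_pdf m s).

(** The Radon-Nikodym derivative and the density have the same integral over every set, hence agree
    almost everywhere. *)
Lemma ge0_integral_normal_prob (f : R -> \bar R) : (forall x, 0 <= f x)%E ->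
  measurable_fun setT f ->
  (\int[normal_prob m s]_x f x = \int[leb]_x (f x * (p x)%:E))%E.
Proof.
move=> f0 mf; have dom := @normal_prob_dominates R m s.
rewrite -(Radon_Nikodym_SigmaFinite.change_of_variables dom)//.
apply: ae_eq_integral => //.
- apply: emeasurable_funM => //; apply: (measurable_int leb).
  exact: Radon_Nikodym_SigmaFinite.f_integrable.
- apply: emeasurable_funM => //; apply/measurable_EFinP.
  exact: measurable_normal_pdf.
- apply: ae_eqe_mul2l; apply: integral_ae_eq => //.
  + exact: Radon_Nikodym_SigmaFinite.f_integrable.
  + by apply/measurable_EFinP; exact: measurable_normal_pdf.
  + by move=> E _ mE; rewrite -Radon_Nikodym_SigmaFinite.f_integral.
Qed.

Definition quadbd (g : R -> R) := exists C, forall x, `|g x| <= C * (1 + (x - m) ^+ 2).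

Lemma pdfE x : p x = normal_peak s * expR (- (x - m) ^+ 2 / (s ^+ 2 *+ 2)).
Proof. by rewrite normal_pdfE. Qed.

Let s2 : 0 < s ^+ 2. Proof. by rewrite exprn_even_gt0. Qed.

Lemma integrable_quad_pdf (g : R -> R) : measurable_fun setT g -> quadbd g ->
  leb.-integrable setT (fun x => (g x * p x)%:E).
Proof.
move=> mg [C gC].
(* Domination by a multiple of the normal density of doubled variance: half of the Gaussian exponent
   remains to absorb the quadratic growth. *)
pose t := s * Num.sqrt 2.
have sq2 : Num.sqrt 2 ^+ 2 = 2 :> R by rewrite sqr_sqrtr.
have t2 : t ^+ 2 = s ^+ 2 * 2 by rewrite exprMn sq2.
have tn0 : t != 0 by rewrite mulf_neq0// sqrtr_eq0 -ltNge.
have pt0 : 0 < normal_peak t by apply: normal_peak_gt0.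
have ps0 : 0 < normal_peak s by apply: normal_peak_gt0.
pose K := `|C| * (1 + 4 * s ^+ 2) * (normal_peak s / normal_peak t).
have i1 : leb.-integrable setT (fun x => (K%:E * (normal_pdf m t x)%:E)%E).
  by apply: integrableZl => //; exact: integrable_normal_pdf.
apply: (@le_integrable _ _ _ leb setT _ _ (fun x => (K%:E * (normal_pdf m t x)%:E)%E)) => //.
  by apply/measurable_EFinP/measurable_funM => //; exact: measurable_normal_pdf.
have K0 : 0 <= K.
  apply: mulr_ge0; last by rewrite divr_ge0// ltW.
  by rewrite mulr_ge0// addr_ge0// mulr_ge0// ltW.
move=> x _; rewrite -EFinM !abse_EFin lee_fin [leRHS]ger0_norm; last first.
  by rewrite mulr_ge0// normal_pdf_ge0.
rewrite normrM (ger0_norm (normal_pdf_ge0 _ _ _)).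
rewrite pdfE normal_pdfE// /normal_fun.
set y := (x - m) ^+ 2; have y0 : 0 <= y by exact: sqr_ge0.
rewrite t2 -[_ *+ 2 in leRHS]mulr_natr -[_ *+ 2 in leLHS]mulr_natr.
set u := y / (4 * s ^+ 2).
have u0 : 0 <= u by rewrite divr_ge0// mulr_ge0// ltW.
have -> : - y / (s ^+ 2 * 2) = - u - u by rewrite /u; field.
have -> : - y / (s ^+ 2 * 2 * 2) = - u by rewrite /u; field.
have yu : y = 4 * s ^+ 2 * u by rewrite /u; field.
have e1 := expR_ge1Dx u.
have e2 : expR u * expR (- u) = 1 by rewrite -expRD subrr expR0.
have -> : K * (normal_peak t * expR (- u)) = `|C| * (1 + 4 * s ^+ 2) * normal_peak s * expR (- u).
  by rewrite /K; field; rewrite gt_eqF.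
rewrite expRD mulrA mulrA; apply: ler_wpM2r; first exact: expR_ge0.
apply: (@le_trans _ _ (`|C| * (1 + y) * (normal_peak s * expR (- u)))).
  rewrite mulrA; apply: ler_wpM2r; first exact: expR_ge0.
  apply: ler_wpM2r; first exact: ltW.
  apply: (le_trans (gC x)); apply: ler_wpM2r; first by rewrite addr_ge0.
  exact: ler_norm.
have -> : `|C| * (1 + y) * (normal_peak s * expR (- u)) = `|C| * normal_peak s * ((1 + y) * expR (- u)) by ring.
have -> : `|C| * (1 + 4 * s ^+ 2) * normal_peak s = `|C| * normal_peak s * (1 + 4 * s ^+ 2) by ring.
apply: ler_wpM2l; first by rewrite mulr_ge0// ltW.
have eu0 : 0 <= expR (- u) := expR_ge0 _.
have a1 : expR (- u) <= 1 by rewrite -expR0 ler_expR oppr_le0.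
have a2 : u * expR (- u) <= 1.
  by rewrite -e2; apply: ler_wpM2r => //; lra.
by rewrite mulrDl mul1r lerD// yu -mulrA ler_piMr// mulr_ge0// ltW.
Qed.

(* The integral of [(F p)'] over the line vanishes since [F p] tends to [0]. *)
Lemma gaussian_ibp (F F' : R -> R) (K : R) :
  (forall x, is_derive x (1 : R) F (F' x)) -> continuous F' ->
  (forall x, `|F x| <= 1 + `|x - m|) -> (forall x, `|F' x| <= K) ->
  (\int[leb]_x ((F' x - F x * (x - m) / s ^+ 2) * p x) = 0)%R.
Proof.
move=> dF cF' F1 FK.
pose D x := F' x - F x * (x - m) / s ^+ 2.
have cF : continuous F.
  move=> x; apply: differentiable_continuous; apply/derivable1_diffP.
  by have [] := dF x.
have cD : continuous D.
  move=> x; apply: (@cvgB _ R^o); first exact: cF'.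
  apply: cvgM; last exact: cvg_cst.
  by apply: cvgM; [exact: cF|apply: (@cvgB _ R^o); [exact: cvg_id|exact: cvg_cst]].
have cp : continuous p by exact: continuous_normal_pdf.
have cDp : continuous (fun x => D x * p x) by move=> x; apply: cvgM; [exact: cD|exact: cp].
have dp (x : R) : is_derive x (1 : R) p (- ((x - m) / s ^+ 2) * p x).
  have -> : p = fun x => normal_peak s * expR (- (x - m) ^+ 2 / (s ^+ 2 *+ 2)).
    by apply/funext => y; exact: pdfE.
  apply: is_derive_eq; rewrite /GRing.scale/= -mulr_natr.
  by field.
have dFp (x : R) : is_derive x (1 : R) (fun x => F x * p x) (D x * p x).
  have := is_deriveM (dF x) (dp x); move=> h; apply: is_derive_eq.
  by rewrite /GRing.scale/= /D; field.
have mD : measurable_fun setT D by exact: continuous_measurable_fun.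
have qD : quadbd D.
  exists (`|K| + 3 / s ^+ 2) => x; rewrite /D.
  set y := x - m.
  have Fx := F1 x; rewrite -/y in Fx.
  apply: (le_trans (ler_normB _ _)); rewrite mulrDl; apply: lerD.
    apply: (le_trans (FK x)); apply: (le_trans (ler_norm _)).
    by rewrite ler_peMr// lerDl sqr_ge0.
  rewrite !normrM normfV (ger0_norm (ltW s2)) [leRHS]mulrAC ler_wpM2r ?invr_ge0 ?(ltW s2)//.
  apply: (le_trans (ler_wpM2r (normr_ge0 _) Fx)).
  rewrite -[y ^+ 2](real_normK (num_real y)); move: (normr_ge0 y); move: `|y| => z z0.
  have : 0 <= (z - 1) ^+ 2 by exact: sqr_ge0.
  by rewrite sqrrB expr1n mulr1; nra.
have iD := integrable_quad_pdf mD qD.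
pose f_ (n : nat) : R -> \bar R := (fun x => (D x * p x)%:E) \_ `[m - n.+1%:R, m + n.+1%:R].
have cvg1 : (\int[leb]_x f_ n x @[n --> \oo] --> \int[leb]_x (D x * p x)%:E)%E.
  apply: (@dominated_cvg _ _ _ leb setT measurableT f_ (fun x => (D x * p x)%:E)
      (fun x => `|(D x * p x)%:E|%E)) => //.
  - move=> n; apply/(measurable_restrictT _ _).1 => //.
    apply: measurable_funTS; exact: (measurable_int _ iD).
  - move=> x _; apply: cvg_near_cst; near=> n.
    rewrite /f_ patchE mem_set//= in_itv/=.
    have : `|x - m| <= n.+1%:R.
      near: n; exists (Num.truncn `|x - m|) => // k /= kn.
      apply: ltW; apply: (lt_le_trans (truncnS_gt _)).
      by rewrite ler_nat.
    by rewrite ler_norml => /andP[h1 h2]; apply/andP; split; lra.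
  - exact: integrable_abse.
  - by move=> n x _; rewrite /f_ patchE; case: ifP => // _; rewrite abse0 abse_ge0.
have val n : (\int[leb]_x f_ n x = (F (m + n.+1%:R) * p (m + n.+1%:R) - F (m - n.+1%:R) * p (m - n.+1%:R))%:E)%E.
  rewrite /f_ -integral_mkcond (@continuous_FTC2 _ _ (fun x => F x * p x)) ?EFinB//.
  - by rewrite ltrD2l gtrN// ltr0n.
  - by apply: continuous_subspaceT.
  - have cFp : {within `[m - n.+1%:R, m + n.+1%:R], continuous (fun x => F x * p x)}.
      by apply: derivable_within_continuous => x _; have [] := dFp x.
    have ab : m - n.+1%:R < m + n.+1%:R by rewrite ltrD2l gtrN// ltr0n.
    move/(continuous_within_itvP _ ab) : cFp => [c1 c2 c3].
    by split => // x _; have [] := dFp x.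
  - by move=> x _; rewrite derive1E; have [_ ->] := dFp x.
pose B : R := normal_peak s * (4 * s ^+ 2).
have ps0 : 0 < normal_peak s by apply: normal_peak_gt0.
(* At distance N = n + 1 from m the bound u * exp (- u) <= 1, with u of order N^2, beats the linear
   growth of F and leaves B / N. *)
have small (n : nat) x : `|x - m| = n.+1%:R -> `|F x * p x| <= B / n.+1%:R.
  move=> xn; have Fx := F1 x; rewrite xn in Fx.
  rewrite normrM (ger0_norm (normal_pdf_ge0 _ _ _)) pdfE.
  rewrite -(real_normK (num_real (x - m))) xn -[_ *+ 2]mulr_natr.
  set N : R := n.+1%:R; have N1 : 1 <= N by rewrite ler1n.
  set u := N ^+ 2 / (s ^+ 2 * 2).
  have -> : - N ^+ 2 / (s ^+ 2 * 2) = - u by rewrite /u; field.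
  have N0 : 0 < N by exact: lt_le_trans ltr01 N1.
  have u0 : 0 < u by apply: divr_gt0; [exact: exprn_gt0|exact: mulr_gt0].
  have ue : u * expR (- u) <= 1.
    have e2 : expR u * expR (- u) = 1 by rewrite -expRD subrr expR0.
    by rewrite -e2 ler_wpM2r ?expR_ge0// (le_trans _ (expR_ge1Dx u))// lerDr.
  have Fx2 : `|F x| <= 2 * N by rewrite (le_trans Fx)//; lra.
  rewrite ler_pdivlMr ?(lt_le_trans ltr01 N1)//.
  apply: (@le_trans _ _ (2 * N * (normal_peak s * expR (- u)) * N)).
    rewrite ler_wpM2r ?(le_trans ler01 N1)// ler_wpM2r// mulr_ge0 ?expR_ge0//; exact: ltW.
  have -> : 2 * N * (normal_peak s * expR (- u)) * N = B * (u * expR (- u)).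
    by rewrite /B /u; field.
  by rewrite ler_piMr// /B mulr_ge0 ?(ltW ps0)// mulr_ge0// ltW.
have cvg2 : (\int[leb]_x f_ n x @[n --> \oo] --> 0)%E.
  have -> : (fun n => \int[leb]_x f_ n x)%E = (fun n =>
     (F (m + n.+1%:R) * p (m + n.+1%:R) - F (m - n.+1%:R) * p (m - n.+1%:R))%:E).
    by apply/funext => n; exact: val.
  apply: cvg_EFin; first by near=> n.
  apply/cvgrPdist_le => e e0; near=> n.
  rewrite sub0r normrN /=; apply: (le_trans (ler_normB _ _)).
  have h1 : `|m + n.+1%:R - m| = n.+1%:R by rewrite addrC addKr ger0_norm.
  have h2 : `|m - n.+1%:R - m| = n.+1%:R by rewrite addrC addKr normrN ger0_norm.
  apply: (le_trans (lerD (small _ _ h1) (small _ _ h2))).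
  rewrite -mulrDl ler_pdivrMr ?ltr0n// mulrC -ler_pdivrMr//.
  near: n; exists (Num.truncn ((B + B) / e)) => // k /= kn.
  apply: ltW; apply: (lt_le_trans (truncnS_gt _)); by rewrite ler_nat.
have E : (\int[leb]_x (D x * p x)%:E = 0)%E.
  exact: (@cvg_unique _ (@ereal_hausdorff R) _ _ _ _ cvg1 cvg2).
by rewrite /Rintegral E.
Unshelve. all: by end_near. Qed.

End GaussianIntegral.

(** * Moments of the normal law by Stein's identity *)

Section GaussianExpectation.
Variable R : realType.
Local Notation leb := (@lebesgue_measure R).

Section Fixed.
Implicit Types g h : R -> R.
Variables (m s : R).
Hypothesis s0 : s != 0.
Local Notation p := (normal_pdf m s).

Definition normE (g : R -> R) : R := (\int[leb]_x (g x * p x))%R.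
Definition qmeas (g : R -> R) := measurable_fun setT g /\ quadbd m g.

Lemma qmeas_integrable g : qmeas g -> leb.-integrable setT (EFin \o (fun x => g x * p x)).
Proof. by move=> [mg qg]; exact: integrable_quad_pdf. Qed.

Lemma qmeas_le g (C : R) : measurable_fun setT g -> (forall x, `|g x| <= C * (1 + (x - m) ^+ 2)) -> qmeas g.
Proof. by move=> mg gC; split => //; exists C. Qed.

Lemma qmeasD g h : qmeas g -> qmeas h -> qmeas (fun x => g x + h x).
Proof.
move=> [mg [C gC]] [mh [D hD]]; split; first exact: measurable_funD.
exists (C + D) => x; apply: (le_trans (ler_normD _ _)).
by rewrite mulrDl lerD.
Qed.

Lemma qmeasZ g (c : R) : qmeas g -> qmeas (fun x => c * g x).
Proof.
move=> [mg [C gC]]; split; first by apply: measurable_funM.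
by exists (`|c| * C) => x; rewrite normrM -mulrA ler_wpM2l.
Qed.

Lemma qmeas_bd g (C : R) : measurable_fun setT g -> (forall x, `|g x| <= C) -> qmeas g.
Proof.
move=> mg gC; apply: (qmeas_le mg (C := C)) => x; apply: (le_trans (gC x)).
rewrite ler_peMr ?lerDl ?sqr_ge0//; exact: le_trans (gC x).
Qed.

Lemma qmeas_norm g : qmeas g -> qmeas (fun x => `|g x|).
Proof.
move=> [mg [C gC]]; split; first by apply: measurableT_comp.
by exists C => x; rewrite normr_id.
Qed.

Lemma normED g h : qmeas g -> qmeas h -> normE (fun x => g x + h x) = normE g + normE h.
Proof.
move=> /qmeas_integrable ig /qmeas_integrable ih; rewrite /normE -RintegralD//.
by apply: eq_Rintegral => x _; rewrite mulrDl.
Qed.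

Lemma normEZ g (c : R) : qmeas g -> normE (fun x => c * g x) = c * normE g.
Proof.
move=> /qmeas_integrable ig; rewrite /normE -RintegralZl//.
by apply: eq_Rintegral => x _; rewrite mulrA.
Qed.

Lemma normE_le g h : qmeas g -> qmeas h -> (forall x, g x <= h x) -> normE g <= normE h.
Proof.
move=> /qmeas_integrable ig /qmeas_integrable ih gh; apply: le_Rintegral => // x _.
by rewrite ler_wpM2r ?normal_pdf_ge0.
Qed.

Lemma normE_ext g h : (forall x, g x = h x) -> normE g = normE h.
Proof. by move=> gh; apply: eq_Rintegral => x _; rewrite gh. Qed.

Lemma normE_cst (c : R) : normE (fun=> c) = c.
Proof.
have i1 : leb.-integrable setT (EFin \o p) by exact: integrable_normal_pdf.
rewrite /normE RintegralZl//; rewrite /Rintegral integral_normal_pdf /= mulr1//.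
Qed.

Lemma normE_abs g h : qmeas g -> qmeas h -> (forall x, `|g x| <= h x) -> `|normE g| <= normE h.
Proof.
move=> qg qh gh; rewrite ler_norml; apply/andP; split.
  rewrite -mulN1r -normEZ//; apply: normE_le => //; first exact: qmeasZ.
  by move=> x; rewrite mulN1r; have := gh x; rewrite ler_norml => /andP[].
by apply: normE_le => // x; exact: le_trans (ler_norm _) (gh x).
Qed.

Let mid : measurable_fun setT (fun x : R => x - m).
Proof. by apply: measurable_funB. Qed.

Let qid : qmeas (fun x => x - m).
Proof.
apply: (qmeas_le mid (C := 1)) => x; rewrite mul1r; set y := x - m.
rewrite -(real_normK (num_real y)); have : 0 <= (`|y| - 1) ^+ 2 by exact: sqr_ge0.
have := normr_ge0 y; nra.
Qed.

Let qsqr : qmeas (fun x => (x - m) ^+ 2).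
Proof.
apply: (@qmeas_le _ 1); first by apply: measurable_funX.
by move=> x; rewrite ger0_norm ?sqr_ge0// mul1r lerDr.
Qed.

Lemma normE_id : normE (fun x => x - m) = 0.
Proof.
have H : (\int[leb]_x ((0 - 1 * (x - m) / s ^+ 2) * p x) = 0)%R.
  apply: (@gaussian_ibp R m s s0 (fun=> 1) (fun=> 0) 0).
  - by move=> x; exact: cvg_cst.
  - by move=> x; rewrite normr1 lerDl.
  - by move=> x; rewrite normr0.
have E : normE (fun x => - (s ^+ 2)^-1 * (x - m)) = 0.
  rewrite -[RHS]H; apply: eq_Rintegral => x _; congr (_ * _).
  by field.
move/eqP: E; rewrite normEZ// mulf_eq0 oppr_eq0 invr_eq0 expf_eq0/= (negbTE s0)/=.
by move/eqP.
Qed.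

Lemma normE_sqr : normE (fun x => (x - m) ^+ 2) = s ^+ 2.
Proof.
have H : (\int[leb]_x ((1 - (x - m) * (x - m) / s ^+ 2) * p x) = 0)%R.
  apply: (@gaussian_ibp R m s s0 (fun x => x - m) (fun=> 1) 1).
  - by move=> x; apply: is_derive_eq; rewrite oppr0 addr0.
  - by move=> x; exact: cvg_cst.
  - by move=> x; rewrite lerDr.
  - by move=> x; rewrite normr1.
have E : normE (fun x => 1 + - (s ^+ 2)^-1 * (x - m) ^+ 2) = 0.
  by rewrite -[RHS]H; apply: eq_Rintegral => x _; congr (_ * _); field.
move: E; rewrite normED; last 2 first.
- by apply: (@qmeas_bd _ 1) => // x; rewrite normr1.
- exact: qmeasZ.
rewrite normE_cst normEZ// => /eqP; rewrite mulNr subr_eq0 eq_sym => /eqP E.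
have sn : s ^+ 2 != 0 by rewrite expf_neq0.
by rewrite -[LHS](mulVKf sn) E mulr1.
Qed.

Let mcos t c : measurable_fun setT (fun x : R => cos (t * (x - m) + c)).
Proof.
apply: continuous_measurable_fun => x.
apply: (@continuous_comp _ _ _ (fun x => t * (x - m) + c) cos); last exact: continuous_cos.
apply: (@cvgD _ R^o); last exact: cvg_cst.
apply: cvgM; first exact: cvg_cst.
by apply: (@cvgB _ R^o); [exact: cvg_id|exact: cvg_cst].
Qed.

Let msin t c : measurable_fun setT (fun x : R => sin (t * (x - m) + c)).
Proof.
apply: continuous_measurable_fun => x.
apply: (@continuous_comp _ _ _ (fun x => t * (x - m) + c) sin); last exact: continuous_sin.
apply: (@cvgD _ R^o); last exact: cvg_cst.
apply: cvgM; first exact: cvg_cst.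
by apply: (@cvgB _ R^o); [exact: cvg_id|exact: cvg_cst].
Qed.

Let qcos t c : qmeas (fun x => cos (t * (x - m) + c)).
Proof. by apply: (@qmeas_bd _ 1) => // x; rewrite ler_norml cos_geN1 cos_le1. Qed.

Let qysin t c : qmeas (fun x => sin (t * (x - m) + c) * (x - m)).
Proof.
split; first by apply: measurable_funM.
have [_ [C hC]] := qid; exists C => x; rewrite normrM; apply: le_trans (hC x).
by rewrite ler_piMl// ler_norml sin_geN1 sin_le1.
Qed.

(** Stein's identity for the sine: it yields the differential equation of the characteristic
    function in t. *)
Lemma normE_ysin t c : normE (fun x => sin (t * (x - m) + c) * (x - m)) =
  s ^+ 2 * t * normE (fun x => cos (t * (x - m) + c)).
Proof.
have H : (\int[leb]_x ((t * cos (t * (x - m) + c) - sin (t * (x - m) + c) * (x - m) / s ^+ 2) * p x) = 0)%R.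
  apply: (@gaussian_ibp R m s s0 (fun x => sin (t * (x - m) + c)) (fun x => t * cos (t * (x - m) + c)) `|t|).
  - by move=> x; apply: is_derive_eq; rewrite /GRing.scale/=; ring.
  - move=> x; apply: cvgM; first exact: cvg_cst.
    apply: (@continuous_comp _ _ _ (fun x => t * (x - m) + c) cos); last exact: continuous_cos.
    apply: (@cvgD _ R^o); last exact: cvg_cst.
    apply: cvgM; first exact: cvg_cst.
    by apply: (@cvgB _ R^o); [exact: cvg_id|exact: cvg_cst].
  - move=> x; apply: (@le_trans _ _ 1); last by rewrite lerDl.
    by rewrite ler_norml sin_geN1 sin_le1.
  - move=> x; rewrite normrM ler_piMr//.
    by rewrite ler_norml cos_geN1 cos_le1.
have E : normE (fun x => t * cos (t * (x - m) + c) + - (s ^+ 2)^-1 * (sin (t * (x - m) + c) * (x - m))) = 0.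
  rewrite -[RHS]H; apply: eq_Rintegral => x _; congr (_ * _).
  by rewrite mulNr [(_)^-1 * _]mulrC.
move: E; rewrite normED; last 2 first.
- exact: qmeasZ.
- exact: qmeasZ.
rewrite !normEZ// => /eqP; rewrite mulNr subr_eq0 eq_sym => /eqP E.
have sn : s ^+ 2 != 0 by rewrite expf_neq0.
by rewrite -[LHS](mulVKf sn) E mulrA.
Qed.

End Fixed.
End GaussianExpectation.

(** * Taylor bounds for sine and cosine *)

Section TrigBounds.
Variable R : realType.
Implicit Types x : R.

Lemma sin_le_id x : 0 <= x -> sin x <= x.
Proof.
move=> x0; have dF (y : R) : is_derive y (1 : R) (fun y => sin y - y) (cos y - 1).
  by apply: is_derive_eq; rewrite /GRing.scale/=; ring.
have := le_of_derive_le0 x0 dF; rewrite sin0 subr0 subr_le0; apply=> y _.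
by rewrite subr_le0 cos_le1.
Qed.

Lemma cos_ge_quad x : 0 <= x -> 1 - x ^+ 2 / 2 <= cos x.
Proof.
move=> x0; have dF (y : R) : is_derive y (1 : R) (fun y => (1 - y ^+ 2 / 2) - cos y) (sin y - y).
  by apply: is_derive_eq; rewrite /GRing.scale/=; field.
have := le_of_derive_le0 x0 dF; rewrite cos0 expr0n/= mul0r subr0 subrr subr_le0; apply=> y /andP[y0 _].
by rewrite subr_le0 sin_le_id.
Qed.

Lemma cos_ge_lin x : 0 <= x -> 1 - x <= cos x.
Proof.
move=> x0; have dF (y : R) : is_derive y (1 : R) (fun y => (1 - y) - cos y) (sin y - 1).
  by apply: is_derive_eq; rewrite /GRing.scale/=; ring.
have := le_of_derive_le0 x0 dF; rewrite cos0 subr0 subrr subr_le0; apply=> y _.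
by rewrite subr_le0 sin_le1.
Qed.

Lemma sin_ge_quad x : 0 <= x -> x - x ^+ 2 / 2 <= sin x.
Proof.
move=> x0; have dF (y : R) : is_derive y (1 : R) (fun y => (y - y ^+ 2 / 2) - sin y) ((1 - y) - cos y).
  by apply: is_derive_eq; rewrite /GRing.scale/=; field.
have := le_of_derive_le0 x0 dF; rewrite sin0 expr0n/= mul0r !subr0 subr_le0; apply=> y /andP[y0 _].
by rewrite subr_le0 cos_ge_lin.
Qed.

Lemma sin_ge_cub x : 0 <= x -> x - x ^+ 3 / 6 <= sin x.
Proof.
move=> x0; have dF (y : R) : is_derive y (1 : R) (fun y => (y - y ^+ 3 / 6) - sin y) ((1 - y ^+ 2 / 2) - cos y).
  by apply: is_derive_eq; rewrite /GRing.scale/=; field.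
have := le_of_derive_le0 x0 dF; rewrite sin0 expr0n/= mul0r !subr0 subr_le0; apply=> y /andP[y0 _].
by rewrite subr_le0 cos_ge_quad.
Qed.

Lemma cos_le_quart x : 0 <= x -> cos x <= 1 - x ^+ 2 / 2 + x ^+ 4 / 24.
Proof.
move=> x0; have dF (y : R) : is_derive y (1 : R) (fun y => cos y - (1 - y ^+ 2 / 2 + y ^+ 4 / 24))
    ((y - y ^+ 3 / 6) - sin y).
  by apply: is_derive_eq; rewrite /GRing.scale/=; field.
have := le_of_derive_le0 x0 dF; rewrite cos0 !expr0n/= !mul0r subr0 addr0 subrr subr_le0; apply=> y /andP[y0 _].
by rewrite subr_le0 sin_ge_cub.
Qed.

Lemma sin_sub_id x : `|sin x - x| <= x ^+ 2 / 2.
Proof.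
wlog x0 : x / 0 <= x.
  move=> H; have [/H//|/ltW x0] := leP 0 x.
  have := H (- x); rewrite oppr_ge0 sqrrN sinN => /(_ x0).
  have -> : - sin x - - x = - (sin x - x) by ring.
  by rewrite normrN.
rewrite ler_norml; have := sin_le_id x0; have := sin_ge_quad x0.
have := sqr_ge0 x; move: (sin x) => y h1 h2 h3; apply/andP; split; lra.
Qed.

Lemma cos_sub1 x : `|cos x - 1| <= x ^+ 2 / 2.
Proof.
wlog x0 : x / 0 <= x.
  move=> H; have [/H//|/ltW x0] := leP 0 x.
  by have := H (- x); rewrite oppr_ge0 sqrrN cosN; apply.
rewrite ler_norml; have := cos_ge_quad x0; have := cos_le1 x.
have := sqr_ge0 x; move: (cos x) => y h1 h2 h3; apply/andP; split; lra.
Qed.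

Lemma cos_taylor1 (a b : R) : `|cos (a + b) - cos a + b * sin a| <= b ^+ 2.
Proof.
have -> : cos (a + b) - cos a + b * sin a = cos a * (cos b - 1) - sin a * (sin b - b).
  by rewrite cosD; ring.
rewrite (le_trans (ler_normB _ _))// !normrM.
have c1 : `|cos a| <= 1 by rewrite ler_norml cos_geN1 cos_le1.
have s1 : `|sin a| <= 1 by rewrite ler_norml sin_geN1 sin_le1.
have h1 := ler_pM (normr_ge0 _) (normr_ge0 _) c1 (cos_sub1 b).
have h2 := ler_pM (normr_ge0 _) (normr_ge0 _) s1 (sin_sub_id b).
by apply: (le_trans (lerD h1 h2)); rewrite !mul1r; lra.
Qed.

Lemma expR_sub1_quad (w M : R) : 1 <= M -> expR w <= M -> `|expR w - 1 - w| <= M * w ^+ 2.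
Proof.
move=> M1 wM; have h0 : expR (0 : R) <= M by rewrite expR0.
have := @e1_lip R 0 w 0 0 M h0 wM h0 h0; rewrite subrr normr0 add0r subr0 e1xx expR0.
have := e1E 0 w; rewrite subr0 expR0; move: (e1 0 w) => e E L.
have -> : expR w - 1 - w = w * (e - 1) by rewrite -E; ring.
rewrite normrM; apply: (le_trans (ler_wpM2l (normr_ge0 _) L)).
by rewrite mulrCA -expr2 real_normK ?num_real.
Qed.

End TrigBounds.

(** * The characteristic function of the normal law *)

Section GaussianChar.
Variable R : realType.
Variables (m s : R).
Hypothesis s0 : s != 0.

Let v := s ^+ 2.
Let v0 : 0 <= v. Proof. exact: sqr_ge0. Qed.

Let g c t : R := normE m s (fun x => cos (t * (x - m) + c)).

Let mcos t c : measurable_fun setT (fun x : R => cos (t * (x - m) + c)).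
Proof.
apply: continuous_measurable_fun => x.
apply: (@continuous_comp _ _ _ (fun x => t * (x - m) + c) cos); last exact: continuous_cos.
apply: (@cvgD _ R^o); last exact: cvg_cst.
apply: cvgM; first exact: cvg_cst.
by apply: (@cvgB _ R^o); [exact: cvg_id|exact: cvg_cst].
Qed.

Let qcos t c : qmeas m (fun x => cos (t * (x - m) + c)).
Proof. by apply: (@qmeas_bd _ m _ 1) => // x; rewrite ler_norml cos_geN1 cos_le1. Qed.

Let mid : measurable_fun setT (fun x : R => x - m).
Proof. by apply: measurable_funB. Qed.

Let qsqr : qmeas m (fun x => (x - m) ^+ 2).
Proof.
apply: (@qmeas_le _ m _ 1); first by apply: measurable_funX.
by move=> x; rewrite ger0_norm ?sqr_ge0// mul1r lerDr.
Qed.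

Let qysin t c : qmeas m (fun x => sin (t * (x - m) + c) * (x - m)).
Proof.
split.
  apply: measurable_funM => //.
  apply: continuous_measurable_fun => x.
  apply: (@continuous_comp _ _ _ (fun x => t * (x - m) + c) sin); last exact: continuous_sin.
  apply: (@cvgD _ R^o); last exact: cvg_cst.
  apply: cvgM; first exact: cvg_cst.
  by apply: (@cvgB _ R^o); [exact: cvg_id|exact: cvg_cst].
exists 1 => x; rewrite normrM mul1r; set y := x - m.
apply: (@le_trans _ _ `|y|); first by rewrite ler_piMl// ler_norml sin_geN1 sin_le1.
rewrite -(real_normK (num_real y)); have : 0 <= (`|y| - 1) ^+ 2 by exact: sqr_ge0.
have := normr_ge0 y; nra.
Qed.

(** The equation g' = - v t g, in the form of a first-order expansion with explicit quadratic error.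
    The phase c covers cosine and sine together. *)
Let g_step c t u : `|g c u - g c t * (1 - (u - t) * (v * t))| <= (u - t) ^+ 2 * v.
Proof.
have -> : g c u - g c t * (1 - (u - t) * (v * t)) = normE m s (fun x =>
    cos (u * (x - m) + c) + (- 1 * cos (t * (x - m) + c)
      + (u - t) * (sin (t * (x - m) + c) * (x - m)))).
  have q1 := qmeasZ (- 1) (qcos t c).
  have q2 := qmeasZ (u - t) (qysin t c).
  rewrite (normED s0 (qcos u c) (qmeasD q1 q2)) (normED s0 q1 q2).
  rewrite (normEZ s0 _ (qcos t c)) (normEZ s0 _ (qysin t c)) (normE_ysin m s0) -/v -/(g c t) -/(g c u).
  by ring.
rewrite /v -(normE_sqr m s0) -normEZ//; apply: normE_abs => //.
- by apply: qmeasD => //; apply: qmeasD; exact: qmeasZ.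
- exact: qmeasZ.
move=> x; set y := x - m.
have := cos_taylor1 (t * y + c) ((u - t) * y).
have -> : t * y + c + (u - t) * y = u * y + c by ring.
rewrite exprMn mulN1r; congr (`|_| <= _); ring.
Qed.

Let g_le1 c t : `|g c t| <= 1.
Proof.
rewrite -[leRHS](normE_cst m s 1); apply: normE_abs => //.
- by apply: (@qmeas_bd _ m _ 1) => // x; rewrite normr1.
- by move=> x; rewrite ler_norml cos_geN1 cos_le1.
Qed.

Let h_step c : exists C, forall t u, 0 <= t -> t <= u -> u <= 1 ->
  `|expR (v * u ^+ 2 / 2) * g c u - expR (v * t ^+ 2 / 2) * g c t| <= C * (u - t) ^+ 2.
Proof.
move: (g c) (g_step c) (g_le1 c) => gc gcstep gc1; move: gcstep; clear -v0 gc1; move: v v0 => v' v'0 gcstep.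
pose M := expR (2 * v').
have M1 : 1 <= M by rewrite -[leLHS]expR0 ler_expR mulr_ge0.
exists (M * (M * (4 * v' ^+ 2) * (1 + v') + v' + 2 * v' ^+ 2 + M * v')) => t u t0 tu u1.
set D := u - t.
have D0 : 0 <= D by rewrite subr_ge0.
have D1 : D <= 1 by rewrite lerBlDr (le_trans u1)// lerDl.
have t1 : t <= 1 by exact: le_trans u1.
set w := v' * t * D + v' * D ^+ 2 / 2.
have -> : v' * u ^+ 2 / 2 = v' * t ^+ 2 / 2 + w by rewrite /w /D; field.
rewrite expRD.
have w0 : 0 <= w by apply: addr_ge0; [rewrite !mulr_ge0|rewrite divr_ge0// mulr_ge0// sqr_ge0].
have tD : t * D <= D by rewrite ler_piMl.
have DD : D ^+ 2 <= D by rewrite expr2 ler_piMl.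
have w2 : w <= 2 * v' * D.
  have a1 := ler_wpM2l v'0 tD; have a2 := ler_wpM2l v'0 DD.
  have a3 : 0 <= v' * D by rewrite mulr_ge0.
  by rewrite /w -mulrA; lra.
have wM : expR w <= M.
  rewrite ler_expR (le_trans w2)// ler_piMr//; exact: mulr_ge0.
have EM : expR (v' * t ^+ 2 / 2) <= M.
  rewrite ler_expR; have : v' * t ^+ 2 <= v' by rewrite ler_piMr// exprn_ile1.
  by move: v'0; lra.
set r := gc u - gc t * (1 - D * (v' * t)).
have rb : `|r| <= D ^+ 2 * v' by exact: gcstep.
have -> : expR (v' * t ^+ 2 / 2) * expR w * gc u - expR (v' * t ^+ 2 / 2) * gc t =
   expR (v' * t ^+ 2 / 2) * (gc t * ((expR w - 1 - w) * (1 - D * (v' * t)) + v' * D ^+ 2 / 2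
      - w * (D * (v' * t))) + expR w * r).
  by rewrite /r; move: (gc u) (gc t) (expR w) => a b e; rewrite /w; field.
rewrite normrM ger0_norm ?expR_ge0// -[leRHS]mulrA; apply: ler_pM; rewrite ?expR_ge0//.
apply: (le_trans (ler_normD _ _)); rewrite [leRHS]mulrDl; apply: lerD; last first.
  rewrite normrM ger0_norm ?expR_ge0// -[leRHS]mulrA [v' * _]mulrC; exact: ler_pM.
rewrite normrM; apply: (@le_trans _ _ (1 * (M * (4 * v' ^+ 2) * (1 + v') + v' + 2 * v' ^+ 2) * D ^+ 2)); last by rewrite mul1r.
rewrite -[leRHS]mulrA; apply: ler_pM => //.
apply: (le_trans (ler_normB _ _)); rewrite [leRHS]mulrDl; apply: lerD; last first.
  rewrite ger0_norm ?mulr_ge0//.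
  have -> : 2 * v' ^+ 2 * D ^+ 2 = (2 * v' * D) * (D * v') by ring.
  apply: ler_pM => //; first by rewrite !mulr_ge0.
  by apply: ler_wpM2l => //; rewrite ler_piMr.
apply: (le_trans (ler_normD _ _)); rewrite [leRHS]mulrDl; apply: lerD; last first.
  rewrite ger0_norm ?divr_ge0 ?mulr_ge0 ?sqr_ge0//.
  have : 0 <= v' * D ^+ 2 by rewrite mulr_ge0 ?sqr_ge0.
  lra.
rewrite normrM.
have b1 : `|1 - D * (v' * t)| <= 1 + v'.
  rewrite (le_trans (ler_normB _ _))// normr1 lerD2l ger0_norm ?mulr_ge0//.
  have : D * (v' * t) <= 1 * (v' * 1).
    by apply: ler_pM; rewrite ?mulr_ge0//; apply: ler_wpM2l.
  by rewrite mul1r mulr1.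
have b2 : `|expR w - 1 - w| <= M * (4 * v' ^+ 2) * D ^+ 2.
  apply: (le_trans (expR_sub1_quad M1 wM)); rewrite -[leRHS]mulrA; apply: ler_wpM2l.
    exact: le_trans M1.
  have -> : 4 * v' ^+ 2 * D ^+ 2 = (2 * v' * D) ^+ 2 by ring.
  by rewrite ler_pXn2r ?nnegrE// !mulr_ge0.
apply: (le_trans (ler_pM (normr_ge0 _) (normr_ge0 _) b2 b1)).
by rewrite mulrAC.
Qed.

(** t |-> exp (v t^2 / 2) * g t and its negative both have quadratically small increments on the
    unit interval, so the function is constant there. *)
Lemma normE_cos c : normE m s (fun x => cos ((x - m) + c)) = expR (- (s ^+ 2 / 2)) * cos c.
Proof.
have [C hC] := h_step c.
pose h t := expR (v * t ^+ 2 / 2) * g c t.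
have le1 : h 1 <= h 0.
  apply: (le_of_quadratic_increments (C := C)) => // t u t0 tu u1.
  exact: le_trans (ler_norm _) (hC t u t0 tu u1).
have le2 : - h 1 <= - h 0.
  apply: (@le_of_quadratic_increments _ (fun t => - h t) C) => // t u t0 tu u1.
  by rewrite -opprD; apply: le_trans (ler_norm _) _; rewrite normrN; exact: hC.
have E : h 1 = h 0 by apply/eqP; rewrite eq_le le1 -lerN2.
have g0 : g c 0 = cos c.
  rewrite -[RHS](normE_cst m s); apply: normE_ext => x.
  by rewrite mul0r add0r.
move: E; rewrite /h expr0n/= mulr0 mul0r expR0 mul1r g0 expr1n mulr1 => <-.
rewrite mulrA -expRD addNr expR0 mul1r; apply: normE_ext => x.
by rewrite mul1r.
Qed.

End GaussianChar.

(** * Calculus of real expectations *)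

Section Expectation.
Variable R : realType.
Context {dT : measure_display} {T : measurableType dT}.
Variable P : probability T R.
Implicit Types f g : T -> R.

Definition rint f := P.-integrable setT (EFin \o f).

Lemma rint_meas f : rint f -> measurable_fun setT f.
Proof. by move=> /integrableP[/measurable_EFinP]. Qed.

Lemma rint_le f g : measurable_fun setT f -> rint g -> (forall x, `|f x| <= g x) -> rint f.
Proof.
move=> mf ig fg; apply: (le_integrable measurableT _ _ ig); first exact/measurable_EFinP.
move=> x _; rewrite /= lee_fin; apply: (le_trans (fg x)); exact: ler_norm.
Qed.

Lemma rint_cst (c : R) : rint (fun=> c).
Proof. exact: finite_measure_integrable_cst. Qed.

Lemma rint_bd f (c : R) : measurable_fun setT f -> (forall x, `|f x| <= c) -> rint f.
Proof. by move=> mf; apply: rint_le => //; exact: rint_cst. Qed.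

Lemma rintD f g : rint f -> rint g -> rint (fun x => f x + g x).
Proof. by move=> hf hg; exact: (integrableD measurableT hf hg). Qed.

Lemma rintZ f (c : R) : rint f -> rint (fun x => c * f x).
Proof. by move=> hf; exact: (integrableZl measurableT c hf). Qed.

Lemma rintN f : rint f -> rint (fun x => - f x).
Proof. by move=> hf; exact: (integrableN hf). Qed.

Lemma rintB f g : rint f -> rint g -> rint (fun x => f x - g x).
Proof. by move=> hf hg; apply: rintD => //; exact: rintN. Qed.

Lemma rint_norm f : rint f -> rint (fun x => `|f x|).
Proof. by move=> hf; exact: (integrable_norm hf). Qed.

Lemma rint_ext f g : (forall x, f x = g x) -> rint f -> rint g.
Proof. by move=> /funext ->. Qed.

Lemma rint_sum (I : Type) (r : seq I) (f : I -> T -> R) :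
  (forall i, rint (f i)) -> rint (fun x => \sum_(i <- r) f i x).
Proof.
move=> hf; elim: r => [|i r IH].
  by apply: rint_ext (rint_cst 0) => x; rewrite big_nil.
by apply: rint_ext (rintD (hf i) IH) => x; rewrite big_cons.
Qed.

Lemma ExD f g : rint f -> rint g -> Ex P (fun x => f x + g x) = Ex P f + Ex P g.
Proof. by move=> hf hg; exact: (RintegralD measurableT hf hg). Qed.

Lemma ExZ f (c : R) : rint f -> Ex P (fun x => c * f x) = c * Ex P f.
Proof. by move=> hf; exact: (RintegralZl c measurableT hf). Qed.

Lemma ExN f : rint f -> Ex P (fun x => - f x) = - Ex P f.
Proof.
move=> hf; rewrite -mulN1r -ExZ//; congr (Ex P _); apply/funext => x.
by rewrite mulN1r.
Qed.

Lemma ExB f g : rint f -> rint g -> Ex P (fun x => f x - g x) = Ex P f - Ex P g.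
Proof. by move=> hf hg; rewrite ExD ?ExN//; exact: rintN. Qed.

Lemma Ex_cst (c : R) : Ex P (fun=> c) = c.
Proof.
apply: (etrans (@Rintegral_cst _ _ _ P setT measurableT c)).
by apply: (etrans (congr1 (fun x => c * fine x) (probability_setT P))); rewrite mulr1.
Qed.

Lemma Ex_ext f g : (forall x, f x = g x) -> Ex P f = Ex P g.
Proof. by move=> /funext ->. Qed.

Lemma Ex_le f g : rint f -> rint g -> (forall x, f x <= g x) -> Ex P f <= Ex P g.
Proof. by move=> hf hg fg; apply: (le_Rintegral measurableT hf hg) => x _. Qed.

Lemma Ex_ge0 f : (forall x, 0 <= f x) -> 0 <= Ex P f.
Proof. by move=> f0; apply: (@Rintegral_ge0 _ _ _ P) => x _. Qed.

Lemma Ex_abs f g : rint f -> rint g -> (forall x, `|f x| <= g x) -> `|Ex P f| <= Ex P g.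
Proof.
move=> hf hg fg; rewrite ler_norml; apply/andP; split.
  rewrite -ExN//; apply: Ex_le => //; first exact: rintN.
  by move=> x; have := fg x; rewrite ler_norml => /andP[].
by apply: Ex_le => // x; exact: le_trans (ler_norm _) (fg x).
Qed.

Lemma Ex_sum (I : Type) (r : seq I) (f : I -> T -> R) :
  (forall i, rint (f i)) -> Ex P (fun x => \sum_(i <- r) f i x) = \sum_(i <- r) Ex P (f i).
Proof.
move=> hf; elim: r => [|i r IH].
  by rewrite big_nil -[RHS]Ex_cst; apply: Ex_ext => x; rewrite big_nil.
rewrite big_cons -IH -ExD//; last exact: rint_sum.
by apply: Ex_ext => x; rewrite big_cons.
Qed.

Lemma ExE f : rint f -> (\int[P]_x (f x)%:E = (Ex P f)%:E)%E.
Proof. by move=> hf; rewrite /Ex fineK//; exact: (integrable_fin_num measurableT hf). Qed.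

End Expectation.

(** * Expectations of functions of a variable with normal or Dirac law *)

Section LawTransfer.
Variable R : realType.
Context {dT : measure_display} {T : measurableType dT}.
Variable P : probability T R.
Local Notation leb := (@lebesgue_measure R).
Implicit Types g : R -> R.

Lemma ge0_law_transfer (f : T -> R) (nu : {measure set (measurableTypeR R) -> \bar R}) (g : R -> R) :
  measurable_fun setT f -> (forall B, measurable B -> P (f @^-1` B) = nu B) ->
  measurable_fun setT g -> (forall x, 0 <= g x) ->
  (\int[P]_w (g (f w))%:E = \int[nu]_x (g x)%:E)%E.
Proof.
move=> mf law mg g0.
rewrite -(@eq_measure_integral _ (measurableTypeR R) _ setT nu (pushforward P (f : T -> measurableTypeR R))) => [|A mA _]; last exact: law.
rewrite (@ge0_integral_pushforward _ _ _ (measurableTypeR R) _ (f : T -> measurableTypeR R) mf P)//; first exact/measurable_EFinP.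
by move=> x _; rewrite lee_fin.
Qed.

Variables (m s : R) (f : T -> R).
Hypothesis mf : measurable_fun setT f.

Section NonDegenerate.
Hypothesis s0 : s != 0.
Hypothesis law : forall B : set R, measurable B -> P (f @^-1` B) = normal_prob m s B.

Let qpos g : qmeas m g -> qmeas m (fun x => Num.max (g x) 0).
Proof.
move=> [mg [C hC]]; split; first exact: measurable_maxr.
exists C => x; apply: le_trans (hC x); rewrite ger0_norm; last by rewrite le_max lexx orbT.
by rewrite ge_max ler_norm normr_ge0.
Qed.

Let law_ge0 g : qmeas m g -> (forall x, 0 <= g x) ->
  (\int[P]_w (g (f w))%:E = (normE m s g)%:E)%E.
Proof.
move=> qg g0; have [mg _] := qg.
rewrite (@ge0_law_transfer f (normal_prob m s) g mf law mg g0) ge0_integral_normal_prob//; last first.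
  exact/measurable_EFinP.
rewrite /normE /Rintegral fineK; first by apply: eq_integral => x _; rewrite EFinM.
exact: (integrable_fin_num measurableT (qmeas_integrable s0 qg)).
Qed.

Lemma law_rint g : qmeas m g -> rint P (fun w => g (f w)).
Proof.
move=> qg; have [mg _] := qg; apply/integrableP; split.
  by apply/measurable_EFinP; exact: measurableT_comp.
have qn := qmeas_norm qg.
rewrite (_ : (\int[P]_x _ = (normE m s (fun x => `|g x|))%:E)%E) ?ltry//.
by rewrite -(law_ge0 qn)//; apply: eq_integral => x _ /=.
Qed.

Lemma law_Ex g : qmeas m g -> Ex P (fun w => g (f w)) = normE m s g.
Proof.
move=> qg; have qN := qmeasZ (- 1) qg.
have qp := qpos qg; have qn := qpos qN.
have E g' : qmeas m g' -> (forall x, 0 <= g' x) -> Ex P (fun w => g' (f w)) = normE m s g'.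
  by move=> q' p'; rewrite /Ex law_ge0.
have d (x : R) : x = Num.max x 0 + - 1 * Num.max (- 1 * x) 0.
  by rewrite !mulN1r; case: (leP x 0) => h; case: (leP (- x) 0) => h'; lra.
rewrite (Ex_ext _ (fun w => d (g (f w)))) (normE_ext _ _ (fun w => d (g w))).
rewrite ExD; [|exact: (law_rint qp)|apply: rintZ; exact: (law_rint qn)].
rewrite normED//; last exact: qmeasZ.
rewrite (ExZ _ (law_rint qn)) (normEZ s0 _ qn) (E _ qp) ?(E _ qn)// => x; rewrite le_max lexx orbT//.
Qed.

End NonDegenerate.

Section Degenerate.
Hypothesis law : forall B : set R, measurable B -> P (f @^-1` B) = \d_m B.

Let dlaw_ge0 g : measurable_fun setT g -> (forall x, 0 <= g x) ->
  (\int[P]_w (g (f w))%:E = (g m)%:E)%E.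
Proof.
move=> mg g0; rewrite (@ge0_law_transfer f (@dirac _ (measurableTypeR R) m R))// integral_dirac//.
  by rewrite diracT mul1e.
exact/measurable_EFinP.
Qed.

Lemma dlaw_rint g : measurable_fun setT g -> rint P (fun w => g (f w)).
Proof.
move=> mg; apply/integrableP; split.
  by apply/measurable_EFinP; exact: measurableT_comp.
rewrite (_ : (\int[P]_x _ = (`|g m|)%:E)%E) ?ltry//.
by rewrite -(@dlaw_ge0 (fun x => `|g x|))//; exact: measurableT_comp.
Qed.

Lemma dlaw_Ex g : measurable_fun setT g -> Ex P (fun w => g (f w)) = g m.
Proof.
move=> mg.
have E g' : measurable_fun setT g' -> (forall x, 0 <= g' x) -> Ex P (fun w => g' (f w)) = g' m.
  by move=> q' p'; rewrite /Ex dlaw_ge0.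
have d (x : R) : x = Num.max x 0 + - 1 * Num.max (- 1 * x) 0.
  by rewrite !mulN1r; case: (leP x 0) => h; case: (leP (- x) 0) => h'; lra.
have mp : measurable_fun setT (fun x => Num.max (g x) 0) by exact: measurable_maxr.
have mn : measurable_fun setT (fun x => Num.max (- 1 * g x) 0).
  by apply: measurable_maxr => //; exact: measurable_funM.
rewrite (Ex_ext _ (fun w => d (g (f w)))).
rewrite ExD; [|exact: (dlaw_rint mp)|apply: rintZ; exact: (dlaw_rint mn)].
rewrite (ExZ _ (dlaw_rint mn)) (E _ mp) ?(E _ mn) -?d// => x; rewrite le_max lexx orbT//.
Qed.

End Degenerate.
End LawTransfer.

(** * Moments and cosine transform of a real Gaussian, possibly degenerate *)

Section RealGaussian.
Variable R : realType.
Context {dT : measure_display} {T : measurableType dT}.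
Variable P : probability T R.
Variable f : T -> R.
Hypothesis gf : real_gaussian P f.

Let sqr_bd (x a : R) : x ^+ 2 <= (2 + 2 * a ^+ 2) * (1 + (x - a) ^+ 2).
Proof.
have h1 : 0 <= (x - 2 * a) ^+ 2 by exact: sqr_ge0.
have h2 : 0 <= a ^+ 2 * (x - a) ^+ 2 by rewrite mulr_ge0 ?sqr_ge0.
have -> : (2 + 2 * a ^+ 2) * (1 + (x - a) ^+ 2) =
  x ^+ 2 + ((x - 2 * a) ^+ 2 + 2 * (a ^+ 2 * (x - a) ^+ 2) + 2) by ring.
by rewrite lerDl; lra.
Qed.

Lemma real_gaussian_rint2 : rint P (fun w => f w ^+ 2).
Proof.
have [mf [m [s law]]] := gf.
have [s0|s0] := eqVneq s 0.
  by apply: (@dlaw_rint _ _ _ P m f mf _ (fun x => x ^+ 2)) => // B mB; rewrite law// s0 eqxx.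
apply: (@law_rint _ _ _ P m s f mf s0 _ (fun x => x ^+ 2)) => [B mB|]; first by rewrite law// (negbTE s0).
apply: (@qmeas_le _ m _ (2 + 2 * m ^+ 2)) => [|x]; first exact: measurable_funX.
by rewrite ger0_norm ?sqr_ge0.
Qed.

Lemma real_gaussian_rint : rint P f.
Proof.
have [mf _] := gf.
apply: (rint_le mf (rintD (rint_cst P 1) real_gaussian_rint2)) => x.
rewrite -(real_normK (num_real (f x))); have : 0 <= (`|f x| - 1) ^+ 2 by exact: sqr_ge0.
have := normr_ge0 (f x); move: `|f x| => y; nra.
Qed.

Lemma real_gaussian_cos c : Ex P f = 0 ->
  Ex P (fun w => cos (f w + c)) = expR (- (Ex P (fun w => f w ^+ 2) / 2)) * cos c.
Proof.
have [mf [m [s law]]] := gf => f0.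
have mcos : measurable_fun setT (fun x : R => cos (x + c)).
  apply: continuous_measurable_fun => x.
  apply: (@continuous_comp _ _ _ (fun x => x + c) cos); last exact: continuous_cos.
  by apply: (@cvgD _ R^o); [exact: cvg_id|exact: cvg_cst].
have msqr : measurable_fun setT (fun x : R => x ^+ 2) by exact: measurable_funX.
have mid : measurable_fun setT (fun x : R => x) by exact: measurable_id.
have [s0|s0] := eqVneq s 0.
  have law' : forall B : set R, measurable B -> P (f @^-1` B) = \d_m B.
    by move=> B mB; rewrite law// s0 eqxx.
  have := dlaw_Ex mf law' mid; rewrite f0 => m0.
  by rewrite (dlaw_Ex mf law' mcos) (dlaw_Ex mf law' msqr) -m0 expr0n/= mul0r oppr0 expR0 mul1r add0r.
have law' : forall B : set R, measurable B -> P (f @^-1` B) = normal_prob m s B.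
  by move=> B mB; rewrite law// (negbTE s0).
have qsqr : qmeas m (fun x => x ^+ 2).
  apply: (@qmeas_le _ m _ (2 + 2 * m ^+ 2)) => [|x] //.
  by rewrite ger0_norm ?sqr_ge0.
have qc : qmeas m (fun=> m) by apply: (@qmeas_bd _ m _ `|m|) => // x.
have qi : qmeas m (fun x => x - m).
  split; first exact: measurable_funB.
  exists 1 => x; rewrite mul1r; set y := x - m.
  rewrite -(real_normK (num_real y)); have : 0 <= (`|y| - 1) ^+ 2 by exact: sqr_ge0.
  have := normr_ge0 y; move: `|y| => z; nra.
have m0 : m = 0.
  rewrite -f0; have -> : Ex P f = Ex P (fun w => (fun x => (x - m) + m) (f w)).
    by apply: Ex_ext => w /=; rewrite subrK.
  rewrite (law_Ex mf s0 law' (qmeasD qi qc)) (normED s0 qi qc) (normE_id m s0) normE_cst add0r//.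
have qcos : qmeas m (fun x => cos (x + c)).
  by apply: (@qmeas_bd _ m _ 1) => // x; rewrite ler_norml cos_geN1 cos_le1.
rewrite (law_Ex mf s0 law' qcos) (law_Ex mf s0 law' qsqr).
have -> : normE m s (fun x => x ^+ 2) = s ^+ 2.
  by rewrite -(normE_sqr m s0); apply: normE_ext => x; rewrite m0 subr0.
by rewrite -(normE_cos m s0 c); apply: normE_ext => x; rewrite m0 subr0.
Qed.

End RealGaussian.

(** * Measurability of continuous functions of a random matrix *)

Section MatrixMeasurability.
Variable R : realType.
Local Notation C := (R[i]).
Variable d : nat.
Implicit Types A B X : 'M[C]_d.

Definition l1cont (h : 'M[C]_d -> R) := forall A e, 0 < e ->
  exists2 del, 0 < del & forall B, l1 (B - A) <= del -> `|h B - h A| <= e.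

(** Functions such as [phi] are controlled on hermitian matrices only. The retraction [hpart] does
    not increase [l1] and reduces this case to [l1cont]. *)
Definition hcont (h : 'M[C]_d -> R) := forall A e, herm A -> 0 < e ->
  exists2 del, 0 < del & forall B, herm B -> l1 (B - A) <= del -> `|h B - h A| <= e.

Definition hpart X : 'M[C]_d := (2^-1 : R)%:C%C *: (X + adjmx X).

Lemma hpart_herm X : herm (hpart X).
Proof. by apply: hermZ; rewrite /herm adjmxD adjmxK addrC. Qed.

Lemma hpart_id X : herm X -> hpart X = X.
Proof.
move=> hX; rewrite /hpart hX scalerDr -scalerDl -rmorphD/=.
have -> : (2^-1 + 2^-1 : R) = 1 by lra.
by rewrite rmorph1 scale1r.
Qed.

Lemma hpartB X B : hpart B - hpart X = hpart (B - X).
Proof. by rewrite /hpart -scalerBr adjmxD adjmxN opprD addrACA. Qed.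

Lemma l1_adjmx X : l1 (adjmx X) = l1 X.
Proof.
rewrite /l1 exchange_big/=; apply: eq_bigr => i _; apply: eq_bigr => j _.
by rewrite !mxE cabs_conj.
Qed.

Lemma l1_hpart X : l1 (hpart X) <= l1 X.
Proof.
rewrite l1Z ger0_norm ?invr_ge0//; have := l1D X (adjmx X); rewrite l1_adjmx.
move: (l1 (_ + _)) (l1 X) => a b; lra.
Qed.

Lemma hcont_hpart h : hcont h -> l1cont (fun X => h (hpart X)).
Proof.
move=> hc A e e0; have [del del0 H] := hc _ _ (hpart_herm A) e0.
exists del => // B AB; apply: H; first exact: hpart_herm.
by rewrite hpartB (le_trans (l1_hpart _)).
Qed.

Section Entries.
Context {dT : measure_display} {T : measurableType dT}.
Implicit Types Y : T -> 'M[C]_d.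

Definition mx_mble Y := forall i j,
  measurable_fun setT (fun w => complex.Re (Y w i j)) /\
  measurable_fun setT (fun w => complex.Im (Y w i j)).

Lemma mx_rv_mble Y : mx_rv Y -> mx_mble Y.
Proof.
move=> mY i j; split=> _ B mB; rewrite setTI.
  apply: (mY [set A : 'M[C]_d | B (complex.Re (A i j))]).
  by apply: sub_gen_smallest; exists i, j, B; split => //; left.
apply: (mY [set A : 'M[C]_d | B (complex.Im (A i j))]).
by apply: sub_gen_smallest; exists i, j, B; split => //; right.
Qed.

Lemma mx_mbleD Y Y' : mx_mble Y -> mx_mble Y' -> mx_mble (fun w => Y w + Y' w).
Proof.
move=> mY mY' i j; have [r m] := mY i j; have [r' m'] := mY' i j; split.
  rewrite (_ : (fun _ => _) = (fun w => complex.Re (Y w i j) + complex.Re (Y' w i j))).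
    exact: measurable_funD.
  by apply/funext => w; rewrite mxE ReD.
rewrite (_ : (fun _ => _) = (fun w => complex.Im (Y w i j) + complex.Im (Y' w i j))).
  exact: measurable_funD.
by apply/funext => w; rewrite mxE ImD.
Qed.

Lemma mx_mbleZ Y (s : R) : mx_mble Y -> mx_mble (fun w => s%:C%C *: Y w).
Proof.
move=> mY i j; have [r m] := mY i j; split.
  rewrite (_ : (fun _ => _) = (fun w => s * complex.Re (Y w i j))).
    exact: measurable_funM.
  by apply/funext => w; rewrite mxE Re_scale.
rewrite (_ : (fun _ => _) = (fun w => s * complex.Im (Y w i j))).
  exact: measurable_funM.
by apply/funext => w; rewrite mxE Im_scale.
Qed.

Lemma mx_mble_cst A : mx_mble (fun=> A).
Proof. by move=> i j; split; exact: measurable_cst. Qed.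

Lemma mx_mbleB Y Y' : mx_mble Y -> mx_mble Y' -> mx_mble (fun w => Y w - Y' w).
Proof.
move=> mY mY'; have := mx_mbleD mY (mx_mbleZ (-1) mY').
congr mx_mble; apply/funext => w; congr (_ + _).
by rewrite rmorphN rmorph1 scaleN1r.
Qed.

Lemma mx_mble_sum (I : Type) (r : seq I) (Y : I -> T -> 'M[C]_d) :
  (forall i, mx_mble (Y i)) -> mx_mble (fun w => \sum_(i <- r) Y i w).
Proof.
move=> mY; elim: r => [|i r IH].
  have := mx_mble_cst 0; congr mx_mble; apply/funext => w; by rewrite big_nil.
have := mx_mbleD (mY i) IH; congr mx_mble; apply/funext => w; by rewrite big_cons.
Qed.

Lemma measurable_floor_eq (f : T -> R) (n : R) (z : int) : measurable_fun setT f ->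
  measurable [set w | Num.floor (f w * n) = z].
Proof.
move=> mf; have mg : measurable_fun setT (fun w => f w * n) by exact: measurable_funM.
rewrite (_ : [set _ | _] = (fun w => f w * n) @^-1` `[z%:~R, (z + 1)%:~R[%classic).
  by rewrite -[X in measurable X]setTI; apply: mg.
apply/seteqP; split => w /=; rewrite in_itv/=.
  by move=> <-; rewrite floor_le floorD1_gt.
by move=> zz; apply: floor_def.
Qed.

Let code n (A : 'M[C]_d) : {ffun 'I_d * 'I_d -> int * int} :=
  [ffun ij => (Num.floor (complex.Re (A ij.1 ij.2) * n.+1%:R),
               Num.floor (complex.Im (A ij.1 ij.2) * n.+1%:R))].
Let grid n (z : {ffun 'I_d * 'I_d -> int * int}) : 'M[C]_d :=
  \matrix_(i, j) (((z (i, j)).1%:~R / n.+1%:R) +i* ((z (i, j)).2%:~R / n.+1%:R))%C.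

Let round_err (x : R) n : `|(Num.floor (x * n.+1%:R))%:~R / n.+1%:R - x| <= n.+1%:R^-1.
Proof.
have n0 : 0 < n.+1%:R :> R by rewrite ltr0n.
have -> : (Num.floor (x * n.+1%:R))%:~R / n.+1%:R - x =
   ((Num.floor (x * n.+1%:R))%:~R - x * n.+1%:R) * n.+1%:R^-1.
  by rewrite mulrBl mulfK// gt_eqF.
rewrite normrM [X in _ * X]ger0_norm ?invr_ge0// ler_piMl ?invr_ge0//.
have h1 := floor_le (x * n.+1%:R).
have h2 := floorD1_gt (x * n.+1%:R); rewrite intrD in h2.
have h3 : (Num.floor (x * n.+1%:R))%:~R - x * n.+1%:R <= 0 by rewrite subr_le0.
by rewrite ler_norml (le_trans h3)// andbT lerBrDl lerBlDr ltW.
Qed.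

Let grid_err A n : l1 (grid n (code n A) - A) <= (d * d)%:R * 2 * n.+1%:R^-1.
Proof.
rewrite /l1; apply: (@le_trans _ _ (\sum_(i < d) \sum_(j < d) (2 * n.+1%:R^-1 : R))).
  apply: ler_sum => i _; apply: ler_sum => j _.
  rewrite (le_trans (cabs_le _))// !mxE !ffunE/= ReD ImD ReN ImN/=.
  by rewrite mulr_natl mulr2n lerD ?round_err.
rewrite !sumr_const !card_ord -mulrnA -[leLHS]mulr_natr [_ * (_ * _)%:R]mulrC -mulrA.
exact: lexx.
Qed.

(** Y is rounded entrywise to a grid of mesh 1 / (n + 1). The rounded matrix takes countably many
    values on measurable pieces, and h at the rounding converges pointwise to h at Y. *)
Lemma measurable_l1cont h Y : l1cont h -> mx_mble Y -> measurable_fun setT (fun w => h (Y w)).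
Proof.
move=> hc mY.
apply: (@measurable_fun_cvg _ _ _ _ (fun n w => h (grid n (code n (Y w))))).
  move=> n _ B mB; rewrite setTI.
  rewrite (_ : _ @^-1` B = \bigcup_z (if pselect (B (h (grid n z)))
     then [set w | code n (Y w) = z] else set0)); last first.
    apply/seteqP; split => w /=.
      by move=> Bw; exists (code n (Y w)) => //; case: pselect.
    by move=> [z _]; case: pselect => // Bz ->.
  apply: countable_bigcupT_measurable; first exact: countableP.
  move=> z; case: pselect => [Bz|Bz] /=; last exact: measurable0.
  rewrite (_ : [set w | code n (Y w) = z] =
    \bigcap_(ij in [set: 'I_d * 'I_d]) ([set w | Num.floor (complex.Re (Y w ij.1 ij.2) * n.+1%:R) = (z ij).1] `&`
      [set w | Num.floor (complex.Im (Y w ij.1 ij.2) * n.+1%:R) = (z ij).2])); last first.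
    apply/seteqP; split => w /=.
      by move=> <- ij _; rewrite ffunE.
    move=> H; apply/ffunP => ij; rewrite ffunE; have [/= -> ->] := H ij I.
    by case: (z ij).
  apply: fin_bigcap_measurable => // ij _.
  by have [mr mi] := mY ij.1 ij.2; apply: measurableI; exact: measurable_floor_eq.
move=> w _; apply/cvgrPdist_le => e e0.
have [del del0 H] := hc (Y w) e e0.
have [N hN] : exists N : nat, (d * d)%:R * 2 / del <= N.+1%:R.
  exists (Num.truncn ((d * d)%:R * 2 / del)); apply: ltW; exact: truncnS_gt.
exists N => // n /= Nn; rewrite distrC; apply: H.
apply: (le_trans (grid_err _ _)); rewrite ler_pdivrMr ?ltr0n// [leRHS]mulrC -ler_pdivrMr//.
by apply: (le_trans hN); rewrite ler_nat ltnS.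
Qed.

Lemma measurable_hcont h Y : hcont h -> mx_mble Y -> (forall w, herm (Y w)) ->
  measurable_fun setT (fun w => h (Y w)).
Proof.
move=> hc mY hY; have := measurable_l1cont (hcont_hpart hc) mY.
by congr measurable_fun; apply/funext => w; rewrite hpart_id.
Qed.

End Entries.
End MatrixMeasurability.

(** * Measurability of the minimal eigenvalue on arbitrary matrices *)

Section LminMeasurable.
Variable R : realType.
Local Notation C := (R[i]).
Variable d : nat.
Hypothesis d_gt0 : (0 < d)%N.
Implicit Types A B X : 'M[C]_d.

Lemma l1M p q r (X : 'M[C]_(p, q)) (Y : 'M[C]_(q, r)) : l1 (X *m Y) <= l1 X * l1 Y.
Proof.
rewrite /l1 mulr_suml; apply: ler_sum => i _.
apply: (@le_trans _ _ (\sum_j \sum_k cabs (X i k) * cabs (Y k j))).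
  apply: ler_sum => j _; rewrite mxE (le_trans (cabs_sum _ _ _))//.
  by apply: ler_sum => k _; rewrite cabsM.
rewrite exchange_big/= mulr_suml; apply: ler_sum => k _; rewrite -mulr_sumr.
apply: ler_wpM2l; first exact: cabs_ge0.
rewrite (bigD1 k)//= lerDl; apply: sumr_ge0 => ? _; apply: sumr_ge0 => ? _; exact: cabs_ge0.
Qed.

Lemma l1_adj p q (X : 'M[C]_(p, q)) : l1 (adjmx X) = l1 X.
Proof.
rewrite /l1 exchange_big/=; apply: eq_bigr => i _; apply: eq_bigr => j _.
by rewrite !mxE cabs_conj.
Qed.

Let shift X (a : R) : 'M[C]_d := X - a%:C%C *: 1%:M.
Let gram X a := shift X a *m adjmx (shift X a).

Let gram_herm X a : herm (gram X a).
Proof. by rewrite /herm adjmxM adjmxK. Qed.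

Let mulmx_adj_row (v : 'rV[C]_d) : complex.Re ((v *m adjmx v) 0 0) = \sum_j cabs2 (v 0 j).
Proof.
rewrite mxE Re_sum; apply: eq_bigr => j _; rewrite adjmxE.
by case: (v 0 j) => x y; rewrite /cabs2/= mulrN opprK !expr2.
Qed.

(** The squared smallest singular value of X - a: it vanishes exactly at the real eigenvalues of X
    and is Lipschitz in (X, a) on bounded sets. *)
Let smin X a := rmin (gram X a).

Let smin_ge0 X a : 0 <= smin X a.
Proof.
apply: (rmin_ge d_gt0) => u _.
have -> : rayl u (gram X a) = \sum_j cabs2 ((adjmx u *m shift X a) 0 j).
  by rewrite -mulmx_adj_row /rayl adjmxM adjmxK /gram !mulmxA.
by apply: sumr_ge0 => j _; exact: cabs2_ge0.
Qed.

Let smin_eigen X a : (smin X a <= 0) = eigenvalue X a%:C%C.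
Proof.
have eq1 (v : 'rV[C]_d) : (v *m X == a%:C%C *: v) = (v *m shift X a == 0).
  by rewrite /shift mulmxBr -scalemxAr mulmx1 subr_eq0.
rewrite /smin (rmin_lmin d_gt0 (gram_herm X a)); apply/idP/idP => [h|/eigenvalueP[v /eqP vX v0]].
  have [_ [i ei]] := lmin_seig d_gt0 (gram_herm X a).
  have l0 : lmin (gram X a) = 0.
    by apply/eqP; rewrite eq_le h -(rmin_lmin d_gt0 (gram_herm X a)) smin_ge0.
  have := seig_eigenvalue i (gram_herm X a); rewrite -ei l0 => /eigenvalueP[v vG v0].
  apply/eigenvalueP; exists v => //; apply/eqP; rewrite eq1.
  have : complex.Re (((v *m shift X a) *m adjmx (v *m shift X a)) 0 0) = 0.
    by rewrite adjmxM mulmxA -[_ *m _ *m adjmx (shift X a)]mulmxA -/(gram X a) vG rmorph0 scale0r mul0mx mxE.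
  rewrite mulmx_adj_row => /eqP; rewrite psumr_eq0 => [|j _]; last exact: cabs2_ge0.
  move=> /allP H; apply/eqP/rowP => j; rewrite [RHS]mxE.
  have := H j (mem_index_enum _); rewrite implyTb.
  move: ((v *m shift X a) 0 j) => [x y] /=.
  by rewrite /cabs2/= paddr_eq0 ?sqr_ge0// !sqrf_eq0 => /andP[/eqP -> /eqP ->].
rewrite eq1 in vX; have [lo _] := lmin_seig d_gt0 (gram_herm X a).
have : eigenvalue (gram X a) (0 : R)%:C%C.
  apply/eigenvalueP; exists v => //.
  by rewrite /gram mulmxA (eqP vX) mul0mx rmorph0 scale0r.
by move=> /(eigenvalue_seig (gram_herm X a))[i <-].
Qed.

Let smin_lip X B a b K : l1 (shift X a) <= K -> l1 (shift B b) <= K ->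
  `|smin X a - smin B b| <= 2 * K * (l1 (X - B) + `|a - b| * l1 (1%:M : 'M[C]_d)).
Proof.
move=> hX hB; apply: (le_trans (rmin_lip d_gt0 _ _)).
set S := shift X a; set U := shift B b.
have -> : gram X a - gram B b = (S - U) *m adjmx S + U *m adjmx (S - U).
  have -> : gram X a - gram B b = S *m adjmx S - U *m adjmx U by [].
  move: S U => S' U'; rewrite adjmxD adjmxN mulmxBl.
  by rewrite (mulmxBr U' (adjmx S')) addrA subrK.
apply: (le_trans (l1D _ _)).
have SU : l1 (S - U) <= l1 (X - B) + `|a - b| * l1 (1%:M : 'M[C]_d).
  have -> : S - U = (X - B) + (b - a)%:C%C *: 1%:M.
    rewrite /S /U /shift rmorphB scalerBl; move: (_ *: _) (b%:C%C *: _) => Y V.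
    by rewrite opprD opprK addrACA (addrC (- Y)).
  by rewrite (le_trans (l1D _ _))// l1Z distrC.
have K0 : 0 <= K by exact: le_trans (l1_ge0 _) hX.
have h1 := le_trans (l1M (S - U) (adjmx S)) (ler_pM (l1_ge0 _) (l1_ge0 _) SU (eq_ind_r (fun z => z <= K) hX (l1_adj S))).
have h2 := le_trans (l1M U (adjmx (S - U))) (ler_pM (l1_ge0 _) (l1_ge0 _) hB (eq_ind_r (fun z => z <= _) SU (l1_adj (S - U)))).
apply: (le_trans (lerD h1 h2)); move: (l1 (X - B) + _) => z.
by rewrite [z * K]mulrC -mulrA mulr_natl mulr2n.
Qed.

Let l1_shift X a c : `|a| <= c -> l1 (shift X a) <= l1 X + c * l1 (1%:M : 'M[C]_d).
Proof.
move=> ac; apply: (le_trans (l1D _ _)); rewrite lerD2l l1N l1Z.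
by apply: ler_wpM2r => //; exact: l1_ge0.
Qed.

Let smin_cont X : continuous (smin X).
Proof.
move=> a; apply/cvgrPdist_le => e e0.
pose K := l1 X + (`|a| + 1) * l1 (1%:M : 'M[C]_d).
have K0 : 0 <= K by rewrite addr_ge0 ?l1_ge0// mulr_ge0 ?l1_ge0// addr_ge0.
pose D := 2 * K * l1 (1%:M : 'M[C]_d) + 1.
have D0 : 0 < D by rewrite ltr_wpDl// !mulr_ge0 ?l1_ge0.
have del0 : 0 < Num.min 1 (e / D) by rewrite lt_min ltr01 divr_gt0.
apply/nbhs_ballP; exists (Num.min 1 (e / D)) => //= b.
rewrite /ball/= lt_min => /andP[ab1 abe].
have hb : `|b| <= `|a| + 1.
  by rewrite -(subrK a b) (le_trans (ler_normD _ _))// addrC lerD2l distrC ltW.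
have ha : `|a| <= `|a| + 1 by rewrite lerDl.
apply: (le_trans (smin_lip (l1_shift X ha) (l1_shift X hb))).
rewrite subrr l10 add0r -/K mulrCA.
apply: (@le_trans _ _ (`|a - b| * D)); first by rewrite ler_wpM2l// /D lerDl.
by rewrite -ler_pdivlMr// ltW.
Qed.

(* The infimum of this continuous function of [X] vanishes exactly when [X] has an eigenvalue
   in [[p, q]]; this makes [lmin] measurable on all matrices, not only on Hermitian ones. *)
Let gmin p q X := inf [set smin X a | a in `[p, q]%classic].

Let gmin_lb p q X a : p <= a -> a <= q -> gmin p q X <= smin X a.
Proof.
move=> pa aq; rewrite /gmin; set E := (X in inf X).
have hlb : has_lbound E by exists 0 => _ [b _ <-]; exact: smin_ge0.
have Ea : E (smin X a) by exists a => //=; rewrite in_itv/= pa.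
by move: (ge_inf hlb Ea).
Qed.

Let gmin_ge p q X x : p <= q -> (forall a, p <= a -> a <= q -> x <= smin X a) -> x <= gmin p q X.
Proof.
move=> pq H; apply: lb_le_inf; first by exists (smin X p), p => //=; rewrite in_itv/= lexx.
by move=> _ [a /= + <-]; rewrite in_itv/= => /andP[]; exact: H.
Qed.

Let gmin_eigen p q X : p <= q ->
  gmin p q X <= 0 <-> exists a, [/\ p <= a, a <= q & eigenvalue X a%:C%C].
Proof.
move=> pq; split=> [g0|[a [pa aq Xa]]]; last first.
  by apply: le_trans (gmin_lb X pa aq) _; rewrite smin_eigen.
have cs : {within `[p, q], continuous (smin X)} by apply: continuous_subspaceT; exact: smin_cont.
have [c + cmin] := EVT_min pq cs; rewrite in_itv/= => /andP[pc cq].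
exists c; split=> //; rewrite -smin_eigen; apply: le_trans _ g0.
by apply: (gmin_ge pq) => a pa aq; apply: (cmin a); rewrite in_itv/= pa aq.
Qed.

Let gmin_l1cont p q : p <= q -> l1cont (gmin p q).
Proof.
move=> pq A e e0.
pose c := `|p| + `|q|.
have cb a : p <= a -> a <= q -> `|a| <= c.
  move=> pa aq; rewrite /c; have := ler_norm q; have := ler_norm (- p).
  by rewrite normrN ler_norml => h1 h2; have := normr_ge0 p; have := normr_ge0 q; lra.
pose K := l1 A + 1 + c * l1 (1%:M : 'M[C]_d).
have K0 : 0 < K.
  by rewrite ltr_wpDr ?mulr_ge0 ?l1_ge0 ?addr_ge0// ltr_wpDl ?l1_ge0.
have K20 : 0 < 2 * K by rewrite mulr_gt0.
exists (Num.min 1 (e / (2 * K))); first by rewrite lt_min ltr01 divr_gt0.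
move=> B; rewrite le_min => /andP[AB1 ABe].
have bd a : p <= a -> a <= q -> `|smin B a - smin A a| <= e.
  move=> pa aq; have ac := cb a pa aq.
  have h1 : l1 (shift A a) <= K.
    by apply: (le_trans (l1_shift A ac)); rewrite /K lerD2r lerDl.
  have h2 : l1 (shift B a) <= K.
    apply: (le_trans (l1_shift B ac)); rewrite /K lerD2r -(subrK A B) addrC.
    by rewrite (le_trans (l1D _ _))// lerD2l.
  apply: (le_trans (smin_lip h2 h1)); rewrite subrr normr0 mul0r addr0.
  by rewrite mulrC -ler_pdivlMr.
have side B1 B2 : (forall a, p <= a -> a <= q -> `|smin B1 a - smin B2 a| <= e) ->
    gmin p q B1 - gmin p q B2 <= e.
  move=> H; rewrite lerBlDr -lerBlDl; apply: (gmin_ge pq) => a pa aq.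
  rewrite lerBlDl; apply: (le_trans (gmin_lb B1 pa aq)).
  have := H a pa aq; rewrite ler_norml => /andP[_]; rewrite lerBlDr//.
have h1 := side _ _ bd.
have h2 : gmin p q A - gmin p q B <= e.
  by apply: side => a pa aq; rewrite distrC; exact: bd.
by rewrite ler_norml h1 andbT lerNl opprB.
Qed.

Context {dT : measure_display} {T : measurableType dT}.
Variable Y : T -> 'M[C]_d.
Hypothesis mY : mx_mble Y.

Let mS p q : p <= q -> measurable [set w | exists a, [/\ p <= a, a <= q & eigenvalue (Y w) a%:C%C]].
Proof.
move=> pq; have mg := measurable_l1cont (gmin_l1cont pq) mY.
rewrite (_ : [set _ | _] = (fun w => gmin p q (Y w)) @^-1` `]-oo, 0]%classic).
  by rewrite -[X in measurable X]setTI; apply: mg.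
by apply/seteqP; split => w /=; rewrite in_itv/= gmin_eigen.
Qed.

Let finite_eigen X : exists b : R, forall a, eigenvalue X a%:C%C -> `|a| <= b.
Proof.
exists (l1 X) => a /eigenvalueP[v vX v0].
have [j0 vj0] : exists j, v 0 j != 0.
  by apply/existsP; apply: contraR v0; rewrite negb_exists => /forallP h; apply/eqP/rowP => j; rewrite [RHS]mxE; apply/eqP; have := h j; rewrite negbK.
have lv0 : 0 < l1 v.
  rewrite /l1 big_ord1 (bigD1 j0)//= ltr_pwDl//; last by apply: sumr_ge0 => j _; exact: cabs_ge0.
  by rewrite lt_def cabs_ge0 andbT; apply: contraNneq vj0 => /Normc.eq0_normc ->.
rewrite -(ler_pM2r lv0) -l1Z -vX mulrC; exact: l1M.
Qed.

(** The second alternative reflects a default value: without real eigenvalues [lmin X] is the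
    infimum of the empty set, which is 0. In the first one the infimum is attained, because by
    continuity of [smin] an interval above a non-eigenvalue c contains no eigenvalue. *)
Let lmin_le_iff X (c : R) : lmin X <= c <->
  (exists a, a <= c /\ eigenvalue X a%:C%C) \/ (0 <= c /\ ~ exists a : R, eigenvalue X a%:C%C).
Proof.
have [b hb] := finite_eigen X.
set E := [set a : R | eigenvalue X a%:C%C].
have hlb : has_lbound E by exists (- b) => a /hb; rewrite ler_norml => /andP[].
rewrite /lmin -/E; split.
  move=> lc; have [[a0 Ea0]|nE] := pselect (exists a : R, eigenvalue X a%:C%C); last first.
    right; split => //; move: lc; rewrite (_ : E = set0) ?inf0//.
    by apply/seteqP; split => // a Ea; case: nE; exists a.
  left.
  apply: contrapT => H.
  have smc : 0 < smin X c.
    by rewrite ltNge smin_eigen; apply/negP => Xc; apply: H; exists c.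
  have /cvgrPdist_lt/(_ _ smc) := @smin_cont X c.
  move=> /nbhs_ballP[/= e e0 he].
  have : c + e / 2 <= inf E.
    apply: lb_le_inf; first by exists a0.
    move=> a Ea; rewrite leNgt; apply/negP => ae.
    have ac : c < a by rewrite ltNge; apply/negP => ac; apply: H; exists a.
    have : ball c e a by rewrite /ball/= distrC gtr0_norm ?subr_gt0// ltrBlDl (lt_trans ae)// ltrD2l ltr_pdivrMr// ltr_pMr// ltr1n.
    move=> /he /=; have : smin X a <= 0 by rewrite smin_eigen.
    move=> s0; rewrite ltNge => /negP; apply; apply: le_trans (ler_norm _).
    by rewrite lerBrDr gerDl.
  by rewrite leNgt => /negP; apply; rewrite (le_lt_trans lc)// ltrDl divr_gt0.
case=> [[a [ac Xa]]|[c0 nE]].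
  by apply: le_trans ac; have Ea : E a by []; move: (ge_inf hlb Ea).
rewrite (_ : E = set0) ?inf0//.
by apply/seteqP; split => // a Ea; case: nE; exists a.
Qed.

Lemma measurable_lmin : measurable_fun setT (fun w => lmin (Y w)).
Proof.
have mex : measurable [set w | exists a : R, eigenvalue (Y w) a%:C%C].
  rewrite (_ : [set _ | _] = \bigcup_n [set w | exists a, [/\ - n%:R <= a, a <= n%:R & eigenvalue (Y w) a%:C%C]]).
    by apply: bigcupT_measurable => n; apply: mS; rewrite (@le_trans _ _ 0)// oppr_le0.
  apply/seteqP; split => w /=; last by move=> [n _ [b [_ _ hb]]]; exists b.
  move=> [a Ha].
  exists (Num.truncn `|a|).+1 => //=; exists a; split => //.
    by rewrite lerNl (le_trans (ler_norm _))// normrN ltW// truncnS_gt.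
  by rewrite (le_trans (ler_norm _))// ltW// truncnS_gt.
have mlec (c : R) : measurable [set w | lmin (Y w) <= c].
  rewrite (_ : [set _ | _] = (\bigcup_n [set w | exists a, [/\ c - n%:R <= a, a <= c & eigenvalue (Y w) a%:C%C]])
     `|` (if 0 <= c then ~` [set w | exists a : R, eigenvalue (Y w) a%:C%C] else set0)).
    apply: measurableU.
      by apply: bigcupT_measurable => n; apply: mS; rewrite gerBl.
    by case: ifP => _; [exact: measurableC|exact: measurable0].
  apply/seteqP; split => w /=.
    move=> /lmin_le_iff[[a [ac Xa]]|[c0 nE]]; last by right; rewrite c0.
    left; exists (Num.truncn (c - a)).+1 => //=; exists a; split => //.
    by rewrite lerBlDr -lerBlDl ltW// truncnS_gt.
  move=> [[n _ [a [_ ac Xa]]]|]; first by apply/lmin_le_iff; left; exists a.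
  by case: ifP => // c0 nE; apply/lmin_le_iff; right.
apply: (measurability _ (RGenOInfty.measurableE R)) => // _ [_ [c ->] <-]; rewrite setTI.
rewrite (_ : _ @^-1` _ = ~` [set w | lmin (Y w) <= c]); first exact: measurableC.
by apply/seteqP; split => w /=; rewrite in_itv/= andbT ltNge => /negP.
Qed.

End LminMeasurable.

(** * Transfer of integrals between variables with the same law *)

Section LawEquality.
Variable R : realType.
Context {d1 d2 : measure_display} {T1 : measurableType d1} {T2 : measurableType d2}.
Variables (m1 : {measure set T1 -> \bar R}) (m2 : {measure set T2 -> \bar R}).
Variables (f : T1 -> R) (g : T2 -> R).
Hypotheses (mf : measurable_fun setT f) (mg : measurable_fun setT g).
Hypothesis fg : forall B : set R, measurable B -> m1 (f @^-1` B) = m2 (g @^-1` B).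

Lemma ge0_law_eq (h : R -> R) : measurable_fun setT h -> (forall x, 0 <= h x) ->
  (\int[m1]_x (h (f x))%:E = \int[m2]_x (h (g x))%:E)%E.
Proof.
move=> mh h0.
have mf' : measurable_fun setT (f : T1 -> measurableTypeR R) by exact: mf.
have mg' : measurable_fun setT (g : T2 -> measurableTypeR R) by exact: mg.
pose f' : {mfun T1 >-> measurableTypeR R} := HB.pack (f : T1 -> measurableTypeR R) (isMeasurableFun.Build _ _ _ _ _ mf').
pose g' : {mfun T2 >-> measurableTypeR R} := HB.pack (g : T2 -> measurableTypeR R) (isMeasurableFun.Build _ _ _ _ _ mg').
have mh' : measurable_fun setT (fun x : measurableTypeR R => (h x)%:E) by exact/measurable_EFinP.
have h0' : {in [set: measurableTypeR R], forall y, (0 <= (h y)%:E)%E} by move=> x _; rewrite lee_fin.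
transitivity (\int[pushforward m1 f']_y (h y)%:E)%E.
  by rewrite (@ge0_integral_pushforward _ _ _ (measurableTypeR R) _ f' mf m1).
rewrite (@eq_measure_integral _ (measurableTypeR R) _ setT (pushforward m2 g')); last first.
  by move=> B mB _; exact: fg.
by rewrite (@ge0_integral_pushforward _ _ _ (measurableTypeR R) _ g' mg m2).
Qed.

End LawEquality.

(** * Transfer of integrability and expectation between variables with the same law *)

Section LawEqualityProb.
Variable R : realType.
Context {d1 d2 : measure_display} {T1 : measurableType d1} {T2 : measurableType d2}.
Variables (P1 : probability T1 R) (P2 : probability T2 R).
Variables (f : T1 -> R) (g : T2 -> R).
Hypotheses (mf : measurable_fun setT f) (mg : measurable_fun setT g).
Hypothesis fg : forall B : set R, measurable B -> P1 (f @^-1` B) = P2 (g @^-1` B).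

Lemma law_eq_rint : rint P1 f -> rint P2 g.
Proof.
move=> /integrableP[_ fi]; apply/integrableP; split; first exact/measurable_EFinP.
have := ge0_law_eq mf mg fg (@normr_measurable R setT) (@normr_ge0 _ _).
by move=> <-; exact: fi.
Qed.

Lemma law_eq_Ex : rint P1 f -> Ex P1 f = Ex P2 g.
Proof.
move=> rf; have rg := law_eq_rint rf.
pose pp (x : R) := Num.max x 0; pose pn (x : R) := Num.max (- x) 0.
have mp : measurable_fun setT pp by apply: measurable_maxr => //; exact: measurable_id.
have mn : measurable_fun setT pn.
  by apply: measurable_maxr => //; apply: measurableT_comp => //; exact: measurable_id.
have d (x : R) : x = pp x - pn x.
  by rewrite /pp /pn; case: (leP x 0) => h; case: (leP (- x) 0) => h'; lra.
have p0 x : 0 <= pp x by rewrite /pp le_max lexx orbT.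
have n0 x : 0 <= pn x by rewrite /pn le_max lexx orbT.
have pa (x : R) : `|pp x| <= `|x|.
  by rewrite ger0_norm// /pp ge_max ler_norm normr_ge0.
have na (x : R) : `|pn x| <= `|x|.
  by rewrite ger0_norm// /pn ge_max normr_ge0 andbT -normrN ler_norm.
rewrite (Ex_ext _ (fun x => d (f x))) (Ex_ext _ (fun x => d (g x))).
have E (h : R -> R) : measurable_fun setT h -> (forall x, 0 <= h x) -> Ex P1 (fun w => h (f w)) = Ex P2 (fun w => h (g w)).
  by move=> mh h0; rewrite /Ex (ge0_law_eq mf mg fg).
rewrite !ExB ?E//.
- by apply: (rint_le _ (rint_norm rg)) => //; exact: measurableT_comp.
- by apply: (rint_le _ (rint_norm rg)) => //; exact: measurableT_comp.
- by apply: (rint_le _ (rint_norm rf)) => //; exact: measurableT_comp.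
- by apply: (rint_le _ (rint_norm rf)) => //; exact: measurableT_comp.
Qed.

End LawEqualityProb.

HB.instance Definition _ (R : realType) := isPointed.Build R[i] 0.

(** * The Borel sets of matrices *)

Section MatrixSigmaAlgebra.
Variable R : realType.
Local Notation C := (R[i]).
Variable d : nat.

Definition mx_gen : set (set 'M[C]_d) :=
  [set B : set 'M[C]_d | exists (i : 'I_d) (j : 'I_d) (S : set R), measurable S /\
        (B = [set A : 'M[C]_d | S (complex.Re (A i j))] \/
         B = [set A : 'M[C]_d | S (complex.Im (A i j))])].

Let M0 := g_sigma_algebraType mx_gen.

Let mx_mble_id : mx_mble (fun A : M0 => A).
Proof.
move=> i j; split=> _ S mS; rewrite setTI; apply: sub_gen_smallest; exists i, j, S; split => //; by [left|right].
Qed.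

Lemma mx_meas_l1cont (h : 'M[C]_d -> R) (S : set R) : l1cont h -> measurable S ->
  mx_meas [set A | S (h A)].
Proof.
move=> hc mS; have := measurable_l1cont hc mx_mble_id measurableT mS.
by rewrite setTI.
Qed.

Lemma mx_measC (B : set 'M[C]_d) : mx_meas B -> mx_meas (~` B).
Proof. by move=> mB; exact: (@measurableC _ M0). Qed.

Lemma mx_measI (B D : set 'M[C]_d) : mx_meas B -> mx_meas D -> mx_meas (B `&` D).
Proof. by move=> mB mD; exact: (@measurableI _ M0). Qed.

Lemma mx_measU (B D : set 'M[C]_d) : mx_meas B -> mx_meas D -> mx_meas (B `|` D).
Proof. by move=> mB mD; exact: (@measurableU _ M0). Qed.

Lemma mx_meas0 : mx_meas (set0 : set 'M[C]_d).
Proof. exact: (@measurable0 _ M0). Qed.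

Lemma mx_measT : mx_meas (setT : set 'M[C]_d).
Proof. exact: (@measurableT _ M0). Qed.

Lemma l1_eq0 (X : 'M[C]_d) : l1 X <= 0 -> X = 0.
Proof.
move=> h; have : l1 X == 0 by rewrite eq_le h l1_ge0.
rewrite psumr_eq0 => [/allP H|i _]; last by apply: sumr_ge0 => j _; exact: cabs_ge0.
apply/matrixP => i j; rewrite [RHS]mxE; have := H i (mem_index_enum _); rewrite implyTb.
rewrite psumr_eq0 => [/allP K|? _]; last exact: cabs_ge0.
by have := K j (mem_index_enum _); rewrite implyTb => /eqP /Normc.eq0_normc.
Qed.

Lemma l1_dist (A B : 'M[C]_d) : `|l1 A - l1 B| <= l1 (A - B).
Proof.
have h1 := l1D (A - B) B; have h2 := l1D (B - A) A; rewrite !subrK in h1 h2.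
by rewrite ler_norml lerBlDr h1 andbT lerNl opprB lerBlDr -[l1 (A - B)]l1N opprB.
Qed.

Lemma lip_l1cont (h : 'M[C]_d -> R) K : (forall A B, `|h A - h B| <= K * l1 (A - B)) -> l1cont h.
Proof.
move=> hK A e e0; exists (e / (`|K| + 1)); first by rewrite divr_gt0// ltr_wpDl.
move=> B AB; apply: (le_trans (hK _ _)); apply: (@le_trans _ _ ((`|K| + 1) * l1 (B - A))).
  by rewrite ler_wpM2r ?l1_ge0// (le_trans (ler_norm _))// lerDl.
by rewrite mulrC -ler_pdivlMr// ltr_wpDl.
Qed.

Lemma psdc_rmin (A : 'M[C]_d) : (0 < d)%N -> psdc A <-> herm A /\ 0 <= rmin A.
Proof.
move=> d0; split=> [[hA pA]|[hA rA]]; split => //; first by apply: (rmin_ge d0) => u _; exact: pA.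
move=> u; rewrite (rmin_lmin d0 hA) in rA; apply: le_trans (lmin_le_rayl d0 u hA).
by rewrite mulr_ge0// sumr_ge0// => i _; exact: cabs2_ge0.
Qed.

Lemma mx_meas_psdc : (0 < d)%N -> mx_meas [set A : 'M[C]_d | psdc A].
Proof.
move=> d0; rewrite (_ : [set _ | _] = [set A | `]-oo, 0]%classic (l1 (A - adjmx A))] `&` [set A | `[0, +oo[%classic (rmin A)]).
  apply: mx_measI; apply: mx_meas_l1cont => //.
    apply: (@lip_l1cont _ 2) => A B; apply: (@le_trans _ _ (l1 ((A - adjmx A) - (B - adjmx B)))).
      exact: l1_dist.
    have -> : A - adjmx A - (B - adjmx B) = (A - B) - adjmx (A - B).
      rewrite adjmxD adjmxN; move: (adjmx A) (adjmx B) => A' B'.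
      by rewrite !opprD !opprK addrACA.
    by rewrite (le_trans (l1D _ _))// l1N l1_adj mulr_natl mulr2n.
  by apply: (@lip_l1cont _ 1) => A B; rewrite mul1r; exact: rmin_lip.
apply/seteqP; split => A /=; rewrite !in_itv/= ?andbT.
  by move=> /(psdc_rmin _ d0)[hA ->]; rewrite hA subrr l10.
move=> [h r]; apply/(psdc_rmin _ d0); split => //.
by have /subr0_eq := l1_eq0 h; rewrite /herm => <-.
Qed.

End MatrixSigmaAlgebra.

(** * Expectations of continuous functions of identically distributed matrices *)

Section MatrixLaw.
Variable R : realType.
Local Notation C := (R[i]).
Variable d : nat.
Context {dT : measure_display} {T : measurableType dT}.
Variable P : probability T R.
Variables W V : T -> 'M[C]_d.
Hypotheses (mW : mx_rv W) (mV : mx_rv V) (WV : same_law P P W V).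

Lemma same_law_l1cont (h : 'M[C]_d -> R) : l1cont h -> rint P (fun w => h (W w)) ->
  rint P (fun w => h (V w)) /\ Ex P (fun w => h (V w)) = Ex P (fun w => h (W w)).
Proof.
move=> hc rW.
have m1 := measurable_l1cont hc (mx_rv_mble mW).
have m2 := measurable_l1cont hc (mx_rv_mble mV).
have E (B : set R) : measurable B -> P ((fun w => h (W w)) @^-1` B) = P ((fun w => h (V w)) @^-1` B).
  by move=> mB; exact: (WV (mx_meas_l1cont hc mB)).
by split; [exact: (law_eq_rint m1 m2 E)|apply/esym; exact: (law_eq_Ex m1 m2 E)].
Qed.

End MatrixLaw.

(** * Separating one summand from the previous ones by independence *)

Section IndependentSplit.
Variable R : realType.
Local Notation C := (R[i]).
Variable d : nat.
Context {dT : measure_display} {T : measurableType dT}.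
Variable P : probability T R.
Variables (k : nat) (V : 'I_k -> T -> 'M[C]_d).
Hypotheses (mV : forall j, mx_rv (V j)) (iV : mx_indep P V).
Variable j : 'I_k.

Let rect (B : 'I_k -> set 'M[C]_d) (D : set 'M[C]_d) : set (T * T) :=
  [set w | (forall i : 'I_k, (i < j)%N -> B i (V i w.1)) /\ D (V j w.2)].
Let G : set (set (T * T)) := [set A | exists B D,
  [/\ forall i, mx_meas (B i), mx_meas D & A = rect B D]].

Let G_setI : setI_closed G.
Proof.
move=> _ _ [B [D [mB mD ->]]] [B' [D' [mB' mD' ->]]].
exists (fun i => B i `&` B' i), (D `&` D'); split.
- by move=> i; exact: mx_measI.
- exact: mx_measI.
apply/seteqP; split => w /=.
  by move=> [[h1 h2] [h1' h2']]; split => // i ij; split; [exact: h1|exact: h1'].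
by move=> [h1 [h2 h2']]; split; split => // i /h1[].
Qed.

Let rectE B D : rect B D = (\bigcap_(i in [set i : 'I_k | (i < j)%N]) (V i @^-1` B i)) `*` (V j @^-1` D).
Proof. by apply/seteqP; split => w /= [h1 h2]; split. Qed.

Let m_cap (B : 'I_k -> set 'M[C]_d) : (forall i, mx_meas (B i)) ->
  measurable (\bigcap_(i in [set i : 'I_k | (i < j)%N]) (V i @^-1` B i)).
Proof. by move=> mB; apply: fin_bigcap_measurable => // i _; exact: mV. Qed.

Let G_meas : G `<=` @measurable _ (T * T)%type.
Proof.
move=> _ [B [D [mB mD ->]]]; rewrite rectE; apply: measurableX; first exact: m_cap.
exact: mV.
Qed.

Let GT : G setT.
Proof.
exists (fun=> setT), setT; split; [by move=> _; exact: mx_measT|exact: mx_measT|].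
by apply/seteqP; split.
Qed.

Let dg (w : T) : T * T := (w, w).
Let mdg : measurable_fun setT dg.
Proof. by apply: measurable_fun_pair; exact: measurable_id. Qed.

Let prod_indep (B : 'I_k -> set 'M[C]_d) D : (forall i, mx_meas (B i)) -> mx_meas D ->
  P (dg @^-1` rect B D) = (P (\bigcap_(i in [set i : 'I_k | (i < j)%N]) (V i @^-1` B i)) * P (V j @^-1` D))%E.
Proof.
move=> mB mD.
(* Independence is stated for all k indices at once; the indices outside the event are filled with
   the full set, which contributes a factor 1. *)
pose B1 (i : 'I_k) := if (i < j)%N then B i else if i == j then D else setT.
pose B2 (i : 'I_k) := if (i < j)%N then B i else setT.
have mB1 i : mx_meas (B1 i) by rewrite /B1; case: ifP => // _; case: ifP => // _; exact: mx_measT.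
have mB2 i : mx_meas (B2 i) by rewrite /B2; case: ifP => // _; exact: mx_measT.
have -> : dg @^-1` rect B D = \bigcap_(i in [set: 'I_k]) (V i @^-1` B1 i).
  apply/seteqP; split => w /=.
    move=> [h1 h2] i _; rewrite /B1 /=; case: ifP => [ij|_]; first exact: h1.
    by case: eqP => [->|].
  move=> H; split => [i ij|]; first by have := H i Logic.I; rewrite /B1/= ij.
  by have := H j Logic.I; rewrite /B1/= ltnn eqxx.
have -> : \bigcap_(i in [set i : 'I_k | (i < j)%N]) (V i @^-1` B i) = \bigcap_(i in [set: 'I_k]) (V i @^-1` B2 i).
  apply/seteqP; split => w /= H i.
    by move=> _; rewrite /B2 /=; case: ifP => [ij|_//]; exact: H.
  by move=> /= ij; have := H i Logic.I; rewrite /B2/= ij.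
rewrite !iV// (bigD1 j)//= muleC [in RHS](bigD1 j)//=.
have -> : B1 j = D by rewrite /B1 ltnn eqxx.
have -> : B2 j = setT by rewrite /B2 ltnn.
rewrite preimage_setT probability_setT mul1e; congr (_ * _)%E.
by apply: eq_bigr => i ij; rewrite /B1 /B2 (negbTE ij).
Qed.

Let agree A : <<s G >> A -> P (dg @^-1` A) = (P \x P)%E A.
Proof.
pose dg' : {mfun T >-> (T * T)%type} := HB.pack dg (isMeasurableFun.Build _ _ _ _ _ mdg).
apply: (@g_sigma_algebra_measure_unique _ R _ G G_meas (fun=> setT) _ _ (pushforward P dg') (P \x P)%E) => //.
- by apply/seteqP; split => // x _; exists 0%N.
- move=> _ [B [D [mB mD ->]]]; rewrite /= /pushforward prod_indep// rectE product_measure1E//.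
    exact: m_cap.
  exact: mV.
- by move=> _; rewrite /= /pushforward preimage_setT probability_setT ltry.
Qed.

Let S (w : T) : 'M[C]_d := \sum_(i < k | (i < j)%N) V i w.

Let mx_mble_S {d' : measure_display} {T' : measurableType d'} (U : 'I_k -> T' -> 'M[C]_d) :
  (forall i : 'I_k, (i < j)%N -> mx_mble (U i)) -> mx_mble (fun w => \sum_(i < k | (i < j)%N) U i w).
Proof.
move=> mU; have : mx_mble (fun w => \sum_(i < k) (if (i < j)%N then U i w else 0)).
  apply: mx_mble_sum => i; case ij: (i < j)%N; first exact: mU.
  exact: mx_mble_cst.
by congr mx_mble; apply/funext => w; rewrite -big_mkcond.
Qed.

(* Push [P] forward by the diagonal of [T * T]: it agrees with [P \x P] on the pi-system
   [G] of rectangles that are measurable for the factors. *)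
Lemma indep_split (h : 'M[C]_d -> R) : l1cont h -> (forall A, 0 <= h A) ->
  (\int[P]_w (h (S w + V j w))%:E = \int[P]_w \int[P]_w' (h (S w + V j w'))%:E)%E.
Proof.
move=> hc h0.
have mVj i := mx_rv_mble (mV i).
pose F (w : T * T) := h (S w.1 + V j w.2).
have mF : measurable_fun setT (F : (T * T)%type -> R).
  apply: measurable_l1cont => //; apply: mx_mbleD.
    apply: mx_mble_S => i _ a b; have [mr mi] := mVj i a b; split.
      exact: (measurableT_comp mr measurable_fst).
    exact: (measurableT_comp mi measurable_fst).
  move=> a b; have [mr mi] := mVj j a b; split.
    exact: (measurableT_comp mr measurable_snd).
  exact: (measurableT_comp mi measurable_snd).
have mFG : measurable_fun setT (F : g_sigma_algebraType G -> R).
  apply: measurable_l1cont => //; apply: mx_mbleD.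
    apply: mx_mble_S => i ij a b.
    have H (f : 'M[C]_d -> R) : (forall D, measurable D -> mx_meas [set A | D (f A)]) ->
        measurable_fun setT (fun w : g_sigma_algebraType G => f (V i w.1)).
      move=> mf _ D mD; rewrite setTI; apply: sub_gen_smallest.
      exists (fun i' => if i' == i then [set A | D (f A)] else setT), setT; split.
      - by move=> i'; case: ifP => _; [exact: mf|exact: mx_measT].
      - exact: mx_measT.
      apply/seteqP; split => w /=.
        by move=> Df; split => // i' _; case: eqP => [->|].
      by move=> [/(_ i ij) + _]; rewrite eqxx.
    split; apply: (H (fun A => _ (A a b))) => D mD; apply: sub_gen_smallest; exists a, b, D; split => //; by [left|right].
  move=> a b.
  have H (f : 'M[C]_d -> R) : (forall D, measurable D -> mx_meas [set A | D (f A)]) ->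
      measurable_fun setT (fun w : g_sigma_algebraType G => f (V j w.2)).
    move=> mf _ D mD; rewrite setTI; apply: sub_gen_smallest.
    exists (fun=> setT), [set A | D (f A)]; split; [by move=> _; exact: mx_measT|exact: mf|].
    by apply/seteqP; split => w /=; [move=> Df|case].
  split; apply: (H (fun A => _ (A a b))) => D mD; apply: sub_gen_smallest; exists a, b, D; split => //; by [left|right].
rewrite -(@fubini_tonelli1 _ _ _ _ _ P P (fun w => (F w)%:E)); last 2 first.
- exact/measurable_EFinP.
- by move=> w; rewrite lee_fin; exact: h0.
(* The transfer of integrals requires a function nonnegative on the whole line; the positive part is
   one and fixes all values of F. *)
pose mx0 (x : R) := Num.max x 0.
have mx0E (x : R) : 0 <= x -> mx0 x = x by move=> x0; rewrite /mx0; case: leP => //; lra.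
have mmx : measurable_fun setT mx0 by apply: measurable_maxr => //; exact: measurable_id.
have mFd : measurable_fun setT (fun w => F (dg w)) by exact: (measurableT_comp mF mdg).
have E (B : set R) : measurable B -> P ((fun w => F (dg w)) @^-1` B) = (P \x P)%E (F @^-1` B).
  by move=> mB; rewrite -agree//; have := mFG measurableT B mB; rewrite setTI.
have K := @ge0_law_eq R _ _ T (T * T)%type P (P \x P)%E _ _ mFd mF E mx0 mmx.
have K0 x : 0 <= mx0 x by rewrite /mx0 le_max lexx orbT.
move: (K K0) => {K} K.
transitivity (\int[P]_w (mx0 (F (dg w)))%:E)%E.
  by apply: eq_integral => w _; rewrite mx0E//; exact: h0.
rewrite K; apply: eq_integral => w _; rewrite mx0E//; exact: h0.
Qed.

End IndependentSplit.

(** * The transfer operator of one summand and its iterates *)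

Section TransferOperator.
Variable R : realType.
Local Notation C := (R[i]).
Variable d : nat.
Local Notation M := 'M[C]_d.

(** A class containing [phi] and stable under all averages used. Decrease along psd directions
    bounds h (A - theta W) by h A, which gives integrability without exponential moments of W; the
    relative Lipschitz bound keeps its constant under averaging and gives measurability. *)
Definition good (h : M -> R) := [/\ forall A, 0 <= h A,
  forall A X, herm A -> psdc X -> h (A - X) <= h A &
  forall A B, herm A -> herm B -> l1 (B - A) <= 1/2 -> `|h B - h A| <= 2 * l1 (B - A) * h A].

Lemma good_hcont h : good h -> hcont h.
Proof.
move=> [h0 _ hl] A e hA e0.
have D0 : 0 < 2 * h A + 1 by rewrite ltr_wpDl// mulr_ge0.
exists (Num.min (1/2) (e / (2 * h A + 1))); first by rewrite lt_min !divr_gt0.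
move=> B hB; rewrite le_min => /andP[l2 le]; apply: (le_trans (hl A B hA hB l2)).
rewrite mulrAC; rewrite ler_pdivlMr// mulrC in le; apply: le_trans le.
by rewrite ler_wpM2r ?l1_ge0// lerDl.
Qed.

Context {dT : measure_display} {T : measurableType dT}.
Variable P : probability T R.
Variable theta : R.
Hypothesis theta0 : 0 <= theta.
Local Notation sc X := (theta%:C%C *: X).

Lemma hcont_subZ (h : M -> R) (A : M) : hcont h -> herm A -> hcont (fun X => h (A - sc X)).
Proof.
move=> hc hA X e hX e0.
have hAX : herm (A - sc X) by apply: hermB => //; exact: hermZ.
have [del del0 H] := hc _ _ hAX e0.
exists (del / (theta + 1)); first by rewrite divr_gt0// ltr_wpDl.
move=> B hB XB; apply: H; first by apply: hermB => //; exact: hermZ.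
rewrite opprB addrC addrA subrK -scalerBr l1Z ger0_norm// -l1N opprB.
rewrite ler_pdivlMr ?ltr_wpDl// mulrC in XB; apply: le_trans XB.
by rewrite ler_wpM2r ?l1_ge0// lerDl.
Qed.

Definition Top (W : T -> M) (h : M -> R) (A : M) : R := Ex P (fun w => h (A - sc (W w))).

Section OneMatrix.
Variable W : T -> M.
Hypotheses (mW : mx_rv W) (pW : forall w, psdc (W w)).

Let hW w : herm (W w). Proof. by case: (pW w). Qed.

Lemma herm_subZ A w : herm A -> herm (A - sc (W w)).
Proof. by move=> hA; apply: hermB => //; exact: hermZ. Qed.

Lemma good_meas h A : good h -> herm A -> measurable_fun setT (fun w => h (A - sc (W w))).
Proof.
move=> gh hA; apply: measurable_hcont; first exact: good_hcont.
  apply: mx_mbleB; first exact: mx_mble_cst.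
  by apply: mx_mbleZ; exact: mx_rv_mble.
by move=> w; exact: herm_subZ.
Qed.

Lemma good_rint h A : good h -> herm A -> rint P (fun w => h (A - sc (W w))).
Proof.
move=> gh hA; apply: (@rint_bd _ _ _ P _ (h A)); first exact: good_meas.
move=> w; have [h0 hm _] := gh; rewrite ger0_norm//.
by apply: hm => //; apply: psdcZ.
Qed.

Lemma good_Top h : good h -> good (Top W h).
Proof.
move=> gh; have [h0 hm hl] := gh; split.
- by move=> A; apply: Ex_ge0.
- move=> A X hA pX; have hX : herm X by case: pX.
  have hAX : herm (A - X) by exact: hermB.
  apply: Ex_le; [exact: good_rint|exact: good_rint|move=> w].
  by rewrite addrAC; apply: hm => //; exact: herm_subZ.
move=> A B hA hB AB; rewrite /Top -ExB ?(good_rint gh)//.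
rewrite -ExZ; last exact: good_rint.
apply: Ex_abs.
- by apply: rintB; exact: good_rint.
- by apply: rintZ; exact: good_rint.
move=> w; have E : (B - sc (W w)) - (A - sc (W w)) = B - A by rewrite opprB addrA subrK.
have := hl _ _ (herm_subZ w hA) (herm_subZ w hB); rewrite E; exact.
Qed.

End OneMatrix.

Section Sum.
Variable W : T -> M.
Hypotheses (mW : mx_rv W) (pW : forall w, psdc (W w)).
Variables (k : nat) (V : 'I_k -> T -> M).
Hypotheses (mV : forall j, mx_rv (V j)) (iV : mx_indep P V).
Hypotheses (pV : forall j w, psdc (V j w)) (WV : forall j, same_law P P W (V j)).

Lemma Top_same_law j h A : good h -> herm A -> Top (V j) h A = Top W h A.
Proof.
move=> gh hA.
pose h' X := h (A - sc (hpart X)).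
have hc : l1cont h' := hcont_hpart (hcont_subZ (good_hcont gh) hA).
have E (U : T -> M) : (forall w, psdc (U w)) -> Top U h A = Ex P (fun w => h' (U w)).
  by move=> pU; apply: Ex_ext => w; rewrite /h' hpart_id//; case: (pU w).
have rW : rint P (fun w => h' (W w)).
  apply: rint_ext (good_rint mW pW gh hA) => w; rewrite /h' hpart_id//; by case: (pW w).
rewrite (E (V j) (pV j)) (E W pW).
have [_ e] := same_law_l1cont mW (mV j) (@WV j) hc rW; exact: e.
Qed.

Let S (j : nat) w : M := \sum_(i < k | (i < j)%N) V i w.

Let hS j w : herm (S j w).
Proof. by apply: (big_ind (@herm R d)) => [|X Y|i _]; [exact: herm0|exact: hermD|case: (pV i w)]. Qed.

Let S_succ j (jk : (j < k)%N) w : S j.+1 w = S j w + V (Ordinal jk) w.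
Proof.
rewrite /S (bigD1 (Ordinal jk))//= addrC; congr (_ + _); apply: eq_bigl => i.
by rewrite ltnS -val_eqE/= ltn_neqAle andbC.
Qed.

(** Integrating out the last copy with the partial sum frozen replaces h by [Top W h], which is good
    again and depends on one summand less. *)
Lemma Ex_partial_sum j h A : (j <= k)%N -> good h -> herm A ->
  Ex P (fun w => h (A - sc (S j w))) = iter j (Top W) h A.
Proof.
move=> + + hA; elim: j h => [|j IH] h jk gh.
  rewrite -[RHS](Ex_cst P); apply: Ex_ext => w.
  by rewrite /S big_pred0_eq scaler0 subr0.
have gT := good_Top mW pW gh.
rewrite iterSr -(IH _ (ltnW jk) gT).
pose h' X := h (A - sc (hpart X)).
have hc : l1cont h' := hcont_hpart (hcont_subZ (good_hcont gh) hA).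
have h'0 X : 0 <= h' X by have [h0 _ _] := gh; exact: h0.
pose J := Ordinal jk.
have E1 w w' : h' (S j w + V J w') = h ((A - sc (S j w)) - sc (V J w')).
  rewrite /h' hpart_id; last by apply: hermD; [exact: hS|case: (pV J w')].
  by rewrite scalerDr opprD addrA.
have K := @indep_split R d _ T P k V mV iV J h' hc h'0.
rewrite [LHS](_ : _ = Ex P (fun w => h' (S j w + V J w))); last first.
  apply: Ex_ext => w; rewrite /h' -(S_succ jk) hpart_id//; exact: hS.
apply: (etrans (congr1 fine K)).
congr fine; apply: eq_integral => w _.
have hB : herm (A - sc (S j w)) by apply: hermB => //; apply: hermZ; exact: hS.
rewrite -(Top_same_law J gh hB).
apply: (etrans _ (ExE (good_rint (mV J) (pV J) gh hB))).
by apply: eq_integral => w' _; apply: (congr1 EFin); exact: E1.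
Qed.

Lemma Ex_sum_iter h A : good h -> herm A ->
  Ex P (fun w => h (A - sc (\sum_(i < k) V i w))) = iter k (Top W) h A.
Proof.
move=> gh hA; rewrite -(Ex_partial_sum (leqnn k) gh hA); apply: Ex_ext => w.
by rewrite /S; congr (h (A - sc _)); apply: eq_bigl => i; rewrite ltn_ord.
Qed.

End Sum.
End TransferOperator.

(** * Comparison of the lazy chain with a drifted Rademacher walk *)

Section PoissonizedComparison.
Variable R : realType.
Local Notation C := (R[i]).
Variable d : nat.
Local Notation M := 'M[C]_d.
Implicit Types (h f g : M -> R) (A B X u v : M) (vs : seq M).

Lemma goodZ h (c : R) : 0 <= c -> good h -> good (fun X => c * h X).
Proof.
move=> c0 [h0 hm hl]; split.
- by move=> A; rewrite mulr_ge0.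
- by move=> A X hA pX; rewrite ler_wpM2l// hm.
- move=> A B hA hB AB; rewrite -mulrBr normrM ger0_norm// [leRHS]mulrCA.
  by rewrite ler_wpM2l// hl.
Qed.

Lemma goodD h g : good h -> good g -> good (fun X => h X + g X).
Proof.
move=> [h0 hm hl] [g0 gm gl]; split.
- by move=> A; rewrite addr_ge0.
- by move=> A X hA pX; rewrite lerD ?hm ?gm.
- move=> A B hA hB AB; rewrite opprD addrACA mulrDr (le_trans (ler_normD _ _))//.
  by rewrite lerD ?hl ?gl.
Qed.

Lemma good_shift h u : herm u -> good h -> good (fun X => h (X + u)).
Proof.
move=> hu [h0 hm hl]; split => //.
- by move=> A X hA pX; rewrite addrAC hm//; exact: hermD.
- move=> A B hA hB AB.
  have := hl (A + u) (B + u) (hermD hA hu) (hermD hB hu).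
  by rewrite opprD addrACA subrr addr0; exact.
Qed.

Lemma good_rade vs h : herms vs -> good h -> good (rade vs h).
Proof.
elim: vs h => [|v vs IH] h hvs gh //=.
have hv : herm v by apply: hvs; rewrite inE eqxx.
have g1 : good (rade vs h) by apply: IH => // x xv; apply: hvs; rewrite inE xv orbT.
have half0 : 0 <= 2^-1 :> R by rewrite invr_ge0.
have -> : (fun A => (rade vs h (A + v) + rade vs h (A - v)) / 2) =
   (fun A => 2^-1 * (rade vs h (A + v) + rade vs h (A - v))).
  by apply/funext => A; rewrite mulrC.
apply: goodZ => //; apply: goodD; apply: good_shift => //; exact: hermN.
Qed.

Lemma rad_eq_herm vs f g A : herm A -> herms vs -> (forall X, herm X -> f X = g X) ->
  rade vs f A = rade vs g A.
Proof. by move=> hA hv fg; apply/eqP; rewrite eq_le !rad_le// => X hX; rewrite fg. Qed.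

Section Operators.
Context {dT : measure_display} {T : measurableType dT}.
Variable P : probability T R.
Variable theta : R.
Hypothesis theta0 : 0 <= theta.
Variable W : T -> M.
Hypotheses (mW : mx_rv W) (pW : forall w, psdc (W w)).
Local Notation Tt := (Top P theta W).

Let gr h A : good h -> herm A -> rint P (fun w => h (A - theta%:C%C *: W w)).
Proof. by move=> gh hA; exact: (good_rint P theta0 mW pW gh hA). Qed.

Let gT h : good h -> good (Tt h).
Proof. exact: (good_Top P theta0 mW pW). Qed.

Lemma Top_le f g A : good f -> good g -> herm A -> (forall X, herm X -> f X <= g X) ->
  Tt f A <= Tt g A.
Proof.
move=> gf gg hA fg; apply: Ex_le; [exact: gr|exact: gr|move=> w].
by apply: fg; exact: herm_subZ.
Qed.

Lemma Top_rade vs h A : herms vs -> good h -> herm A -> Tt (rade vs h) A = rade vs (Tt h) A.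
Proof.
elim: vs A => [|v vs IH] A hvs gh hA //=.
have hv : herm v by apply: hvs; rewrite inE eqxx.
have hvs' : herms vs by move=> x xv; apply: hvs; rewrite inE xv orbT.
rewrite -!IH//; [|exact: hermB|exact: hermD].
have g1 : good (rade vs h) by exact: good_rade.
have h1 : herm (A + v) by exact: hermD.
have h2 : herm (A - v) by exact: hermB.
rewrite mulrC -ExD ?gr// -ExZ; last by apply: rintD; exact: gr.
apply: Ex_ext => w; rewrite [RHS]mulrC.
by rewrite [A + v - _]addrAC [A - v - _]addrAC.
Qed.

Lemma Top_decr h A : good h -> herm A -> Tt h A <= h A.
Proof.
move=> gh hA; rewrite -[leRHS](Ex_cst P); apply: Ex_le; [exact: gr|exact: rint_cst|move=> w].
by have [_ hm _] := gh; apply: hm => //; apply: psdcZ.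
Qed.

Lemma good_iterT j h : good h -> good (iter j Tt h).
Proof. by move=> gh; elim: j => //= j IH; exact: gT. Qed.

Lemma iterT_decr j h A : good h -> herm A -> iter j Tt h A <= h A.
Proof.
move=> gh hA; elim: j => //= j IH; apply: le_trans IH.
by apply: Top_decr => //; exact: good_iterT.
Qed.

Variable p : R.
Hypothesis p01 : 0 <= p <= 1.

Definition mixT h A : R := (1 - p) * h A + p * Tt h A.

Let p0 : 0 <= p. Proof. by case/andP: p01. Qed.
Let p1 : 0 <= 1 - p. Proof. by case/andP: p01 => _; rewrite subr_ge0. Qed.

Lemma good_mixT h : good h -> good (mixT h).
Proof. by move=> gh; apply: goodD; apply: goodZ => //; exact: gT. Qed.

Lemma good_iter_mixT m h : good h -> good (iter m mixT h).
Proof. by move=> gh; elim: m => //= m IH; exact: good_mixT. Qed.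

Lemma mixT_le f g A : good f -> good g -> herm A -> (forall X, herm X -> f X <= g X) ->
  mixT f A <= mixT g A.
Proof. by move=> gf gg hA fg; rewrite lerD// ler_wpM2l// ?fg// Top_le. Qed.

Lemma iter_mixT_ge (q : nat -> nat -> R) : (forall m j, 0 <= q m j) -> (forall j, q 0%N j <= 1) ->
  (forall m, q m.+1 0%N <= (1 - p) * q m 0%N) ->
  (forall m j, q m.+1 j.+1 <= (1 - p) * q m j.+1 + p * q m j) ->
  forall m j h A, good h -> herm A -> q m j * iter j Tt h A <= iter m mixT h A.
Proof.
move=> q0 q1 qa qb; elim=> [|m IH] j h A gh hA.
  have [h0 _ _] := good_iterT j gh.
  apply: (@le_trans _ _ (1 * iter j Tt h A)); first by rewrite ler_wpM2r.
  by rewrite mul1r /=; exact: iterT_decr.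
have gm := good_iter_mixT m gh; have [m0 _ _] := gm.
rewrite iterS {1}/mixT; case: j => [|j].
  have [T0 _ _] := gT gm; have [i0 _ _] := gh.
  apply: (@le_trans _ _ ((1 - p) * iter m mixT h A)); last by rewrite lerDl mulr_ge0.
  apply: (@le_trans _ _ ((1 - p) * q m 0%N * h A)); first by rewrite ler_wpM2r.
  by rewrite -mulrA ler_wpM2l//; exact: (IH 0%N).
have [j0 _ _] := good_iterT j.+1 gh.
apply: (@le_trans _ _ (((1 - p) * q m j.+1 + p * q m j) * iter j.+1 Tt h A)); first by rewrite ler_wpM2r.
rewrite mulrDl; apply: lerD.
  by rewrite -mulrA ler_wpM2l// IH.
rewrite -mulrA ler_wpM2l//= {1}/Top -ExZ; last by apply: gr => //; exact: good_iterT.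
apply: Ex_le.
- by apply: rintZ; apply: gr => //; exact: good_iterT.
- exact: gr.
- by move=> w; apply: IH => //; exact: herm_subZ.
Qed.

Variables (vs : seq M) (u : M).
Hypotheses (hvs : herms vs) (hu : herm u).

Definition stepG h A : R := rade vs h (A - u).

Lemma good_stepG h : good h -> good (stepG h).
Proof. by move=> gh; apply: (good_shift (hermN hu)); exact: good_rade. Qed.

Lemma good_iter_stepG m h : good h -> good (iter m stepG h).
Proof. by move=> gh; elim: m => //= m IH; exact: good_stepG. Qed.

Lemma iter_stepG_le m f g A : herm A -> (forall X, herm X -> f X <= g X) ->
  iter m stepG f A <= iter m stepG g A.
Proof.
move=> + fg; elim: m A => [|m IH] A hA; first exact: fg.
by apply: rad_le => //; exact: hermB.
Qed.

Lemma iter_stepGZ m f (c : R) A : iter m stepG (fun X => c * f X) A = c * iter m stepG f A.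
Proof.
elim: m A => //= m IH A; rewrite /stepG -radZ; apply: rad_ext => X; exact: IH.
Qed.

(** Both operators average over translations of the argument, hence commute; [good] supplies the
    integrability for the exchange. *)
Lemma mixT_stepG h A : good h -> herm A -> mixT (stepG h) A = stepG (mixT h) A.
Proof.
move=> gh hA; rewrite /mixT /stepG radD !radZ; congr (_ + p * _).
rewrite -Top_rade//; last exact: hermB.
by apply: Ex_ext => w; rewrite addrAC.
Qed.

Lemma mixT_iter_stepG m h A : good h -> herm A -> mixT (iter m stepG h) A = iter m stepG (mixT h) A.
Proof.
move=> gh; elim: m A => [//|m IH] A hA.
rewrite !iterS mixT_stepG//; last exact: good_iter_stepG.
by apply: rad_eq_herm => //; exact: hermB.
Qed.

(** Each new lazy step is moved inside, past the walk steps already made, and compared there on h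
    itself, the only function for which the one-step bound is known. *)
Lemma iter_mixT_le (c : R) h : 0 <= c -> good h ->
  (forall A, herm A -> mixT h A <= c * stepG h A) ->
  forall m A, herm A -> iter m mixT h A <= c ^+ m * iter m stepG h A.
Proof.
move=> c0 gh hc; elim=> [|m IH] A hA; first by rewrite expr0 mul1r.
have cm : 0 <= c ^+ m by rewrite exprn_ge0.
have gi := good_iter_stepG m gh.
have gc := goodZ cm gi.
rewrite iterS; apply: (le_trans (mixT_le (good_iter_mixT m gh) gc hA IH)).
have -> : mixT (fun X => c ^+ m * iter m stepG h X) A = c ^+ m * mixT (iter m stepG h) A.
  rewrite /mixT {1}/Top ExZ; last exact: gr.
  by rewrite mulrDr; congr (_ + _); rewrite mulrCA.
rewrite mixT_iter_stepG// exprSr -mulrA ler_wpM2l// iterSr -iter_stepGZ.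
exact: iter_stepG_le.
Qed.

Lemma iter_stepG_shift n h A : iter n stepG h A = iter n (rade vs) h (A - (n%:R : R)%:C%C *: u).
Proof.
elim: n A => [|n IH] A; first by rewrite rmorph0 scale0r subr0.
rewrite !iterS /stepG (rad_ext _ _ IH) (rad_shift _ _ _ (- _)); congr (rade _ _ _).
rewrite -natr1 rmorphD rmorph1 scalerDl scale1r; move: (_ *: u) => Y.
by rewrite opprD addrA addrAC.
Qed.

End Operators.
End PoissonizedComparison.

(** * The Poisson median and lower bounds for binomial probabilities *)

Section PoissonMedian.
Variable R : realType.
Implicit Types (x u t : R) (k n j m : nat).

Let sumexp k t : R := \sum_(i < k.+1) t ^+ i / (i`!)%:R.

Let is_derive_sumexp k t : is_derive t (1 : R) (sumexp k) (sumexp k t - t ^+ k / (k`!)%:R).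
Proof.
elim: k t => [|k IH] t.
  rewrite /sumexp big_ord1 expr0 subrr.
  rewrite (_ : (fun t => \sum_(i < 1) _) = cst (1 / (0`!)%:R)); first exact: is_derive_cst.
  by apply/funext => y; rewrite big_ord1 expr0.
have -> : sumexp k.+1 = sumexp k + (fun y => y ^+ k.+1 / (k.+1`!)%:R).
  by apply/funext => y; rewrite /sumexp big_ord_recr.
have f0 : (k`!)%:R != 0 :> R by rewrite pnatr_eq0 -lt0n fact_gt0.
have k0 : k.+1%:R != 0 :> R by rewrite pnatr_eq0.
have dk := IH t.
have dp : is_derive t (1 : R) (fun y : R => y ^+ k.+1 / (k.+1`!)%:R) (t ^+ k / (k`!)%:R).
  have dx := is_deriveZ ((k.+1`!)%:R^-1) (is_deriveX k.+1 (is_derive_id t (1 : R))).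
  rewrite (_ : (fun y => _) = (k.+1`!)%:R^-1 \*: (id ^+ k.+1)); last first.
    by apply/funext => y; rewrite /GRing.scale/= mulrC fctE.
  apply: (is_derive_eq dx); rewrite /GRing.scale/= factS natrM mulr1.
  by rewrite invfM mulrACA mulVf// mul1r mulrC.
apply: (is_derive_eq (is_deriveD dk dp)); rewrite fctE.
by rewrite -addrA -[in RHS]addrA subrr addr0 addNr addr0.
Qed.

Let pois k t : R := expR (- t) * sumexp k t.

Let is_derive_pois k t : is_derive t (1 : R) (pois k) (- (expR (- t) * (t ^+ k / (k`!)%:R))).
Proof.
have := is_derive_sumexp k t; rewrite /pois; move: (sumexp k) => S dS.
by apply: is_derive_eq; rewrite /GRing.scale/=; ring.
Qed.

Lemma exp_sub_le_exp_add x : 0 <= x -> expR x * (1 - x) <= expR (- x) * (1 + x).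
Proof.
move=> x0.
have dF (y : R) : is_derive y (1 : R) (fun y => expR y * (1 - y) - expR (- y) * (1 + y))
   (y * (expR (- y) - expR y)).
  by apply: is_derive_eq; rewrite /GRing.scale/=; ring.
have := le_of_derive_le0 x0 dF; rewrite subr0 addr0 oppr0 subrr subr_le0; apply=> y /andP[y0 _].
rewrite mulr_ge0_le0// subr_le0 ler_expR; lra.
Qed.

(* With F t = P(Poisson(t) <= k), the function u |-> F (k - u) + F (k + u) decreases on
   [0, k] from 2 F k to F 0 + F (2 k) >= 1. *)
Lemma poisson_median k : 1 / 2 <= expR (- k%:R) * \sum_(i < k.+1) (k%:R : R) ^+ i / (i`!)%:R.
Proof.
rewrite -/(sumexp k k%:R) -/(pois k k%:R).
case: k => [|k]; first by rewrite /pois /sumexp big_ord1 oppr0 expR0 expr0 divr1; lra.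
set K : R := k.+1%:R; have K0 : 0 < K by rewrite ltr0n.
have f0 : 0 < (k.+1`!)%:R :> R by rewrite ltr0n fact_gt0.
pose D u := pois k.+1 (K - u) + pois k.+1 (K + u).
pose e u := (expR (- (K - u)) * ((K - u) ^+ k.+1 / (k.+1`!)%:R)) - (expR (- (K + u)) * ((K + u) ^+ k.+1 / (k.+1`!)%:R)).
have dD (y : R) : is_derive y (1 : R) D (e y).
  have d1 : is_derive y (1 : R) (fun u => K - u) (-1) by apply: is_derive_eq; rewrite /GRing.scale/=; ring.
  have d2 : is_derive y (1 : R) (fun u => K + u) 1 by apply: is_derive_eq; rewrite /GRing.scale/=; ring.
  have c1 := @is_derive1_comp R (pois k.+1) (fun u => K - u) y _ _ (is_derive_pois k.+1 (K - y)) d1.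
  have c2 := @is_derive1_comp R (pois k.+1) (fun u => K + u) y _ _ (is_derive_pois k.+1 (K + y)) d2.
  have c3 := is_deriveD c1 c2.
  by apply: is_derive_eq c3 _; rewrite /e; move: (expR _ * _) (expR _ * _) => a b; ring.
have le := le_of_derive_le0 (ltW K0) dD.
have {le} : D K <= D 0.
  apply: le => y /andP[y0 yK]; rewrite /e subr_le0 !mulrA ler_pM2r ?invr_gt0//.
  rewrite !opprD opprK !expRD -!mulrA ler_pM2l ?expR_gt0//.
  have z0 : 0 <= y / K by rewrite divr_ge0// ltW.
  have Ky : K * (y / K) = y by rewrite mulrC divfK// gt_eqF.
  have -> : K - y = K * (1 - y / K) by rewrite mulrBr mulr1 Ky.
  have -> : K + y = K * (1 + y / K) by rewrite mulrDr mulr1 Ky.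
  have z1 : 0 <= 1 - y / K by rewrite subr_ge0 ler_pdivrMr// mul1r.
  have main : expR (K * (y / K)) * (1 - y / K) ^+ k.+1 <= expR (- (K * (y / K))) * (1 + y / K) ^+ k.+1.
    rewrite -(mulrN K) /K !expRM_natl -!exprMn.
    apply: lerXn2r; last exact: (exp_sub_le_exp_add z0).
      by rewrite nnegrE mulr_ge0 ?expR_ge0.
    by rewrite nnegrE mulr_ge0 ?expR_ge0// (addr_ge0 ler01 z0).
  rewrite Ky in main.
  by rewrite !exprMn mulrCA [leRHS]mulrCA ler_pM2l ?exprn_gt0.
rewrite /D subr0 addr0 subrr.
have -> : pois k.+1 0 = 1.
  rewrite /pois /sumexp oppr0 expR0 mul1r big_ord_recl expr0 divr1 big1 ?addr0// => i _.
  by rewrite expr0n mul0r.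
have : 0 <= pois k.+1 (K + K).
  rewrite mulr_ge0 ?expR_ge0// sumr_ge0// => i _.
  by rewrite divr_ge0// exprn_ge0// addr_ge0// ltW.
by move: (pois _ _) (pois _ _) => a b; lra.
Qed.

(** P(Bin(m, p) <= j) for p = k / n, with (1 - p)^m factored out: the ratio p / (1 - p) is k / (n -
    k). *)
Definition binq (k n m j : nat) : R :=
  (1 - k%:R / n%:R) ^+ m * \sum_(i < j.+1) ('C(m, i))%:R * (k%:R / (n%:R - k%:R)) ^+ i.

Section Binq.
Variables k n : nat.
Hypothesis kn : (k < n)%N.
Let x : R := k%:R / (n%:R - k%:R).
Let p : R := k%:R / n%:R.
Let n0 : 0 < n%:R :> R. Proof. by rewrite ltr0n (leq_ltn_trans _ kn). Qed.
Let nk0 : 0 < n%:R - k%:R :> R. Proof. by rewrite subr_gt0 ltr_nat. Qed.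
Let x0 : 0 <= x. Proof. by rewrite divr_ge0// ltW. Qed.
Let p1 : 0 <= 1 - p.
Proof. by rewrite subr_ge0 ler_pdivrMr// mul1r ler_nat ltnW. Qed.

Lemma binq_ge0 m j : 0 <= binq k n m j.
Proof.
by rewrite mulr_ge0 ?exprn_ge0// sumr_ge0// => i _; rewrite mulr_ge0 ?exprn_ge0.
Qed.

Lemma binq0 j : binq k n 0 j <= 1.
Proof.
rewrite /binq expr0 mul1r big_ord_recl bin0 expr0 mulr1 big1 ?addr0// => i _.
by rewrite bin0n mul0r.
Qed.

Lemma binqS0 m : binq k n m.+1 0 <= (1 - p) * binq k n m 0.
Proof. by rewrite /binq !big_ord1 !bin0 exprS -mulrA -/p lexx. Qed.

Lemma binqSS m j : binq k n m.+1 j.+1 <= (1 - p) * binq k n m j.+1 + p * binq k n m j.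
Proof.
rewrite /binq -/x -/p.
have -> : \sum_(i < j.+2) ('C(m.+1, i))%:R * x ^+ i =
    \sum_(i < j.+2) ('C(m, i))%:R * x ^+ i + x * \sum_(i < j.+1) ('C(m, i))%:R * x ^+ i.
  rewrite big_ord_recl [in RHS]big_ord_recl !bin0 -addrA; congr (_ + _).
  rewrite mulr_sumr -big_split/=; apply: eq_bigr => i _.
  rewrite /bump/= add1n binS natrD mulrDl exprS; congr (_ + _); exact: mulrCA.
have xp : (1 - p) * x = p.
  by rewrite /x /p; field; rewrite !gt_eqF.
rewrite exprS le_eqVlt; apply/orP; left; apply/eqP.
move: (\sum_(i < j.+2) _) (\sum_(i < j.+1) _) ((1 - p) ^+ m) => S1 S2 E.
have -> : p * (E * S2) = (1 - p) * x * (E * S2) by rewrite xp.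
move: (1 - p) x => q y; ring.
Qed.

(** Term by term comparison with the Poisson sum: for i <= k the falling factorial of n dominates (n
    - k)^i. *)
Lemma binq_ge : (1 - p) ^+ n * \sum_(i < k.+1) (k%:R : R) ^+ i / (i`!)%:R <= binq k n n k.
Proof.
rewrite /binq ler_wpM2l ?exprn_ge0//; apply: ler_sum => i _.
have ik : (i <= k)%N by rewrite -ltnS.
have f0 : 0 < (i`!)%:R :> R by rewrite ltr0n fact_gt0.
rewrite ler_pdivrMr// mulrAC -natrM bin_ffact expr_div_n mulrA ler_pdivlMr ?exprn_gt0//.
rewrite [leRHS]mulrC ler_wpM2l ?exprn_ge0//.
have -> : n%:R - k%:R = (n - k)%:R :> R by rewrite natrB// ltnW.
rewrite -natrX ler_nat.
have : forall l, (l <= k)%N -> ((n - k) ^ l <= n ^_ l)%N.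
  elim=> [|l IH] lk; first by rewrite expn0 ffactn0.
  rewrite expnSr ffactnSr leq_mul ?IH//; first exact: ltnW.
  by apply: leq_sub2l; exact: ltnW.
by apply.
Qed.

(** Replacing (1 - k / n)^n by exp (- k) costs the factor exp (- 2 k^2 / n) by [ln_ge_quad], whose
    range requires 2 k <= n; the median bound gives the 1 / 2. *)
Lemma binq_lower : (2 * k <= n)%N -> expR (- (2 * k%:R ^+ 2 / n%:R)) / 2 <= binq k n n k.
Proof.
move=> kn2; apply: le_trans binq_ge.
have p2 : p <= 1 / 2.
  by rewrite ler_pdivrMr// mulrAC mul1r ler_pdivlMr// -natrM ler_nat mulnC.
have pp : 0 <= p by rewrite divr_ge0// ltW.
have H : expR (- k%:R - 2 * k%:R ^+ 2 / n%:R) <= (1 - p) ^+ n.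
  have l := @ln_ge_quad R (- p); rewrite normrN ger0_norm// in l; have {}l := l p2.
  have q0 : 0 < 1 - p by lra.
  rewrite -[1 - p]lnK ?posrE// -expRM_natl ler_expR.
  have := ler_wpM2l (ltW n0) l; apply: le_trans.
  rewrite /p le_eqVlt; apply/orP; left; apply/eqP; field.
  by rewrite gt_eqF.
have med := poisson_median k.
have S0 : 0 <= \sum_(i < k.+1) (k%:R : R) ^+ i / (i`!)%:R.
  by rewrite sumr_ge0// => i _; rewrite divr_ge0// exprn_ge0.
apply: (le_trans _ (ler_wpM2r S0 H)); rewrite expRD.
rewrite [expR (- k%:R) * _]mulrC -[leRHS]mulrA ler_wpM2l ?expR_ge0//.
by rewrite -[2^-1]mul1r.
Qed.

End Binq.
End PoissonMedian.

(** * The central limit theorem for a power of a cosine *)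

Section CosPower.
Variable R : realType.
Implicit Types (a x : R) (n : nat).

Lemma expR_cvg0 (b c : R) : expR (b + c * n.+1%:R^-1) @[n --> \oo] --> expR b.
Proof.
apply: continuous_cvg; first exact: continuous_expR.
rewrite -[in X in _ --> X](addr0 b); apply: (@cvgD _ R^o); first exact: cvg_cst.
rewrite -[in X in _ --> X](mulr0 c); apply: cvgM; first exact: cvg_cst.
exact: cvg_harmonic.
Qed.

(** Taylor bounds of orders two and four enclose the power between two exponentials whose exponents
    differ from the limit by O(1 / n). *)
Lemma cos_pow_cvg a : cos ((Num.sqrt n.+1%:R)^-1 * a) ^+ n.+1 @[n --> \oo] --> expR (- (a ^+ 2 / 2)).
Proof.
pose x n := (Num.sqrt n.+1%:R)^-1 * `|a|.
have ev n : cos ((Num.sqrt n.+1%:R)^-1 * a) = cos (x n).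
  by rewrite /x; have [a0|a0] := leP 0 a; [rewrite ger0_norm|rewrite ltr0_norm// mulrN cosN].
have x0 n : 0 <= x n by rewrite mulr_ge0// invr_ge0 sqrtr_ge0.
have nx n : n.+1%:R * x n ^+ 2 = a ^+ 2.
  rewrite exprMn exprVn sqr_sqrtr// mulrA mulfV ?pnatr_eq0// mul1r real_normK// num_real//.
have x4 n : n.+1%:R * x n ^+ 4 = a ^+ 4 * n.+1%:R^-1.
  have n0 : n.+1%:R != 0 :> R by rewrite pnatr_eq0.
  have -> : a ^+ 4 = (n.+1%:R * x n ^+ 2) ^+ 2 by rewrite nx -exprM.
  by field; rewrite nat1r.
under eq_fun do rewrite ev.
apply: (@squeeze_cvgr _ _ _ _ (fun n => expR (- (a ^+ 2 / 2) + - (a ^+ 4 / 2) * n.+1%:R^-1))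
   (fun n => expR (- (a ^+ 2 / 2) + (a ^+ 4 / 24) * n.+1%:R^-1))); [|exact: expR_cvg0|exact: expR_cvg0].
exists (Num.truncn (a ^+ 2)).+1 => // n /= an.
have x21 : x n ^+ 2 <= 1.
  rewrite -(ler_pM2l (x := n.+1%:R)) ?ltr0n// nx mulr1.
  by apply: (le_trans (ltW (truncnS_gt _))); rewrite ler_nat (leq_trans an).
have c1 := cos_ge_quad (x0 n); have c2 := cos_le_quart (x0 n).
have t : `|- (x n ^+ 2 / 2)| <= 1 / 2.
  by rewrite normrN ger0_norm ?divr_ge0 ?exprn_ge0//; lra.
have l := ln_ge_quad t.
have pos : 0 < 1 - x n ^+ 2 / 2 by move: t; rewrite normrN ger0_norm ?divr_ge0 ?exprn_ge0//; lra.
have pc : 0 < cos (x n) by exact: lt_le_trans c1.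
apply/andP; split.
  have -> : - (a ^+ 2 / 2) + - (a ^+ 4 / 2) * n.+1%:R^-1 = n.+1%:R * (- (x n ^+ 2 / 2) - 2 * (- (x n ^+ 2 / 2)) ^+ 2).
    rewrite -(nx n) [- (a ^+ 4 / 2) * _](_ : _ = - (1 / 2) * (a ^+ 4 * n.+1%:R^-1)); last by field; rewrite nat1r.
    by rewrite -x4; move: (n.+1%:R) (x n) => m y; field.
  rewrite expRM_natl; apply: lerXn2r; rewrite ?nnegrE ?expR_ge0// ?(ltW pc)//.
  apply: le_trans c1; rewrite -[leRHS]lnK ?posrE// ler_expR; exact: l.
have -> : - (a ^+ 2 / 2) + (a ^+ 4 / 24) * n.+1%:R^-1 = n.+1%:R * (- (x n ^+ 2 / 2) + x n ^+ 4 / 24).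
  rewrite -(nx n) [(a ^+ 4 / 24) * _](_ : _ = (1 / 24) * (a ^+ 4 * n.+1%:R^-1)); last by field; rewrite nat1r.
  by rewrite -x4; move: (n.+1%:R) (x n) => m y; field.
rewrite expRM_natl; apply: lerXn2r; rewrite ?nnegrE ?expR_ge0// ?(ltW pc)//.
apply: (le_trans c2); rewrite -addrA; exact: expR_ge1Dx.
Qed.

End CosPower.

(** * Binomial averages *)

Section BernoulliAverage.
Variable R : realType.
Implicit Types (y c : R) (g : nat -> R) (N : nat).

(** Expectation of g under Binomial(N, y), a polynomial in y: the Bernstein polynomial of the values
    g l. *)
Fixpoint bav N y g : R :=
  if N is N'.+1 then y * bav N' y (fun l => g l.+1) + (1 - y) * bav N' y g else g 0%N.

Lemma bav_le N y g g' : 0 <= y <= 1 -> (forall l, g l <= g' l) -> bav N y g <= bav N y g'.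
Proof.
move=> /andP[y0 y1]; elim: N g g' => [|N IH] g g' gg; first exact: gg.
by rewrite /= lerD// ler_wpM2l ?subr_ge0// IH.
Qed.

Lemma bavD N y g g' : bav N y (fun l => g l + g' l) = bav N y g + bav N y g'.
Proof. by elim: N g g' => [|N IH] g g' //=; rewrite !IH; ring. Qed.

Lemma bavZ N y g c : bav N y (fun l => c * g l) = c * bav N y g.
Proof. by elim: N g => [|N IH] g //=; rewrite !IH; ring. Qed.

Lemma bav_cst N y c : bav N y (fun=> c) = c.
Proof. by elim: N => [|N IH] //=; rewrite !IH; ring. Qed.

Lemma bav_ext N y g g' : (forall l, g l = g' l) -> bav N y g = bav N y g'.
Proof. by move=> /funext ->. Qed.

Lemma bav_sqr N y c : bav N y (fun l => (l%:R + c) ^+ 2) = (N%:R * y + c) ^+ 2 + N%:R * y * (1 - y).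
Proof.
elim: N c => [|N IH] c /=; first by rewrite !mul0r addr0 add0r.
rewrite (@bav_ext N y _ (fun l => (l%:R + (1 + c)) ^+ 2)) => [|l]; last by rewrite -natr1 addrA.
by rewrite !IH -natr1; ring.
Qed.

Lemma bav_abs N y g c e : 0 <= y <= 1 -> (forall l, `|g l - c| <= e l) -> `|bav N y g - c| <= bav N y e.
Proof.
move=> y01 ge; rewrite ler_norml; apply/andP; split.
  rewrite lerBrDr -{1}(bav_cst N y c) addrC -mulN1r -bavZ -bavD; apply: bav_le => // l.
  by have := ge l; rewrite ler_norml lerBrDr mulN1r => /andP[+ _]; rewrite addrC.
rewrite lerBlDr; apply: (@le_trans _ _ (bav N y e + bav N y (fun=> c))); last by rewrite bav_cst.
rewrite -bavD; apply: bav_le => // l.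
by have := ge l; rewrite ler_norml lerBlDr => /andP[].
Qed.

End BernoulliAverage.

(** * Approximation of Lipschitz functions of a matrix by trigonometric sums *)

Section TrigonometricSums.
Variable R : realType.
Local Notation C := (R[i]).
Variable d : nat.
Local Notation M := 'M[C]_d.
Implicit Types (f g h : M -> R) (X Y A : M).

(** The linear span of the functions on which both the Rademacher average and the Gaussian
    expectation are explicit; it is an algebra by the product formula for cosines. *)
Inductive trig : (M -> R) -> Prop :=
| trig_cos A (c : R) : trig (fun X => cos (rtr A X + c))
| trigD f g : trig f -> trig g -> trig (fun X => f X + g X)
| trigZ (c : R) f : trig f -> trig (fun X => c * f X).

Lemma trig_ext f g : (forall X, f X = g X) -> trig f -> trig g.
Proof. by move=> /funext ->. Qed.

Lemma trig_cst (c : R) : trig (fun=> c).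
Proof.
apply: trig_ext (trigZ c (trig_cos 0 0)) => X.
by rewrite /rtr mul0mx mxtrace0 addr0 cos0 mulr1.
Qed.

Lemma trigM f g : trig f -> trig g -> trig (fun X => f X * g X).
Proof.
move=> tf tg; elim: tf => [A a|f1 f2 _ IH1 _ IH2|c f1 _ IH]; last 2 first.
- by apply: trig_ext (trigD IH1 IH2) => X; rewrite mulrDl.
- by apply: trig_ext (trigZ c IH) => X; rewrite mulrA.
elim: tg => [B b|g1 g2 _ IH1 _ IH2|c g1 _ IH]; last 2 first.
- by apply: trig_ext (trigD IH1 IH2) => X; rewrite mulrDr.
- by apply: trig_ext (trigZ c IH) => X; rewrite mulrCA.
apply: trig_ext (trigZ (1 / 2) (trigD (trig_cos (A + B) (a + b)) (trig_cos (A - B) (a - b)))) => X.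
have -> : rtr (A + B) X + (a + b) = (rtr A X + a) + (rtr B X + b) by rewrite rtrDl addrACA.
have -> : rtr (A - B) X + (a - b) = (rtr A X + a) - (rtr B X + b) by rewrite rtrBl opprD addrACA.
move: (rtr A X + a) (rtr B X + b) => x y; rewrite !cosD cosN sinN; by field.
Qed.

Lemma trig_sin A (c : R) : trig (fun X => sin (rtr A X + c)).
Proof.
apply: trig_ext (trig_cos A (c - pi / 2)) => X; rewrite addrA.
by rewrite cosD cosN sinN cos_pihalf sin_pihalf; ring.
Qed.

Lemma trig_bav N (y : M -> R) (G : nat -> M -> R) : trig y -> (forall l, trig (G l)) ->
  trig (fun X => bav N (y X) (fun l => G l X)).
Proof.
move=> ty; elim: N G => [|N IH] G tG /=; first exact: tG.
have t1 := trigM ty (IH (fun l => G l.+1) (fun l => tG l.+1)).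
have ty1 : trig (fun X => 1 - y X).
  by apply: trig_ext (trigD (trig_cst 1) (trigZ (-1) ty)) => X; rewrite mulN1r.
exact: (trigD t1 (trigM ty1 (IH G tG))).
Qed.

Section Approximation.
Variables (N : nat) (K eta : R).
Hypotheses (N0 : (0 < N)%N) (K0 : 0 < K) (eta0 : 0 < eta).

Let node (l : nat) : R := K * (2 * l%:R / N%:R - 1).
Let yco (F X : M) : R := (1 + sin (rtr F X / K)) / 2.

(* The average of [h] at independent binomial nodes replacing the coordinates of [X]: for
   fixed [Y] it is a trigonometric polynomial in [X], and it is close to [h (Y + X)]. *)
Fixpoint app (ps : seq (M * M)) h X Y : R :=
  if ps is (E, F) :: ps' then
    bav N ((1 + sin (rtr F X / K)) / 2)
      (fun l => app ps' h X (Y + (K * (2 * l%:R / N%:R - 1))%:C%C *: E))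
  else h Y.

Lemma trig_app ps h Y : trig (fun X => app ps h X Y).
Proof.
elim: ps Y => [|[E F] ps IH] Y /=; first exact: trig_cst.
apply: (@trig_bav N (yco F) (fun l X => app ps h X _)) => [|l]; last exact: IH.
apply: trig_ext (trigZ (1 / 2) (trigD (trig_cst 1) (trig_sin (K^-1%:C%C *: F) 0))) => X.
by rewrite rtrZl addr0 /yco [K^-1 * _]mulrC mul1r [LHS]mulrC.
Qed.

Let am_gm (t : R) : `|t| <= t ^+ 2 / (2 * eta) + eta / 2.
Proof.
rewrite -(real_normK (num_real t)) -subr_ge0; move: `|t| => s.
have -> : s ^+ 2 / (2 * eta) + eta / 2 - s = (s - eta) ^+ 2 / (2 * eta) by field; rewrite gt_eqF.
by rewrite divr_ge0 ?sqr_ge0// mulr_ge0// ltW.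
Qed.

Let yco01 F X : 0 <= yco F X <= 1.
Proof.
rewrite /yco; have := sin_geN1 (rtr F X / K); have := sin_le1 (rtr F X / K).
by move: (sin _) => z h1 h2; apply/andP; split; lra.
Qed.

(** The node has mean K sin (x / K). Its fluctuation is estimated by the binomial variance through
    |t| <= t^2 / (2 eta) + eta / 2, and the distance from K sin (x / K) to x by x^2 / (2 K). The
    resulting bound is quadratic in x, so that second moments control it. *)
Let node_err F X : bav N (yco F X) (fun l => `|node l - rtr F X|) <=
  K ^+ 2 / (2 * N%:R * eta) + eta / 2 + rtr F X ^+ 2 / (2 * K).
Proof.
set x := rtr F X; set y := yco F X.
have n0 : 0 < N%:R :> R by rewrite ltr0n.
have ys : K * sin (x / K) = K * (2 * y - 1) by rewrite /y /yco; field.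
have h1 l : `|node l - x| <= (2 * K ^+ 2 / (N%:R ^+ 2 * eta)) * (l%:R + (- (N%:R * y))) ^+ 2 + (eta / 2 + x ^+ 2 / (2 * K)).
  have -> : node l - x = (node l - K * sin (x / K)) + (K * (sin (x / K) - x / K)).
    by rewrite mulrBr [K * (x / K)]mulrC divfK ?gt_eqF// addrA subrK.
  apply: (le_trans (ler_normD _ _)); rewrite addrA; apply: lerD.
    rewrite ys; apply: (le_trans (am_gm _)); rewrite lerD2r le_eqVlt; apply/orP; left; apply/eqP.
    by rewrite /node; field; rewrite !gt_eqF.
  rewrite normrM (gtr0_norm K0); apply: (le_trans (ler_wpM2l (ltW K0) (sin_sub_id _))).
  by rewrite le_eqVlt; apply/orP; left; apply/eqP; field; rewrite gt_eqF.
apply: (le_trans (bav_le (N) (yco01 F X) h1)).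
rewrite bavD bavZ bav_cst bav_sqr -/y addrN expr0n/= add0r addrA lerD2r lerD2r.
have y4 : y * (1 - y) <= 1 / 4 by have := sqr_ge0 (y - 1 / 2); lra.
have -> : K ^+ 2 / (2 * N%:R * eta) = (2 * K ^+ 2 / (N%:R ^+ 2 * eta)) * (N%:R * (1 / 4)).
  by field; rewrite !gt_eqF.
rewrite ler_wpM2l//; last by rewrite -mulrA ler_wpM2l// ltW.
by rewrite divr_ge0 ?mulr_ge0 ?exprn_ge0// ltW.
Qed.

(** Coordinates are replaced one at a time; since l1 E <= 1, moving a node changes h by at most the
    displacement of the node. *)
Lemma app_err ps h X Y : (forall A B, `|h A - h B| <= l1 (A - B)) ->
  (forall q, q \in ps -> l1 q.1 <= 1) ->
  `|app ps h X Y - h (Y + \sum_(q <- ps) (rtr q.2 X)%:C%C *: q.1)| <=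
  \sum_(q <- ps) (K ^+ 2 / (2 * N%:R * eta) + eta / 2 + rtr q.2 X ^+ 2 / (2 * K)).
Proof.
move=> hl; elim: ps Y => [|[E F] ps IH] Y q1; first by rewrite !big_nil addr0 subrr normr0.
have E1 : l1 E <= 1 by apply: (q1 (E, F)); rewrite inE eqxx.
have q1' q : q \in ps -> l1 q.1 <= 1 by move=> qp; apply: q1; rewrite inE qp orbT.
rewrite !big_cons /=; set S := \sum_(q <- ps) _ *: _; set Er := \sum_(q <- ps) _.
have H l : `|app ps h X (Y + (node l)%:C%C *: E) - h (Y + ((rtr F X)%:C%C *: E + S))| <= `|node l - rtr F X| + Er.
  apply: (le_trans (ler_distD (h (Y + (node l)%:C%C *: E + S)) _ _)).
  rewrite [leRHS]addrC; apply: lerD; first exact: (IH _ q1').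
  apply: (le_trans (hl _ _)).
  have -> : Y + (node l)%:C%C *: E + S - (Y + ((rtr F X)%:C%C *: E + S)) = (node l - rtr F X)%:C%C *: E.
    by rewrite rmorphB scalerBl; move: (_ *: E) (_ *: E) => U V; rewrite !addrA opprD addrACA subrr addr0 opprD addrACA subrr add0r.
  by rewrite l1Z ler_piMr.
apply: (le_trans (bav_abs N (yco01 F X) H)).
by rewrite bavD bav_cst lerD2r.
Qed.

End Approximation.
End TrigonometricSums.

(** * A one-sided central limit theorem for Lipschitz functions of Rademacher sums *)

Section CentralLimit.
Variable R : realType.
Local Notation C := (R[i]).
Variable d : nat.
Local Notation M := 'M[C]_d.
Implicit Types (f g h : M -> R) (X Y A : M) (vs ws : seq M).

Lemma iter_rade n ws h A : iter n (rade ws) h A = rade (flatten (nseq n ws)) h A.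
Proof.
elim: n A => [//|n IH] A; rewrite iterS /= rad_cat; apply: rad_ext => X; exact: IH.
Qed.

Lemma rtr_delta (i j : 'I_d) X : \tr (delta_mx j i *m X) = X i j.
Proof.
rewrite /mxtrace (bigD1 j)//= mxE (bigD1 i)//= mxE !eqxx mul1r !big1 ?addr0// => [k kj|l li].
  by rewrite mxE big1// => l _; rewrite mxE (negbTE kj) mul0r.
by rewrite mxE (negbTE li) andbF mul0r.
Qed.

Definition imagi : C := (0 +i* 1)%C.

(** The 2 d^2 real coordinates of a complex matrix, each as a pair of a basis element and the matrix
    representing its coordinate under [rtr]. *)
Definition coords : seq (M * M) :=
  [seq (delta_mx ij.1 ij.2, delta_mx ij.2 ij.1) | ij <- index_enum ('I_d * 'I_d)%type] ++
  [seq (imagi *: delta_mx ij.1 ij.2, (- imagi) *: delta_mx ij.2 ij.1) | ij <- index_enum ('I_d * 'I_d)%type].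

Lemma coords_sum X : \sum_(q <- coords) (rtr q.2 X)%:C%C *: q.1 = X.
Proof.
rewrite big_cat !big_map/= -big_split/= [RHS]matrix_sum_delta pair_big/=.
apply: eq_bigr => -[i j] _ /=; rewrite /rtr -scalemxAl mxtraceZ !rtr_delta scalerA -scalerDl.
congr (_ *: _); case: (X i j) => x y; rewrite /imagi.
by apply/eqP; rewrite eq_complex/=; apply/andP; split; apply/eqP; ring.
Qed.

Lemma coords_l1 q : q \in coords -> l1 q.1 <= 1.
Proof.
have ld i j : l1 (delta_mx i j : M) <= 1.
  rewrite /l1 (bigD1 i)//= (bigD1 j)//= mxE !eqxx !big1 ?addr0// => [||k kj].
  - by rewrite -[1]/((1 : R)%:C%C) cabs_real normr1.
  - by move=> k ki; rewrite big1// => l _; rewrite mxE (negbTE ki) cabs0.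
  - by rewrite mxE (negbTE kj) andbF cabs0.
rewrite mem_cat => /orP[] /mapP[[i j] _ ->] //=.
apply: le_trans (ld i j); rewrite /l1; apply: ler_sum => k _; apply: ler_sum => l _.
by rewrite mxE cabsM (_ : cabs imagi = 1) ?mul1r// /cabs /imagi /= expr0n expr1n add0r sqrtr1.
Qed.

Variable vs : seq M.
Hypothesis hvs : herms vs.
Let s n : R := (Num.sqrt n%:R)^-1.
Let big n : seq M := flatten (nseq n (scal (s n) vs)).

Let herms_big n : herms (big n).
Proof.
move=> v /flattenP[ws]; rewrite mem_nseq => /andP[_ /eqP ->]; exact: (herms_scal hvs).
Qed.

Let sum_big (F : R -> R) (l : M -> R) n : (forall v, l ((s n)%:C%C *: v) = s n * l v) ->
  \sum_(v <- big n) F (l v) = n%:R * \sum_(v <- vs) F (s n * l v).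
Proof.
move=> lZ; rewrite /big; elim: {1 3}n => [|m IH] /=; first by rewrite big_nil mul0r.
rewrite big_cat IH big_map/= -natr1 [in RHS]addrC mulrDl mul1r; congr (_ + _).
by apply: eq_bigr => v _; rewrite lZ.
Qed.

Context {dT : measure_display} {T : measurableType dT}.
Variable P : probability T R.
Variable Z : T -> M.
Hypothesis mZ : forall A, measurable_fun setT (fun w => rtr A (Z w)).
Hypothesis Zcos : forall A (c : R), Ex P (fun w => cos (rtr A (Z w) + c)) =
  expR (- ((\sum_(v <- vs) rtr A v ^+ 2) / 2)) * cos c.
Hypothesis Zsqr : forall A, rint P (fun w => rtr A (Z w) ^+ 2).

Lemma trig_rint f : trig f -> rint P (fun w => f (Z w)).
Proof.
elim=> [A c|f1 f2 _ IH1 _ IH2|c f1 _ IH]; last 2 first.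
- exact: rintD.
- exact: rintZ.
apply: (@rint_bd _ _ _ P _ 1) => [|w]; last by rewrite ler_norml cos_geN1 cos_le1.
apply: measurableT_comp; last by apply: measurable_funD.
by apply: continuous_measurable_fun; exact: continuous_cos.
Qed.

Lemma clt_trig f : trig f -> rade (big n.+1) f 0 @[n --> \oo] --> Ex P (fun w => f (Z w)).
Proof.
elim=> [A c|f1 f2 t1 IH1 t2 IH2|c f1 t1 IH]; last 2 first.
- rewrite ExD ?trig_rint//; under eq_fun do rewrite radD.
  exact: (@cvgD _ R^o).
- rewrite ExZ ?trig_rint//; under eq_fun do rewrite radZ.
  by apply: cvgM => //; exact: cvg_cst.
have lA : addl (rtr A) by move=> X Y; rewrite rtrDr.
rewrite Zcos.
have -> : (fun n => rade (big n.+1) (fun X => cos (rtr A X + c)) 0) =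
    (fun n => (\prod_(v <- vs) cos ((Num.sqrt n.+1%:R)^-1 * rtr A v) ^+ n.+1) * cos c).
  apply/funext => n; rewrite rad_cos// (addl0 lA) add0r; congr (_ * _).
  rewrite prodrXl /big; elim: {1 4}n.+1 => [|m IH] /=; first by rewrite big_nil expr0.
  rewrite big_cat IH big_map exprS; congr (_ * _).
  by apply: eq_bigr => v _; rewrite rtrZr.
apply: cvgM; last exact: cvg_cst.
have -> : expR (- ((\sum_(v <- vs) rtr A v ^+ 2) / 2)) = \prod_(v <- vs) expR (- (rtr A v ^+ 2 / 2)).
  elim: (vs) => [|v ws IH]; first by rewrite !big_nil mul0r oppr0 expR0.
  by rewrite !big_cons -IH -expRD mulrDl opprD.
elim: (vs) => [|v ws IH].
  by under eq_fun do rewrite big_nil; rewrite big_nil; exact: cvg_cst.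
under eq_fun do rewrite big_cons; rewrite big_cons.
by apply: cvgM; [exact: cos_pow_cvg|exact: IH].
Qed.

(** h is replaced by a trigonometric sum with an error D of quadratic growth. The mean of D under
    the walk is the same for all n, so the approximation is uniform in n and the limit is needed for
    one trigonometric sum only. *)
Lemma clt_lip h (e : R) : (forall A B, `|h A - h B| <= l1 (A - B)) -> rint P (fun w => h (Z w)) -> 0 < e ->
  \forall n \near \oo, iter n.+1 (rade (scal (Num.sqrt n.+1%:R)^-1 vs)) h 0 <= Ex P (fun w => h (Z w)) + e.
Proof.
move=> hl hZ e0.
pose S1 := \sum_(q <- coords) \sum_(v <- vs) rtr q.2 v ^+ 2.
pose S2 := \sum_(q <- coords) Ex P (fun w => rtr q.2 (Z w) ^+ 2).
pose L : R := (size coords)%:R.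
have S10 : 0 <= S1 by rewrite sumr_ge0// => q _; rewrite sumr_ge0// => v _; exact: sqr_ge0.
have S20 : 0 <= S2 by rewrite sumr_ge0// => q _; apply: Ex_ge0 => w; exact: sqr_ge0.
have L0 : 0 <= L by [].
(* K is fixed first and reduces the quadratic part of both errors to e / 2; eta and then N bring the
   constant parts to e / 4, and e / 4 is left for the limit. *)
pose K := (S1 + S2) / e + 1.
have K0 : 0 < K by rewrite ltr_wpDl// divr_ge0 ?addr_ge0// ltW.
pose eta := e / (8 * (L + 1)).
have eta0 : 0 < eta by rewrite divr_gt0// mulr_gt0// ltr_wpDl.
pose N := (Num.truncn (8 * L * K ^+ 2 / (eta * e))).+1.
have N0 : (0 < N)%N by [].
have Nb : 8 * L * K ^+ 2 / (eta * e) <= N%:R by apply: ltW; exact: truncnS_gt.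
pose D X := \sum_(q <- coords) (K ^+ 2 / (2 * N%:R * eta) + eta / 2 + rtr q.2 X ^+ 2 / (2 * K)).
pose f X := app N K coords h X 0.
have tf : trig f by exact: trig_app.
have err X : `|f X - h X| <= D X.
  have := @app_err R d N K eta N0 K0 eta0 coords h X 0 hl coords_l1.
  by rewrite add0r coords_sum.
pose c0 := K ^+ 2 / (2 * N%:R * eta) + eta / 2.
have DE X : D X = L * c0 + (2 * K)^-1 * \sum_(q <- coords) rtr q.2 X ^+ 2.
  rewrite /D big_split/= big_const_seq count_predT iter_addr_0; congr (_ + _); first by rewrite -[LHS]mulr_natl.
  by rewrite mulr_sumr; apply: eq_bigr => q _; rewrite mulrC.
have ED : Ex P (fun w => D (Z w)) = L * c0 + (2 * K)^-1 * S2.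
  rewrite (Ex_ext _ (fun w => DE (Z w))) ExD ?Ex_cst ?ExZ ?Ex_sum//.
  - exact: rint_sum.
  - exact: rint_cst.
  - by apply: rintZ; exact: rint_sum.
have rD : rint P (fun w => D (Z w)).
  apply: (rint_ext (fun w => esym (DE (Z w)))); apply: rintD; first exact: rint_cst.
  by apply: rintZ; exact: rint_sum.
have RD n : rade (big n.+1) D 0 = L * c0 + (2 * K)^-1 * S1.
  rewrite (rad_ext _ _ DE) radD rad_cst radZ; congr (_ + _ * _).
  rewrite /S1; elim: (coords) => [|q qs IH].
    by rewrite big_nil -[RHS](rad_cst (big n.+1) 0 0); apply: rad_ext => X; rewrite big_nil.
  rewrite big_cons -IH -[X in X + _](_ : rade (big n.+1) (fun X => rtr q.2 X ^+ 2) 0 = _).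
    by rewrite -radD; apply: rad_ext => X; rewrite big_cons.
  have lA : addl (rtr q.2) by move=> X Y; rewrite rtrDr.
  rewrite rad_sqr// (addl0 lA) expr0n/= add0r (@sum_big (fun x => x ^+ 2)) => [|v]; last by rewrite rtrZr.
  rewrite mulr_sumr; apply: eq_bigr => v _; rewrite exprMn mulrA exprVn sqr_sqrtr//.
  by rewrite mulfV ?mul1r// pnatr_eq0.
have small : 2 * (L * c0) + (2 * K)^-1 * (S1 + S2) <= e * (3 / 4).
  have t1 : (2 * K)^-1 * (S1 + S2) <= e / 2.
    rewrite invfM -mulrA mulrC ler_pM2r ?invr_gt0// ler_pdivrMl// mulrC.
    by rewrite /K mulrDr mulr1 mulrC divfK ?gt_eqF// lerDl ltW.
  have t2 : L * eta <= e / 8.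
    have y0 : 0 < L + 1 by rewrite ltr_wpDl.
    have -> : L * eta = (e / 8) * (L / (L + 1)) by rewrite /eta; field; rewrite gt_eqF.
    rewrite ler_piMr ?divr_ge0 ?(ltW e0)//.
    by rewrite (ler_pdivrMr _ _ y0) mul1r lerDl.
  have t3 : L * (K ^+ 2 / (N%:R * eta)) <= e / 8.
    have Ne : 0 < N%:R * eta by apply: mulr_gt0 => //; rewrite ltr0n.
    have ee : 0 < eta * e by exact: (mulr_gt0 eta0 e0).
    rewrite mulrA (ler_pdivrMr _ _ Ne).
    move: Nb; rewrite (ler_pdivrMr _ _ ee).
    move: (N%:R) (K ^+ 2) => n k2 Nb.
    have : 8 * (L * k2) <= n * (eta * e) by rewrite mulrA.
    have -> : e / 8 * (n * eta) = n * (eta * e) / 8 by ring.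
    by move: (L * k2) (n * (eta * e)) => a b; lra.
  have -> : 2 * (L * c0) = L * (K ^+ 2 / (N%:R * eta)) + L * eta.
    by rewrite /c0; field; rewrite !gt_eqF// ltr0n.
  by move: t1 t2 t3; move: (_^-1 * _) (L * eta) (L * _) => a b c; lra.
have e40 : 0 < e / 4 by rewrite divr_gt0.
have /cvgrPdist_le /(_ _ e40) := clt_trig tf.
apply: filterS => n hn.
rewrite iter_rade -/(s n.+1) -/(big n.+1).
have b1 : rade (big n.+1) h 0 <= rade (big n.+1) f 0 + (L * c0 + (2 * K)^-1 * S1).
  rewrite -(RD n) -radD; apply: rad_le => //; first exact: herm0.
  by move=> X _; have := err X; rewrite ler_norml => /andP[+ _]; rewrite lerBrDr addrC lerBlDr addrC.
have b2 : Ex P (fun w => f (Z w)) <= Ex P (fun w => h (Z w)) + (L * c0 + (2 * K)^-1 * S2).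
  rewrite -ED -ExD//; apply: Ex_le; [exact: trig_rint|exact: rintD|move=> w].
  by have := err (Z w); rewrite ler_norml => /andP[_]; rewrite lerBlDl.
move: hn; rewrite distrC ler_norml => /andP[_ b3]; move: b1 b2 b3 small; rewrite (mulrDr (2 * K)^-1).
move: (rade _ h 0) (rade _ f 0) (Ex P _) (Ex P _) (L * c0) (_ * S1) (_ * S2) => x1 x2 x3 x4 x5 x6 x7.
by move=> *; lra.
Qed.

End CentralLimit.

(** * Nonnegative real quadratic forms as sums of squares *)

Section SumOfSquares.
Variable R : realType.
Local Notation C := (R[i]).

(** Spectral decomposition of the Gram matrix; eigenvectors are complex, so each contributes the
    squares of two real forms. *)
Lemma gram_sum_squares n (g : 'I_n -> 'I_n -> R) : (forall p q, g p q = g q p) ->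
  (forall a : 'I_n -> R, 0 <= \sum_p \sum_q a p * a q * g p q) ->
  exists ls : seq ('I_n -> R), forall a : 'I_n -> R,
    \sum_(l <- ls) (\sum_p a p * l p) ^+ 2 = \sum_p \sum_q a p * a q * g p q.
Proof.
move=> gs g0; pose G : 'M[C]_n := \matrix_(p, q) (g p q)%:C%C.
have hG : herm G.
  by apply/matrixP => p q; rewrite adjmxE !mxE -gs; apply/eqP; rewrite eq_complex/= oppr0 !eqxx.
have pG : psdc G.
  split=> // u; rewrite quad_sum Re_sum.
  have -> : \sum_j complex.Re (\sum_k conjc (u j 0) * G j k * u k 0) =
    \sum_j \sum_k complex.Re (u j 0) * complex.Re (u k 0) * g j k +
    \sum_j \sum_k complex.Im (u j 0) * complex.Im (u k 0) * g j k.
    rewrite -big_split; apply: eq_bigr => j _; rewrite Re_sum -big_split; apply: eq_bigr => k _.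
    rewrite mxE; case: (u j 0) => x y; case: (u k 0) => x' y' /=; ring.
  by rewrite addr_ge0.
have [UU GE] := specP hG; set U := sbas G in UU GE.
have l0 k : 0 <= seig G k.
  have n0 : (0 < n)%N by exact: leq_ltn_trans (ltn_ord k).
  have [lo _] := lmin_seig n0 hG; apply: le_trans (lo k).
  by rewrite -(rmin_lmin n0 hG); have /(psdc_rmin _ n0)[] := pG.
have gE p q : g p q = \sum_k seig G k * (complex.Re (U k p) * complex.Re (U k q) + complex.Im (U k p) * complex.Im (U k q)).
  have : complex.Re (G p q) = g p q by rewrite mxE.
  rewrite {1}GE /fmx -mulmxA mxE Re_sum => <-; apply: eq_bigr => k _.
  rewrite rdiagME adjmxE; case: (U k p) => x y; case: (U k q) => x' y' /=; ring.
exists ([seq (fun p => Num.sqrt (seig G k) * complex.Re (U k p)) | k <- index_enum 'I_n] ++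
        [seq (fun p => Num.sqrt (seig G k) * complex.Im (U k p)) | k <- index_enum 'I_n]) => a.
have sq (r : 'I_n -> 'I_n -> R) k : (\sum_p a p * (Num.sqrt (seig G k) * r k p)) ^+ 2 =
   \sum_p \sum_q a p * a q * (seig G k * (r k p * r k q)).
  rewrite expr2 mulr_suml; apply: eq_bigr => p _; rewrite mulr_sumr; apply: eq_bigr => q _.
  by rewrite -[in RHS](sqr_sqrtr (l0 k)); ring.
rewrite big_cat !big_map/= -big_split/=.
under eq_bigr => k _ do rewrite (sq (fun k p => complex.Re (U k p))) (sq (fun k p => complex.Im (U k p))).
under eq_bigr => k _ do rewrite -big_split/=.
rewrite exchange_big/=; apply: eq_bigr => p _.
under eq_bigr => k _ do rewrite -big_split/=.
rewrite exchange_big/=; apply: eq_bigr => q _.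
by rewrite gE mulr_sumr; apply: eq_bigr => k _; rewrite -mulrDr -mulrDr.
Qed.

End SumOfSquares.

(** * Finitely many vectors with the second moments of a random matrix *)

Section Covariance.
Variable R : realType.
Local Notation C := (R[i]).
Variable d : nat.
Local Notation M := 'M[C]_d.
Context {dT : measure_display} {T : measurableType dT}.
Variable P : probability T R.
Variable W : T -> M.
Hypothesis hW : forall w, herm (W w).
Hypothesis W2 : forall A, rint P (fun w => rtr A (W w) ^+ 2).
Hypothesis mW : forall A, measurable_fun setT (fun w => rtr A (W w)).

Lemma rint_rtrM A B : rint P (fun w => rtr A (W w) * rtr B (W w)).
Proof.
apply: (@rint_le _ _ _ P _ (fun w => rtr A (W w) ^+ 2 + rtr B (W w) ^+ 2)).
- exact: measurable_funM.
- exact: rintD.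
move=> w; rewrite ler_norml; have := sqr_ge0 (rtr A (W w) + rtr B (W w)).
have := sqr_ge0 (rtr A (W w) - rtr B (W w)); have := sqr_ge0 (rtr A (W w)); have := sqr_ge0 (rtr B (W w)).
rewrite sqrrB sqrrD; move: (_ * _) (_ ^+ 2) (_ ^+ 2) => c x y; rewrite !mulr2n => *; apply/andP; split; lra.
Qed.

Lemma Re_tr_adj (X : M) : complex.Re (\tr (adjmx X)) = complex.Re (\tr X).
Proof. by rewrite /mxtrace !Re_sum; apply: eq_bigr => i _; rewrite adjmxE ReJ. Qed.

Lemma rtr_hpart (A X : M) : rtr A (hpart X) = rtr (hpart A) X.
Proof.
rewrite /hpart rtrZr rtrZl rtrDr rtrDl; congr (_ * (_ + _)).
by rewrite /rtr -Re_tr_adj adjmxM adjmxK mxtrace_mulC.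
Qed.

(** The second-moment form of W in real coordinates is a sum of squares, and each linear form in it
    is represented by a matrix. Taking hermitian parts does not spoil the identity, since W is
    hermitian. *)
Lemma covariance_vectors (kappa : R) : 0 <= kappa -> exists vs : seq M, herms vs /\
  forall A, \sum_(v <- vs) rtr A v ^+ 2 = kappa * Ex P (fun w => rtr A (W w) ^+ 2).
Proof.
move=> k0.
pose n := size (coords R d); pose q (p : 'I_n) : M * M := nth (0, 0) (coords R d) p.
have cs X : \sum_p (rtr (q p).2 X)%:C%C *: (q p).1 = X.
  by rewrite -[RHS]coords_sum (big_nth (0, 0)) big_mkord.
pose g (p r : 'I_n) := kappa * Ex P (fun w => rtr (q p).2 (W w) * rtr (q r).2 (W w)).
have gE (a : 'I_n -> R) : \sum_p \sum_r a p * a r * g p r = kappa * Ex P (fun w => (\sum_p a p * rtr (q p).2 (W w)) ^+ 2).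
  have -> : Ex P (fun w => (\sum_p a p * rtr (q p).2 (W w)) ^+ 2) =
     \sum_p \sum_r a p * a r * Ex P (fun w => rtr (q p).2 (W w) * rtr (q r).2 (W w)).
    rewrite (@Ex_ext _ _ _ P _ (fun w => \sum_p \sum_r (a p * a r) * (rtr (q p).2 (W w) * rtr (q r).2 (W w)))); last first.
      move=> w; rewrite expr2 mulr_suml; apply: eq_bigr => p _; rewrite mulr_sumr; apply: eq_bigr => r _; ring.
    rewrite Ex_sum => [|p]; last by apply: rint_sum => r; apply: rintZ; exact: rint_rtrM.
    apply: eq_bigr => p _; rewrite Ex_sum => [|r]; last by apply: rintZ; exact: rint_rtrM.
    by apply: eq_bigr => r _; rewrite ExZ//; exact: rint_rtrM.
  rewrite mulr_sumr; apply: eq_bigr => p _; rewrite mulr_sumr; apply: eq_bigr => r _.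
  by rewrite mulrCA.
have [p r|a|ls hls] := @gram_sum_squares R n g.
- exact: (congr1 (fun z => kappa * z) (Ex_ext P (fun w => mulrC (rtr (q p).2 (W w)) (rtr (q r).2 (W w))))).
- by rewrite gE mulr_ge0// Ex_ge0// => w; exact: sqr_ge0.
exists [seq hpart (\sum_p (l p)%:C%C *: (q p).1) | l : 'I_n -> R <- ls]; split.
  by move=> v /mapP[l _ ->]; exact: hpart_herm.
move=> A; rewrite big_map.
have sumr (B : M) (c : 'I_n -> R) : rtr B (\sum_p (c p)%:C%C *: (q p).1) = \sum_p rtr B (q p).1 * c p.
  rewrite (big_morph (rtr B) (fun X Y => rtrDr X Y B) (_ : rtr B 0 = 0)); last by rewrite /rtr mulmx0 mxtrace0.
  by apply: eq_bigr => p _; rewrite rtrZr mulrC.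
under eq_bigr => l _ do rewrite rtr_hpart sumr.
rewrite hls gE; congr (_ * _); apply: Ex_ext => w; congr (_ ^+ 2).
by rewrite -(sumr (hpart A) (fun p => rtr (q p).2 (W w))) cs -rtr_hpart hpart_id.
Qed.

(** Expressed through squares of linear functionals, the Hessian takes equal values on families with
    equal second moments. *)
Lemma Qf_rtr (A : M) : exists ms : seq (R * M),
  forall Y : M, Qf A Y = \sum_(m <- ms) m.1 * rtr m.2 Y ^+ 2.
Proof.
set U := sbas A.
pose B (ik : 'I_d * 'I_d) := adjmx U *m delta_mx ik.2 ik.1 *m U.
pose e (ik : 'I_d * 'I_d) := e1 (seig A ik.1) (seig A ik.2).
have tB ik Y : \tr (B ik *m Y) = chg U U Y ik.1 ik.2.
  by rewrite /B -!mulmxA mxtrace_mulC -!mulmxA rtr_delta /chg mulmxA.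
exists ([seq (e ik, B ik) | ik <- index_enum ('I_d * 'I_d)%type] ++
  [seq (e ik, (- imagi R) *: B ik) | ik <- index_enum ('I_d * 'I_d)%type]) => Y.
rewrite big_cat !big_map/= -big_split/= /Qf pair_big/=; apply: eq_bigr => ik _.
rewrite /rtr -scalemxAl mxtraceZ !tB -mulrDr mulrC -/(e ik); congr (_ * _).
by case: (chg U U Y ik.1 ik.2) => x y; rewrite /cabs2/=; congr (_ + _); ring.
Qed.

Lemma Qf_covariance (vs : seq M) (kappa : R) :
  (forall A, \sum_(v <- vs) rtr A v ^+ 2 = kappa * Ex P (fun w => rtr A (W w) ^+ 2)) ->
  forall A, rint P (fun w => Qf A (W w)) /\
    \sum_(v <- vs) Qf A v = kappa * Ex P (fun w => Qf A (W w)).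
Proof.
move=> H A; have [ms E] := Qf_rtr A.
have rr (m : R * M) : rint P (fun w => m.1 * rtr m.2 (W w) ^+ 2) by exact: rintZ.
split.
  apply: rint_ext (rint_sum ms rr) => w; by rewrite E.
rewrite (Ex_ext _ (fun w => E (W w))) (Ex_sum _ rr) mulr_sumr.
under eq_bigr => v _ do rewrite E.
rewrite exchange_big/=; apply: eq_bigr => m _.
by rewrite -mulr_sumr H ExZ// mulrCA.
Qed.

End Covariance.

(** * The exponential moment bound for the sum *)

Section MomentBound.
Variable R : realType.
Local Notation C := (R[i]).
Variable d : nat.
Hypothesis d_gt0 : (0 < d)%N.
Local Notation M := 'M[C]_d.

Lemma phi_good : good (@phi R d).
Proof.
split; [by move=> A; exact: phi_ge0|by move=> A X hA pX; exact: phi_sub_le|].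
by move=> A B hA hB AB; exact: phi_rel_lip.
Qed.

Lemma rayl_rtr (u : 'cV[C]_d) X : rayl u X = rtr (u *m adjmx u) X.
Proof. by rewrite /rayl /rtr mxtrace_mulC mulmxA mxtrace_mulC mulmxA trace_mx11. Qed.

Context {dT : measure_display} {T : measurableType dT}.
Variable P : probability T R.
Variable W : T -> M.
Hypotheses (mW : mx_rv W) (pW : forall w, psdc (W w)).
Hypothesis mrW : forall A, measurable_fun setT (fun w => rtr A (W w)).
Hypothesis rW : forall A, rint P (fun w => rtr A (W w)).
Hypothesis rW2 : forall A, rint P (fun w => rtr A (W w) ^+ 2).
Variable EW : M.
Hypotheses (hEW : herm EW) (EWE : forall A, rtr A EW = Ex P (fun w => rtr A (W w))).
Variables (k : nat) (theta s2 : R).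
Hypothesis theta0 : 0 < theta.

Let hW w : herm (W w). Proof. by case: (pW w). Qed.
Let wbar : M := (k%:R * theta)%:C%C *: EW.
Let hwbar : herm wbar. Proof. exact: hermZ. Qed.

Section OneStep.
Variable vs : seq M.
Hypothesis hvs : herms vs.
Hypothesis vsW : forall A, \sum_(v <- vs) rtr A v ^+ 2 =
  k%:R * theta ^+ 2 * Ex P (fun w => rtr A (W w) ^+ 2).

Lemma Top_phi_le A : herm A ->
  k%:R * (Top P theta W (@phi R d) A - phi A) <= - rtr (dphi A) wbar + (\sum_(v <- vs) Qf A v) / 2.
Proof.
move=> hA; have [rQ ->] := Qf_covariance rW2 vsW A.
have t0 := ltW theta0.
have H : Top P theta W (@phi R d) A <= phi A + - theta * rtr (dphi A) EW + theta ^+ 2 / 2 * Ex P (fun w => Qf A (W w)).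
  have r1 := rintZ (- theta) (rW (dphi A)).
  have r2 := rintZ (theta ^+ 2 / 2) rQ.
  rewrite EWE -(ExZ _ (rW (dphi A))) -(ExZ _ rQ) -[X in X + _ + _ ](Ex_cst P) -ExD//; last exact: rint_cst.
  rewrite -ExD//; last by apply: rintD => //; exact: rint_cst.
  apply: Ex_le; [exact: (good_rint P t0 mW pW phi_good hA)|by apply: rintD => //; apply: rintD => //; exact: rint_cst|].
  move=> w; have pt : psdc (theta%:C%C *: W w) by exact: psdcZ.
  have := phi_sub_le_quad hA pt; rewrite rtrZl QfZ rtrC.
  by move: (Qf _ _) (rtr _ _) (phi _) (phi _) => a b c e h; rewrite mulNr mulrAC.
have := ler_wpM2l (ler0n R k) H; rewrite rtrZr.
move: (Top _ _ _ _ _) (rtr _ _) (Ex _ _) (phi _) (k%:R) => a b c e n; lra.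
Qed.

(** The weight k / n is divided between the data and the scale: k is already contained in [wbar] and
    in the covariance of vs, and 1 / n is the square of the scaling factor. *)
Lemma mixT_phi_le (n : nat) A : (k <= n)%N -> herm A -> (0 < n)%N ->
  (Num.sqrt n%:R)^-1 * (l1 wbar + l1s vs) <= 1 / 2 ->
  mixT P theta W (k%:R / n%:R) (@phi R d) A <=
  (1 + 6 * d%:R ^+ 4 * (l1 wbar + l1s vs) ^+ 3 * (Num.sqrt n%:R)^-1 ^+ 3) *
  stepG (scal (Num.sqrt n%:R)^-1 vs) (((Num.sqrt n%:R)^-1 ^+ 2)%:C%C *: wbar) (@phi R d) A.
Proof.
move=> kn hA n0 small; set s := (Num.sqrt _)^-1 in small *.
have n0' : 0 < n%:R :> R by rewrite ltr0n.
have s2E : s ^+ 2 = n%:R^-1 by rewrite /s exprVn sqr_sqrtr// ltW.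
have s01 : 0 <= s <= 1.
  rewrite invr_ge0 sqrtr_ge0/=; have : s ^+ 2 <= 1 by rewrite s2E invf_le1// ler1n.
  have : 0 <= s by rewrite invr_ge0 sqrtr_ge0.
  by move=> s0 h; rewrite -(ler_pXn2r (n := 2))// ?nnegrE// expr1n.
apply: (le_trans _ (rad_phi_ge hA hwbar hvs s01 small)).
have := ler_wpM2l (sqr_ge0 s) (Top_phi_le hA); rewrite /mixT s2E.
move: (Top _ _ _ _ _) (rtr _ _) (\sum_(v <- vs) _) (phi _) (n%:R^-1) (k%:R) => a b c e m j; lra.
Qed.

End OneStep.

Context {dT' : measure_display} {T' : measurableType dT'}.
Variable P' : probability T' R.
Variable Z : T' -> M.
Hypothesis hZ : forall w, herm (Z w).
Hypothesis mrZ : forall A, measurable_fun setT (fun w => rtr A (Z w)).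
Hypothesis rZ2 : forall A, rint P' (fun w => rtr A (Z w) ^+ 2).
Hypothesis Zcos : forall A (c : R), Ex P' (fun w => cos (rtr A (Z w) + c)) =
  expR (- (k%:R * Ex P (fun w => rtr A (W w) ^+ 2) / 2)) * cos c.
Hypothesis s2W : forall u : 'cV[C]_d, \sum_i cabs2 (u i 0) = 1 ->
  k%:R * Ex P (fun w => rayl u (W w) ^+ 2) <= s2.
Hypothesis s20 : 0 <= s2.
Variable D : M.
Hypothesis hD : herm D.
Hypothesis rl : rint P' (fun w => lmin (Z w + D)).

(** The maximal eigenvalue of a hermitian X, written with [rmin] so as to be 1-Lipschitz on all
    matrices, as [clt_lip] requires. *)
Let h0 (X : M) : R := - theta * rmin ((- theta^-1)%:C%C *: X).

Let h0_lip A B : `|h0 A - h0 B| <= l1 (A - B).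
Proof.
have ti : 0 < theta^-1 by rewrite invr_gt0.
rewrite /h0 -mulrBr normrM normrN (gtr0_norm theta0).
have := rmin_lip d_gt0 ((- theta^-1)%:C%C *: A) ((- theta^-1)%:C%C *: B).
rewrite -scalerBr l1Z normrN (gtr0_norm ti) => h.
apply: (le_trans (ler_wpM2l (ltW theta0) h)).
by rewrite mulrA mulfV ?gt_eqF// mul1r.
Qed.

Let ln_phi_le X : herm X -> ln (phi X) <= h0 X + ln d%:R.
Proof.
move=> hX; have d0 : 0 < d%:R :> R by rewrite ltr0n.
have hY : herm ((- theta^-1)%:C%C *: X) by exact: hermZ.
have := phi_le_lmin d_gt0 theta0 hY.
have -> : (- theta)%:C%C *: ((- theta^-1)%:C%C *: X) = X.
  by rewrite scalerA -rmorphM/= mulrNN mulfV ?gt_eqF// rmorph1 scale1r.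
move=> h; rewrite /h0 (rmin_lmin d_gt0 hY) addrC.
by rewrite -[_ * lmin _]expRK -lnM ?posrE ?expR_gt0// ler_ln ?posrE ?phi_gt0// mulr_gt0 ?expR_gt0.
Qed.

Lemma moment_bound :
  iter k (Top P theta W) (@phi R d) (wbar - theta%:C%C *: D) <=
  2 * d%:R * expR (theta ^+ 2 * s2 / 2 - theta * Ex P' (fun w => lmin (Z w + D))).
Proof.
set a := Ex P' _; set L := theta ^+ 2 * s2; set Tk := iter k _ _ _.
have t0 := ltW theta0.
have kap0 : 0 <= k%:R * theta ^+ 2 by rewrite mulr_ge0 ?sqr_ge0.
have [vs [hvs vsW]] := covariance_vectors hW rW2 mrW kap0.
have L0 : 0 <= L by rewrite mulr_ge0 ?sqr_ge0.
have wv : weak_var_le vs L.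
  move=> u u1; under eq_bigr => v _ do rewrite rayl_rtr.
  rewrite vsW mulrAC mulrC /L ler_wpM2l ?sqr_ge0//.
  by have := s2W u1; rewrite (Ex_ext _ (fun w => congr1 (fun z => z ^+ 2) (rayl_rtr u (W w)))).
pose base := - (theta%:C%C *: D).
have hbase : herm base by apply: hermN; exact: hermZ.
pose Zt w := (- theta)%:C%C *: Z w.
pose h Y := h0 (Y + base).
have hZt w : h (Zt w) = - theta * lmin (Z w + D).
  rewrite /h /h0 /Zt /base.
  have -> : (- theta)%:C%C *: Z w - theta%:C%C *: D = (- theta)%:C%C *: (Z w + D).
    by rewrite scalerDr !rmorphN !scaleNr.
  have E : (- theta^-1) * (- theta) = 1 by rewrite mulrNN mulVf ?gt_eqF.
  have E' : (- theta^-1)%:C%C * (- theta)%:C%C = 1 :> C by rewrite -rmorphM E rmorph1.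
  by rewrite scalerA E' scale1r (rmin_lmin d_gt0)//; exact: hermD.
have rh : rint P' (fun w => h (Zt w)).
  by apply: rint_ext (rintZ (- theta) rl) => w; rewrite hZt.
have Eh : Ex P' (fun w => h (Zt w)) = - theta * a by rewrite (Ex_ext _ hZt) ExZ.
have rtrZt A w : rtr A (Zt w) = rtr ((- theta)%:C%C *: A) (Z w) by rewrite rtrZl rtrZr.
have mZt A : measurable_fun setT (fun w => rtr A (Zt w)).
  by rewrite (funext (rtrZt A)).
have ZtcosE A (c : R) : Ex P' (fun w => cos (rtr A (Zt w) + c)) = expR (- ((\sum_(v <- vs) rtr A v ^+ 2) / 2)) * cos c.
  have EE : Ex P (fun w => rtr ((- theta)%:C%C *: A) (W w) ^+ 2) = theta ^+ 2 * Ex P (fun w => rtr A (W w) ^+ 2).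
    rewrite -(ExZ _ (rW2 A)); apply: Ex_ext => w.
    by rewrite rtrZl exprMn sqrrN.
  by rewrite (Ex_ext _ (fun w => congr1 (fun z => cos (z + c)) (rtrZt A w))) Zcos vsW EE [k%:R * (_ * _)]mulrA.
have Zt2 A : rint P' (fun w => rtr A (Zt w) ^+ 2) by rewrite (funext (fun w => congr1 (fun z => z ^+ 2) (rtrZt A w))).
have hlip A B : `|h A - h B| <= l1 (A - B).
  by apply: (le_trans (h0_lip _ _)); rewrite opprD addrACA subrr addr0.
apply/ler_addgt0Pr => e e0.
pose Q := 2 * d%:R * expR (L / 2 - theta * a).
have Q0 : 0 <= Q by rewrite !mulr_ge0 ?expR_ge0.
(* The exponent may exceed its target by 2 * eps: one eps is spent on the central limit theorem, the
   other on the discretization errors s * J. *)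
have [eps eps0 Qe] : exists2 eps, 0 < eps & Q * expR (2 * eps) <= Q + e.
  exists (ln (1 + e / (Q + 1)) / 2).
    by rewrite divr_gt0// ln_gt0// ltrDl divr_gt0// ltr_wpDl.
  rewrite [2 * (_ / 2)]mulrC divfK// lnK ?posrE ?addr_gt0 ?divr_gt0 ?ltr_wpDl//.
  rewrite mulrDr mulr1 lerD2l mulrCA ler_piMr ?(ltW e0)// ler_pdivrMr ?ltr_wpDl// mul1r lerDl//.
apply: le_trans Qe.
pose C3 := 6 * d%:R ^+ 4 * (l1 wbar + l1s vs) ^+ 3 : R.
pose cc := conc_const vs L.
have ls0 := l1s_ge0 vs.
have lw0 := l1_ge0 wbar.
have C30 : 0 <= C3 by rewrite !mulr_ge0 ?exprn_ge0// addr_ge0.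
have cc0 : 0 <= cc by rewrite /cc /conc_const !addr_ge0 ?mulr_ge0 ?exprn_ge0.
pose J := C3 + cc + 2 * k%:R ^+ 2.
have J0 : 0 <= J by apply: addr_ge0; [exact: addr_ge0|rewrite mulr_ge0 ?exprn_ge0].
pose r1 := 2 * l1 wbar + 4 * l1s vs; pose r2 := 2 * k%:R : R; pose r3 := J / eps.
have r10 : 0 <= r1 by rewrite /r1; lra.
have r20 : 0 <= r2 by rewrite mulr_ge0.
have r30 : 0 <= r3 by rewrite divr_ge0// ltW.
(* For N >= q^2 one has s * q <= 1, and every smallness condition on s is of the form s * x <= 1 for
   a summand x of q. *)
pose q := 1 + (r1 + L + r2 + r3).
have [q1 qr1 qL qr2 qr3] : [/\ 1 <= q, r1 <= q, L <= q, r2 <= q & r3 <= q].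
  by rewrite /q; move: r10 L0 r20 r30; move: (r1) (L) (r2) (r3) => x1 x2 x3 x4 *; split; lra.
have q0 : 0 < q by exact: lt_le_trans q1.
have clt := clt_lip hvs mZt ZtcosE Zt2 hlip rh eps0.
have ev : \forall n \near \oo, q ^+ 2 <= n.+1%:R.
  exists (Num.truncn (q ^+ 2)).+1 => // n /= qn.
  by apply: (le_trans (ltW (truncnS_gt _))); rewrite ler_nat (leq_trans qn).
have [n [clt_n qn]] := @filter_ex _ _ _ _ (@filterI _ _ _ _ _ clt ev).
set N := n.+1 in clt_n qn; set s := (Num.sqrt N%:R)^-1 in clt_n.
have N0 : 0 < N%:R :> R by rewrite ltr0n.
have s2E : s ^+ 2 = N%:R^-1 by rewrite /s exprVn sqr_sqrtr// ltW.
have s0 : 0 <= s by rewrite invr_ge0 sqrtr_ge0.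
have sq : s * q <= 1.
  rewrite -(ler_pXn2r (n := 2))// ?nnegrE ?mulr_ge0 ?(ltW q0)// expr1n exprMn s2E.
  by rewrite mulrC ler_pdivrMr// mul1r.
have sX x : x <= q -> s * x <= 1 by move=> xq; apply: le_trans sq; exact: ler_wpM2l.
have s1 : s <= 1 by have := sX _ q1; rewrite mulr1.
have ss : s ^+ 2 <= s by rewrite expr2 ler_piMl.
have h1 : s * (2 * l1 wbar + 4 * l1s vs) <= 1 := sX _ qr1.
have sw0 : 0 <= s * l1 wbar by rewrite mulr_ge0.
have sl0 : 0 <= s * l1s vs by rewrite mulr_ge0.
have sl4 : s * l1s vs <= 1 / 4.
  by move: h1; rewrite mulrDr ![s * (_ * _)]mulrCA; lra.
have sl2 : s * (l1 wbar + l1s vs) <= 1 / 2.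
  by move: h1; rewrite !mulrDr ![s * (_ * l1 _)]mulrCA [s * (_ * l1s _)]mulrCA; lra.
have sL : s ^+ 2 * L <= 1 by apply: le_trans (sX _ qL); exact: ler_wpM2r.
have sJ : s * J <= eps by have := sX _ qr3; rewrite /r3 mulrA ler_pdivrMr// mul1r.
have k2 : (2 * k <= N)%N.
  rewrite -(ler_nat R) natrM -[leRHS]mul1r -ler_pdivrMr// mulrC -s2E.
  by apply: le_trans (sX _ qr2); exact: ler_wpM2r.
have kN : (k < N)%N.
  by case: (k) k2 => [|m] //; apply: leq_trans; rewrite mul2n -addnn -[X in (X < _)%N]addn0 ltn_add2l.
have k0N : k%:R / N%:R <= 1 :> R by rewrite ler_pdivrMr// mul1r ler_nat ltnW.
have p01 : 0 <= (k%:R / N%:R : R) <= 1 by rewrite k0N divr_ge0.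
set A0 := wbar - theta%:C%C *: D in Tk *.
have hA0 : herm A0 by apply: hermB => //; exact: hermZ.
have s01 : 0 <= s <= 1 by rewrite s0.
have U1 := iter_mixT_ge P t0 mW pW p01 (binq_ge0 R kN) (binq0 R k N) (binqS0 R k N) (binqSS R kN) N k phi_good hA0.
have B1 := binq_lower R kN k2.
have hvs' : herms (scal s vs) by exact: herms_scal.
have hu : herm ((s ^+ 2)%:C%C *: wbar) by exact: hermZ.
have c0 : 0 <= 1 + C3 * s ^+ 3 by rewrite addr_ge0// mulr_ge0// exprn_ge0.
have U2 := iter_mixT_le t0 mW pW p01 hvs' hu c0 phi_good
  (fun A hA => mixT_phi_le hvs vsW (ltnW kN) hA (isT : (0 < N)%N) sl2) N hA0.
(* The drifts of the N steps add up to [wbar] and cancel the centering contained in A0. *)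
have U3 : iter N (stepG (scal s vs) ((s ^+ 2)%:C%C *: wbar)) (@phi R d) A0 = iter N (rade (scal s vs)) (@phi R d) base.
  rewrite iter_stepG_shift; congr (iter _ _ _ _).
  by rewrite scalerA -rmorphM s2E mulfV ?gt_eqF// rmorph1 scale1r /A0 addrAC subrr add0r.
have s3 : 3 * (s * l1s vs) ^+ 2 <= 1.
  have : (s * l1s vs) ^+ 2 <= (1 / 4) ^+ 2 by rewrite ler_pXn2r ?nnegrE.
  by rewrite expr_div_n; lra.
have sl2' : s * l1s vs <= 1 / 2 by lra.
have U4 := iter_rad_phi d_gt0 hvs L0 wv s01 sl2' s3 sL N hbase.
have U5 := iter_rad_le s hvs N ln_phi_le hbase.
rewrite iter_rad_addc in U5.
have U6 : iter N (rade (scal s vs)) h0 base = iter N (rade (scal s vs)) h 0.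
  have E := rad_shift (flatten (nseq N (scal s vs))) h0 0 base; rewrite add0r in E.
  exact: (etrans (iter_rade N _ h0 base) (etrans (esym E) (esym (iter_rade N _ h 0)))).
rewrite U6 in U5; rewrite Eh in clt_n.
have dpos : 0 < d%:R :> R by rewrite ltr0n.
have NsE : N%:R * (s ^+ 2 * L / 2 + cc * s ^+ 3) = L / 2 + cc * s.
  have Ns : N%:R * s ^+ 2 = 1 by rewrite s2E mulfV// gt_eqF.
  have -> : N%:R * (s ^+ 2 * L / 2 + cc * s ^+ 3) = (N%:R * s ^+ 2) * (L / 2 + cc * s) by ring.
  by rewrite Ns mul1r.
have cN : (1 + C3 * s ^+ 3) ^+ N <= expR (C3 * s).
  have -> : C3 * s = N%:R * (C3 * s ^+ 3).
    have Ns : N%:R * s ^+ 2 = 1 by rewrite s2E mulfV// gt_eqF.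
    have -> : N%:R * (C3 * s ^+ 3) = (N%:R * s ^+ 2) * (C3 * s) by ring.
    by rewrite Ns mul1r.
  rewrite expRM_natl; apply: lerXn2r; rewrite ?nnegrE ?expR_ge0//; exact: expR_ge1Dx.
have Tk0 : 0 <= Tk by have [g0 _ _] := good_iterT P t0 mW pW k phi_good; exact: g0.
have F1 : iter N (rade (scal s vs)) (@phi R d) base <= d%:R * expR (- theta * a + eps + (L / 2 + cc * s)).
  have dE (x : R) : d%:R * expR x = expR (ln (d%:R : R) + x).
    by rewrite (expRD (ln d%:R)) lnK// posrE.
  rewrite dE; apply: (le_trans U4); rewrite NsE ler_expR.
  move: U5 clt_n; move: (iter _ _ _ _) (iter _ _ _ _) (cc * s) => x y z.
  by move: (ln _) (- theta * a) => u v; lra.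
have F2 : expR (- (2 * k%:R ^+ 2 / N%:R)) / 2 * Tk <= expR (C3 * s) * (d%:R * expR (- theta * a + eps + (L / 2 + cc * s))).
  apply: (le_trans (ler_wpM2r Tk0 B1)); apply: (le_trans U1); apply: (le_trans U2).
  rewrite U3; apply: ler_pM => //; first by rewrite exprn_ge0.
  by rewrite iter_rade -[leLHS](rad_cst (flatten (nseq N (scal s vs))) 0 base); apply: rad_le => //;
    [move=> v /flattenP[ws]; rewrite mem_nseq => /andP[_ /eqP ->]; exact: hvs'|move=> X _; exact: phi_ge0].
have F3 : Tk <= 2 * expR (2 * k%:R ^+ 2 / N%:R) * (expR (C3 * s) * (d%:R * expR (- theta * a + eps + (L / 2 + cc * s)))).
  have E0 := expR_gt0 (2 * k%:R ^+ 2 / N%:R : R).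
  move: F2; rewrite expRN; move: (expR (2 * _ / _)) E0 (expR (C3 * s) * _) => E E0 rhs h'.
  have := ler_wpM2l (ltW (mulr_gt0 (ltr0n R 2) E0)) h'.
  by congr (_ <= _); field; rewrite gt_eqF.
apply: (le_trans F3).
have -> : 2 * expR (2 * k%:R ^+ 2 / N%:R) * (expR (C3 * s) * (d%:R * expR (- theta * a + eps + (L / 2 + cc * s)))) =
  2 * d%:R * expR (2 * k%:R ^+ 2 / N%:R + C3 * s + (- theta * a + eps + (L / 2 + cc * s))).
  by rewrite !expRD; move: (expR (2 * _ / _)) (expR (C3 * s)) (expR _ * _ * _) => x y z; ring.
rewrite /Q -[leRHS]mulrA -expRD ler_wpM2l ?mulr_ge0// ler_expR -s2E.
have : 2 * k%:R ^+ 2 * s ^+ 2 <= 2 * k%:R ^+ 2 * s by rewrite ler_wpM2l// mulr_ge0 ?exprn_ge0.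
move: sJ; rewrite /J mulrDr mulrDr mulNr; move: (k%:R ^+ 2) (theta * a) (L) => x y z.
rewrite [s * C3]mulrC [s * cc]mulrC [s * _]mulrC; move: (C3 * s) (cc * s) (_ * s) => u v t.
move: (2 * x * s ^+ 2) => t'; lra.
Qed.

End MomentBound.

(** * From exponential moments to the tail and the expectation *)

Section ExponentialMoments.
Variable R : realType.
Context {dT : measure_display} {T : measurableType dT}.
Variable P : probability T R.
Variables (f : T -> R) (a s2 c : R).
Hypothesis mf : measurable_fun setT f.
Hypotheses (s20 : 0 <= s2) (c2 : 2 <= c).
Hypothesis mgf : forall theta, 0 < theta ->
  rint P (fun w => expR (- theta * f w)) /\
  Ex P (fun w => expR (- theta * f w)) <= c * expR (theta ^+ 2 * s2 / 2 - theta * a).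

Let c0 : 0 < c. Proof. by move: c2; lra. Qed.
Let lnc0 : 0 < ln c. Proof. by rewrite ln_gt0//; move: c2; lra. Qed.

Let Ex_indic A : measurable A -> rint P \1_A /\ Ex P \1_A = fine (P A).
Proof.
move=> mA; split; last by rewrite /Ex integral_indic// setIT.
by apply: (@rint_bd _ _ _ P _ 1) => [|w]; rewrite ?indicE ?normr_nat ?lern1 ?leq_b1.
Qed.

Let m_le x : measurable [set w | f w <= x].
Proof.
rewrite (_ : [set _ | _] = f @^-1` `]-oo, x]%classic); last by apply/seteqP; split => w; rewrite /= in_itv.
by rewrite -[X in measurable X]setTI; exact: mf.
Qed.

Let chernoff theta t : 0 < theta ->
  fine (P [set w | f w <= a - t]) <= c * expR (theta ^+ 2 * s2 / 2 - theta * t).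
Proof.
move=> theta0; set A := [set w | f w <= a - t].
have mA : measurable A by exact: m_le.
have [r1 e1'] := Ex_indic mA; have [r2 e2'] := mgf theta0.
rewrite -e1'; apply: (@le_trans _ _ (expR (theta * (a - t)) * Ex P (fun w => expR (- theta * f w)))).
  rewrite -ExZ//; apply: Ex_le => //; first exact: rintZ.
  move=> w; rewrite indicE; have [|_] := boolP (w \in A); last by rewrite mulr_ge0 ?expR_ge0.
  rewrite inE /A/= => fw; rewrite -expRD -[leLHS]expR0 ler_expR mulNr subr_ge0.
  by rewrite ler_wpM2l// ltW.
apply: (le_trans (ler_wpM2l (expR_ge0 _) e2')); rewrite mulrCA ler_wpM2l ?(ltW c0)//.
rewrite -expRD ler_expR; move: (theta ^+ 2 * _) => x; rewrite mulrBr; move: (theta * a) (theta * t) => y z; lra.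
Qed.

Lemma gauss_tail_bound t : 0 <= t -> (P [set w | (f w <= a - t)%R] <= (c * gauss_tail t s2)%:E)%E.
Proof.
move=> t0; set A := [set w | _]; have mA : measurable A by exact: m_le.
have Pfin : P A \is a fin_num by exact: fin_num_measure.
rewrite -(fineK Pfin) lee_fin.
have P1 : fine (P A) <= 1.
  by rewrite -lee_fin fineK// probability_le1.
have c1 : 1 <= c by move: c2; lra.
rewrite /gauss_tail; case: eqVneq => [s0|s0].
  case: eqVneq => [_|tn]; first by rewrite mulr1 (le_trans P1).
  have tp : 0 < t by rewrite lt_def tn.
  rewrite mulr0; apply/ler_addgt0Pr => e e0; rewrite add0r.
  (* Without variance the exponent is linear in theta, and theta is taken large enough to bring the
     bound below e. *)
  have th0 : 0 < c / (e * t) by rewrite divr_gt0// mulr_gt0.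
  apply: (le_trans (chernoff t th0)); rewrite s0 mulr0 mul0r add0r expRN.
  have -> : c / (e * t) * t = c / e by field; rewrite !gt_eqF.
  have ce : 0 < c / e by rewrite divr_gt0.
  rewrite ler_pdivrMr ?expR_gt0//; apply: (@le_trans _ _ (e * (c / e))).
    by rewrite mulrC divfK ?gt_eqF.
  rewrite ler_wpM2l ?(ltW e0)//; apply: le_trans (expR_ge1Dx _); rewrite lerDr//.
have sp : 0 < s2 by rewrite lt_def s0.
have [->|tn] := eqVneq t 0; first by rewrite expr0n/= oppr0 mul0r expR0 mulr1 (le_trans P1).
have tp : 0 < t by rewrite lt_def tn.
(* The minimizer of theta^2 * s2 / 2 - theta * t. *)
have th0 : 0 < t / s2 by rewrite divr_gt0.
apply: (le_trans (chernoff t th0)); rewrite ler_wpM2l ?(ltW c0)// ler_expR.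
by rewrite le_eqVlt; apply/orP; left; apply/eqP; field; rewrite gt_eqF.
Qed.

Let jensen theta : rint P f -> 0 < theta -> a - Ex P f <= ln c / theta + theta * s2 / 2.
Proof.
move=> rf th0; have [r2 e2'] := mgf th0; set m := Ex P f.
have : expR (- theta * m) <= Ex P (fun w => expR (- theta * f w)).
  have -> : expR (- theta * m) = Ex P (fun w => expR (- theta * m) * (1 + - theta * (f w - m))).
    have rm : rint P (fun w => f w - m) by apply: rintB => //; exact: rint_cst.
    rewrite ExZ; last by apply: rintD; [exact: rint_cst|exact: rintZ].
    rewrite ExD ?Ex_cst ?ExZ ?ExB ?Ex_cst//; [|exact: rint_cst|exact: rint_cst|exact: rintZ].
    by rewrite subrr mulr0 addr0 mulr1.
  apply: Ex_le => //.
    apply: rintZ; apply: rintD; first exact: rint_cst.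
    by apply: rintZ; apply: rintB => //; exact: rint_cst.
  move=> w; have -> : - theta * f w = - theta * m + - theta * (f w - m) by ring.
  by rewrite expRD ler_wpM2l ?expR_ge0// expR_ge1Dx.
move=> /le_trans/(_ e2'); rewrite -{1}(@lnK _ c) ?posrE// -expRD ler_expR => h.
have : theta * (a - m) <= ln c + theta ^+ 2 * s2 / 2.
  by move: h; rewrite mulrBr mulNr; move: (theta * a) (theta * m) (ln c) (_ * _ / 2) => x y z u; lra.
rewrite mulrC -ler_pdivlMr// => /le_trans; apply.
by rewrite le_eqVlt; apply/orP; left; apply/eqP; field; rewrite gt_eqF.
Qed.

Lemma expectation_bound : rint P f -> a - Num.sqrt (2 * s2 * ln c) <= Ex P f.
Proof.
move=> rf; rewrite lerBlDr -lerBlDl.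
have [s0|s0] := eqVneq s2 0.
  rewrite s0 mulr0 mul0r sqrtr0; apply/ler_addgt0Pr => e e0; rewrite add0r.
  have th0 : 0 < ln c / e by rewrite divr_gt0.
  have := jensen rf th0; rewrite s0 mulr0 mul0r addr0.
  by have -> : ln c / (ln c / e) = e by field; rewrite !gt_eqF.
have sp : 0 < s2 by rewrite lt_def s0.
set r := Num.sqrt _.
have r2 : r ^+ 2 = 2 * s2 * ln c by rewrite sqr_sqrtr// !mulr_ge0// ltW.
have r0 : 0 < r by rewrite sqrtr_gt0 !mulr_gt0.
(* The minimizer of ln c / theta + theta * s2 / 2, at which both terms equal r / 2. *)
have th0 : 0 < r / s2 by rewrite divr_gt0.
apply: (le_trans (jensen rf th0)).
have -> : ln c = r ^+ 2 / (2 * s2) by rewrite r2; field; rewrite gt_eqF.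
by rewrite le_eqVlt; apply/orP; left; apply/eqP; field; rewrite !gt_eqF.
Qed.

End ExponentialMoments.

(** * Entrywise expectation, integrability and null sets *)

Section MatrixExpectation.
Variable R : realType.
Local Notation C := (R[i]).
Variable d : nat.
Local Notation M := 'M[C]_d.
Implicit Types A B X : M.

Lemma rtr_le A X : `|rtr A X| <= l1 A * l1 X.
Proof.
apply: le_trans (l1M A X); apply: (le_trans (Re_le_cabs _)); rewrite /mxtrace.
apply: (le_trans (cabs_sum _ _ _)); apply: ler_sum => i _.
by rewrite (bigD1 i)//= lerDl sumr_ge0// => j _; exact: cabs_ge0.
Qed.

Lemma rtr_l1cont A : l1cont (rtr A).
Proof. by apply: (@lip_l1cont _ _ _ (l1 A)) => X Y; rewrite -rtrBr; exact: rtr_le. Qed.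

Lemma l1_coords X : l1 X <= \sum_(q <- coords R d) `|rtr q.2 X|.
Proof.
rewrite -{1}(coords_sum X) big_seq [leRHS]big_seq.
elim/big_ind2: _ => [|Y y Z z h1 h2|q qc]; first by rewrite l10.
  exact: le_trans (l1D _ _) (lerD h1 h2).
by rewrite l1Z ler_piMr// coords_l1.
Qed.

Lemma psdcD X Y : psdc X -> psdc Y -> psdc (X + Y).
Proof.
move=> [hX pX] [hY pY]; split; first exact: hermD.
by move=> u; rewrite mulmxDr mulmxDl mxE ReD addr_ge0.
Qed.

Lemma psdc0 : psdc (0 : M).
Proof. by split; [exact: herm0|move=> u; rewrite mulmx0 mul0mx mxE]. Qed.

Context {dT : measure_display} {T : measurableType dT}.
Variable P : probability T R.

Section Rtr.
Variable Y : T -> M.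
Hypothesis rY : forall A, rint P (fun w => rtr A (Y w)).

Let rtr_re i j w : complex.Re (Y w i j) = rtr (delta_mx j i) (Y w).
Proof. by rewrite /rtr rtr_delta. Qed.

Let rtr_im i j w : complex.Im (Y w i j) = rtr ((- imagi R) *: delta_mx j i) (Y w).
Proof.
rewrite /rtr -scalemxAl mxtraceZ rtr_delta; case: (Y w i j) => x y /=; ring.
Qed.

Lemma rtr_mxEx A : rtr A (mxEx P Y) = Ex P (fun w => rtr A (Y w)).
Proof.
have E X : rtr A X = \sum_(q <- coords R d) rtr A q.1 * rtr q.2 X.
  rewrite -{1}(coords_sum X) (big_morph (rtr A) (fun X Y => rtrDr X Y A) (_ : rtr A 0 = 0)).
    by apply: eq_bigr => q _; rewrite rtrZr mulrC.
  by rewrite /rtr mulmx0 mxtrace0.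
rewrite E (Ex_ext _ (fun w => E (Y w))) Ex_sum => [|q]; last exact: rintZ.
rewrite big_seq [RHS]big_seq; apply: eq_bigr => q qc; rewrite ExZ//; congr (_ * _).
move: qc; rewrite mem_cat => /orP[] /mapP[[i j] _ ->] /=.
  rewrite {1}/rtr rtr_delta mxE/=; apply: Ex_ext => w; exact: rtr_re.
rewrite (_ : rtr _ _ = complex.Im (mxEx P Y i j)).
  by rewrite mxE/=; apply: Ex_ext => w; exact: rtr_im.
by rewrite /rtr -scalemxAl mxtraceZ rtr_delta; case: (mxEx P Y i j) => x y /=; ring.
Qed.

Lemma herm_mxEx : (forall w, herm (Y w)) -> herm (mxEx P Y).
Proof.
move=> hY; apply/matrixP => i j; rewrite adjmxE !mxE/=.
have e w : Y w i j = conjc (Y w j i) by rewrite -adjmxE (hY w).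
congr (_ +i* _)%C; first by apply: Ex_ext => w; rewrite e ReJ.
rewrite -ExN; last by apply: rint_ext (rY ((- imagi R) *: delta_mx i j)) => w; rewrite rtr_im.
by apply: Ex_ext => w; rewrite e ImJ.
Qed.

Lemma rint_l1 : rint P (fun w => l1 (Y w)).
Proof.
have m : measurable_fun setT (fun w => l1 (Y w)).
  apply: (measurable_l1cont (h := fun X : M => l1 X)).
    by apply: (@lip_l1cont _ _ _ 1) => A B; rewrite mul1r; exact: l1_dist.
  move=> i j; split.
    by rewrite (funext (rtr_re i j)); exact: rint_meas (rY _).
  by rewrite (funext (rtr_im i j)); exact: rint_meas (rY _).
apply: (rint_le m (rint_sum (coords R d) (fun q => rint_norm (rY q.2)))) => w.
by rewrite ger0_norm ?l1_ge0//; exact: l1_coords.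
Qed.

Lemma mx_mble_rtr : mx_mble Y.
Proof.
move=> i j; split.
  by rewrite (funext (rtr_re i j)); exact: rint_meas (rY _).
by rewrite (funext (rtr_im i j)); exact: rint_meas (rY _).
Qed.

Lemma rint_lmin D : (0 < d)%N -> (forall w, herm (Y w)) -> herm D -> rint P (fun w => lmin (Y w + D)).
Proof.
move=> d0 hY hD.
have m : measurable_fun setT (fun w => lmin (Y w + D)).
  apply: (measurable_lmin d0); apply: mx_mbleD; [exact: mx_mble_rtr|exact: mx_mble_cst].
apply: (rint_le m (rintD (rint_cst P `|lmin D|) rint_l1)) => w.
have h := lmin_lip d0 (hermD (hY w) hD) hD; rewrite addrK in h.
rewrite -[lmin (Y w + D)](subrK (lmin D)) addrC (le_trans (ler_normD _ _))// lerD2l//.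
Qed.

End Rtr.

Lemma null_ext (A B N : set T) : measurable A -> measurable B -> measurable N -> P N = 0%E ->
  A `\` N = B `\` N -> P A = P B.
Proof.
move=> mA mB mN N0 AB.
have H D : measurable D -> P D = P (D `\` N).
  move=> mD; rewrite (measureDI P mD mN).
  have DN : P (D `&` N) = 0%E.
    by apply: (subset_measure0 _ mN _ N0) => //; exact: measurableI.
  by rewrite -[RHS]adde0; congr (_ + _)%E.
by rewrite (H A mA) AB -H.
Qed.

End MatrixExpectation.

(** * Replacing almost surely psd copies by psd ones *)

Section PsdModification.
Variable R : realType.
Local Notation C := (R[i]).
Variable d : nat.
Hypothesis d_gt0 : (0 < d)%N.
Local Notation M := 'M[C]_d.
Context {dT : measure_display} {T : measurableType dT}.
Variable P : probability T R.

Let Psd : set M := [set A | psdc A].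

(* The copies [Ws j] are only almost surely psd. *)
Definition psd_part (X : M) : M := if pselect (psdc X) then X else 0.

Lemma psdc_psd_part X : psdc (psd_part X).
Proof. by rewrite /psd_part; case: pselect => [//|nX]; exact: psdc0. Qed.

Lemma psd_part_id X : psdc X -> psd_part X = X.
Proof. by move=> pX; rewrite /psd_part; case: pselect => [//|nX]; case: (nX pX). Qed.

Lemma psd_part_meas (B : set M) : mx_meas B -> mx_meas (psd_part @^-1` B).
Proof.
move=> mB; have mP : mx_meas Psd by exact: mx_meas_psdc.
rewrite (_ : _ @^-1` _ = (Psd `&` B) `|` (if pselect (B 0) then ~` Psd else set0)).
  apply: mx_measU; first exact: mx_measI.
  by case: pselect => B0; [exact: mx_measC|exact: mx_meas0].
apply/seteqP; split => X /=; rewrite /psd_part.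
  case: pselect => [pX|nX] BX; [by left|right].
  by case: pselect => [B0|nB] //=; case: (nB BX).
move=> [[pX BX]|]; first by case: pselect => [//|nX]; case: (nX pX).
case: pselect => [B0|nB] //= nX; case: pselect => [pX|//]; by case: (nX pX).
Qed.

Variables (W X : T -> M).
Hypotheses (mW : mx_rv W) (pW : forall w, psdc (W w)) (mX : mx_rv X) (WX : same_law P P W X).

Lemma psd_part_rv : mx_rv (fun w => psd_part (X w)).
Proof. by move=> B mB; exact: mX (psd_part_meas mB). Qed.

(** W is psd at every sample point, so [psd_part] fixes it, and equality of laws passes through the
    measurable map [psd_part]. *)
Lemma psd_part_law : same_law P P W (fun w => psd_part (X w)).
Proof.
move=> B mB; rewrite -[RHS](WX (psd_part_meas mB)); congr (P _).
by apply/seteqP; split => w /=; rewrite psd_part_id.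
Qed.

Lemma psd_part_null : measurable [set w | ~ psdc (X w)] /\ P [set w | ~ psdc (X w)] = 0%E.
Proof.
have mC : mx_meas (~` Psd) by apply: mx_measC; exact: mx_meas_psdc.
split; first exact: (mX mC).
rewrite -[LHS]/(P (X @^-1` (~` Psd))) -(WX mC) (_ : _ @^-1` _ = set0) ?measure0//.
by apply/seteqP; split => // w /=; apply; exact: pW.
Qed.

End PsdModification.

(** * Passage from real to complex test matrices and vectors *)

Section ScalarFields.
Variable R : realType.
Local Notation C := (R[i]).
Variable d : nat.
Local Notation M := 'M[C]_d.
Implicit Types (A B X : M) (F : scalar_field).

Lemma rtr_sum A X : rtr A X = \sum_i \sum_j complex.Re (A i j * X j i).
Proof. by rewrite /rtr /mxtrace Re_sum; apply: eq_bigr => i _; rewrite mxE Re_sum. Qed.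

(** The variance function is prescribed on self-adjoint matrices over F only. The hermitian part of
    A, or for F = R its entrywise real part, induces the same functional on them. *)
Lemma selfadj_representative F A : exists B, selfadj F B /\
  forall X, selfadj F X -> rtr A X = rtr B X.
Proof.
have E X : herm X -> rtr A X = rtr (hpart A) X by move=> hX; rewrite -rtr_hpart hpart_id.
case: F; last first.
  by exists (hpart A); split; [split=> //; exact: hpart_herm|move=> X [_ hX]; exact: E].
move: (hpart A) (hpart_herm A) E => H hH E.
exists (\matrix_(i, j) (complex.Re (H i j))%:C%C); split.
  split; first by move=> i j; rewrite mxE.
  apply/matrixP => i j; rewrite adjmxE !mxE /= oppr0; congr (_ +i* _)%C.
  by rewrite -[in RHS]hH adjmxE ReJ.
move=> X [rX hX]; rewrite E// !rtr_sum; apply: eq_bigr => i _; apply: eq_bigr => j _.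
have := rX j i; rewrite mxE /inF; case: (X j i) => x y /= ->; case: (H i j) => a b /=; ring.
Qed.

Lemma inF_real F (z : C) : complex.Im z = 0 -> inF F z.
Proof. by case: F. Qed.

Definition revec (u : 'cV[C]_d) : 'cV[C]_d := map_mx (fun z => (complex.Re z)%:C%C) u.
Definition imvec (u : 'cV[C]_d) : 'cV[C]_d := map_mx (fun z => (complex.Im z)%:C%C) u.

Lemma revec_real u : mxF FieldR (revec u). Proof. by move=> i j; rewrite mxE. Qed.
Lemma imvec_real u : mxF FieldR (imvec u). Proof. by move=> i j; rewrite mxE. Qed.

(** Against a real entry the real part of conj(z) * w contains no mixed product of real and
    imaginary parts. *)
Lemma rayl_split (u : 'cV[C]_d) X : mxF FieldR X -> rayl u X = rayl (revec u) X + rayl (imvec u) X.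
Proof.
move=> rX; rewrite /rayl !quad_sum !Re_sum -big_split; apply: eq_bigr => j _ /=.
rewrite !Re_sum -big_split; apply: eq_bigr => l _ /=; rewrite !mxE.
by have := rX j l; rewrite /inF; case: (X j l) => x y /= ->; case: (u j 0) => a b; case: (u l 0) => a' b' /=; ring.
Qed.

Lemma cabs2_split (u : 'cV[C]_d) : \sum_i cabs2 (u i 0) =
  \sum_i cabs2 (revec u i 0) + \sum_i cabs2 (imvec u i 0).
Proof.
rewrite -big_split; apply: eq_bigr => i _ /=; rewrite !mxE; case: (u i 0) => a b.
by rewrite /cabs2/= expr0n/= !addr0.
Qed.

Lemma psd_psdc F X : psd F X -> psdc X.
Proof.
move=> [[rX hX] pX]; split => // u.
have re v : mxF F v -> 0 <= rayl v X.
  by move=> /pX; rewrite /rayl lecE => /andP[_].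
case: F rX pX re => rX pX re; last exact: re.
rewrite -/(rayl u X) (rayl_split u rX).
by apply: addr_ge0; apply: re; [exact: revec_real|exact: imvec_real].
Qed.

Lemma vnorm_sqr (u : 'cV[C]_d) : vnorm u ^+ 2 = \sum_i cabs2 (u i 0).
Proof. by rewrite sqr_sqrtr// sumr_ge0// => i _; exact: cabs2_ge0. Qed.

Lemma vnorm_unit (u : 'cV[C]_d) : vnorm u = 1 <-> \sum_i cabs2 (u i 0) = 1.
Proof.
rewrite -vnorm_sqr; split=> [->|/eqP]; first exact: expr1n.
by rewrite sqrp_eq1 ?sqrtr_ge0// => /eqP.
Qed.

(** Tested on basis vectors, which are admissible over both fields; the crude bound l1 X * d ensures
    that the supremum dominates its members. *)
Lemma cabs_le_opnorm F X i j : cabs (X i j) <= opnorm F X.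
Proof.
have vl (v : 'cV[C]_d) : vnorm v <= l1 v.
  rewrite -(ler_pXn2r (n := 2))// ?nnegrE ?sqrtr_ge0 ?l1_ge0// vnorm_sqr.
  have -> : l1 v = \sum_i cabs (v i 0) by apply: eq_bigr => l _; rewrite big_ord1.
  apply: le_trans (sum_sqr_le (fun l => cabs_ge0 (v l 0))).
  by apply: ler_sum => l _; rewrite sqr_cabs.
rewrite /opnorm; set E := [set vnorm (X *m u) | u in _].
have ub : has_ubound E.
  exists (l1 X * d%:R) => _ [u [_ u1] <-]; apply: (le_trans (vl _)); apply: (le_trans (l1M _ _)).
  rewrite ler_wpM2l ?l1_ge0// /l1; apply: (@le_trans _ _ (\sum_(l < d) 1)); last by rewrite sumr_const card_ord.
  apply: ler_sum => l _; rewrite big_ord1 -(ler_pXn2r (n := 2))// ?nnegrE ?cabs_ge0// expr1n sqr_cabs.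
  move/vnorm_unit: u1 => <-; rewrite (bigD1 l)//= lerDl sumr_ge0// => m _; exact: cabs2_ge0.
pose e : 'cV[C]_d := delta_mx j 0.
have Ee : E (vnorm (X *m e)).
  exists e => //; split.
    by move=> a b; rewrite mxE; apply: inF_real; case: (_ && _).
  apply/vnorm_unit; rewrite (bigD1 j)//= mxE !eqxx /cabs2/= expr1n expr0n addr0 big1 ?addr0// => l lj.
  by rewrite mxE (negbTE lj)/= expr0n addr0.
apply: (@le_trans _ _ (vnorm (X *m e))); last by move: (ub_le_sup ub Ee).
rewrite -(ler_pXn2r (n := 2))// ?nnegrE ?cabs_ge0 ?sqrtr_ge0// sqr_cabs vnorm_sqr (bigD1 i)//=.
rewrite (_ : (X *m e) i 0 = X i j); last by rewrite -colE mxE.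
by rewrite lerDl sumr_ge0// => l _; exact: cabs2_ge0.
Qed.

Lemma l1_le_opnorm F X : l1 X <= (d * d)%:R * opnorm F X.
Proof.
apply: (@le_trans _ _ (\sum_(i < d) \sum_(j < d) opnorm F X)).
  by apply: ler_sum => i _; apply: ler_sum => j _; exact: cabs_le_opnorm.
by rewrite !sumr_const !card_ord -mulrnA -[leLHS]mulr_natl.
Qed.

End ScalarFields.

(** * Covariance and weak variance of the Gaussian matrix *)

Section GaussianSide.
Variable R : realType.
Local Notation C := (R[i]).
Variables (d : nat) (F : scalar_field).
Hypothesis d_gt0 : (0 < d)%N.
Local Notation M := 'M[C]_d.
Context {dT : measure_display} {T : measurableType dT}.
Variable P : probability T R.
Variables (Z : T -> M) (V : M -> R).
Hypothesis nZ : normal_mx F P Z V.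

Let sZ w : selfadj F (Z w). Proof. by case: nZ => s _ _ _; exact: s. Qed.

Lemma gaussian_rtr A : real_gaussian P (fun w => rtr A (Z w)).
Proof.
have [_ jZ _ _] := nZ.
have := jZ (fun i j => complex.Re (A j i)) (fun i j => - complex.Im (A j i)).
congr real_gaussian; apply/funext => w; rewrite rtr_sum exchange_big/=.
by apply: eq_bigr => i _; apply: eq_bigr => j _; case: (A i j) => a b; case: (Z w j i) => x y /=; ring.
Qed.

Lemma gaussian_rtr_rint A : rint P (fun w => rtr A (Z w)).
Proof. exact: real_gaussian_rint (gaussian_rtr A). Qed.

Lemma gaussian_rtr_mean A : Ex P (fun w => rtr A (Z w)) = 0.
Proof.
have [_ _ Z0 _] := nZ.
by rewrite -(rtr_mxEx gaussian_rtr_rint) Z0 /rtr mulmx0 mxtrace0.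
Qed.

Lemma gaussian_rayl_var u : var P (fun w => complex.Re ((adjmx u *m Z w *m u) 0 0)) =
  Ex P (fun w => rayl u (Z w) ^+ 2).
Proof.
rewrite /var (_ : Ex P (fun w => complex.Re ((adjmx u *m Z w *m u) 0 0)) = 0).
  by apply: Ex_ext => w; rewrite subr0.
rewrite -(gaussian_rtr_mean (u *m adjmx u)); apply: Ex_ext => w; exact: (rayl_rtr u (Z w)).
Qed.

Lemma gaussian_rtr_var A : exists B, [/\ selfadj F B,
  forall X, selfadj F X -> rtr A X = rtr B X & Ex P (fun w => rtr A (Z w) ^+ 2) = V B].
Proof.
have [_ _ _ vZ] := nZ; have [B [sB BE]] := selfadj_representative F A.
exists B; split=> //; rewrite -vZ//; have [_ hB] := sB.
have e w : complex.Re (hsinner B (Z w)) = rtr B (Z w) by rewrite /hsinner hB.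
rewrite /var (Ex_ext _ e) gaussian_rtr_mean; apply: Ex_ext => w.
by rewrite e subr0 BE.
Qed.

Let r2 A : rint P (fun w => rtr A (Z w) ^+ 2) := real_gaussian_rint2 (gaussian_rtr A).

Let rayl2 u : rint P (fun w => rayl u (Z w) ^+ 2).
Proof. by apply: rint_ext (r2 (u *m adjmx u)) => w; rewrite rayl_rtr. Qed.

Let unitF (u : 'cV[C]_d) : mxF F u -> \sum_i cabs2 (u i 0) = 1 ->
  Ex P (fun w => rayl u (Z w) ^+ 2) <= sigma_star2 F P Z.
Proof.
move=> Fu u1; rewrite /sigma_star2; set E := [set var _ _ | _ in _].
(* A supremum dominates the members of its set only if that set is bounded; the second moments of
   the coordinates provide a bound uniform in the unit vector. *)
have hub : has_ubound E.
  exists (\sum_(q <- coords R d) \sum_(q' <- coords R d) Ex P (fun w => `|rtr q.2 (Z w) * rtr q'.2 (Z w)|)).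
  move=> _ [v [_ v1] <-]; rewrite gaussian_rayl_var; move/vnorm_unit: v1 => v1.
  have rr q q' : rint P (fun w => `|rtr q (Z w) * rtr q' (Z w)|).
    by apply: rint_norm; apply: rint_rtrM => A; [exact: r2|exact: rint_meas (gaussian_rtr_rint A)].
  under eq_bigr => q _ do rewrite -(Ex_sum _ (fun q' => rr q.2 q'.2)).
  rewrite -Ex_sum => [|q]; last by apply: rint_sum => q'.
  apply: Ex_le => //; first by apply: rint_sum => q; apply: rint_sum => q'.
  move=> w; apply: (@le_trans _ _ ((\sum_(q <- coords R d) `|rtr q.2 (Z w)|) ^+ 2)).
    rewrite -[rayl _ _ ^+ 2]real_normK ?num_real// -normrX.
    rewrite normrX ler_pXn2r ?nnegrE ?sumr_ge0//.
    exact: le_trans (rayl_le (Z w) v1) (l1_coords _).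
  rewrite expr2 mulr_suml; apply: ler_sum => q _; rewrite mulr_sumr; apply: ler_sum => q' _.
  by rewrite normrM.
have Eu : E (Ex P (fun w => rayl u (Z w) ^+ 2)).
  by exists u; [split=> //; apply/vnorm_unit|exact: gaussian_rayl_var].
by move: (ub_le_sup hub Eu).
Qed.

Lemma sigma_star2_ge0 : 0 <= sigma_star2 F P Z.
Proof.
pose e : 'cV[C]_d := delta_mx (Ordinal d_gt0) 0.
apply: le_trans (unitF (u := e) _ _); first by apply: Ex_ge0 => w; exact: sqr_ge0.
  by move=> a b; rewrite mxE; apply: inF_real; case: (_ && _).
rewrite (bigD1 (Ordinal d_gt0))//= mxE !eqxx /cabs2/= expr1n expr0n addr0 big1 ?addr0// => l lj.
by rewrite mxE (negbTE lj)/= expr0n addr0.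
Qed.

(** For F = R the supremum runs over real unit vectors. A complex unit vector splits into real parts
    a and b with |a|^2 + |b|^2 = 1, and (x + y)^2 <= x^2 / |a|^2 + y^2 / |b|^2 combines the bounds
    |a|^4 s and |b|^4 s to s. *)
Lemma rayl_sigma_star2 (u : 'cV[C]_d) : \sum_i cabs2 (u i 0) = 1 ->
  Ex P (fun w => rayl u (Z w) ^+ 2) <= sigma_star2 F P Z.
Proof.
move=> u1; case E : F; last by rewrite -E; apply: unitF => //; rewrite E.
rewrite -E; set s := sigma_star2 _ _ _.
have rZ w : mxF FieldR (Z w) by rewrite -E; case: (sZ w).
pose nn (v : 'cV[C]_d) := \sum_i cabs2 (v i 0).
have nn0 v : 0 <= nn v by rewrite sumr_ge0// => i _; exact: cabs2_ge0.
have scale v : mxF FieldR v -> nn v != 0 -> Ex P (fun w => rayl v (Z w) ^+ 2) <= nn v ^+ 2 * s.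
  move=> rv v0; have vp : 0 < nn v by rewrite lt_def v0 nn0.
  pose c := (Num.sqrt (nn v))^-1; pose v' := c%:C%C *: v.
  have c2 : c ^+ 2 = (nn v)^-1 by rewrite exprVn sqr_sqrtr.
  have v'1 : \sum_i cabs2 (v' i 0) = 1.
    have -> : \sum_i cabs2 (v' i 0) = c ^+ 2 * nn v; last by rewrite c2 mulVf.
    rewrite /nn mulr_sumr; apply: eq_bigr => i _.
    by rewrite mxE /cabs2 Re_scale Im_scale !exprMn -mulrDr.
  have Fv' : mxF F v' by rewrite E => i j; rewrite mxE /= Im_scale; have := rv i j => /= ->; rewrite mulr0.
  have := unitF Fv' v'1; rewrite -/s => h.
  have rE w : rayl v (Z w) ^+ 2 = nn v ^+ 2 * rayl v' (Z w) ^+ 2.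
    have -> : rayl v' (Z w) = c ^+ 2 * rayl v (Z w).
      by rewrite /rayl /v' adjmxZ -scalemxAr -!scalemxAl scalerA mxE -rmorphM Re_scale expr2.
    by rewrite c2 exprMn mulrA -exprMn mulfV// expr1n mul1r.
  by rewrite (Ex_ext _ rE) ExZ// ler_wpM2l ?sqr_ge0.
set a := revec u; set b := imvec u.
have ab : nn a + nn b = 1 by rewrite -u1 cabs2_split.
have ra := revec_real u; have rb := imvec_real u.
have split w : rayl u (Z w) = rayl a (Z w) + rayl b (Z w) by exact: rayl_split.
have zero v : nn v = 0 -> forall w, rayl v (Z w) = 0.
  move=> v0 w; have {}v0 : v = 0.
    apply/colP => i; rewrite [RHS]mxE; move/eqP: v0; rewrite psumr_eq0 => [/allP|l _]; last exact: cabs2_ge0.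
    move=> /(_ i (mem_index_enum _)); rewrite implyTb; case: (v i 0) => x y.
    by rewrite /cabs2/= paddr_eq0 ?sqr_ge0// !sqrf_eq0 => /andP[/eqP -> /eqP ->].
  by rewrite v0 /rayl mulmx0 mxE.
have [a0|a0] := eqVneq (nn a) 0.
  have b1 : nn b = 1 by rewrite -ab a0 add0r.
  rewrite (@Ex_ext _ _ _ P _ (fun w => rayl b (Z w) ^+ 2)) => [|w]; last by rewrite split (zero a a0) add0r.
  by have := scale b rb; rewrite b1 expr1n mul1r oner_eq0; apply.
have [b0|b0] := eqVneq (nn b) 0.
  have a1 : nn a = 1 by rewrite -ab b0 addr0.
  rewrite (@Ex_ext _ _ _ P _ (fun w => rayl a (Z w) ^+ 2)) => [|w]; last by rewrite split (zero b b0) addr0.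
  by have := scale a ra; rewrite a1 expr1n mul1r oner_eq0; apply.
have ap : 0 < nn a by rewrite lt_def a0 nn0.
have bp : 0 < nn b by rewrite lt_def b0 nn0.
apply: (@le_trans _ _ (Ex P (fun w => (nn a)^-1 * rayl a (Z w) ^+ 2 + (nn b)^-1 * rayl b (Z w) ^+ 2))).
  apply: Ex_le => //; first by apply: rintD; exact: rintZ.
  move=> w; rewrite split -subr_ge0; move: (rayl a _) (rayl b _) => x y.
  have -> : (nn a)^-1 * x ^+ 2 + (nn b)^-1 * y ^+ 2 - (x + y) ^+ 2 =
    (nn b * x - nn a * y) ^+ 2 / (nn a * nn b).
    have -> : nn b = 1 - nn a by rewrite -ab addrC addKr.
    by move: a0 b0; rewrite (_ : nn b = 1 - nn a) => [a0 b0|]; [field; rewrite b0 a0|rewrite -ab addrC addKr].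
  by rewrite divr_ge0 ?sqr_ge0// mulr_ge0// ltW.
rewrite ExD ?ExZ//; try exact: rintZ.
have ha := ler_wpM2l (ltW (_ : 0 < (nn a)^-1)) (scale a ra a0).
have hb := ler_wpM2l (ltW (_ : 0 < (nn b)^-1)) (scale b rb b0).
rewrite !invr_gt0 in ha hb; apply: (le_trans (lerD (ha ap) (hb bp))).
have e (x : R) : x != 0 -> x^-1 * (x ^+ 2 * s) = x * s by move=> x0; field.
by rewrite !e// -mulrDl ab mul1r.
Qed.

End GaussianSide.

(** * Reduction of both inequalities to the exponential moment bound *)

Theorem theorem9p1 (R : realType) (F : scalar_field) (d : nat)
  (dT : measure_display) (T : measurableType dT) (P : probability T R)
  (dT' : measure_display) (T' : measurableType dT') (P' : probability T' R)
  (W : T -> 'M[R[i]]_d) (k : nat) (Ws : 'I_k -> T -> 'M[R[i]]_d)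
  (Z : T' -> 'M[R[i]]_d) (Delta : 'M[R[i]]_d) :
  (0 < d)%N ->
  mx_rv W ->
  (forall w, psd F (W w)) ->
  P.-integrable setT (fun w => ((opnorm F (W w)) ^+ 2)%:E) ->
  (forall j, mx_rv (Ws j) /\ same_law P P W (Ws j)) ->
  mx_indep P Ws ->
  normal_mx F P' Z (fun M => k%:R * Mom P W M) ->
  selfadj F Delta ->
  let Y := fun w => \sum_(j < k) Ws j w in
  let s2 := sigma_star2 F P' Z in
  Ex P' (fun w => lmin (Z w + Delta)) - Num.sqrt (2 * s2 * ln (2 * d%:R))
    <= Ex P (fun w => lmin (Y w - mxEx P Y + Delta))
  /\
  (forall t : R, 0 <= t ->
    (P [set w | (lmin (Y w - mxEx P Y + Delta)
                 <= Ex P' (fun w' => lmin (Z w' + Delta)) - t)%R]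
      <= ((2 * d%:R) * gauss_tail t s2)%:E)%E).
Proof.
move=> d0 mW pW iW hWs iWs nZ sD Y s2.
have pcW w : psdc (W w) by exact: psd_psdc (pW w).
have hW w : herm (W w) by case: (pcW w).
have sW w : selfadj F (W w) by case: (pW w).
have sZ w : selfadj F (Z w) by case: nZ => s _ _ _; exact: s.
have hZ w : herm (Z w) by case: (sZ w).
have hD : herm Delta by case: sD.
have mrW A : measurable_fun setT (fun w => rtr A (W w)).
  exact: measurable_l1cont (rtr_l1cont A) (mx_rv_mble mW).
have rW2 A : rint P (fun w => rtr A (W w) ^+ 2).
  apply: (rint_le _ (rintZ ((l1 A * (d * d)%:R) ^+ 2) iW)); first exact: measurable_funX.
  move=> w; rewrite ger0_norm ?sqr_ge0// -exprMn -real_normK ?num_real//.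
  have o0 : 0 <= opnorm F (W w).
    exact: le_trans (cabs_ge0 _) (cabs_le_opnorm F (W w) (Ordinal d0) (Ordinal d0)).
  rewrite ler_pXn2r ?nnegrE ?mulr_ge0 ?l1_ge0//; apply: (le_trans (rtr_le _ _)).
  by rewrite -mulrA ler_wpM2l ?l1_ge0 ?l1_le_opnorm.
have rW A : rint P (fun w => rtr A (W w)).
  apply: (rint_le (mrW A) (rintD (rint_cst P 1) (rW2 A))) => w.
  rewrite -(real_normK (num_real (rtr A (W w)))); have : 0 <= (`|rtr A (W w)| - 1) ^+ 2 by exact: sqr_ge0.
  have := normr_ge0 (rtr A (W w)); move: `|rtr A (W w)| => y; nra.
set EW := mxEx P W.
have EWE A : rtr A EW = Ex P (fun w => rtr A (W w)) by exact: rtr_mxEx.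
have hEW : herm EW by exact: herm_mxEx.
have lawR j A := same_law_l1cont mW (hWs j).1 (hWs j).2 (rtr_l1cont A) (rW A).
have rtrY A w : rtr A (Y w) = \sum_(j < k) rtr A (Ws j w).
  by rewrite /Y (big_morph (rtr A) (fun X Y => rtrDr X Y A) (_ : rtr A 0 = 0))// /rtr mulmx0 mxtrace0.
have rY A : rint P (fun w => rtr A (Y w)).
  apply: (rint_ext (fun w => esym (rtrY A w))); apply: rint_sum => j; exact: (lawR j A).1.
have EY : mxEx P Y = (k%:R : R)%:C%C *: EW.
  rewrite -[LHS]coords_sum -[RHS]coords_sum; apply: eq_bigr => q _; congr (_%:C%C *: _).
  rewrite rtrZr EWE (rtr_mxEx rY) (Ex_ext _ (rtrY q.2)) Ex_sum => [|j]; last exact: (lawR j _).1.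
  rewrite (eq_bigr (fun=> Ex P (fun w => rtr q.2 (W w)))) => [|j _]; last exact: (lawR j _).2.
  by rewrite sumr_const card_ord mulr_natl.
(* The operator calculus needs psd summands at every sample point; V keeps the joint independence
   and the law of the copies. *)
pose V (j : 'I_k) w := psd_part (Ws j w).
have pV j w : psdc (V j w) by exact: psdc_psd_part.
have mV j : mx_rv (V j) by apply: (psd_part_rv d0); case: (hWs j).
have lV j : same_law P P W (V j).
  by apply: (psd_part_law d0 pcW); case: (hWs j).
have iV : mx_indep P V.
  move=> B mB; have H := iWs (fun j => @psd_part R d @^-1` B j) (fun j => psd_part_meas d0 (mB j)).
  by apply: (etrans _ (etrans H _)).
pose SV w := \sum_(j < k) V j w.
have pSV w : psdc (SV w) by apply: (big_ind (@psdc R d)) => // [|X X']; [exact: psdc0|exact: psdcD].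
have hSV w : herm (SV w) by case: (pSV w).
pose D := Delta - mxEx P Y.
have hD' : herm D by apply: hermB => //; rewrite EY; exact: hermZ.
pose fY w := lmin (Y w - mxEx P Y + Delta).
pose fV w := lmin (SV w + D).
have mSV : mx_mble SV by apply: mx_mble_sum => j; exact: mx_rv_mble.
have mY : mx_mble Y by apply: mx_mble_sum => j; apply: mx_rv_mble; case: (hWs j).
have mfV : measurable_fun setT fV.
  by apply: (measurable_lmin d0); apply: mx_mbleD => //; exact: mx_mble_cst.
have mfY : measurable_fun setT fY.
  by apply: (measurable_lmin d0); apply: mx_mbleD; [apply: mx_mbleB => //|]; exact: mx_mble_cst.
(* Both variables agree outside the null set where some copy fails to be psd. There Y need not be
   hermitian, which is why [lmin] had to be measurable on all matrices. *)
have lawf (B : set R) : measurable B -> P (fV @^-1` B) = P (fY @^-1` B).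
  move=> mB; pose N := \bigcup_(j in [set: 'I_k]) [set w | ~ psdc (Ws j w)].
  have nj j := psd_part_null d0 pcW (hWs j).1 (hWs j).2.
  have mN : measurable N by apply: fin_bigcup_measurable => // j _; exact: (nj j).1.
  have N0 : P N = 0%E.
    have fI : finite_set [set: 'I_k] by [].
    have h := content_sub_fsum P (A := N) fI (fun j _ => (nj j).1) mN (fun w Nw => Nw).
    apply/eqP; rewrite -measure_le0; apply: (le_trans h).
    by rewrite fsbig1// => j _; exact: (nj j).2.
  have m1 : measurable (fV @^-1` B) by rewrite -[X in measurable X]setTI; exact: mfV.
  have m2 : measurable (fY @^-1` B) by rewrite -[X in measurable X]setTI; exact: mfY.
  apply: (null_ext m1 m2 mN N0).
  have e w : ~ N w -> fV w = fY w.
    move=> nw; have VW : SV w = Y w.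
      apply: eq_bigr => j _; apply: psd_part_id.
      by apply: contrapT => h; apply: nw; exists j.
    by rewrite /fV /fY VW /D addrCA addrC.
  apply/seteqP; split => w [h1 h2]; split; [|exact: h2| |exact: h2].
    exact: (eq_ind _ B h1 _ (e w h2)).
  exact: (eq_ind_r B h1 (e w h2)).
have rSV A : rint P (fun w => rtr A (SV w)).
  have E w : rtr A (SV w) = \sum_(j < k) rtr A (V j w).
    by rewrite /SV (big_morph (rtr A) (fun X Y => rtrDr X Y A) (_ : rtr A 0 = 0))// /rtr mulmx0 mxtrace0.
  apply: (rint_ext (fun w => esym (E w))); apply: rint_sum => j.
  by have [] := same_law_l1cont mW (mV j) (lV j) (rtr_l1cont A) (rW A).
have rfV : rint P fV by exact: rint_lmin.
have s20 : 0 <= s2 by exact: (sigma_star2_ge0 d0 nZ).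
have varZ A : Ex P' (fun w => rtr A (Z w) ^+ 2) = k%:R * Ex P (fun w => rtr A (W w) ^+ 2).
  have [B [[rB hB] AB ->]] := gaussian_rtr_var nZ A; congr (_ * _).
  apply: Ex_ext => w; rewrite (AB _ (sW w)) /cabs2 /hsinner hB.
  (* The trace of a product of two hermitian matrices is real, so [Mom] reduces to the second moment
     of [rtr]. *)
  have -> : complex.Im (\tr (B *m W w)) = 0.
    have : \tr (adjmx (B *m W w)) = conjc (\tr (B *m W w)).
      by rewrite /mxtrace rmorph_sum; apply: eq_bigr => i _; rewrite adjmxE.
    rewrite adjmxM hB hW mxtrace_mulC.
    by case: (\tr _) => x y [] /=; move=> h; lra.
  by rewrite expr0n addr0.
have Zcos A (c : R) : Ex P' (fun w => cos (rtr A (Z w) + c)) =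
    expR (- (k%:R * Ex P (fun w => rtr A (W w) ^+ 2) / 2)) * cos c.
  by rewrite (real_gaussian_cos (gaussian_rtr nZ A) _ (gaussian_rtr_mean nZ A)) varZ.
have s2W (u : 'cV[R[i]]_d) : \sum_i cabs2 (u i 0) = 1 -> k%:R * Ex P (fun w => rayl u (W w) ^+ 2) <= s2.
  move=> u1; apply: le_trans (rayl_sigma_star2 nZ u1).
  rewrite (Ex_ext _ (fun w => congr1 (fun z => z ^+ 2) (rayl_rtr u (W w)))) -varZ.
  by rewrite (Ex_ext _ (fun w => congr1 (fun z => z ^+ 2) (rayl_rtr u (Z w)))).
have rl : rint P' (fun w => lmin (Z w + Delta)).
  by apply: (rint_lmin _ d0 hZ hD) => A; exact: gaussian_rtr_rint nZ A.
set a := Ex P' (fun w => lmin (Z w + Delta)).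
have mgf theta : 0 < theta -> rint P (fun w => expR (- theta * fV w)) /\
    Ex P (fun w => expR (- theta * fV w)) <= 2 * d%:R * expR (theta ^+ 2 * s2 / 2 - theta * a).
  move=> th0; have th := ltW th0.
  (* Chosen so that A0 - theta * SV = - theta * (SV + D), because the mean of Y is k times EW. *)
  pose A0 := (k%:R * theta)%:C%C *: EW - theta%:C%C *: Delta.
  have hA0 : herm A0 by apply: hermB; exact: hermZ.
  have B := moment_bound d0 mW pcW mrW rW rW2 hEW EWE th0 hZ
    (fun A => rint_meas (gaussian_rtr_rint nZ A)) (fun A => real_gaussian_rint2 (gaussian_rtr nZ A)) Zcos s2W s20 hD rl.
  have SE := Ex_sum_iter th mW pcW mV iV pV lV (phi_good R d) hA0.
  have AE w : A0 - theta%:C%C *: SV w = (- theta)%:C%C *: (SV w + D).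
    rewrite /A0 /D EY rmorphN scaleNr scalerDr scalerBr scalerA -rmorphM [theta * k%:R]mulrC.
    by move: (_ *: EW) (theta%:C%C *: Delta) (theta%:C%C *: SV w) => x y z; rewrite opprD opprB [RHS]addrC.
  have bd w : expR (- theta * fV w) <= phi (A0 - theta%:C%C *: SV w).
    by rewrite AE; apply: phi_ge_lmin => //; exact: hermD.
  have rphi : rint P (fun w => phi (A0 - theta%:C%C *: SV w)).
    have m : measurable_fun setT (fun w => phi (A0 - theta%:C%C *: SV w)).
      apply: measurable_hcont; first exact: good_hcont (phi_good R d).
        by apply: mx_mbleB; [exact: mx_mble_cst|exact: mx_mbleZ].
      by move=> w; apply: hermB => //; exact: hermZ.
    apply: (@rint_bd _ _ _ P _ (phi A0) m) => w; rewrite ger0_norm ?phi_ge0//.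
    by apply: phi_sub_le => //; exact: psdcZ.
  have mexp : measurable_fun setT (fun w => expR (- theta * fV w)).
    by apply: measurableT_comp => //; exact: measurable_funM.
  have re : rint P (fun w => expR (- theta * fV w)).
    by apply: (rint_le mexp rphi) => w; rewrite ger0_norm ?expR_ge0.
  split=> //; apply: (le_trans (Ex_le re rphi bd)).
  by rewrite SE.
have c2 : 2 <= 2 * d%:R :> R by rewrite ler_peMr// ler1n.
split.
  have H := expectation_bound s20 c2 mgf rfV.
  have E : Ex P fV = Ex P fY := law_eq_Ex mfV mfY lawf rfV.
  exact: (eq_ind _ (fun z => a - Num.sqrt (2 * s2 * ln (2 * d%:R)) <= z) H _ E).
move=> t t0; have H := gauss_tail_bound mfV s20 c2 mgf t0.
have I (f : T -> R) : [set w | f w <= a - t] = f @^-1` `]-oo, a - t]%classic.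
  by apply/seteqP; split => w; rewrite /= in_itv.
have E : P [set w | fV w <= a - t] = P [set w | fY w <= a - t].
  have mI : measurable (`]-oo, a - t]%classic : set R) by exact: measurable_itv.
  exact: (etrans (congr1 (fun S => P S) (I fV)) (etrans (lawf _ mI) (esym (congr1 (fun S => P S) (I fY))))).
exact: (eq_ind _ (fun z => (z <= (2 * d%:R * gauss_tail t s2)%:E)%E) H _ E).
Qed.
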